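(* There exists a basis of $\mathcal{M}(\Gamma,v,k,R)$ consisting of Maass waveforms $f$ with Fourier expansions $f(z)=\sum_{n=-\infty}^{\infty}c(n)\,\mathcal{W}_{n,k,R}(z)$ whose coefficients $c(n)$ satisfy the following relations whenever $c(0)\neq 0$. For positive integers $m,n$ with $12m\equiv 12n\equiv 0 \pmod k$ set $m_1=\frac{12m}{k}$ and $n_1=\frac{12n}{k}$. (i) If $(m_1+1,D)=(n_1+1,D)=1$, then $$c(m)c(n)=c(0)\sum_{0<d\mid(m_1+1,\,n_1+1)}\chi_k(d)\,c\!\left(\frac{k}{12}\left(\frac{(m_1+1)(n_1+1)}{d^2}-1\right)\right).$$ (ii) If $(m_1-1,D)=(n_1-1,D)=1$, then $$c(-m)c(-n)=\Lambda_{k,R}\;c(0)\sum_{0<d\mid(m_1-1,\,n_1-1)}\chi_k(d)\,c\!\left(\frac{k}{12}\left(\frac{(m_1-1)(n_1-1)}{d^2}-1\right)\right),$$ where $$\Lambda_{k,R}=\begin{cases}\prod_{j=1}^{l}\left(j(j-1)+\frac14+R^2\right)^2,& k=2l,\\[2pt] -R^2\prod_{j=1}^{l}\left(j^2+R^2\right)^2,& k=2l+1.\end{cases}$$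
   Context: Let $\mathcal{H}$ be the upper half-plane, $\overline{\Gamma}=SL(2,\mathbb{Z})$, $\Gamma=PSL(2,\mathbb{Z})$, $e(z)=e^{2\pi i z}$; $(a,b)$ denotes the greatest common divisor; $\mathrm{Arg}$ takes values in $]-\pi,\pi]$. Fix an integer $k$ with $1\le k\le 11$ and put $D=\frac{k}{(12,k)}$ and $\chi_k(d)=i^{k(d-1)}$ for integers $d$. Let $v=v_\eta^{2k}:\overline{\Gamma}\to S^1$ be the weight $k$ multiplier system of $\eta^{2k}$, i.e. $\eta(gz)^{2k}=v(g)(cz+d)^k\eta(z)^{2k}$ for $g=\begin{pmatrix}a&b\\c&d\end{pmatrix}\in\overline{\Gamma}$, where $\eta(z)=e(z/24)\prod_{n\ge1}(1-e(nz))$; in particular $v\begin{pmatrix}1&1\\0&1\end{pmatrix}=e(k/12)$. Fix a real $R$ with $\lambda=\frac14+R^2>\frac14$. $\mathcal{M}(\Gamma,v,k,R)$ is the space of Maass waveforms: functions $f$ on $\mathcal{H}$ with $f(gz)=v(g)\,e^{ik\mathrm{Arg}(cz+d)}f(z)$ for all $g=\begin{pmatrix}a&b\\c&d\end{pmatrix}\in\overline{\Gamma}$, with $(\Delta_k+\lambda)f=0$, where $\Delta_k=y^2\left(\frac{\partial^2}{\partial x^2}+\frac{\partial^2}{\partial y^2}\right)-iky\frac{\partial}{\partial x}$, and with $\int_{\Gamma\backslash\mathcal{H}}|f|^2\frac{dx\,dy}{y^2}<\infty$. Every such $f$ has a Fourier expansion $f(z)=\sum_{n\in\mathbb{Z}}c(n)\mathcal{W}_{n,k,R}(z)$,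 where, for $z=x+iy$ and $\alpha_k=\frac{k}{12}$, $$\mathcal{W}_{n,k,R}(z)=\frac{1}{\sqrt{|n+\alpha_k|}}\,W_{\frac k2\mathrm{sgn}(n+\alpha_k),\,iR}\left(4\pi|n+\alpha_k|y\right)e\left((n+\alpha_k)x\right)$$ and $W_{l,\mu}$ is the Whittaker $W$-function. *)

(* Defs.v *)
(* MathComp / MathComp-Analysis, with complex numbers R[i] from real-closed. *)
From HB Require Import structures.
From mathcomp Require Import all_boot all_order all_algebra.
From mathcomp Require Import all_classical all_reals all_analysis.
From mathcomp Require Import complex.
Set Implicit Arguments.
Unset Strict Implicit.
Unset Printing Implicit Defensive.
Import Order.TTheory GRing.Theory Num.Theory.
Import numFieldNormedType.Exports.
Import ComplexField.Normc.
Local Open Scope classical_set_scope.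
Local Open Scope ring_scope.
Local Open Scope complex_scope.

Local Notation Re := complex.Re.
Local Notation Im := complex.Im.

Section ComplexFunctions.
Context {R : realType}.
Local Notation C := R[i].

(* In what follows C^o is C with its topology (that of the modulus). *)

Definition cexp (z : C) : C :=
  (expR (Re z))%:C * (cos (Im z) +i* sin (Im z)).

Definition e2pi (z : C) : C := cexp (2 * pi%:C * 'i * z).

(* Values in ]-pi, pi] for z <> 0, as acos has values in [0, pi]. *)
Definition Arg (z : C) : R :=
  let t := acos (Re z / normc z) in if 0 <= Im z then t else - t.

(* Real positive base, principal value. *)
Definition rpowc (y : R) (s : C) : C := cexp (s * (ln y)%:C).

(* Gauss' product formula, valid for every s outside {0, -1, -2, ...}. *)
Definition Gammac (s : C) : C :=
  limn (fun n : nat =>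
    (n`!%:R * rpowc n%:R s / \prod_(0 <= j < n.+1) (s + j%:R)) : C^o).

Definition pochhammer (a : C) (n : nat) : C := \prod_(0 <= j < n) (a + j%:R).

(* Kummer's confluent hypergeometric function 1F1(a; b; x). *)
Definition kummerM (a b x : C) : C :=
  limn (series (fun n : nat =>
    (pochhammer a n / (pochhammer b n * n`!%:R) * x ^+ n) : C^o)).

Definition whittakerM (l mu : C) (y : R) : C :=
  cexp (- (y / 2)%:C) * rpowc y (2^-1 + mu)
  * kummerM (2^-1 + mu - l) (1 + 2 * mu) y%:C.

(* Whittaker's W_{l,mu} on the positive half-line, for 2 mu not an integer
   (DLMF 13.14.33).  Here mu = i r with r a nonzero real, so this is the only
   case needed, and no Gamma factor below is taken at a pole when l is real. *)
Definition whittakerW (l mu : C) (y : R) : C :=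
  Gammac (- (2 * mu)) / Gammac (2^-1 - mu - l) * whittakerM l mu y
  + Gammac (2 * mu) / Gammac (2^-1 + mu - l) * whittakerM l (- mu) y.

(* A series over Z converges when its two one-sided halves do. *)
Definition has_sumZ (u : int -> C) (s : C) : Prop :=
  exists a b : C,
    [/\ series (fun n : nat => (u n%:Z : C^o)) @ \oo --> (a : C^o),
        series (fun n : nat => (u (- n.+1%:Z) : C^o)) @ \oo --> (b : C^o)
      & s = a + b].

End ComplexFunctions.

Section HalfPlane.
Context {R : realType}.
Local Notation C := R[i].

Definition uhp : set C := [set z | 0 < Im z].

(* Elements of SL(2,Z) are the g : 'M[int]_2 with \det g = 1. *)
Definition autj (g : 'M[int]_2) (z : C) : C :=
  (g 1 0)%:~R * z + (g 1 1)%:~R.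

Definition moebius (g : 'M[int]_2) (z : C) : C :=
  ((g 0 0)%:~R * z + (g 0 1)%:~R) / autj g z.

Definition dedekind_eta (z : C) : C :=
  e2pi (z / 24) *
  limn (fun N : nat => (\prod_(1 <= n < N.+1) (1 - e2pi (n%:R * z))) : C^o).

(* Off SL(2,Z) the values of v are irrelevant. *)
Definition eta_multiplier (k : nat) (v : 'M[int]_2 -> C) : Prop :=
  forall g : 'M[int]_2, \det g = 1 ->
    normc (v g) = 1 /\
    forall z, uhp z ->
      dedekind_eta (moebius g z) ^+ (2 * k)
      = v g * autj g z ^+ k * dedekind_eta z ^+ (2 * k).

(* Calculus for functions of one or two real variables with complex values. *)
Definition derivableC (h : R -> C) (x : R) : Prop :=
  derivable (fun t => Re (h t)) x 1 /\ derivable (fun t => Im (h t)) x 1.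

Definition deriveC (h : R -> C) (x : R) : C :=
  derive1 (fun t => Re (h t)) x +i* derive1 (fun t => Im (h t)) x.

Definition hslice (f : C -> C) (z : C) : R -> C := fun x => f (x +i* Im z).
Definition vslice (f : C -> C) (z : C) : R -> C := fun y => f (Re z +i* y).

Definition dx (f : C -> C) (z : C) : C := deriveC (hslice f z) (Re z).
Definition dy (f : C -> C) (z : C) : C := deriveC (vslice f z) (Im z).

Definition uhp_C1 (f : C -> C) : Prop :=
  forall z, uhp z ->
    [/\ derivableC (hslice f z) (Re z), derivableC (vslice f z) (Im z),
        {for z, continuous (dx f : C^o -> C^o)}
      & {for z, continuous (dy f : C^o -> C^o)}].

Definition uhp_C2 (f : C -> C) : Prop :=
  [/\ uhp_C1 f, uhp_C1 (dx f) & uhp_C1 (dy f)].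

Definition laplacian (k : nat) (f : C -> C) (z : C) : C :=
  (Im z)%:C ^+ 2 * (dx (dx f) z + dy (dy f) z)
  - 'i * k%:R * (Im z)%:C * dx f z.

(* The standard fundamental domain of PSL(2,Z), in the coordinates (x, y).
   The integral over the quotient of an invariant function is its integral
   over this set, since the boundary identifications are negligible. *)
Definition fundamental_domain : set (R * R) :=
  [set p | [/\ `|p.1| <= 2^-1, 0 < p.2 & 1 <= p.1 ^+ 2 + p.2 ^+ 2]].

Definition square_integrable (f : C -> C) : Prop :=
  (\int[(@lebesgue_measure R) \x (@lebesgue_measure R)]_(p in fundamental_domain)
     (normc (f (p.1 +i* p.2)) ^+ 2 / p.2 ^+ 2)%:E < +oo)%E.

(* A function on the upper half-plane is represented by a function on C whose
   values elsewhere are irrelevant: everything below depends only on the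
   restriction to uhp. *)
Definition maass_space (v : 'M[int]_2 -> C) (k : nat) (r : R) : set (C -> C) :=
  [set f : C -> C |
    [/\ uhp_C2 f,
        forall g, \det g = 1 -> forall z, uhp z ->
          f (moebius g z)
          = v g * cexp ('i * k%:R * (Arg (autj g z))%:C) * f z,
        forall z, uhp z -> laplacian k f z + (4^-1 + r ^+ 2)%:C * f z = 0
      & square_integrable f]].

(* Vector space basis over C, functions being compared on uhp only. *)
Definition uhp_basis (M B : set (C -> C)) : Prop :=
  [/\ B `<=` M,
      forall (N : nat) (b : 'I_N -> C -> C) (a : 'I_N -> C),
        injective b -> (forall i, B (b i)) ->
        (forall z, uhp z -> \sum_(i < N) a i * b i z = 0) ->
        forall i, a i = 0
    & forall f, M f ->
        exists (N : nat) (b : 'I_N -> C -> C) (a : 'I_N -> C),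
          (forall i, B (b i)) /\
          forall z, uhp z -> f z = \sum_(i < N) a i * b i z].

(* n + k/12; it is never 0 for 1 <= k <= 11. *)
Definition freq (k : nat) (n : int) : R := n%:~R + k%:R / 12.

Definition whittaker_term (n : int) (k : nat) (r : R) (z : C) : C :=
  (Num.sqrt `|freq k n|)^-1%:C
  * whittakerW (k%:R / 2 * Num.sg (freq k n))%:C (0 +i* r)
      (4 * pi * `|freq k n| * Im z)
  * e2pi ((freq k n * Re z)%:C).

Definition fourier_expansion (k : nat) (r : R) (f : C -> C) (c : int -> C) :
    Prop :=
  forall z, uhp z -> has_sumZ (fun n => c n * whittaker_term n k r z) (f z).

Definition chi (k : nat) (d : int) : C := 'i ^ (k%:Z * (d - 1)).

Definition Lambda (k : nat) (r : R) : R :=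
  let l := k./2 in
  if odd k
  then - r ^+ 2 * \prod_(1 <= j < l.+1) (j%:R ^+ 2 + r ^+ 2) ^+ 2
  else \prod_(1 <= j < l.+1) (j%:R * (j%:R - 1) + 4^-1 + r ^+ 2) ^+ 2.

End HalfPlane.

Definition Dk (k : nat) : nat := (k %/ gcdn 12 k)%N.

(* k/12 * (a b / d^2 - 1); the divisions are exact and the subtraction is not
   truncated in all uses, see hecke_indexE below. *)
Definition hecke_index (k a b d : nat) : nat :=
  ((k * (a * b %/ d ^ 2 - 1)) %/ 12)%N.

Definition hecke_sum (R : realType) (k : nat) (c : int -> R[i]) (a b : nat) :
    R[i] :=
  \sum_(d <- divisors (gcdn a b)) chi k d%:Z * c (hecke_index k a b d)%:Z.


Lemma hecke_mod12 (k d a b : 'I_12) :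
  ((12 %| k * (d * a + 11)) && (12 %| k * (d * b + 11))
   || (12 %| k * (d * a + 1)) && (12 %| k * (d * b + 1)))%N ->
  (12 %| k * (a * b + 11))%N.
Proof.
apply/implyP; move: k d a b.
pose P (k d a b : nat) :=
  ((12 %| k * (d * a + 11)) && (12 %| k * (d * b + 11))
   || (12 %| k * (d * a + 1)) && (12 %| k * (d * b + 1))
   ==> (12 %| k * (a * b + 11)))%N.
have /allP chk : all (fun k => all (fun d => all (fun a => all (P k d a)
  (iota 0 12)) (iota 0 12)) (iota 0 12)) (iota 0 12) by vm_compute.
have io (i : 'I_12) : (i : nat) \in iota 0 12 by rewrite mem_iota ltn_ord.
move=> k d a b.
by have /allP/(_ d (io d))/allP/(_ a (io a))/allP/(_ b (io b)) := chk k (io k).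
Qed.

(* The two hypotheses are 12 | k (a - 1) and 12 | k (a + 1), as satisfied by
   a = m1 + 1 and a = m1 - 1 when k m1 = 12 m. *)
Lemma hecke_indexE (k a b d : nat) :
  (0 < a)%N -> (0 < b)%N -> (d %| a)%N -> (d %| b)%N ->
  (12 %| k * (a - 1))%N && (12 %| k * (b - 1))%N
  || (12 %| k * (a + 1))%N && (12 %| k * (b + 1))%N ->
  ((12 * hecke_index k a b d + k) * d ^ 2 = k * (a * b))%N.
Proof.
move=> a0 b0 /dvdnP[a' ea] /dvdnP[b' eb] H.
have [a'0 d0] : (0 < a' /\ 0 < d)%N.
  by move: a0; rewrite ea muln_gt0 => /andP[].
have b'0 : (0 < b')%N by move: b0; rewrite eb muln_gt0 => /andP[].
have sub11 (x y : nat) :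
    (0 < y)%N -> (12 %| x * (y - 1) = (12 %| x * (y + 11)))%N.
  case: y => // y _.
  by rewrite subn1 /= addSnnS mulnDr dvdn_addl // dvdn_mull.
have idx : (12 %| k * (a' * b' - 1))%N.
  rewrite sub11 ?muln_gt0 ?a'0 //.
  have := @hecke_mod12 (inord (k %% 12)) (inord (d %% 12)) (inord (a' %% 12))
            (inord (b' %% 12)).
  rewrite !inordK ?ltn_mod //.
  have red (u x y w : nat) : (12 %| (u %% 12) * ((x %% 12) * (y %% 12) + w) =
     (12 %| u * (x * y + w)))%N.
    by rewrite /dvdn modnMml -modnMmr -modnDml modnMm modnDml modnMmr.
  rewrite !red; apply.
  by move: H; rewrite !sub11 // ea eb ![(_ * d)%N]mulnC.
have dd : (a * b %/ d ^ 2 = a' * b')%N.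
  by rewrite ea eb mulnACA mulnK // muln_gt0 d0.
rewrite /hecke_index dd [(12 * _)%N]mulnC divnK // -mulnSr -addn1 subnK.
  by rewrite ea eb -mulnA; congr (_ * _)%N; rewrite mulnACA.
by rewrite muln_gt0 a'0.
Qed.

(* Main.v *)
(* Put N = 12/(12,k), D = k/(12,k); the frequencies are n + k/12 = t/N with
   t = Nn + D.  In a Maass waveform the Fourier coefficients satisfy Whittaker's
   equation in y, and square integrability leaves only W; so the waveforms are
   the automorphic series in the functions W_{n,k,R} with subexponential
   coefficients.  For m = 1 mod N the Hecke operator T_m, summed over the
   triangular matrices of determinant m, acts on coefficients, written A(t), by
     A(t) -> sum_{a | (m,t)} chi(a) A(m t / a^2)
   up to a scalar.  When m < 0 these matrices act on conj z and send weight k to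
   weight -k; k raising operators bring it back, at the price of a factor Lambda
   at the negative t.  The operators commute, and the space is finite
   dimensional because z -> -1/z compares the heights 1/2 and 1.  If c(0) is not
   identically zero, take a nonzero subspace of minimal dimension stable under
   all T_m on which c(0) does not vanish: for an eigenvalue l of T_m on it, the
   image of T_m - l is a smaller stable subspace, so c(0)(T_m f) = l c(0)(f) on
   it.  Evaluating c(0)(T_m T_m' f) gives the relations for any f there with
   c(0)(f) <> 0, and f is completed by a basis of the kernel of c(0). *)

Require Import Defs.
From HB Require Import structures.
From mathcomp Require Import all_boot all_order all_algebra.
From mathcomp Require Import all_classical all_reals all_analysis.
From mathcomp Require Import complex.
From mathcomp Require Import measurable_realfun zify ring lra.
Set Implicit Arguments.
Unset Strict Implicit.
Unset Printing Implicit Defensive.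
Import Order.TTheory GRing.Theory Num.Theory.
Import numFieldNormedType.Exports.
Import ComplexField.Normc.
Local Open Scope classical_set_scope.
Local Open Scope ring_scope.
Local Open Scope complex_scope.
Local Notation Re := complex.Re.
Local Notation Im := complex.Im.

(** * Complex numbers *)

Section ComplexBasics.
Context {R : realType}.
Local Notation C := R[i].
Implicit Types (x y z w : C) (T : Type).

(** No Petersson inner product occurs: self-adjointness of the Hecke operators would need unfolding
    over the quotient, whereas the relations concern the single functional c(0), for which commuting
    matrices over an algebraically closed field suffice. The work is done on coefficient sequences:
    automorphy is checked on functions, commutation on divisor sums, and the two pictures agree
    because a waveform and its coefficients determine each other. As k/12 is not an integer, no
    frequency is 0; so there is no constant term and every automorphic Whittaker series is square
    integrable. Coprimality to D enters when T_m is read at n = 0, where t = D: it leaves the single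
    divisor 1. W is given as a combination of two growing functions; its decay is invisible there
    and is won from an Abelian theorem for the power series of M and from a constant Wronskian. The
    transformation law of eta is a hypothesis, and its multiplier is pinned down by the shift z + 1,
    the relations between S and T, and the fact that eta(i) is nonzero. *)

Lemma cplxP z w : Re z = Re w -> Im z = Im w -> z = w.
Proof. by case: z w => a b [c d] /= -> ->. Qed.

Lemma cplxE z : z = Re z +i* Im z. Proof. by case: z. Qed.

Lemma ReMc z w : Re (z * w) = Re z * Re w - Im z * Im w.
Proof. by case: z w => ? ? [? ?]. Qed.

Lemma ImMc z w : Im (z * w) = Re z * Im w + Im z * Re w.
Proof. by case: z w => ? ? [? ?]. Qed.

Lemma ReD z w : Re (z + w) = Re z + Re w. Proof. by case: z w => ? ? [? ?]. Qed.
Lemma ImD z w : Im (z + w) = Im z + Im w. Proof. by case: z w => ? ? [? ?]. Qed.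
Lemma ReN z : Re (- z) = - Re z. Proof. by case: z. Qed.
Lemma ImN z : Im (- z) = - Im z. Proof. by case: z. Qed.
Lemma ReB z w : Re (z - w) = Re z - Re w. Proof. by rewrite ReD ReN. Qed.
Lemma ImB z w : Im (z - w) = Im z - Im w. Proof. by rewrite ImD ImN. Qed.
Lemma Re_nat n : Re (n%:R : C) = n%:R. Proof. by rewrite -(rmorph_nat (real_complex R)). Qed.
Lemma Im_nat n : Im (n%:R : C) = 0. Proof. by rewrite -(rmorph_nat (real_complex R)). Qed.
Lemma Re_sum I (r : seq I) (P : pred I) (F : I -> C) :
  Re (\sum_(i <- r | P i) F i) = \sum_(i <- r | P i) Re (F i).
Proof. exact: (big_morph _ ReD (erefl _)). Qed.

Lemma Im_sum I (r : seq I) (P : pred I) (F : I -> C) :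
  Im (\sum_(i <- r | P i) F i) = \sum_(i <- r | P i) Im (F i).
Proof. exact: (big_morph _ ImD (erefl _)). Qed.

Lemma normrcE z : `|z| = (normc z)%:C. Proof. by case: z. Qed.

Lemma normcRE (a : R) : normc a%:C = `|a|.
Proof. by rewrite /= expr0n addr0 sqrtr_sqr. Qed.

Lemma normc_nat n : normc (n%:R : C) = n%:R.
Proof. by rewrite -(rmorph_nat (real_complex R)) normcRE ger0_norm. Qed.

Lemma normc_ge0 z : 0 <= normc z.
Proof. by case: z => a b; rewrite sqrtr_ge0. Qed.

Lemma normc_eq0 z : (normc z == 0) = (z == 0).
Proof.
apply/eqP/eqP => [/eq0_normc//|->]; exact: normc0.
Qed.

Lemma normc_gt0 z : (0 < normc z) = (z != 0).
Proof. by rewrite lt_def normc_ge0 andbT normc_eq0. Qed.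

Lemma normcX z n : normc (z ^+ n) = normc z ^+ n.
Proof.
elim: n => [|n IH]; first by rewrite !expr0 normc1.
by rewrite !exprS normcM IH.
Qed.

Lemma normcB_sym z w : normc (z - w) = normc (w - z).
Proof. by rewrite -normcN opprB. Qed.

Lemma ler_normcB z w : normc (z - w) <= normc z + normc w.
Proof. by rewrite -(normcN w) le_normcD. Qed.

Lemma lerB_normc z w : normc z - normc w <= normc (z - w).
Proof. by rewrite lerBlDr; have := le_normcD (z - w) w; rewrite subrK. Qed.

Lemma normc_sqr z : normc z ^+ 2 = Re z ^+ 2 + Im z ^+ 2.
Proof. by case: z => a b; rewrite /= sqr_sqrtr // addr_ge0 ?sqr_ge0. Qed.

Lemma normc_sum I (r : seq I) (P : pred I) (F : I -> C) :
  normc (\sum_(i <- r | P i) F i) <= \sum_(i <- r | P i) normc (F i).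
Proof.
elim/big_ind2: _ => [|x a y b xa yb|//]; first by rewrite normc0.
by rewrite (le_trans (le_normcD _ _)) ?lerD.
Qed.

Lemma Re_le_normc z : `|Re z| <= normc z.
Proof.
rewrite -ler_sqr ?nnegrE ?normc_ge0 // normc_sqr real_normK ?num_real //.
by rewrite lerDl sqr_ge0.
Qed.

Lemma Im_le_normc z : `|Im z| <= normc z.
Proof.
rewrite -ler_sqr ?nnegrE ?normc_ge0 // normc_sqr real_normK ?num_real //.
by rewrite lerDr sqr_ge0.
Qed.

Lemma normc_le_ReIm z : normc z <= `|Re z| + `|Im z|.
Proof.
rewrite -ler_sqr ?nnegrE ?normc_ge0 ?addr_ge0 //.
rewrite normc_sqr sqrrD !real_normK ?num_real // addrAC lerDl.
by rewrite mulrn_wge0 // mulr_ge0.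
Qed.

Lemma normc_conj z : normc (conjc z) = normc z.
Proof. by case: z => a b; rewrite /= sqrrN. Qed.

Lemma mulc_conj z : z * conjc z = (normc z ^+ 2)%:C.
Proof.
rewrite normc_sqr; case: z => a b /=.
by apply: cplxP; rewrite ?ReMc ?ImMc /=; ring.
Qed.

Lemma rcM (a b : R) : (a * b)%:C = a%:C * b%:C :> C. Proof. exact: rmorphM. Qed.
Lemma rcD (a b : R) : (a + b)%:C = a%:C + b%:C :> C. Proof. exact: rmorphD. Qed.
Lemma rcB (a b : R) : (a - b)%:C = a%:C - b%:C :> C. Proof. exact: rmorphB. Qed.
Lemma rcN (a : R) : (- a)%:C = - a%:C :> C. Proof. exact: rmorphN. Qed.
Lemma rcV (a : R) : (a^-1)%:C = (a%:C)^-1 :> C. Proof. exact: fmorphV. Qed.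
Lemma rcX (a : R) n : (a ^+ n)%:C = a%:C ^+ n :> C. Proof. exact: rmorphXn. Qed.
Lemma rc_nat n : (n%:R : R)%:C = n%:R :> C. Proof. exact: rmorph_nat. Qed.
Lemma rc_int (n : int) : (n%:~R : R)%:C = n%:~R :> C. Proof. exact: rmorph_int. Qed.
Lemma rc_eq0 (a : R) : (a%:C == 0 :> C) = (a == 0). Proof. exact: fmorph_eq0. Qed.
Lemma ReZ (a : R) z : Re (a%:C * z) = a * Re z. Proof. by rewrite ReMc /= mul0r subr0. Qed.
Lemma ImZ (a : R) z : Im (a%:C * z) = a * Im z. Proof. by rewrite ImMc /= mul0r addr0. Qed.

Lemma cexpD z w : cexp (z + w) = cexp z * cexp w.
Proof.
rewrite /cexp ReD ImD expRD cosD sinD.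
by apply: cplxP; rewrite ?(ReMc, ImMc) /=; ring.
Qed.

Lemma cexp0 : cexp 0 = 1 :> C.
Proof. by rewrite /cexp /= expR0 cos0 sin0 mul1r. Qed.

Lemma normc_cexp z : normc (cexp z) = expR (Re z).
Proof.
rewrite /cexp normcM normcRE ger0_norm ?expR_ge0 //=.
by rewrite cos2Dsin2 sqrtr1 mulr1.
Qed.

Lemma cexp_neq0 z : cexp z != 0.
Proof. by rewrite -normc_gt0 normc_cexp expR_gt0. Qed.

Lemma cexpN z : cexp (- z) = (cexp z)^-1.
Proof.
apply: (mulfI (cexp_neq0 z)); rewrite -cexpD subrr cexp0 mulfV //.
exact: cexp_neq0.
Qed.

Lemma cexpMn z n : cexp (n%:R * z) = cexp z ^+ n.
Proof.
elim: n => [|n IH]; first by rewrite mul0r cexp0 expr0.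
by rewrite -natr1 mulrDl mul1r cexpD IH exprSr.
Qed.

Lemma cexp_real (a : R) : cexp a%:C = (expR a)%:C.
Proof. by rewrite /cexp /= cos0 sin0; apply: cplxP; rewrite ?(ReMc, ImMc) /=; ring. Qed.

Lemma cexp_imag (a : R) : cexp (0 +i* a) = cos a +i* sin a.
Proof. by rewrite /cexp /= expR0 mul1r. Qed.

Lemma e2piD z w : e2pi (z + w) = e2pi z * e2pi w.
Proof. by rewrite /e2pi mulrDr cexpD. Qed.

Lemma e2pi0 : e2pi 0 = 1 :> C. Proof. by rewrite /e2pi mulr0 cexp0. Qed.

Lemma e2pi_neq0 z : e2pi z != 0. Proof. exact: cexp_neq0. Qed.

Lemma e2piN z : e2pi (- z) = (e2pi z)^-1.
Proof. by rewrite /e2pi mulrN cexpN. Qed.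

Lemma e2pi_real (a : R) : e2pi a%:C = cos (2 * pi * a) +i* sin (2 * pi * a).
Proof.
rewrite /e2pi -cexp_imag; congr cexp; rewrite -rc_nat.
by apply: cplxP; rewrite ?(ReMc, ImMc) /=; ring.
Qed.

Lemma normc_e2pi_real (a : R) : normc (e2pi a%:C) = 1.
Proof. by rewrite e2pi_real /= cos2Dsin2 sqrtr1. Qed.

Lemma e2pi1 : e2pi 1 = 1 :> C.
Proof.
have -> : 1 = (1 : R)%:C :> C by [].
by rewrite e2pi_real mulr1 [2 * pi]mulrC mulr_natr cos2pi sin2pi.
Qed.

Lemma e2pi_nat n : e2pi n%:R = 1 :> C.
Proof.
elim: n => [|n IH]; first by rewrite e2pi0.
by rewrite -natr1 e2piD IH e2pi1 mulr1.
Qed.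

Lemma e2pi_int (n : int) : e2pi n%:~R = 1 :> C.
Proof. by case: n => n; rewrite ?NegzE ?mulrNz ?e2piN e2pi_nat ?invr1. Qed.

Lemma e2piMn z n : e2pi (n%:R * z) = e2pi z ^+ n.
Proof. by rewrite /e2pi mulrCA cexpMn. Qed.

Lemma e2pi_conj (a : R) : conjc (e2pi a%:C) = e2pi (- a%:C).
Proof.
rewrite -rcN !e2pi_real /= mulrN cosN sinN //.
Qed.

End ComplexBasics.

Section ComplexConvergence.
Context {R : realType}.
Local Notation C := R[i].

(** Componentwise, so that limit theorems for real functions apply directly; [cvgcP] passes to the
    topology of [C^o] used in the statement. *)
Definition cvgc {T} (F : set_system T) (f : T -> C) (a : C) : Prop :=
  (fun x => Re (f x)) @ F --> Re a /\ (fun x => Im (f x)) @ F --> Im a.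

Section Filter.
Context {T : Type} (F : set_system T) {FF : ProperFilter F}.
Implicit Types (f g : T -> C) (a b : C).

Lemma cvgc_cst a : cvgc F (fun=> a) a.
Proof. by split; exact: cvg_cst. Qed.

Lemma cvgcD f g a b : cvgc F f a -> cvgc F g b -> cvgc F (fun x => f x + g x) (a + b).
Proof.
move=> [f1 f2] [g1 g2]; split.
  under eq_fun do rewrite ReD.
  by rewrite ReD; exact: cvgD.
under eq_fun do rewrite ImD.
by rewrite ImD; exact: cvgD.
Qed.

Lemma cvgcN f a : cvgc F f a -> cvgc F (fun x => - f x) (- a).
Proof.
move=> [f1 f2]; split.
  under eq_fun do rewrite ReN.
  by rewrite ReN; exact: cvgN.
under eq_fun do rewrite ImN.
by rewrite ImN; exact: cvgN.
Qed.

Lemma cvgcB f g a b : cvgc F f a -> cvgc F g b -> cvgc F (fun x => f x - g x) (a - b).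
Proof. by move=> fa gb; apply: cvgcD => //; exact: cvgcN. Qed.

Lemma cvgcM f g a b : cvgc F f a -> cvgc F g b -> cvgc F (fun x => f x * g x) (a * b).
Proof.
move=> [f1 f2] [g1 g2]; split.
  under eq_fun do rewrite ReMc.
  by rewrite ReMc; apply: cvgB; exact: cvgM.
under eq_fun do rewrite ImMc.
by rewrite ImMc; apply: cvgD; exact: cvgM.
Qed.

Lemma cvgc_normc f a : cvgc F f a <-> (fun x => normc (f x - a)) @ F --> (0 : R).
Proof.
split=> [[f1 f2]|fa].
  have h : (fun x => `|Re (f x) - Re a| + `|Im (f x) - Im a|) @ F --> (0 : R).
    rewrite -[0 in X in _ --> X](addr0 (0 : R)) -(normr0 R).
    rewrite -{1}(subrr (Re a)) -(subrr (Im a)).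
    by apply: cvgD; apply: cvg_norm; apply: cvgB => //; exact: cvg_cst.
  apply: squeeze_cvgr (cvg_cst _) h; apply: nearW => x.
  by rewrite normc_ge0 -ReB -ImB normc_le_ReIm.
split; apply/cvgrPdist_le => e e0.
  have := fa; move/cvgrPdist_le => /(_ e e0); apply: filterS => x.
  rewrite sub0r normrN ger0_norm ?normc_ge0 // => /(le_trans _); apply.
  by rewrite distrC -ReB Re_le_normc.
have := fa; move/cvgrPdist_le => /(_ e e0); apply: filterS => x.
rewrite sub0r normrN ger0_norm ?normc_ge0 // => /(le_trans _); apply.
by rewrite distrC -ImB Im_le_normc.
Qed.

Lemma cvgcP f a : cvgc F f a <-> (f : T -> C^o) @ F --> (a : C^o).
Proof.
rewrite cvgc_normc; split.
  move=> H; apply/cvgrPdist_lt => e.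
  case: e => e e'; rewrite ltcE /= => /andP[/eqP -> e0].
  move/cvgrPdist_lt : H => /(_ e e0); apply: filterS => x.
  rewrite sub0r normrN ger0_norm ?normc_ge0 // normrcE ltcE /= eqxx /=.
  by rewrite normcB_sym.
move/cvgrPdist_lt => H; apply/cvgrPdist_lt => e e0.
have /H : 0 < e%:C :> C by rewrite ltcR.
apply: filterS => x; rewrite normrcE ltcR.
by rewrite sub0r normrN ger0_norm ?normc_ge0 // normcB_sym.
Qed.

Lemma cvgc_norm f a : cvgc F f a -> (fun x => normc (f x)) @ F --> normc a.
Proof.
move=> /cvgc_normc fa; apply/cvgrPdist_le => e e0.
move/cvgrPdist_le : fa => /(_ e e0); apply: filterS => x.
rewrite sub0r normrN ger0_norm ?normc_ge0 // => /(le_trans _); apply.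
rewrite ler_norml; apply/andP; split.
  by rewrite lerNl opprB lerB_normc.
by rewrite normcB_sym lerB_normc.
Qed.

Lemma cvgc_near_neq0 f a : cvgc F f a -> a != 0 -> \forall x \near F, f x != 0.
Proof.
move=> /cvgc_norm fa; rewrite -normc_gt0 => a0.
move/cvgr_gt : fa => /(_ 0 a0); apply: filterS => x; by rewrite normc_gt0.
Qed.

Lemma cvgcV f a : a != 0 -> cvgc F f a -> cvgc F (fun x => (f x)^-1) a^-1.
Proof.
move=> a0 fa; have an := cvgc_norm fa; have na0 : normc a != 0 by rewrite normc_eq0.
apply/cvgc_normc.
have h : (fun x => normc (f x - a) * ((normc (f x))^-1 * (normc a)^-1)) @ F --> (0 : R).
  rewrite -[0 in X in _ --> X](mul0r ((normc a)^-1 * (normc a)^-1)).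
  apply: cvgM; first exact/cvgc_normc.
  by apply: cvgM; [exact: cvgV | exact: cvg_cst].
apply: cvg_trans h; apply: near_eq_cvg; have := cvgc_near_neq0 fa a0.
apply: filterS => x fx0.
have -> : (f x)^-1 - a^-1 = (a - f x) * ((f x)^-1 * a^-1).
  by field; rewrite fx0 a0.
by rewrite !normcM !normcV normcB_sym.
Qed.

Lemma cvgc_unique f a b : cvgc F f a -> cvgc F f b -> a = b.
Proof.
move=> [a1 a2] [b1 b2].
by apply: cplxP; [exact: (cvg_unique _ a1 b1) | exact: (cvg_unique _ a2 b2)].
Qed.

Lemma near_eq_cvgc f g a : (\forall x \near F, f x = g x) -> cvgc F f a -> cvgc F g a.
Proof.
move=> fg [f1 f2]; split.
  apply: cvg_trans f1; apply: near_eq_cvg; apply: filterS fg => x ->; by [].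
apply: cvg_trans f2; apply: near_eq_cvg; apply: filterS fg => x ->; by [].
Qed.

Lemma cvgc_real (f : T -> R) (a : R) : f @ F --> a -> cvgc F (fun x => (f x)%:C) a%:C.
Proof. by move=> fa; split => //=; exact: cvg_cst. Qed.

Lemma squeeze_cvgc f a (g : T -> R) :
  (\forall x \near F, normc (f x - a) <= g x) -> g @ F --> (0 : R) -> cvgc F f a.
Proof.
move=> fg g0; apply/cvgc_normc; apply: squeeze_cvgr (cvg_cst 0) g0.
by apply: filterS fg => x ->; rewrite normc_ge0.
Qed.

Lemma cvgc_le_norm f a (M : R) :
  cvgc F f a -> (\forall x \near F, normc (f x) <= M) -> normc a <= M.
Proof. by move=> /cvgc_norm fa fM; apply: (cvgr_to_le fa fM). Qed.

End Filter.

Lemma limn_cvgc (u : nat -> C) a : cvgc \oo u a -> limn (u : nat -> C^o) = a.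
Proof. by move=> /cvgcP ua; apply: (@cvg_lim C^o) => //; exact: norm_hausdorff. Qed.

End ComplexConvergence.
#[global] Arguments normc : simpl never.
#[global] Arguments cexp : simpl never.
#[global] Arguments rpowc : simpl never.
#[global] Arguments e2pi : simpl never.

(** * Calculus in one real variable *)

Section RealVariableCalculus.
Context {R : realType}.
Local Notation C := R[i].

(** The derivative is an explicit value, so that computing it in two ways yields an identity through
    [derivesC_unique]. *)
Definition derivesC (h : R -> C) (t : R) (d : C) : Prop :=
  is_derive t 1 (fun x => Re (h x)) (Re d) /\
  is_derive t 1 (fun x => Im (h x)) (Im d).

Lemma derivesC_cst (a : C) t : derivesC (fun=> a) t 0.
Proof. by split; exact: is_derive_cst. Qed.

Lemma derivesC_eq h t d d' : d = d' -> derivesC h t d -> derivesC h t d'.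
Proof. by move=> ->. Qed.

Lemma derivesCD h g t d e : derivesC h t d -> derivesC g t e -> derivesC (fun x => h x + g x) t (d + e).
Proof.
move=> [h1 h2] [g1 g2]; split.
  under eq_fun do rewrite ReD.
  by rewrite ReD; exact: is_deriveD.
under eq_fun do rewrite ImD.
by rewrite ImD; exact: is_deriveD.
Qed.

Lemma derivesCN h t d : derivesC h t d -> derivesC (fun x => - h x) t (- d).
Proof.
move=> [h1 h2]; split.
  under eq_fun do rewrite ReN.
  by rewrite ReN; exact: is_deriveN.
under eq_fun do rewrite ImN.
by rewrite ImN; exact: is_deriveN.
Qed.

Lemma derivesCB h g t d e : derivesC h t d -> derivesC g t e -> derivesC (fun x => h x - g x) t (d - e).
Proof. by move=> hd ge; apply: derivesCD => //; exact: derivesCN. Qed.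

Lemma is_deriveMr (f g : R -> R) (t d e : R) : is_derive t 1 f d -> is_derive t 1 g e ->
  is_derive t 1 (fun x => f x * g x) (d * g t + f t * e).
Proof.
move=> fd ge; apply: is_derive_eq.
by rewrite addrC /GRing.scale /= [g t * d]mulrC.
Qed.

Lemma derivesCM h g t d e : derivesC h t d -> derivesC g t e ->
  derivesC (fun x => h x * g x) t (d * g t + h t * e).
Proof.
move=> [h1 h2] [g1 g2]; split.
  under eq_fun do rewrite ReMc.
  apply: is_derive_eq (is_deriveB (is_deriveMr h1 g1) (is_deriveMr h2 g2)) _.
  by rewrite ReD !ReMc; ring.
under eq_fun do rewrite ImMc.
apply: is_derive_eq (is_deriveD (is_deriveMr h1 g2) (is_deriveMr h2 g1)) _.
by rewrite ImD !ImMc; ring.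
Qed.

Lemma derivesCZ (a : C) h t d : derivesC h t d -> derivesC (fun x => a * h x) t (a * d).
Proof. by move=> hd; apply: derivesC_eq (derivesCM (derivesC_cst a t) hd); rewrite mul0r add0r. Qed.

Lemma derivesCZr (a : C) h t d : derivesC h t d -> derivesC (fun x => h x * a) t (d * a).
Proof. by move=> hd; apply: derivesC_eq (derivesCM hd (derivesC_cst a t)); rewrite mulr0 addr0. Qed.

Lemma derivesC_real (f : R -> R) (t d : R) : is_derive t 1 f d -> derivesC (fun x => (f x)%:C) t d%:C.
Proof. by move=> fd; split => //=; exact: is_derive_cst. Qed.

Lemma derivesC_id t : derivesC (fun x => x%:C) t 1.
Proof. by apply: derivesC_real; exact: is_derive_id. Qed.

Lemma derivesC_sum I (r : seq I) (h : I -> R -> C) t (d : I -> C) :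
  (forall i, derivesC (h i) t (d i)) ->
  derivesC (fun x => \sum_(i <- r) h i x) t (\sum_(i <- r) d i).
Proof.
move=> hd; elim: r => [|i r IH].
  under eq_fun do rewrite big_nil.
  by rewrite big_nil; exact: derivesC_cst.
under eq_fun do rewrite big_cons.
by rewrite big_cons; exact: derivesCD.
Qed.

Lemma is_derive_comp1 (f g : R -> R) (t d e : R) :
  is_derive (g t) 1 f d -> is_derive t 1 g e ->
  is_derive t 1 (fun x => f (g x)) (e * d).
Proof. by move=> fd ge; rewrite mulrC; exact: (is_derive1_comp (f := f)). Qed.

Lemma derivesC_comp h (g : R -> R) (t : R) d (e : R) : derivesC h (g t) d -> is_derive t 1 g e ->
  derivesC (fun x => h (g x)) t (e%:C * d).
Proof.
move=> [h1 h2] ge; split; rewrite ?ReZ ?ImZ.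
  exact: (is_derive_comp1 h1 ge).
exact: (is_derive_comp1 h2 ge).
Qed.

Lemma derivesC_cexp h t d : derivesC h t d -> derivesC (fun x => cexp (h x)) t (d * cexp (h t)).
Proof.
move=> [h1 h2].
have e1 : is_derive t 1 (fun x => expR (Re (h x))) (Re d * expR (Re (h t))).
  exact: (is_derive_comp1 (is_derive_expR _) h1).
have e2 : is_derive t 1 (fun x => cos (Im (h x))) (Im d * (- sin (Im (h t)))).
  exact: (is_derive_comp1 (is_derive_cos _) h2).
have e3 : is_derive t 1 (fun x => sin (Im (h x))) (Im d * cos (Im (h t))).
  exact: (is_derive_comp1 (is_derive_sin _) h2).
split.
  rewrite /cexp; under eq_fun do rewrite ReZ /=.
  apply: is_derive_eq (is_deriveMr e1 e2) _.
  by rewrite /= !(ReMc, ImMc) /=; ring.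
rewrite /cexp; under eq_fun do rewrite ImZ /=.
apply: is_derive_eq (is_deriveMr e1 e3) _.
by rewrite /= !(ReMc, ImMc) /=; ring.
Qed.

Lemma is_derive_unique_val (f : R -> R) (t d d' : R) :
  is_derive t 1 f d -> is_derive t 1 f d' -> d = d'.
Proof. by move=> [_ <-] [_ <-]. Qed.

Lemma derivesC_unique h t d d' : derivesC h t d -> derivesC h t d' -> d = d'.
Proof.
by move=> [a1 a2] [b1 b2]; apply: cplxP; apply: is_derive_unique_val; eassumption.
Qed.

Lemma is_derive_near (f g : R -> R) (t d : R) : (\forall x \near t, f x = g x) ->
  is_derive t 1 f d -> is_derive t 1 g d.
Proof. by move=> fg; apply: near_eq_is_derive => //; rewrite oner_neq0. Qed.

Lemma derivesC_ext h g t d : (forall x, h x = g x) -> derivesC h t d -> derivesC g t d.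
Proof. by move=> /funext ->. Qed.

Lemma derivesC_near h g t d : (\forall x \near t, h x = g x) -> derivesC h t d -> derivesC g t d.
Proof.
move=> hg [h1 h2]; split.
  by apply: is_derive_near h1; apply: filterS hg => x ->.
by apply: is_derive_near h2; apply: filterS hg => x ->.
Qed.

Lemma is_derive_continuous (f : R -> R) (t d : R) : is_derive t 1 f d -> {for t, continuous f}.
Proof. by move=> [fd _]; apply: differentiable_continuous; apply/derivable1_diffP. Qed.

Lemma derivesC_cvg h t d : derivesC h t d -> cvgc (nbhs t) h (h t).
Proof. by move=> [h1 h2]; split; apply: is_derive_continuous; eassumption. Qed.

Lemma is_derive_le_dist (f f' : R -> R) (a b K : R) : a <= b ->
  (forall t, a <= t <= b -> is_derive t 1 f (f' t)) ->
  (forall t, a <= t <= b -> `|f' t| <= K) -> `|f b - f a| <= K * (b - a).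
Proof.
move=> ab fd fK.
have [||c cab ->] := @MVT_segment R f f' a b ab.
- by move=> x; rewrite in_itv /= => /andP[/ltW ax /ltW xb]; apply: fd; rewrite ax xb.
- apply: continuous_in_subspaceT => x; rewrite inE /= in_itv /= => xab.
  exact: is_derive_continuous (fd x xab).
- rewrite normrM (ger0_norm (_ : 0 <= b - a)) ?subr_ge0 //.
  by rewrite ler_wpM2r ?subr_ge0 //; apply: fK; move: cab; rewrite in_itv.
Qed.

(** The mean value theorem fails for complex values; applying it to real and imaginary parts costs
    the factor 2 that reappears in later constants. *)
Lemma derivesC_le_dist (f f' : R -> C) (a b K : R) : a <= b ->
  (forall t, a <= t <= b -> derivesC f t (f' t)) ->
  (forall t, a <= t <= b -> normc (f' t) <= K) ->
  normc (f b - f a) <= 2 * K * (b - a).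
Proof.
move=> ab fd fK; apply: le_trans (normc_le_ReIm _) _.
rewrite ReB ImB -mulrA mulr_natl mulr2n; apply: lerD.
  apply: (@is_derive_le_dist (fun t => Re (f t)) (fun t => Re (f' t))) => // t tab.
    by case: (fd t tab).
  by apply: le_trans (Re_le_normc _) _; exact: fK.
apply: (@is_derive_le_dist (fun t => Im (f t)) (fun t => Im (f' t))) => // t tab.
  by case: (fd t tab).
by apply: le_trans (Im_le_normc _) _; exact: fK.
Qed.

Lemma derivesC_le_distW (f f' : R -> C) (a b K : R) (lo hi : R) :
  lo <= a <= hi -> lo <= b <= hi ->
  (forall t, lo <= t <= hi -> derivesC f t (f' t)) ->
  (forall t, lo <= t <= hi -> normc (f' t) <= K) ->
  normc (f b - f a) <= 2 * K * `|b - a|.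
Proof.
move=> /andP[la ah] /andP[lb bh] fd fK; have [ab|/ltW ba] := leP a b.
  rewrite ger0_norm ?subr_ge0 //; apply: (@derivesC_le_dist f f') => // t /andP[h1 h2].
    by apply: fd; rewrite (le_trans la) // (le_trans h2).
  by apply: fK; rewrite (le_trans la) // (le_trans h2).
rewrite distrC ger0_norm ?subr_ge0 // normcB_sym.
apply: (@derivesC_le_dist f f') => // t /andP[h1 h2].
  by apply: fd; rewrite (le_trans lb) // (le_trans h2).
by apply: fK; rewrite (le_trans lb) // (le_trans h2).
Qed.

Lemma derivesC_cst_on (f : R -> C) (lo : R) :
  (forall t, lo < t -> derivesC f t 0) -> forall a b, lo < a -> lo < b -> f a = f b.
Proof.
move=> fd a b la lb; apply/esym/eqP; rewrite -subr_eq0 -normc_eq0.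
have : normc (f b - f a) <= 2 * 0 * `|b - a|.
  apply: (@derivesC_le_distW f (fun=> 0) a b 0 (Num.min a b) (Num.max a b)).
  - by rewrite ge_min le_max lexx.
  - by rewrite ge_min le_max lexx !orbT.
  - move=> t /andP[h _]; apply: fd; apply: lt_le_trans h.
    by rewrite lt_min la lb.
  - by move=> t _; rewrite normc0.
rewrite mulr0 mul0r => h; apply/eqP; apply/le_anti; by rewrite h normc_ge0.
Qed.

(** Mean value bound for exp(z t) on [0, 1]: |exp(z t)| <= e <= 4, and the factor 2 of
    [derivesC_le_dist] makes 8. *)
Lemma normc_cexp_sub1_le (z : C) : normc z <= 1 ->
  normc (cexp z - 1) <= 8 * normc z.
Proof.
move=> z1.
have := @derivesC_le_dist (fun t => cexp (z * t%:C)) (fun t => z * cexp (z * t%:C)) 0 1 (normc z * 4) ler01.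
rewrite mulr0 cexp0 mulr1 subr0 mulr1.
have -> : 2 * (normc z * 4) = 8 * normc z by ring.
apply.
  move=> t _; apply: derivesC_cexp; apply: derivesC_eq (derivesCZ z (derivesC_id t)).
  by rewrite mulr1.
move=> t /andP[t0 t1]; rewrite normcM ler_wpM2l ?normc_ge0 // normc_cexp.
apply: (@le_trans _ _ (expR 1)).
  rewrite ler_expR mulrC ReZ; apply: le_trans (ler_norm _) _.
  rewrite normrM (ger0_norm t0); apply: mulr_ile1 => //.
  by apply: le_trans (Re_le_normc _) _.
(* From exp(-1/2) >= 1 - 1/2; squaring gives e <= 4. *)
have h : expR (2^-1) <= (2 : R).
  have := expR_ge1Dx (- 2^-1 : R); rewrite expRN => h.
  rewrite -[leLHS]invrK -[leRHS]invrK lef_pV2 ?posrE ?invr_gt0 ?expR_gt0 //.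
  by apply: le_trans h; lra.
have -> : (1 : R) = 2 * 2^-1 by rewrite mulfV ?pnatr_eq0.
rewrite expRM_natl.
apply: le_trans (_ : 2 ^+ 2 <= _); last by rewrite expr2; lra.
by rewrite lerXn2r ?nnegrE ?expR_ge0.
Qed.

Lemma normc_cexp_sub1B_le (z : C) : normc z <= 1 ->
  normc (cexp z - 1 - z) <= 16 * normc z ^+ 2.
Proof.
move=> z1.
have := @derivesC_le_dist (fun t => cexp (z * t%:C) - z * t%:C) (fun t => z * (cexp (z * t%:C) - 1)) 0 1 (normc z * (8 * normc z)) ler01.
rewrite mulr0 cexp0 mulr1 !subr0 mulr1 => H.
have -> : cexp z - 1 - z = cexp z - z - 1 by ring.
have -> : 16 * normc z ^+ 2 = 2 * (normc z * (8 * normc z)) by ring.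
apply: H.
  move=> t _.
  have d1 : derivesC (fun x => z * x%:C) t z by apply: derivesC_eq (derivesCZ z (derivesC_id t)); rewrite mulr1.
  by apply: derivesC_eq (derivesCB (derivesC_cexp d1) d1); ring.
move=> t /andP[t0 t1]; rewrite normcM ler_wpM2l ?normc_ge0 //.
have zt : normc (z * t%:C) <= normc z.
  by rewrite normcM normcRE ger0_norm // ler_piMr ?normc_ge0.
apply: le_trans (normc_cexp_sub1_le (le_trans zt z1)) _.
by rewrite ler_wpM2l.
Qed.

End RealVariableCalculus.

(** * The Gamma function *)

Section GammaFunction.
Context {R : realType}.
Local Notation C := R[i].

Lemma invSnB (n : nat) : (n.+1%:R : R)^-1 - n.+2%:R^-1 = (n.+1%:R * n.+2%:R)^-1.
Proof.
have := ltr0Sn R n; have := ltr0Sn R n.+1; rewrite -(natr1 n.+1) => h1 h2.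
by field; lra.
Qed.

(** The bound telescopes as K / (n + 1) - K / (n + 2), so [x n - K / n.+1%:R] is nondecreasing and
    bounded above. *)
Lemma cvg_slow (x : nat -> R) (K : R) : 0 <= K ->
  (forall n, `|x n.+1 - x n| <= K / (n.+1%:R * n.+2%:R)) -> cvgn x.
Proof.
move=> K0 xK; pose y n := x n - K / n.+1%:R.
have ynd : nondecreasing_seq y.
  apply/nondecreasing_seqP => n; rewrite /y -subr_ge0.
  have -> : x n.+1 - K / n.+2%:R - (x n - K / n.+1%:R) =
    (x n.+1 - x n) + K * (n.+1%:R^-1 - n.+2%:R^-1) by ring.
  by rewrite invSnB -lerBlDr sub0r lerNl; apply: le_trans (xK n); rewrite -normrN ler_norm.
have yub n : x n - x 0 <= K * (1 - n.+1%:R^-1).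
  elim: n => [|n IH]; first by rewrite subrr invr1 subrr mulr0.
  have -> : x n.+1 - x 0 = (x n.+1 - x n) + (x n - x 0) by ring.
  have -> : K * (1 - n.+2%:R^-1) = K * (n.+1%:R^-1 - n.+2%:R^-1) + K * (1 - n.+1%:R^-1) by ring.
  by apply: lerD => //; rewrite invSnB (le_trans (ler_norm _)).
have cy : cvgn y.
  apply: nondecreasing_is_cvgn => //; exists (x 0 + K) => _ [n _ <-].
  have i0 : 0 <= (n.+1%:R : R)^-1 by rewrite invr_ge0.
  have := yub n; have : 0 <= K / n.+1%:R by rewrite mulr_ge0.
  have -> : K * (1 - n.+1%:R^-1) = K - K / n.+1%:R by ring.
  by rewrite /y; set a := K / _; lra.
have ck : (fun n => K / n.+1%:R) @ \oo --> (0 : R).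
  by rewrite -[0](mulr0 K); apply: cvgM; [exact: cvg_cst | exact: cvg_harmonic].
have -> : x = y \+ (fun n => K / n.+1%:R) by apply/funext => n; rewrite /y /= subrK.
by apply: is_cvgD => //; apply/cvg_ex; exists 0.
Qed.

Lemma cvgc_slow (u : nat -> C) (K : R) : 0 <= K ->
  (forall n, normc (u n.+1 - u n) <= K / (n.+1%:R * n.+2%:R)) ->
  exists l, cvgc \oo u l.
Proof.
move=> K0 uK.
have /cvg_ex[a ha] : cvgn (fun n => Re (u n)).
  by apply: (@cvg_slow _ K) => // n; rewrite -ReB (le_trans (Re_le_normc _)).
have /cvg_ex[b hb] : cvgn (fun n => Im (u n)).
  by apply: (@cvg_slow _ K) => // n; rewrite -ImB (le_trans (Im_le_normc _)).
by exists (a +i* b); split.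
Qed.

(** Factors 1 + O(1/n^2): comparison with exp(M) bounds the products, hence their increments are
    small enough for [cvgc_slow]. *)
Lemma cvgc_ratio (u : nat -> C) (M : R) : 0 <= M -> (forall n, u n != 0) ->
  (forall n, normc (u n.+1 / u n - 1) <= M / (n.+1%:R * n.+2%:R)) ->
  exists l, cvgc \oo u l.
Proof.
move=> M0 u0 uM.
have stp n : normc (u n.+1 - u n) <= normc (u n) * (M / (n.+1%:R * n.+2%:R)).
  have -> : u n.+1 - u n = u n * (u n.+1 / u n - 1) by field; rewrite u0.
  by rewrite normcM ler_wpM2l ?normc_ge0.
have bnd n : normc (u n) <= normc (u 0) * expR (M * (1 - n.+1%:R^-1)).
  elim: n => [|n IH]; first by rewrite invr1 subrr mulr0 expR0 mulr1.
  have h : normc (u n.+1) <= normc (u n) * (1 + M / (n.+1%:R * n.+2%:R)).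
    rewrite mulrDr mulr1 -lerBlDl; apply: le_trans (stp n); exact: lerB_normc.
  apply: le_trans h _.
  have -> : M * (1 - n.+2%:R^-1) = M * (1 - n.+1%:R^-1) + M * (n.+1%:R^-1 - n.+2%:R^-1) by ring.
  rewrite expRD mulrA; apply: ler_pM => //; rewrite ?normc_ge0 //.
    by rewrite addr_ge0 // divr_ge0 // mulr_ge0.
  by rewrite invSnB expR_ge1Dx.
pose B := normc (u 0) * expR M.
have uB n : normc (u n) <= B.
  apply: le_trans (bnd n) _; rewrite ler_wpM2l ?normc_ge0 // ler_expR.
  rewrite ler_piMr // lerBlDl lerDr invr_ge0 //.
apply: (@cvgc_slow u (B * M)).
  by rewrite mulr_ge0 // (le_trans (normc_ge0 _) (uB 0%N)).
move=> n; apply: le_trans (stp n) _; rewrite -mulrA ler_wpM2r //.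
by rewrite divr_ge0 // mulr_ge0.
Qed.

(** The limit is nonzero because the reciprocals converge by the same criterion, and the two limits
    multiply to 1. *)
Lemma cvgc_ratio_neq0 (u : nat -> C) (M : R) (n0 : nat) : 0 <= M ->
  (forall n, (n0 <= n)%N -> u n != 0) ->
  (forall n, (n0 <= n)%N -> normc (u n.+1 / u n - 1) <= M / (n.+1%:R * n.+2%:R)) ->
  exists2 l, l != 0 & cvgc \oo u l.
Proof.
move=> M0 u0 uM.
(* Beyond [m] the relative increments e are at most 1/2, so that 1 / (1 + e) - 1 = - e / (1 + e) is
   at most 2 |e|. *)
pose m := maxn n0 (Num.bound (2 * M)).
have mM n : (m <= n)%N -> M / (n.+1%:R * n.+2%:R) <= 2^-1.
  rewrite geq_max => /andP[_ h].
  have nM : 2 * M <= n.+1%:R.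
    apply: ltW; apply: lt_le_trans (archi_boundP _) _; first by rewrite mulr_ge0.
    by rewrite ler_nat (leq_trans h).
  rewrite ler_pdivrMr ?mulr_gt0 //.
  rewrite -ler_pdivrMl // invrK; apply: le_trans nM _.
  by rewrite ler_peMr // ler1n.
pose w n := u (n + m)%N.
have w0 n : w n != 0 by apply: u0; rewrite (leq_trans (leq_maxl _ _) (leq_addl _ _)).
have mono n : M / ((n + m).+1%:R * (n + m).+2%:R) <= M / (n.+1%:R * n.+2%:R).
  rewrite ler_wpM2l // lef_pV2 ?posrE ?mulr_gt0 //.
  by apply: ler_pM => //; rewrite ler_nat !ltnS leq_addr.
have wM' n : normc (w n.+1 / w n - 1) <= M / ((n + m).+1%:R * (n + m).+2%:R).
  by rewrite /w addSn; apply: uM; rewrite (leq_trans (leq_maxl _ _) (leq_addl _ _)).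
have wM n : normc (w n.+1 / w n - 1) <= M / (n.+1%:R * n.+2%:R).
  exact: le_trans (wM' n) (mono n).
have [l wparam] := cvgc_ratio M0 w0 wM.
have wV0 n : (w n)^-1 != 0 by rewrite invr_eq0.
have [l' wl'] : exists l', cvgc \oo (fun n => (w n)^-1) l'.
  apply: (@cvgc_ratio _ (2 * M)) => //; first by rewrite mulr_ge0.
  move=> n; rewrite invrK -mulrA.
  set e := w n.+1 / w n - 1.
  have he : normc e <= 2^-1 by apply: le_trans (wM' n) (mM _ _); rewrite leq_addl.
  have e1 : 1 + e != 0.
    rewrite -normc_gt0; apply: lt_le_trans (_ : 1 - normc e <= _).
      by rewrite subr_gt0; apply: le_lt_trans he _; rewrite invf_lt1 // ltr1n.
    by have := lerB_normc 1 (- e); rewrite opprK normcN normc1.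
  have -> : (w n.+1)^-1 * w n - 1 = - (e / (1 + e)).
    have we : w n.+1 = w n * (1 + e) by rewrite /e; field; rewrite w0.
    by rewrite we; field; rewrite e1 w0.
  rewrite normcN normcM normcV.
  have e2 : 2^-1 <= normc (1 + e).
    have := lerB_normc 1 (- e); rewrite opprK normcN normc1; apply: le_trans.
    by lra.
  rewrite mulrC; apply: ler_pM; rewrite ?invr_ge0 ?normc_ge0 //.
    by rewrite -[leRHS]invrK lef_pV2 ?posrE ?invr_gt0 // (lt_le_trans _ e2) ?invr_gt0.
  exact: wM.
exists l.
  have h1 : l * l' = 1.
    apply: (cvgc_unique (cvgcM wparam wl')).
    have -> : (fun n => w n * (w n)^-1) = fun=> 1 by apply/funext => n; rewrite mulfV.
    exact: cvgc_cst.
  by apply/eqP => l0; move: h1; rewrite l0 mul0r => /eqP; rewrite eq_sym oner_eq0.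
have [l1 l2] := wparam; split.
  by have := l1; rewrite /w (cvg_shiftn m (fun n => Re (u n))).
by have := l2; rewrite /w (cvg_shiftn m (fun n => Im (u n))).
Qed.

Definition gauss (s : C) (n : nat) : C :=
  n`!%:R * rpowc n%:R s / \prod_(0 <= j < n.+1) (s + j%:R).

Definition nonpole (s : C) := forall j : nat, s + j%:R != 0.

Lemma nonpole_Im (s : C) : Im s != 0 -> nonpole s.
Proof.
move=> h j; apply: contra h => /eqP h.
by have := congr1 (@complex.Im R) h; rewrite ImD Im_nat addr0 /= => ->.
Qed.

Lemma rpowc_neq0 (y : R) (s : C) : rpowc y s != 0. Proof. exact: cexp_neq0. Qed.

Lemma rpowcD (y : R) (s t : C) : rpowc y (s + t) = rpowc y s * rpowc y t.
Proof. by rewrite /rpowc mulrDl cexpD. Qed.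

Lemma rpowcN (y : R) (s : C) : rpowc y (- s) = (rpowc y s)^-1.
Proof. by rewrite /rpowc mulNr cexpN. Qed.

Lemma rpowc1 (y : R) : 0 < y -> rpowc y 1 = y%:C.
Proof. by move=> y0; rewrite /rpowc mul1r cexp_real lnK ?posrE. Qed.

Lemma normc_rpowc (y : R) (s : C) : normc (rpowc y s) = expR (Re s * ln y).
Proof. by rewrite /rpowc normc_cexp ReMc /= mulr0 subr0. Qed.

Lemma gauss_neq0 s n : nonpole s -> gauss s n != 0.
Proof.
move=> sp; rewrite /gauss; apply: mulf_neq0.
  by apply: mulf_neq0 (rpowc_neq0 _ _); rewrite pnatr_eq0 -lt0n fact_gt0.
by rewrite invr_eq0 prodf_seq_neq0; apply/allP => j _; exact: sp.
Qed.

Lemma gauss_ratio s n : nonpole s -> (0 < n)%N ->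
  gauss s n.+1 / gauss s n =
  n.+1%:R * cexp (s * (ln (n.+1%:R / n%:R))%:C) / (s + n.+1%:R).
Proof.
move=> sp n0.
rewrite /gauss (big_nat_recr n.+1) //= factS natrM.
have p0 : \prod_(0 <= j < n.+1) (s + j%:R) != 0.
  by rewrite prodf_seq_neq0; apply/allP => j _; exact: sp.
have f0 : (n`!%:R : C) != 0 by rewrite pnatr_eq0 -lt0n fact_gt0.
have -> : rpowc n.+1%:R s = rpowc n%:R s * cexp (s * (ln (n.+1%:R / n%:R))%:C).
  rewrite /rpowc -cexpD -mulrDr -rcD ln_div ?posrE ?ltr0n //; congr (cexp (_ * _%:C)).
  by rewrite addrC subrK.
have r0 := rpowc_neq0 n%:R s; have s0 := sp n.+1.
move: p0 f0 r0 s0; move: (\prod_(_ <= _ < _) _) (rpowc _ _) => p q p0 f0 r0.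
move: (cexp _) f0 (n.+1%:R : C) => ce; move: (n`!%:R : C) => f f0 m s0.
by field; rewrite p0 f0 r0 s0.
Qed.

Lemma ln_succ_bound (n : nat) : (0 < n)%N ->
  let h := ln (n.+1%:R / n%:R : R) in n.+1%:R^-1 <= h <= n%:R^-1.
Proof.
move=> n0 /=; set h := ln _; have n0' : 0 < (n%:R : R) by rewrite ltr0n.
have n1 := ltr0Sn R n.
apply/andP; split.
  rewrite /h -[_ / _]invrK lnV ?posrE ?invr_gt0 ?divr_gt0 // lerNr.
  have -> : (n.+1%:R / n%:R)^-1 = 1 + (- n.+1%:R^-1) :> R.
    by rewrite -natr1; field; rewrite ?natr1; lra.
  apply: le_ln1Dx; rewrite ltrN2 invf_lt1 // ltr1n //.
have -> : h = ln (1 + n%:R^-1).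
  by rewrite /h -natr1; congr ln; field; lra.
apply: le_ln1Dx; apply: lt_trans (_ : 0 < _); by rewrite ?invr_gt0 // oppr_lt0.
Qed.

(** With h = ln((n + 1) / n), consecutive terms have the quotient (n + 1) exp(s h) / (s + n + 1),
    which is 1 + O(1/n^2) because 1/(n + 1) <= h <= 1/n. *)
Lemma gauss_cvg s : nonpole s -> exists2 l, l != 0 & cvgc \oo (gauss s) l.
Proof.
move=> sp; pose a := normc s.
have a0 : 0 <= a := normc_ge0 s.
pose n0 := (Num.bound (2 * a)).+1.
(* The 2 comes from |s + n + 1| >= (n + 1) / 2, the 3 from n + 2 <= 3 n, and 32 is twice the 16 of
   the second order remainder [E]. *)
apply: (@cvgc_ratio_neq0 _ (2 * 3 * (a + 32 * a ^+ 2)) n0).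
- by rewrite !mulr_ge0 // addr_ge0 // mulr_ge0 // sqr_ge0.
- by move=> n _; exact: gauss_neq0.
move=> n nn0; have n1 : (0 < n)%N by apply: leq_trans nn0.
rewrite gauss_ratio //.
have n0' : 0 < (n%:R : R) by rewrite ltr0n.
have nS := ltr0Sn R n.
have na : 2 * a <= n%:R.
  apply: ltW; apply: lt_le_trans (archi_boundP _) _; first by rewrite mulr_ge0.
  by rewrite ler_nat; apply: leq_trans nn0; rewrite /n0 leqnSn.
have /andP[h1 h2] := ln_succ_bound n1.
set h := ln _ in h1 h2 *.
have h0 : 0 <= h by apply: le_trans h1; rewrite invr_ge0.
pose E := cexp (s * h%:C) - 1 - s * h%:C.
have nsh : normc (s * h%:C) <= a / n%:R.
  by rewrite normcM normcRE ger0_norm // ler_wpM2l.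
have an1 : a / n%:R <= 1 by rewrite ler_pdivrMr // mul1r; lra.
have EE : normc E <= 16 * (a / n%:R) ^+ 2.
  apply: le_trans (normc_cexp_sub1B_le (le_trans nsh an1)) _.
  by rewrite ler_wpM2l // lerXn2r ?nnegrE ?normc_ge0 // divr_ge0.
have s0 := sp n.+1.
have -> : n.+1%:R * cexp (s * h%:C) / (s + n.+1%:R) - 1 =
   (s * (n.+1%:R * h - 1)%:C + n.+1%:R * E) / (s + n.+1%:R).
  rewrite /E rcB rcM rc_nat; have -> : ((1 : R)%:C = 1) by [].
  by move: s0; move: (n.+1%:R : C) (cexp _) => m ce s0; field.
rewrite normcM normcV ler_pdivrMr ?normc_gt0 //.
have den : n.+1%:R / 2 <= normc (s + n.+1%:R).
  have := lerB_normc (n.+1%:R : C) (- s); rewrite opprK normcN normc_nat [_ + s]addrC.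
  apply: le_trans; rewrite -/a; move: na; rewrite -(natr1 n) => na; lra.
have num : normc (s * (n.+1%:R * h - 1)%:C + n.+1%:R * E) <= (a + 32 * a ^+ 2) / n%:R.
  apply: le_trans (le_normcD _ _) _; rewrite mulrDl; apply: lerD.
    rewrite normcM normcRE ler_wpM2l // ger0_norm.
      rewrite lerBlDr; apply: le_trans (_ : n.+1%:R * n%:R^-1 <= _); first by rewrite ler_wpM2l.
      by rewrite -natr1; have -> : (n%:R + 1) / n%:R = n%:R^-1 + 1 :> R by field; lra.
    by rewrite subr_ge0 -ler_pdivrMl // mulr1.
  rewrite normcM normc_nat.
  apply: le_trans (_ : n.+1%:R * (16 * (a / n%:R) ^+ 2) <= _); first by rewrite ler_wpM2l.
  have -> : n.+1%:R * (16 * (a / n%:R) ^+ 2) = (16 * a ^+ 2 / n%:R) * (n.+1%:R / n%:R).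
    by field; lra.
  have -> : 32 * a ^+ 2 / n%:R = (16 * a ^+ 2 / n%:R) * 2 by field; lra.
  rewrite ler_wpM2l //; first by rewrite !mulr_ge0 ?sqr_ge0 // invr_ge0 ltW.
  rewrite ler_pdivrMr // -natr1; have : (1 : R) <= n%:R by rewrite ler1n.
  lra.
apply: le_trans num _.
set A := a + 32 * a ^+ 2.
have A0 : 0 <= A by rewrite addr_ge0 // mulr_ge0 // sqr_ge0.
have n1R : (1 : R) <= n%:R by rewrite ler1n.
have SS : 0 < (n.+1%:R * n.+2%:R : R) by rewrite mulr_gt0.
apply: le_trans (_ : 2 * 3 * A / (n.+1%:R * n.+2%:R) * (n.+1%:R / 2) <= _); last first.
  by rewrite ler_wpM2l // divr_ge0 ?mulr_ge0.
have -> : 2 * 3 * A / (n.+1%:R * n.+2%:R) * (n.+1%:R / 2) = A * (3 / n.+2%:R).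
  have : 0 < (n.+2%:R : R) by [].
  by move=> ?; field; lra.
rewrite ler_wpM2l // ler_pdivlMr // mulrC ler_pdivrMr //.
by rewrite -(natr1 n.+1) -(natr1 n); lra.
Qed.

Lemma Gammac_cvg s : nonpole s -> cvgc \oo (gauss s) (Gammac s).
Proof. by move=> /gauss_cvg[l _ h]; rewrite [Gammac s](limn_cvgc h). Qed.

Lemma Gammac_neq0 s : nonpole s -> Gammac s != 0.
Proof. by move=> /gauss_cvg[l l0 h]; rewrite [Gammac s](limn_cvgc h). Qed.

Lemma cvgc_invn (a : C) : cvgc \oo (fun n => (a + n%:R)^-1) 0.
Proof.
have nK k : cvgn (fun n => harmonic (n + k)%N : R).
  by apply/cvg_ex; exists 0; rewrite (cvg_shiftn k (harmonic : R^nat)); exact: cvg_harmonic.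
pose m := (Num.bound (normc a)).
apply: (@squeeze_cvgc _ _ _ _ _ _ (fun n => (n.+1 - m.+1)%:R^-1)).
  exists m.+2 => // n /= hn; rewrite subr0 normcV lef_pV2 ?posrE.
  - have := lerB_normc (n%:R : C) (- a); rewrite opprK normcN normc_nat [_ + a]addrC; apply: le_trans.
    rewrite lerBrDr; apply: le_trans (_ : (n.+1 - m.+1)%:R + m%:R <= _).
      rewrite lerD2l; apply: ltW; apply: archi_boundP; exact: normc_ge0.
    by rewrite -natrD ler_nat; move: hn; lia.
  - have := lerB_normc (n%:R : C) (- a); rewrite opprK normcN normc_nat [_ + a]addrC.
    apply: lt_le_trans; rewrite subr_gt0; apply: lt_le_trans (archi_boundP (normc_ge0 a)) _.
    by rewrite ler_nat; move: hn; rewrite /m; lia.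
  - by rewrite ltr0n; move: hn; lia.
rewrite -(cvg_shiftn m.+1 (fun n => (n.+1 - m.+1)%:R^-1 : R)).
under eq_fun do rewrite -addSn addnK.
exact: cvg_harmonic.
Qed.

(** Gauss' products satisfy gauss(s + 1, n) = s gauss(s, n) n / (s + 1 + n), and the last factor
    tends to 1. *)
Lemma GammacS s : nonpole s -> Gammac (s + 1) = s * Gammac s.
Proof.
move=> sp.
have sp1 : nonpole (s + 1) by move=> j; rewrite -addrA nat1r; exact: sp.
apply: (cvgc_unique (Gammac_cvg sp1)).
have h : cvgc \oo (fun n => s * (gauss s n * (1 - (s + 1) * (s + 1 + n%:R)^-1))) (s * Gammac s).
  apply: cvgcM; first exact: cvgc_cst.
  rewrite -[Gammac s]mulr1; apply: cvgcM; first exact: Gammac_cvg.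
  rewrite -[X in cvgc _ _ X](_ : 1 - (s + 1) * 0 = 1); last by rewrite mulr0 subr0.
  apply: cvgcB; first exact: cvgc_cst.
  by apply: cvgcM; [exact: cvgc_cst | exact: cvgc_invn].
apply: near_eq_cvgc h; exists 1%N => // n /= n0.
have n0' : 0 < (n%:R : R) by rewrite ltr0n.
rewrite /gauss rpowcD rpowc1 // rc_nat.
have s0 : s != 0 by have := sp 0%N; rewrite addr0.
have p0 : \prod_(0 <= j < n.+1) (s + j%:R) != 0.
  by rewrite prodf_seq_neq0; apply/allP => j _; exact: sp.
have sn := sp1 n.
have -> : \prod_(0 <= j < n.+1) (s + 1 + j%:R) =
    \prod_(0 <= j < n.+1) (s + j%:R) * ((s + 1 + n%:R) / s).
  rewrite mulrA; apply: (mulIf s0); rewrite divfK //.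
  transitivity (\prod_(0 <= j < n.+2) (s + j%:R)).
    rewrite [RHS]big_nat_recl //= addr0 mulrC; congr (_ * _).
    by apply: eq_bigr => j _; rewrite -addrA nat1r.
  by rewrite (big_nat_recr n.+1) //= -addrA nat1r.
move: p0 sn; move: (\prod_(_ <= _ < _) _) (rpowc _ _) (n`!%:R : C) (n%:R : C) => p q f m p0 sn.
by field; rewrite p0 s0 sn.
Qed.

End GammaFunction.

(** * Asymptotics of exponential generating functions *)

Section ExponentialGeneratingFunctions.
Context {R : realType}.
Local Notation C := R[i].
Implicit Types (b c : nat -> C) (x : R).

Definition expseq b : Prop := exists B G : R, forall n, normc (b n) <= B * G ^+ n.

(** Two real power series, so that the differentiation theorem for real power series applies to
    each; [egf_cvg] recovers the complex series. *)
Definition egf b x : C :=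
  limn (pseries (fun n => Re (b n) / n`!%:R) x) +i*
  limn (pseries (fun n => Im (b n) / n`!%:R) x).

Lemma pseries_expseq_cvg (f : nat -> R) (B G x : R) :
  (forall n, `|f n| <= B * G ^+ n) ->
  cvgn (pseries (fun n => f n / n`!%:R) x).
Proof.
move=> fB; apply: normed_cvg.
apply: (@series_le_cvg _ _ (fun n => B * exp_coeff (`|G| * `|x|) n)).
- by move=> n; exact: normr_ge0.
- move=> n; rewrite mulr_ge0 //; first by have := fB 0%N; rewrite expr0 mulr1; apply: le_trans.
  by rewrite exp_coeff_ge0 // mulr_ge0.
- move=> n; rewrite /exp_coeff /= !normrM normrX normfV (ger0_norm (_ : 0 <= n`!%:R)) // exprMn.
  rewrite mulrAC !mulrA ler_pM2r ?invr_gt0 ?ltr0n ?fact_gt0 // ler_wpM2r ?exprn_ge0 //.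
  apply: le_trans (fB n) _.
  have B0 : 0 <= B by have := fB 0%N; rewrite expr0 mulr1; apply: le_trans.
  by rewrite ler_wpM2l // -normrX ler_norm.
- by apply: is_cvg_seriesZ; exact: is_cvg_series_exp_coeff.
Qed.

Lemma expseq_re b : expseq b -> exists B G : R, forall n, `|Re (b n)| <= B * G ^+ n.
Proof.
by move=> [B [G h]]; exists B, G => n; apply: le_trans (Re_le_normc _) _.
Qed.

Lemma expseq_im b : expseq b -> exists B G : R, forall n, `|Im (b n)| <= B * G ^+ n.
Proof.
by move=> [B [G h]]; exists B, G => n; apply: le_trans (Im_le_normc _) _.
Qed.

Lemma egf_cvg b x : expseq b ->
  cvgc \oo (series (fun n => b n * ((x ^+ n / n`!%:R)%:C))) (egf b x).
Proof.
move=> hb.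
have [B1 [G1 h1]] := expseq_re hb; have [B2 [G2 h2]] := expseq_im hb.
have c1 := pseries_expseq_cvg (x := x) h1; have c2 := pseries_expseq_cvg (x := x) h2.
split => /=.
  rewrite (_ : (fun n => _) = pseries (fun n => Re (b n) / n`!%:R) x); first exact: c1.
  apply/funext => n; rewrite /pseries /series /= Re_sum; apply: eq_bigr => i _.
  by rewrite mulrC ReZ mulrC mulrA mulrAC mulrC mulrCA mulrA.
rewrite (_ : (fun n => _) = pseries (fun n => Im (b n) / n`!%:R) x); first exact: c2.
apply/funext => n; rewrite /pseries /series /= Im_sum; apply: eq_bigr => i _.
by rewrite mulrC ImZ mulrC mulrA mulrAC mulrC mulrCA mulrA.
Qed.

Lemma expseqW b (B G : R) : (forall n, normc (b n) <= B * G ^+ n) ->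
  exists B' G' : R, [/\ 0 <= B', 1 <= G' & forall n, normc (b n) <= B' * G' ^+ n].
Proof.
move=> h; have B0 : 0 <= B by have := h 0%N; rewrite expr0 mulr1; apply: le_trans; exact: normc_ge0.
exists B, (1 + `|G|); split => //; first by rewrite lerDl.
move=> n; apply: le_trans (h n) _; rewrite ler_wpM2l //.
apply: le_trans (ler_norm _) _; rewrite normrX; apply: lerXn2r; rewrite ?nnegrE ?addr_ge0 //.
by rewrite lerDr.
Qed.

Lemma expseqD b c : expseq b -> expseq c -> expseq (fun n => b n + c n).
Proof.
move=> [B [G /expseqW[B1 [G1 [B10 G11 h1]]]]] [B' [G' /expseqW[B2 [G2 [B20 G21 h2]]]]].
exists (B1 + B2), (G1 * G2) => n; apply: le_trans (le_normcD _ _) _.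
rewrite mulrDl exprMn; apply: lerD; first apply: le_trans (h1 n) _.
  rewrite ler_wpM2l // ler_peMr ?exprn_ge0 ?exprn_ege1 //; exact: le_trans G11.
apply: le_trans (h2 n) _.
rewrite ler_wpM2l // ler_peMl ?exprn_ge0 ?exprn_ege1 //; exact: le_trans G21.
Qed.

Lemma expseqZ (a : C) b : expseq b -> expseq (fun n => a * b n).
Proof.
move=> [B [G h]]; exists (normc a * B), G => n.
by rewrite normcM -mulrA ler_wpM2l ?normc_ge0.
Qed.

Lemma expseqS b : expseq b -> expseq (fun n => b n.+1).
Proof. by move=> [B [G h]]; exists (B * G), G => n; rewrite -mulrA -exprS. Qed.

Lemma expseqM b c : expseq b -> expseq c -> expseq (fun n => b n * c n).
Proof.
move=> [B [G /expseqW[B1 [G1 [B10 G11 h1]]]]] [B' [G' /expseqW[B2 [G2 [B20 G21 h2]]]]].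
exists (B1 * B2), (G1 * G2) => n; rewrite normcM exprMn mulrACA.
by apply: ler_pM; rewrite ?normc_ge0.
Qed.

Lemma expseq_nat : expseq (fun n => n%:R).
Proof.
exists 1, 2 => n; rewrite mul1r normc_nat -natrX ler_nat; apply: ltnW; exact: ltn_expl.
Qed.

Lemma expseq_cst (a : C) : expseq (fun=> a).
Proof. by exists (normc a), 1 => n; rewrite expr1n mulr1. Qed.

Lemma eq_egf b c x : (forall n, b n = c n) -> egf b x = egf c x.
Proof. by move=> /funext ->. Qed.

Lemma egfD b c x : expseq b -> expseq c -> egf (fun n => b n + c n) x = egf b x + egf c x.
Proof.
move=> hb hc; apply: (cvgc_unique (egf_cvg x (expseqD hb hc))).
apply: near_eq_cvgc (cvgcD (egf_cvg x hb) (egf_cvg x hc)); apply: nearW => n.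
by rewrite /series /= -big_split /=; apply: eq_bigr => i _; rewrite mulrDl.
Qed.

Lemma egfZ a b x : expseq b -> egf (fun n => a * b n) x = a * egf b x.
Proof.
move=> hb; apply: (cvgc_unique (egf_cvg x (expseqZ a hb))).
apply: near_eq_cvgc (cvgcM (cvgc_cst a) (egf_cvg x hb)); apply: nearW => n.
by rewrite /series /= big_distrr /=; apply: eq_bigr => i _; rewrite mulrA.
Qed.

(** Differentiation shifts the coefficients of an exponential generating function, so x d/dx
    multiplies the n-th one by n. *)
Lemma egf_natM b x : expseq b -> egf (fun n => n%:R * b n) x = x%:C * egf (fun n => b n.+1) x.
Proof.
move=> hb.
have h1 := egf_cvg x (expseqM expseq_nat hb).
have h1' : cvgc \oo (fun n => series (fun n => n%:R * b n * (x ^+ n / n`!%:R)%:C) (n + 1)%N) (egf (fun n => n%:R * b n) x).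
  case: h1 => a1 a2; split; first by rewrite (cvg_shiftn 1 (fun n => Re (series (fun n => n%:R * b n * (x ^+ n / n`!%:R)%:C) n))).
  by rewrite (cvg_shiftn 1 (fun n => Im (series (fun n => n%:R * b n * (x ^+ n / n`!%:R)%:C) n))).
apply: (cvgc_unique h1').
apply: near_eq_cvgc (cvgcM (cvgc_cst x%:C) (egf_cvg x (expseqS hb))); apply: nearW => n.
rewrite /series /= addn1 big_nat_recl //= mul0r mul0r add0r big_distrr /=.
apply: eq_bigr => i _; rewrite factS natrM exprS.
have f0 : (i`!%:R : R) != 0 by rewrite pnatr_eq0 -lt0n fact_gt0.
have s0 : (i.+1%:R : R) != 0 by rewrite pnatr_eq0.
have -> : (x * x ^+ i / (i.+1%:R * i`!%:R)) = x * (x ^+ i / i`!%:R) * i.+1%:R^-1.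
  by move: s0; move: (i.+1%:R : R) => m s0; field; rewrite f0 s0.
set t := x ^+ i / i`!%:R; rewrite [in RHS]rcM [in RHS]rcM rcV rc_nat.
have s0' : (i.+1%:R : C) != 0 by rewrite pnatr_eq0.
by move: s0'; move: (i.+1%:R : C) => m s0'; field.
Qed.

Lemma derivesC_egf b x : expseq b -> derivesC (egf b) x (egf (fun n => b n.+1) x).
Proof.
have aux (f : nat -> R) (B G : R) : (forall n, `|f n| <= B * G ^+ n) ->
   is_derive x 1 (fun x => limn (pseries (fun n => f n / n`!%:R) x))
     (limn (pseries (fun n => f n.+1 / n`!%:R) x)).
  move=> fB.
  have dE (g : nat -> R) : pseries_diffs (fun n => g n / n`!%:R) = (fun n => g n.+1 / n`!%:R).
    apply/funext => n; rewrite /pseries_diffs factS natrM invfM.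
    by rewrite mulrCA mulVKf ?pnatr_eq0 // mulrC.
  rewrite -dE; apply: (@pseries_snd_diffs _ _ (`|x| + 1)).
  - exact: pseries_expseq_cvg fB.
  - rewrite dE; apply: (@pseries_expseq_cvg _ (B * G) G) => n.
    by rewrite -mulrA -exprS.
  - rewrite !dE; apply: (@pseries_expseq_cvg (fun n => f n.+2) (B * G * G) G) => n.
    by rewrite -!mulrA -!exprS.
  - by rewrite [ltRHS]ger0_norm ?addr_ge0 // ltrDl.
move=> hb; have [B1 [G1 h1]] := expseq_re hb; have [B2 [G2 h2]] := expseq_im hb.
by split => /=; [exact: aux h1 | exact: aux h2].
Qed.

Lemma egf_1 x : egf (fun=> 1) x = (expR x)%:C.
Proof.
apply: (cvgc_unique (egf_cvg x (expseq_cst 1))).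
split => /=; last first.
  rewrite (_ : (fun n => _) = fun=> 0); first exact: cvg_cst.
  by apply/funext => n; rewrite /series /= Im_sum big1 // => i _; rewrite mul1r.
rewrite (_ : (fun n => _) = series (exp_coeff x)); first exact: is_cvg_series_exp_coeff.
by apply/funext => n; rewrite /series /= Re_sum; apply: eq_bigr => i _; rewrite mul1r.
Qed.

(** Up to the normalisation e^(-x), this is the variance x of the Poisson law with mean x. *)
Lemma egf_poisson_var x :
  egf (fun n => ((n%:R - x) ^+ 2)%:C) x = (x * expR x)%:C.
Proof.
have e1 := expseq_cst 1.
have e2 : expseq (fun n => n%:R) := expseq_nat.
have hn : egf (fun n => n%:R) x = (x * expR x)%:C.
  have := @egf_natM (fun=> 1) x e1; rewrite egf_1 -rcM => <-.
  by apply: eq_egf => n; rewrite mulr1.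
have hnn : egf (fun n => n%:R * n%:R) x = x%:C * (x * expR x + expR x)%:C.
  rewrite egf_natM //; congr (_ * _); rewrite rcD -hn -egf_1.
  rewrite -egfD //; apply: eq_egf => n; by rewrite -natr1.
have -> : egf (fun n => ((n%:R - x) ^+ 2)%:C) x =
  egf (fun n => n%:R * n%:R + ((- 2 * x)%:C * n%:R + (x ^+ 2)%:C * 1)) x.
  apply: eq_egf => n; rewrite -rc_nat -!rcM -rcD.
  by rewrite -rcD; congr (_%:C); ring.
have e2' := expseqZ (- 2 * x)%:C e2; have e1' := expseqZ (x ^+ 2)%:C e1.
rewrite egfD; [|exact: expseqM|exact: expseqD].
rewrite egfD // !egfZ // hnn hn egf_1 -!rcM -!rcD; congr (_%:C).
ring.
Qed.

Lemma egf_le_norm b (c : nat -> R) x : 0 <= x -> expseq b -> expseq (fun n => (c n)%:C) ->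
  (forall n, normc (b n) <= c n) -> normc (egf b x) <= Re (egf (fun n => (c n)%:C) x).
Proof.
move=> x0 hb hc bc.
have [h2 _] := egf_cvg x hc.
apply: (ler_cvg_to (cvgc_norm (egf_cvg x hb)) h2); apply: nearW => n.
rewrite /series /= Re_sum; apply: le_trans (normc_sum _ _ _) _.
apply: ler_sum => i _; rewrite normcM normcRE ReMc /= mulr0 subr0.
have t0 : 0 <= x ^+ i / i`!%:R by rewrite divr_ge0 ?exprn_ge0.
by rewrite ger0_norm // ler_wpM2r.
Qed.

End ExponentialGeneratingFunctions.

(** * An Abelian theorem for exponential generating functions *)

Section AbelianAsymptotics.
Context {R : realType}.
Local Notation C := R[i].
Implicit Types (b c : nat -> C) (x : R).

Lemma ln_le_self (n : nat) : ln (n%:R : R) <= n%:R.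
Proof.
case: n => [|n]; first by rewrite ln0.
by apply: ltW; apply: ln_sublinear.
Qed.

Lemma ln_nat_ge0 (n : nat) : 0 <= ln (n%:R : R).
Proof. by case: n => [|n]; [rewrite ln0 | apply: ln_ge0; rewrite ler1n]. Qed.

Lemma normc_rpowc_natN (s : C) (n : nat) :
  normc (rpowc n%:R s) <= expR `|Re s| ^+ n.
Proof.
rewrite normc_rpowc -expRM_natr ler_expR; apply: le_trans (ler_norm _) _.
by rewrite normrM ler_wpM2l // ger0_norm ?ln_le_self // ln_nat_ge0.
Qed.

Lemma expseq_rpowc (s : C) : expseq (fun n => rpowc n%:R s).
Proof. by exists 1, (expR `|Re s|) => n; rewrite mul1r normc_rpowc_natN. Qed.

Lemma cvgc_bounded (u : nat -> C) (l : C) : cvgc \oo u l ->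
  exists2 B : R, 0 <= B & forall n, normc (u n) <= B.
Proof.
move=> ul.
have [n0 _ hn] : \forall n \near \oo, normc (u n) <= normc l + 1.
  by apply: (cvgr_le _ (cvgc_norm ul)); rewrite ltrDl.
pose B := normc l + 1 + \sum_(0 <= i < n0) normc (u i).
exists B.
  by rewrite !addr_ge0 ?normc_ge0 // sumr_ge0 // => i _; exact: normc_ge0.
move=> n; have [h|h] := leqP n0 n.
  apply: le_trans (hn n h) _; rewrite /B lerDl sumr_ge0 // => i _; exact: normc_ge0.
rewrite /B (big_rem n) ?mem_index_iota //= addrCA lerDl !addr_ge0 ?normc_ge0 //.
by rewrite sumr_ge0 // => i _; exact: normc_ge0.
Qed.

Lemma expseq_asym b (s K : C) : cvgc \oo (fun n => b n * rpowc n%:R (- s)) K -> expseq b.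
Proof.
move=> /cvgc_bounded[B _ h].
have h0 : expseq (fun n => b n * rpowc n%:R (- s)).
  by exists B, 1 => n; rewrite expr1n mulr1; exact: h.
have [B' [G' h']] := expseqM h0 (expseq_rpowc s).
exists B', G' => n; apply: le_trans (h' n).
by rewrite rpowcN divfK ?rpowc_neq0.
Qed.

(** The Poisson weights x^n e^(-x) / n! concentrate near n = x, so the mean of n^s is x^s to first
    order. It is a predicate on [s] because it is extended from a strip by steps of 1. *)
Definition abel_asym (s : C) := forall b (K : C),
  cvgc \oo (fun n => b n * rpowc n%:R (- s)) K ->
  cvgc +oo%R (fun x => egf b x * rpowc x (- s) * cexp (- x%:C)) K.

Lemma cvg_near_pinfty (P : R -> Prop) (A : R) : (forall x, A < x -> P x) -> \forall x \near +oo%R, P x.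
Proof. by move=> h; exists A; split => //; exact: num_real. Qed.

Lemma cvgc_invy : cvgc +oo%R (fun x : R => x^-1%:C) (0 : C).
Proof.
apply: cvgc_real; apply/cvgrPdist_le => e e0; near=> x.
have x0 : 0 < x by near: x; exact/nbhs_pinfty_gt/num_real.
rewrite sub0r normrN ger0_norm; last by rewrite invr_ge0 ltW.
have xe : e^-1 <= x by near: x; exact/nbhs_pinfty_ge/num_real.
by rewrite -[leRHS]invrK lef_pV2 ?posrE ?invr_gt0.
Unshelve. all: by end_near. Qed.

Lemma ratio_rpowc_cvg (s : C) :
  cvgc \oo (fun n => rpowc n.+1%:R s / rpowc n%:R s) 1.
Proof.
apply: (@squeeze_cvgc _ _ _ _ _ _ (fun n => 8 * normc s * n%:R^-1)); last first.
  rewrite -[0 in X in _ --> X](mulr0 (8 * normc s)); apply: cvgM; first exact: cvg_cst.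
  by rewrite -(cvg_shiftn 1); under eq_fun do rewrite addn1; exact: cvg_harmonic.
exists (Num.bound (normc s)).+1 => // n /= hn.
have n0 : (0 < n)%N by apply: leq_trans hn.
have n0' : 0 < (n%:R : R) by rewrite ltr0n.
have /andP[h1 h2] := @ln_succ_bound R n n0; set h := ln _ in h1 h2.
have h0 : 0 <= h by apply: le_trans h1; rewrite invr_ge0.
have -> : rpowc n.+1%:R s / rpowc n%:R s = cexp (s * h%:C).
  rewrite -cexpN /rpowc -cexpD -mulrBr -rcB /h ln_div ?posrE //.
have sh : normc (s * h%:C) <= normc s * n%:R^-1.
  by rewrite normcM normcRE ger0_norm // ler_wpM2l ?normc_ge0.
apply: le_trans (normc_cexp_sub1_le _) _.
  apply: le_trans sh _; rewrite ler_pdivrMr // mul1r ltW //.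
  apply: lt_le_trans (archi_boundP (normc_ge0 s)) _.
  by rewrite ler_nat (leq_trans _ hn) // leqnSn.
by rewrite -mulrA ler_wpM2l.
Qed.

Lemma ln_dist_le (u : R) : `|u - 1| <= 2^-1 -> `|ln u| <= 2 * `|u - 1|.
Proof.
move=> h; have u0 : 2^-1 <= u by move: h; rewrite ler_norml => /andP[]; lra.
have u0' : 0 < u by lra.
have h1 : ln u <= u - 1.
  have -> : u = 1 + (u - 1) by ring.
  by rewrite [1 + _ - _]addrAC subrr add0r; apply: le_ln1Dx; lra.
have h2 : - ln u <= u^-1 - 1.
  rewrite -lnV ?posrE // -[u^-1 in leLHS](subrK 1) addrC; apply: le_ln1Dx.
  by rewrite ltrBrDr addNr invr_gt0.
have h3 : u^-1 - 1 <= 2 * `|u - 1|.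
  have -> : u^-1 - 1 = u^-1 * (1 - u) by field; lra.
  apply: le_trans (_ : u^-1 * `|u - 1| <= _).
    by apply: ler_wpM2l; [rewrite invr_ge0 ltW | rewrite distrC ler_norm].
  rewrite ler_wpM2r // -[leRHS]invrK lef_pV2 ?posrE ?invr_gt0 //.
rewrite ler_norml; apply/andP; split; first by rewrite lerNl; apply: le_trans h2 _.
apply: le_trans h1 _; apply: le_trans (ler_norm _) _; have := normr_ge0 (u - 1); lra.
Qed.

(* Chebyshev's inequality for the Poisson weights x^n e^(-x) / n!; the other
   values of s follow by integer shifts. *)
Lemma abel_asym_base (s : C) : - 1 < Re s <= 0 -> abel_asym s.
Proof.
move=> /andP[s1 s0] b K bK.
have hb := expseq_asym bK.
have [B B0 bB] := cvgc_bounded bK.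
set sg := Re s in s1 s0.
(* Here Re s <= 0 makes [b] bounded. *)
have [B1 B10 bB1] : exists2 B1 : R, 0 <= B1 & forall n, normc (b n) <= B1.
  exists B => // n; have := bB n; rewrite rpowcN normcM normcV normc_rpowc -/sg.
  rewrite ler_pdivrMr ?expR_gt0 // => /le_trans; apply.
  by rewrite ler_piMr // expR_le1 mulr_le0_ge0 // ln_nat_ge0.
apply/cvgc_normc; apply/cvgrPdist_le => e e0.
set D := normc K.
have D0 : 0 <= D := normc_ge0 K.
(* The terms near n = x will cost e' (2 + 16 (|s| + 1) |K|) x^(Re s) in all; this makes it at most
   half of e x^(Re s). *)
pose e' := e / (2 * (2 + 16 * (normc s + 1) * D + 1)).
have den0 : 0 < 2 * (2 + 16 * (normc s + 1) * D + 1).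
  have : 0 <= 16 * (normc s + 1) * D by rewrite mulr_ge0 // mulr_ge0 // addr_ge0 // normc_ge0.
  lra.
have e'0 : 0 < e' by rewrite divr_gt0.
pose d := Num.min e' (2 * (8 * (normc s + 1)))^-1.
have ns1 : 0 < normc s + 1 by rewrite ltr_wpDl // normc_ge0.
have d0 : 0 < d by rewrite lt_min e'0 invr_gt0 !mulr_gt0.
have de : d <= e' by rewrite ge_min lexx.
have d1 : d <= (2 * (8 * (normc s + 1)))^-1 by rewrite ge_min lexx orbT.
have d2 : 2 * normc s * d <= 1.
  apply: le_trans (_ : 2 * normc s * (2 * (8 * (normc s + 1)))^-1 <= _).
    by rewrite ler_wpM2l // mulr_ge0 // normc_ge0.
  rewrite ler_pdivrMr ?mulr_gt0 //; have := normc_ge0 s; lra.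
have d3 : d <= 2^-1.
  apply: le_trans d1 _; rewrite lef_pV2 ?posrE ?mulr_gt0 //; have := normc_ge0 s; lra.
have [n0 _ hn0] : \forall n \near \oo, normc (b n * rpowc n%:R (- s) - K) <= e'.
  move/cvgc_normc/cvgrPdist_le : bK => /(_ e' e'0); apply: filterS => n.
  by rewrite sub0r normrN ger0_norm // normc_ge0.
pose sgp x := expR (sg * ln x).
pose Q := (B1 + D) / d ^+ 2.
have Q0 : 0 <= Q by rewrite divr_ge0 ?sqr_ge0 ?addr_ge0.
have main x : 2 * n0%:R + 1 <= x ->
    forall n : nat, normc (b n - K * rpowc x s) <=
       (e / 2) * sgp x + Q / x ^+ 2 * (n%:R - x) ^+ 2.
  move=> xn n.
  have x1 : 1 <= x by apply: le_trans xn; rewrite lerDr mulr_ge0.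
  have x0 : 0 < x by apply: lt_le_trans x1.
  have sx0 : 0 < sgp x := expR_gt0 _.
  have sx1 : sgp x <= 1 by rewrite expR_le1 mulr_le0_ge0 // ln_ge0.
  (* Far from x the bounded difference is charged to (n - x)^2 / (d x)^2, as in Chebyshev's
     inequality; near x the quotient n / x is within [d] of 1, so n^s is close to x^s. *)
  have [close|far] := leP (`|n%:R - x|) (d * x); last first.
    apply: le_trans (_ : B1 + D <= _).
      apply: le_trans (ler_normcB _ _) _; apply: lerD => //.
      by rewrite normcM normc_rpowc -/sg ler_piMr.
    apply: le_trans (_ : Q / x ^+ 2 * (n%:R - x) ^+ 2 <= _); last first.
      by rewrite lerDr mulr_ge0 // ltW // divr_gt0.
    rewrite /Q -[leLHS]mulr1 -!mulrA ler_wpM2l ?addr_ge0 //.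
    rewrite mulrA -invfM -exprMn mulrC ler_pdivlMr ?exprn_gt0 ?mulr_gt0 // mul1r.
    rewrite -[leRHS]real_normK ?num_real // lerXn2r ?nnegrE ?mulr_ge0 // ltW //.
  apply: le_trans (_ : (e / 2) * sgp x <= _); last first.
    by rewrite lerDl mulr_ge0 ?sqr_ge0 // divr_ge0 // sqr_ge0.
  set u := n%:R / x.
  have u1 : `|u - 1| <= d.
    have -> : u - 1 = (n%:R - x) / x by rewrite /u; field; lra.
    by rewrite normrM normfV (gtr0_norm x0) ler_pdivrMr.
  have u1' : `|u - 1| <= 2^-1 by apply: le_trans d3.
  have uh : 2^-1 <= u by move: u1'; rewrite ler_norml => /andP[]; lra.
  have nx : x / 2 <= n%:R.
    have -> : (n%:R : R) = u * x by rewrite /u divfK //; lra.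
    by rewrite mulrC ler_wpM2r // ltW.
  have n00 : (n0 <= n)%N by rewrite -(ler_nat R); apply: le_trans nx; move: xn; lra.
  have npos : 0 < (n%:R : R) by apply: lt_le_trans nx; rewrite divr_gt0.
  have lnu : ln (n%:R : R) = ln x + ln u.
    rewrite -lnM ?posrE //; first by congr ln; rewrite /u; field; lra.
    by apply: lt_le_trans uh.
  have rpn : rpowc n%:R s = rpowc x s * cexp (s * (ln u)%:C).
    by rewrite /rpowc -cexpD -mulrDr -rcD lnu.
  have lu : `|ln u| <= 2 * d by apply: le_trans (ln_dist_le u1') _; rewrite ler_wpM2l.
  have su : normc (s * (ln u)%:C) <= normc s * (2 * d).
    by rewrite normcM normcRE ler_wpM2l ?normc_ge0.
  have su1 : normc (s * (ln u)%:C) <= 1.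
    by apply: le_trans su _; rewrite mulrA [_ * 2]mulrC.
  have sn : sgp n%:R <= 2 * sgp x.
    rewrite /sgp lnu mulrDr expRD mulrC ler_wpM2r ?expR_ge0 //.
    have h2 : expR (- 1 * ln u) <= 2.
      rewrite mulN1r expRN lnK ?posrE; last by lra.
      by rewrite -[leRHS]invrK lef_pV2 ?posrE ?invr_gt0 //; lra.
    have [ul|ul] := leP 0 (ln u).
      by apply: le_trans (_ : 1 <= _); rewrite ?expR_le1 ?mulr_le0_ge0 // ler1n.
    apply: le_trans h2; rewrite ler_expR ler_nM2r //; lra.
  have -> : b n - K * rpowc x s = (b n * rpowc n%:R (- s) - K) * rpowc n%:R s +
     K * (rpowc x s * (cexp (s * (ln u)%:C) - 1)).
    rewrite rpowcN mulrBl divfK ?rpowc_neq0 // rpn; ring.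
  apply: le_trans (le_normcD _ _) _.
  apply: le_trans (_ : e' * (2 * sgp x) + D * (sgp x * (8 * (normc s * (2 * d)))) <= _).
    apply: lerD; rewrite normcM.
      rewrite normc_rpowc -/sg -/(sgp _).
      apply: ler_pM => //; [exact: normc_ge0|exact: expR_ge0|exact: hn0].
    rewrite ler_wpM2l // normcM normc_rpowc -/sg -/(sgp _) ler_wpM2l ?expR_ge0 //.
    by apply: le_trans (normc_cexp_sub1_le su1) _; rewrite ler_wpM2l.
  apply: le_trans (_ : e' * (2 + 16 * (normc s + 1) * D) * sgp x <= _).
    rewrite [leRHS](_ : _ = e' * (2 * sgp x) + e' * (16 * (normc s + 1) * D * sgp x)); last by ring.
    rewrite lerD2l.
    rewrite [leLHS](_ : _ = D * sgp x * 16 * (normc s * d)); last by ring.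
    rewrite [leRHS](_ : _ = D * sgp x * 16 * ((normc s + 1) * e')); last by ring.
    rewrite ler_wpM2l //; first by rewrite !mulr_ge0 // ltW.
    by apply: ler_pM; [exact: normc_ge0 | exact: ltW | rewrite lerDl | exact: de].
  rewrite ler_wpM2r ?expR_ge0 //.
  rewrite /e' [leLHS](_ : _ = (e / 2) * ((2 + 16 * (normc s + 1) * D) / (2 + 16 * (normc s + 1) * D + 1))); last first.
    by field; move: den0; rewrite pmulr_rgt0 // => /lt0r_neq0.
  have den1 : 0 < 2 + 16 * (normc s + 1) * D + 1 by move: den0; rewrite pmulr_rgt0.
  apply: ler_piMr; first by rewrite divr_ge0 // ltW.
  by rewrite ler_pdivrMr // mul1r lerDl.
have sum x : 2 * n0%:R + 1 <= x ->
   normc (egf b x * rpowc x (- s) * cexp (- x%:C) - K) <= e / 2 + Q * expR (- (sg + 1) * ln x).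
  move=> xn.
  have x1 : 1 <= x by apply: le_trans xn; rewrite lerDr mulr_ge0.
  have x0 : 0 < x by apply: lt_le_trans x1.
  have e1 := @expseq_cst R 1.
  have hd : expseq (fun n => b n + (- (K * rpowc x s)) * 1).
    by apply: expseqD => //; apply: expseqZ.
  have E1 : egf (fun n => b n + (- (K * rpowc x s)) * 1) x = egf b x - K * rpowc x s * (expR x)%:C.
    have h' := expseqZ (- (K * rpowc x s)) e1.
    by rewrite (egfD x hb h') (egfZ _ x e1) egf_1 mulNr.
  have ev : expseq (fun n => (((n%:R - x) ^+ 2)%:C : C)).
    have en := @expseq_nat R.
    have := expseqM (expseqD en (expseq_cst (- x%:C))) (expseqD en (expseq_cst (- x%:C))).
    move=> [p [q h]]; exists p, q => n; apply: le_trans (h n).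
    by rewrite -expr2 rcX rcB rc_nat.
  pose m n := (e / 2) * sgp x + Q / x ^+ 2 * (n%:R - x) ^+ 2.
  have mE n : (m n)%:C = (e / 2 * sgp x)%:C * 1 + (Q / x ^+ 2)%:C * ((n%:R - x) ^+ 2)%:C :> C.
    by rewrite /m rcD !rcM mulr1.
  have hm : expseq (fun n => (m n)%:C).
    have h := expseqD (expseqZ (e / 2 * sgp x)%:C e1) (expseqZ (Q / x ^+ 2)%:C ev).
    by move: h => [p [q h]]; exists p, q => n; rewrite mE.
  have E2 : egf (fun n => (m n)%:C) x = (((e / 2) * sgp x + Q / x) * expR x)%:C.
    rewrite (eq_egf _ mE) egfD; [|exact: expseqZ|exact: expseqZ].
    rewrite !egfZ // egf_1 egf_poisson_var -!rcM -rcD; congr (_%:C).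
    by field; lra.
  have := @egf_le_norm R _ m x (ltW x0) hd hm.
  rewrite E1 E2 /= => H.
  have {}H : normc (egf b x - K * rpowc x s * (expR x)%:C) <= (e / 2 * sgp x + Q / x) * expR x.
    by apply: H => n; rewrite mulr1; exact: main.
  have ex0 := expR_gt0 x; have sx0 : 0 < sgp x := expR_gt0 _.
  have -> : egf b x * rpowc x (- s) * cexp (- x%:C) - K =
     (egf b x - K * rpowc x s * (expR x)%:C) * (rpowc x (- s) * cexp (- x%:C)).
    have cx0 := cexp_neq0 x%:C; have rx0 := rpowc_neq0 x s.
    rewrite rpowcN cexpN -cexp_real; move: rx0 cx0; move: (rpowc _ _) (cexp _) => p q p0 q0.
    by field; rewrite p0 q0.
  rewrite normcM normcM normc_rpowc normc_cexp !ReN /= -/sg.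
  have -> : expR (- sg * ln x) = (sgp x)^-1 by rewrite mulNr expRN.
  apply: le_trans (_ : (e / 2 * sgp x + Q / x) * expR x * ((sgp x)^-1 * expR (- x)) <= _).
    by rewrite ler_wpM2r // mulr_ge0 ?invr_ge0 ?expR_ge0.
  have -> : expR (- (sg + 1) * ln x) = (sgp x)^-1 * x^-1.
    by rewrite mulNr expRN mulrDl mul1r expRD lnK ?posrE // invfM.
  rewrite expRN le_eqVlt; apply/orP; left; apply/eqP.
  by field; rewrite !gt_eqF.
(* Here Re s > -1 is used: relative to x^(Re s), the variance contributes x^(-1 - Re s), which tends
   to 0. *)
have hl : (fun x => Q * expR (- (sg + 1) * ln x)) @ +oo%R --> (0 : R).
  rewrite -[0 in X in _ --> X](mulr0 Q); apply: cvgM; first exact: cvg_cst.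
  under eq_fun do rewrite mulNr.
  apply: (@cvg_comp _ _ _ (fun x => (sg + 1) * ln x) (fun y => expR (- y)) _ +oo%R).
    have sgn_if : 0 < sg + 1 by lra.
    apply/cvgryPge => A; near=> x.
    have x0 : 0 < x by near: x; exact/nbhs_pinfty_gt/num_real.
    rewrite -ler_pdivrMl // -[leLHS]expRK ler_ln ?posrE ?expR_gt0 //; near: x.
  exact: cvgr_expR.
have e20 : 0 < e / 2 by rewrite divr_gt0.
move/cvgrPdist_le : hl => /(_ _ e20) hl.
near=> x.
rewrite sub0r normrN ger0_norm ?normc_ge0 //.
have xn : 2 * n0%:R + 1 <= x by near: x; exact/nbhs_pinfty_ge/num_real.
apply: le_trans (sum x xn) _.
have : `|0 - Q * expR (- (sg + 1) * ln x)| <= e / 2 by near: x.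
rewrite sub0r normrN ger0_norm; last by rewrite mulr_ge0 ?expR_ge0.
by move=> h; rewrite [leRHS](splitr e) lerD2l.
Unshelve. all: by end_near. Qed.

(** Write b n = (n + 1) g n. The function of [b] is that of [g] plus x times that of the shifted
    [g]; both have exponent s, and the first is smaller by a factor x. *)
Lemma abel_asym_up (s : C) : abel_asym s -> abel_asym (s + 1).
Proof.
move=> ab b K bK; have hb := expseq_asym bK.
pose g n := b n / n.+1%:R.
have hg : cvgc \oo (fun n => g n * rpowc n%:R (- s)) K.
  have h : cvgc \oo (fun n => b n * rpowc n%:R (- (s + 1)) * (1 - (1 + n%:R)^-1)) K.
    rewrite -[K]mulr1; apply: cvgcM => //; rewrite -[X in cvgc _ _ X]subr0.
    by apply: cvgcB; [exact: cvgc_cst | exact: cvgc_invn].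
  apply: near_eq_cvgc h; exists 1%N => // n /= n0.
  rewrite /g opprD rpowcD [rpowc _ (-1)]rpowcN rpowc1 ?ltr0n // rc_nat nat1r -natr1.
  have : (n%:R : C) != 0 by rewrite pnatr_eq0 -lt0n.
  have : (n.+1%:R : C) != 0 by rewrite pnatr_eq0.
  rewrite -natr1; move: (n%:R : C) (rpowc _ _) => m q m1 m0.
  by field; rewrite m1 m0.
have hg' : cvgc \oo (fun n => g n.+1 * rpowc n%:R (- s)) K.
  have h1 : cvgc \oo (fun n => g n.+1 * rpowc n.+1%:R (- s)) K.
    case: hg => a1 a2; split.
      have := a1; rewrite -(cvg_shiftn 1) => a; apply: cvg_trans a; apply: near_eq_cvg; apply: nearW => n /=.
      by rewrite addn1.
    have := a2; rewrite -(cvg_shiftn 1) => a; apply: cvg_trans a; apply: near_eq_cvg; apply: nearW => n /=.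
    by rewrite addn1.
  have h2 := ratio_rpowc_cvg s.
  rewrite -[K]mulr1; apply: near_eq_cvgc (cvgcM h1 h2); apply: nearW => n.
  have := rpowc_neq0 (n%:R : R) s; have := rpowc_neq0 (n.+1%:R : R) s.
  rewrite !rpowcN; move: (rpowc _ _) (rpowc _ _) => p q p0 q0; by field; rewrite p0 q0.
have h0 := ab _ _ hg; have h1 := ab _ _ hg'.
have h2 : cvgc +oo%R (fun x => egf g x * rpowc x (- s) * cexp (- x%:C) * x^-1%:C +
    egf (fun n => g n.+1) x * rpowc x (- s) * cexp (- x%:C)) K.
  by rewrite -[K]add0r -[X in cvgc _ _ (X + _)](mulr0 K); apply: cvgcD => //; apply: cvgcM => //; exact: cvgc_invy.
apply: near_eq_cvgc h2; apply: (@cvg_near_pinfty _ 0) => x x0.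
have eg := expseq_asym hg.
have -> : egf b x = egf g x + x%:C * egf (fun n => g n.+1) x.
  rewrite -egf_natM // -egfD //; last by apply: expseqM => //; exact: expseq_nat.
  apply: eq_egf => n; rewrite /g.
  have : (n.+1%:R : C) != 0 by rewrite pnatr_eq0.
  by rewrite -natr1; move: (n%:R : C) => m m0; field.
rewrite opprD rpowcD [rpowc _ (-1)]rpowcN rpowc1 //.
have x0' : x%:C != 0 :> C by rewrite rc_eq0; lra.
rewrite rcV; move: x0'; move: (x%:C) => y y0; by field.
Qed.

(** The sequence n b(n - 1) has exponent s + 1, and its function is x times that of [b]; at n = 0
    the factor n hides the truncated predecessor. *)
Lemma abel_asym_down (s : C) : abel_asym (s + 1) -> abel_asym s.
Proof.
move=> ab b K bK; have hb := expseq_asym bK.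
pose g n := n%:R * b n.-1.
have hg : cvgc \oo (fun n => g n * rpowc n%:R (- (s + 1))) K.
  have h : cvgc \oo (fun n => b n * rpowc n.+1%:R (- s)) K.
    rewrite -[K]divr1; apply: near_eq_cvgc (cvgcM bK (cvgcV (oner_neq0 _) (ratio_rpowc_cvg s))).
    apply: nearW => n; have := rpowc_neq0 (n%:R : R) s; have := rpowc_neq0 (n.+1%:R : R) s.
    rewrite !rpowcN; move: (rpowc _ _) (rpowc _ _) => p q p0 q0; by field; rewrite p0 q0.
  have E n : g n.+1 * rpowc n.+1%:R (- (s + 1)) = b n * rpowc n.+1%:R (- s).
    rewrite /g /= opprD rpowcD [rpowc _ (-1)]rpowcN rpowc1 // rc_nat.
    have : (n.+1%:R : C) != 0 by rewrite pnatr_eq0.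
    by move: (n.+1%:R : C) => m m0; field.
  case: h => a1 a2; split; rewrite -(cvg_shiftn 1).
    by under eq_fun do rewrite addn1 E.
  by under eq_fun do rewrite addn1 E.
apply: near_eq_cvgc (ab _ _ hg); apply: (@cvg_near_pinfty _ 0) => x x0.
have -> : egf g x = x%:C * egf b x.
  have [B [G /expseqW[B1 [G1 [B10 G11 h]]]]] := hb.
  have hb' : expseq (fun n => b n.-1).
    exists B1, G1 => n; apply: le_trans (h _) _; rewrite ler_wpM2l //.
    by case: n => //= n; rewrite exprS ler_peMl // exprn_ge0 // (le_trans _ G11).
  by rewrite egf_natM.
rewrite opprD rpowcD [rpowc _ (-1)]rpowcN rpowc1 //.
have x0' : x%:C != 0 :> C by rewrite rc_eq0; lra.
move: x0'; move: (x%:C) => y y0; by field.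
Qed.

Lemma abel_asym_all (s : C) : abel_asym s.
Proof.
have up (n : nat) : forall s : C, Re s <= n%:R -> - 1 < Re s -> abel_asym s.
  elim: n => [|n IH] {}s sn s1; first by apply: abel_asym_base; rewrite s1.
  have [s0|s0] := leP (Re s) 0; first by apply: abel_asym_base; rewrite s1.
  rewrite -[s](subrK 1); apply: abel_asym_up; apply: IH; rewrite ReB /=.
    by rewrite lerBlDr natr1.
  by lra.
have dn (n : nat) : forall s : C, - n%:R - 1 < Re s -> abel_asym s.
  elim: n => [|n IH] {}s sn.
    apply: (up (Num.bound (Re s))); last by move: sn; rewrite oppr0; lra.
    apply: le_trans (ler_norm _) _; apply: ltW.
    by have := archi_boundP (normr_ge0 (Re s)); rewrite /Num.bound normr_id.
  apply: abel_asym_down; apply: IH; rewrite ReD /=; move: sn; rewrite -natr1; lra.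
apply: (dn (Num.bound (Re s))).
have h : - Re s < (Num.bound (Re s))%:R.
  apply: le_lt_trans (_ : `|Re s| < _); first by rewrite -normrN ler_norm.
  by have := archi_boundP (normr_ge0 (Re s)); rewrite /Num.bound normr_id.
lra.
Qed.

End AbelianAsymptotics.

(** * Kummer and Whittaker functions *)

Section Kummer.
Context {R : realType}.
Local Notation C := R[i].

Definition kummer_coef (a b : C) (n : nat) : C := pochhammer a n / pochhammer b n.
Definition kummerR (a b : C) (x : R) : C := egf (kummer_coef a b) x.

Lemma pochhammerS (a : C) n : pochhammer a n.+1 = pochhammer a n * (a + n%:R).
Proof. by rewrite /pochhammer big_nat_recr. Qed.

Lemma pochhammer_neq0 (a : C) n : nonpole a -> pochhammer a n != 0.
Proof. by move=> ha; rewrite prodf_seq_neq0; apply/allP => j _; exact: ha. Qed.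

Lemma pochhammer_shift (a : C) n : a * pochhammer (a + 1) n = (a + n%:R) * pochhammer a n.
Proof.
elim: n => [|n IH]; first by rewrite /pochhammer !big_nil addr0.
by rewrite !pochhammerS mulrA IH -natr1; ring.
Qed.

Lemma kummer_coefS (a b : C) n : nonpole b -> (b + n%:R) * kummer_coef a b n.+1 = (a + n%:R) * kummer_coef a b n.
Proof.
move=> hb; have := hb n; have := pochhammer_neq0 n hb.
rewrite /kummer_coef !pochhammerS; move: (pochhammer b n) (pochhammer a n) (n%:R : C) => p q m p0 m0.
by field; rewrite p0 m0.
Qed.

Lemma kummer_coef_shift (a b : C) n : a * kummer_coef (a + 1) b n = (a + n%:R) * kummer_coef a b n.
Proof. by rewrite /kummer_coef !mulrA pochhammer_shift. Qed.

(** The quotient of Pochhammer symbols is a quotient of Gauss products up to the factor (b + n) / (a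
    + n). *)
Lemma kummer_coef_cvg (a b : C) : nonpole a -> nonpole b ->
  cvgc \oo (fun n => kummer_coef a b n * rpowc n%:R (- (a - b))) (Gammac b / Gammac a).
Proof.
move=> ha hb.
have h1 : cvgc \oo (fun n => gauss b n * (gauss a n)^-1) (Gammac b / Gammac a).
  by apply: cvgcM; [exact: Gammac_cvg | apply: cvgcV; [exact: Gammac_neq0 | exact: Gammac_cvg]].
have h2 : cvgc \oo (fun n => 1 + (b - a) * (a + n%:R)^-1) 1.
  rewrite -[X in cvgc _ _ X]addr0 -[X in cvgc _ _ (1 + X)](mulr0 (b - a)).
  by apply: cvgcD; [exact: cvgc_cst | apply: cvgcM; [exact: cvgc_cst | exact: cvgc_invn]].
rewrite -[_ / _]mulr1; apply: near_eq_cvgc (cvgcM h1 h2); apply: nearW => n.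
rewrite /gauss -/(pochhammer a n.+1) -/(pochhammer b n.+1) !pochhammerS /kummer_coef.
have -> : rpowc n%:R (- (a - b)) = rpowc n%:R b / rpowc n%:R a.
  by rewrite opprB addrC rpowcD rpowcN mulrC.
have f0 : (n`!%:R : C) != 0 by rewrite pnatr_eq0 -lt0n fact_gt0.
have := ha n; have := hb n; have := pochhammer_neq0 n ha; have := pochhammer_neq0 n hb.
have := rpowc_neq0 (n%:R : R) a.
move: f0; move: (pochhammer b n) (pochhammer a n) (n%:R : C) (n`!%:R : C) (rpowc _ a) (rpowc _ b).
move=> p q m f x y f0 x0 p0 q0 bm am.
by field; rewrite f0 x0 p0 q0 bm am.
Qed.

Lemma expseq_kummer_coef (a b : C) : nonpole a -> nonpole b -> expseq (kummer_coef a b).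
Proof. by move=> ha hb; exact: expseq_asym (kummer_coef_cvg ha hb). Qed.

Lemma kummerME (a b : C) x : nonpole a -> nonpole b -> kummerM a b x%:C = kummerR a b x.
Proof.
move=> ha hb; apply: limn_cvgc; apply: near_eq_cvgc (egf_cvg x (expseq_kummer_coef ha hb)).
apply: nearW => n; apply: eq_bigr => i _; rewrite /kummer_coef rcM rcX rcV rc_nat invfM.
by rewrite -!mulrA; congr (_ * _); congr (_ * _); rewrite mulrC.
Qed.

Lemma kummerR_asym (a b : C) : nonpole a -> nonpole b ->
  cvgc +oo%R (fun x => kummerR a b x * rpowc x (- (a - b)) * cexp (- x%:C)) (Gammac b / Gammac a).
Proof. by move=> ha hb; apply: abel_asym_all; exact: kummer_coef_cvg. Qed.

Lemma derivesC_kummerR (a b : C) x : nonpole a -> nonpole b ->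
  derivesC (kummerR a b) x (egf (fun n => kummer_coef a b n.+1) x).
Proof. by move=> ha hb; apply: derivesC_egf; exact: expseq_kummer_coef. Qed.

Lemma nonpoleS (a : C) : nonpole a -> nonpole (a + 1).
Proof. by move=> ha j; rewrite -addrA nat1r; exact: ha. Qed.

(** Contiguous relations are read off coefficient by coefficient, since x d/dx multiplies by n. This
    one and [kummerR_down] become the lowering and raising relations of Whittaker functions. *)
Lemma kummerR_up (a b : C) x : nonpole a -> nonpole b ->
  x%:C * egf (fun n => kummer_coef a b n.+1) x = a * kummerR (a + 1) b x - a * kummerR a b x.
Proof.
move=> ha hb; have e := expseq_kummer_coef ha hb.
have e1 := expseq_kummer_coef (nonpoleS ha) hb.
rewrite -egf_natM // /kummerR -!egfZ // -mulN1r -egfZ; last exact: expseqZ.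
rewrite -egfD; [|exact: expseqZ|by apply: expseqZ; apply: expseqZ].
by apply: eq_egf => n; rewrite kummer_coef_shift; ring.
Qed.

Lemma kummerR_down (a b : C) x : nonpole (a - 1) -> nonpole b ->
  x%:C * egf (fun n => kummer_coef a b n.+1) x = (b - a) * kummerR (a - 1) b x + (a - b + x%:C) * kummerR a b x.
Proof.
move=> ha1 hb; have ha : nonpole a by rewrite -[a](subrK 1); exact: nonpoleS.
have e := expseq_kummer_coef ha hb; have e1 := expseq_kummer_coef ha1 hb.
(* These are the coefficients of x times the Kummer function; the value at n = 0 is 0 in spite of
   the truncated predecessor. *)
pose g n := n%:R * kummer_coef a b n.-1.
have e2 : expseq (fun n => kummer_coef a b n.-1).
  have [B [G /expseqW[B1 [G1 [B10 G11 h]]]]] := e.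
  exists B1, G1 => n; apply: le_trans (h _) _; rewrite ler_wpM2l //.
  by case: n => //= n; rewrite exprS ler_peMl // exprn_ge0 // (le_trans _ G11).
have xk : x%:C * kummerR a b x = egf g x by rewrite /g egf_natM.
have eg : expseq g by apply: expseqM => //; exact: expseq_nat.
rewrite [(a - b + _) * _]mulrDl xk -egf_natM // /kummerR -!egfZ //.
have z1 := expseqZ (b - a) e1; have z2 := expseqZ (a - b) e.
have z3 := expseqD z2 eg.
rewrite -(egfD x z2 eg) -(egfD x z1 z3).
apply: eq_egf => n; rewrite /g.
have h1 := kummer_coef_shift (a - 1) b n; rewrite subrK in h1.
have h2 := ha1 n.
case: n h1 h2 => [|n] h1 h2.
  rewrite mul0r; have := ha1 0%N; rewrite addr0 => a10.
  by rewrite /kummer_coef /pochhammer !big_nil; ring.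
rewrite /=; have h3 := kummer_coefS a n hb; have h4 := hb n; have h5 := ha n.
have E1 : kummer_coef (a - 1) b n.+1 = (a - 1) * kummer_coef a b n.+1 / (a - 1 + n.+1%:R).
  by rewrite h1 mulrC mulKf.
have E2 : kummer_coef a b n = (b + n%:R) * kummer_coef a b n.+1 / (a + n%:R).
  by rewrite h3 mulrC mulKf.
rewrite E1 E2; move: h2 h5; rewrite -natr1; move: (kummer_coef _ _ _) (n%:R : C) => c m h2 h5.
by field; rewrite h5.
Qed.

End Kummer.

(** * Whittaker's M and W and their contiguous relations *)

Section WhittakerFunctions.
Context {R : realType}.
Local Notation C := R[i].
Implicit Types (r l y : R).

Definition imu r : C := 0 +i* r.

Lemma real_complex1 : (1 : R)%:C = 1 :> C. Proof. by []. Qed.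

Lemma rc_half : (2^-1 : R)%:C = 2^-1 :> C. Proof. by rewrite rcV rc_nat. Qed.

Lemma Im_2imu r : Im (2 * imu r) = 2 * r.
Proof. by rewrite ImMc Im_nat Re_nat /= mul0r addr0. Qed.

Lemma nonpole_a r l : r != 0 -> nonpole (2^-1 + imu r - l%:C : C).
Proof.
by move=> r0; apply: nonpole_Im; rewrite -rc_half ImB ImD /= add0r subr0.
Qed.

Lemma nonpole_b r : r != 0 -> nonpole (1 + 2 * imu r : C).
Proof.
by move=> r0; apply: nonpole_Im; rewrite ImD Im_2imu /= add0r mulf_neq0 // pnatr_eq0. Qed.

Lemma nonpole_2mu r : r != 0 -> nonpole (2 * imu r : C).
Proof. by move=> r0; apply: nonpole_Im; rewrite Im_2imu mulf_neq0 // pnatr_eq0. Qed.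

Lemma imuN r : imu (- r) = - imu r. Proof. by rewrite /imu; apply: cplxP; rewrite ?ReN ?ImN /= ?oppr0. Qed.

Lemma imu_sqr r : imu r ^+ 2 = - (r ^+ 2)%:C.
Proof. by rewrite expr2; apply: cplxP; rewrite ?ReN ?ImN ?ReMc ?ImMc /=; ring. Qed.

Fact wM_key : unit. Proof. exact: tt. Qed.

(** Whittaker's M with second parameter i r; locked to act as an atom in algebraic identities. *)
Definition wM l r y : C := locked_with wM_key (
  cexp (- (y / 2)%:C) * rpowc y (2^-1 + imu r) * kummerR (2^-1 + imu r - l%:C) (1 + 2 * imu r) y).

Lemma wME l r y : wM l r y = cexp (- (y / 2)%:C) * rpowc y (2^-1 + imu r) *
  kummerR (2^-1 + imu r - l%:C) (1 + 2 * imu r) y.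
Proof. by rewrite /wM locked_withE. Qed.

Lemma whittakerME l r y : r != 0 -> whittakerM l%:C (imu r) y = wM l r y.
Proof. by move=> r0; rewrite wME /whittakerM kummerME //; [exact: nonpole_a | exact: nonpole_b]. Qed.

(** The coefficient of M_{l, ir} in W_{l, ir}; the other term is the same with r replaced by - r,
    whence the parametrisation by r instead of mu. *)
Definition wA l r : C := Gammac (- (2 * imu r)) / Gammac (2^-1 - imu r - l%:C).
Fact wW_key : unit. Proof. exact: tt. Qed.

Definition wW l r y : C :=
  locked_with wW_key (wA l r * wM l r y + wA l (- r) * wM l (- r) y).

Lemma wWE l r y : wW l r y = wA l r * wM l r y + wA l (- r) * wM l (- r) y.
Proof. by rewrite /wW locked_withE. Qed.

Lemma whittakerWE l r y : r != 0 -> whittakerW l%:C (imu r) y = wW l r y.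
Proof.
move=> r0; rewrite /whittakerW wWE /wA !whittakerME // -imuN whittakerME ?oppr_eq0 //.
by rewrite !imuN mulrN !opprK.
Qed.

Lemma is_derive_ln y : 0 < y -> is_derive y 1 (@ln R) y^-1.
Proof. exact: is_derive1_ln. Qed.

Lemma derivesC_rpowc (s : C) y : 0 < y -> derivesC (fun y => rpowc y s) y (s / y%:C * rpowc y s).
Proof.
move=> y0; have y0' : y%:C != 0 :> C by rewrite rc_eq0 gt_eqF.
apply: derivesC_eq (derivesC_cexp (derivesCZ s (derivesC_real (is_derive_ln y0)))).
by rewrite rcV.
Qed.

Lemma derivesC_wM_aux l r y : r != 0 -> 0 < y ->
  derivesC (wM l r) y (((- (y / 2)%:C + 2^-1 + imu r) * wM l r y +
     cexp (- (y / 2)%:C) * rpowc y (2^-1 + imu r) *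
     (y%:C * egf (fun n => kummer_coef (2^-1 + imu r - l%:C) (1 + 2 * imu r) n.+1) y)) / y%:C).
Proof.
move=> r0 y0; have y0' : y%:C != 0 :> C by rewrite rc_eq0 gt_eqF.
have d1 : derivesC (fun y => cexp (- (y / 2)%:C) : C) y (- 2^-1 * cexp (- (y / 2)%:C)).
  apply: derivesC_cexp; have := @derivesCZr R (- 2^-1) _ y _ (derivesC_id y).
  rewrite mul1r; apply: derivesC_ext => x.
  by rewrite rcM rcV rc_nat mulrN.
have d2 := derivesC_rpowc (2^-1 + imu r) y0.
have d3 := derivesC_kummerR y (nonpole_a l r0) (nonpole_b r0).
apply: derivesC_ext (fun x => esym (wME l r x)) _.
apply: derivesC_eq (derivesCM (derivesCM d1 d2) d3).
rewrite wME rcM rcV rc_nat; move: (cexp _) (rpowc _ _) (kummerR _ _ _) (egf _ _) => p q k e.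
move: (imu r) (y%:C) y0' => m z z0.
have t0 : (2 : C) != 0 by rewrite pnatr_eq0.
by field; rewrite z0.
Qed.

Lemma derivesC_wM_up l r y : r != 0 -> 0 < y ->
  derivesC (wM l r) y ((((y / 2 - l)%:C) * wM l r y + (2^-1 + imu r + l%:C) * wM (l + 1) r y) / y%:C).
Proof.
move=> r0 y0; apply: derivesC_eq (derivesC_wM_aux l r0 y0); congr (_ / _).
rewrite kummerR_down; [|by have := nonpole_a (l + 1) r0; rewrite rcD opprD addrA|exact: nonpole_b].
rewrite !wME (_ : 2^-1 + imu r - (l + 1)%:C = 2^-1 + imu r - l%:C - 1); last by rewrite rcD real_complex1; ring.
rewrite rcB !rcM !rcV rc_nat.
have t0 : (2 : C) != 0 by rewrite pnatr_eq0.
move: (cexp _) (rpowc _ _) (kummerR _ _ _) (kummerR _ _ _) => p q k e.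
move: (imu r) (y%:C) (l%:C) => m z L.
by field.
Qed.

Lemma derivesC_wM_down l r y : r != 0 -> 0 < y ->
  derivesC (wM l r) y ((((l - y / 2)%:C) * wM l r y + (2^-1 + imu r - l%:C) * wM (l - 1) r y) / y%:C).
Proof.
move=> r0 y0; apply: derivesC_eq (derivesC_wM_aux l r0 y0); congr (_ / _).
rewrite kummerR_up; [|exact: nonpole_a|exact: nonpole_b].
rewrite !wME (_ : 2^-1 + imu r - (l - 1)%:C = 2^-1 + imu r - l%:C + 1); last by rewrite rcB real_complex1; ring.
rewrite rcB !rcM !rcV rc_nat.
have t0 : (2 : C) != 0 by rewrite pnatr_eq0.
move: (cexp _) (rpowc _ _) (kummerR _ _ _) (kummerR _ _ _) => p q k e.
move: (imu r) (y%:C) (l%:C) => m z L.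
by field.
Qed.

Lemma wM_asym l r : r != 0 ->
  cvgc +oo%R (fun y => wM l r y * (cexp (- (y / 2)%:C) * rpowc y l%:C))
    (Gammac (1 + 2 * imu r) / Gammac (2^-1 + imu r - l%:C)).
Proof.
move=> r0; apply: near_eq_cvgc (kummerR_asym (nonpole_a l r0) (nonpole_b r0)); apply: nearW => y.
have t0 : (2 : C) != 0 by rewrite pnatr_eq0.
have -> : - (2^-1 + imu r - l%:C - (1 + 2 * imu r)) = 2^-1 + imu r + l%:C :> C.
  by move: (imu r) => m; field.
have -> : - y%:C = - (y / 2)%:C + - (y / 2)%:C :> C by rewrite -opprD -rcD -splitr.
rewrite [rpowc _ (_ + l%:C)]rpowcD [cexp (_ + _)]cexpD wME; ring.
Qed.

(** The functional equation of Gamma turns the factor 1/2 + ir + l, which depends on the sign of r,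
    into the constant -1, which does not; hence both terms of W obey one raising relation. [wA_down]
    does the same with (l - 1/2)^2 + r^2. *)
Lemma wA_up l r : r != 0 -> wA l r * (2^-1 + imu r + l%:C) = - wA (l + 1) r.
Proof.
move=> r0; rewrite /wA.
have n1 : nonpole (2^-1 - imu r - (l + 1)%:C : C).
  by have := @nonpole_a (- r) (l + 1); rewrite oppr_eq0 imuN; apply.
have := GammacS n1; have := Gammac_neq0 n1; have := n1 0%N; rewrite addr0.
have -> : 2^-1 - imu r - (l + 1)%:C + 1 = 2^-1 - imu r - l%:C :> C by rewrite rcD; ring.
move=> h0 g0 ->; move: h0 g0.
have t0 : (2 : C) != 0 by rewrite pnatr_eq0.
move: (Gammac (2^-1 - imu r - (l + 1)%:C)) (Gammac (- (2 * imu r))) => g f.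
have -> : 2^-1 - imu r - (l + 1)%:C = - (2^-1 + imu r + l%:C) :> C.
  by rewrite rcD real_complex1; move: (imu r) => m; field.
move: (2^-1 + _ + _) => s; rewrite oppr_eq0 => h0 g0; by field; rewrite g0 h0.
Qed.

Lemma wA_down l r : r != 0 ->
  wA l r * (2^-1 + imu r - l%:C) = (((l - 2^-1) ^+ 2 + r ^+ 2)%:C) * wA (l - 1) r.
Proof.
move=> r0; rewrite /wA.
have n1 : nonpole (2^-1 - imu r - l%:C : C).
  by have := @nonpole_a (- r) l; rewrite oppr_eq0 imuN; apply.
have := GammacS n1; have := Gammac_neq0 n1; have := n1 0%N; rewrite addr0.
have -> : 2^-1 - imu r - l%:C + 1 = 2^-1 - imu r - (l - 1)%:C :> C by rewrite rcB; ring.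
move=> h0 g0 ->; move: h0 g0.
have t0 : (2 : C) != 0 by rewrite pnatr_eq0.
have -> : ((l - 2^-1) ^+ 2 + r ^+ 2)%:C = (l%:C - 2^-1) ^+ 2 - imu r ^+ 2 :> C.
  by rewrite imu_sqr opprK rcD rcX rcB rcV rc_nat.
move: (Gammac (2^-1 - imu r - l%:C)) (Gammac (- (2 * imu r))) => g f.
have -> : (l%:C - 2^-1) ^+ 2 - imu r ^+ 2 = (2^-1 + imu r - l%:C) * (2^-1 - imu r - l%:C) by ring.
move: (2^-1 + imu r - _) (2^-1 - imu r - _) => x z z0 g0; by field; rewrite g0 z0.
Qed.

Lemma derivesC_wW_up l r y : r != 0 -> 0 < y ->
  derivesC (wW l r) y (((y / 2 - l)%:C * wW l r y - wW (l + 1) r y) / y%:C).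
Proof.
move=> r0 y0; have r0' : - r != 0 by rewrite oppr_eq0.
apply: derivesC_ext (fun x => esym (wWE l r x)) _.
apply: derivesC_eq (derivesCD (derivesCZ (wA l r) (derivesC_wM_up l r0 y0)) (derivesCZ (wA l (- r)) (derivesC_wM_up l r0' y0))).
have h1 : wA (l + 1) r = - (wA l r * (2^-1 + imu r + l%:C)) by rewrite wA_up ?opprK.
have h2 : wA (l + 1) (- r) = - (wA l (- r) * (2^-1 + imu (- r) + l%:C)) by rewrite wA_up ?opprK.
rewrite !wWE h1 h2.
move: (wA _ _) (wA _ _) (wM _ _ _) (wM _ _ _) (wM _ _ _) (wM _ _ _) => a b p q s t.
by ring.
Qed.

Lemma derivesC_wW_down l r y : r != 0 -> 0 < y ->
  derivesC (wW l r) y (((l - y / 2)%:C * wW l r y + ((l - 2^-1) ^+ 2 + r ^+ 2)%:C * wW (l - 1) r y) / y%:C).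
Proof.
move=> r0 y0; have r0' : - r != 0 by rewrite oppr_eq0.
apply: derivesC_ext (fun x => esym (wWE l r x)) _.
apply: derivesC_eq (derivesCD (derivesCZ (wA l r) (derivesC_wM_down l r0 y0)) (derivesCZ (wA l (- r)) (derivesC_wM_down l r0' y0))).
have h1 := wA_down l r0; have h2 := wA_down l r0'; rewrite sqrrN in h2.
rewrite !wWE [(_ + r ^+ 2)%:C * _]mulrDr [_%:C * (wA _ _ * _)]mulrA -h1.
rewrite [((l - _) ^+ 2 + _)%:C * (wA _ _ * _)]mulrA -h2.
move: (wA _ _) (wA _ _) (wM _ _ _) (wM _ _ _) (wM _ _ _) (wM _ _ _) => a b p q s t.
by ring.
Qed.

End WhittakerFunctions.

(** * Decay of a recessive solution from a constant Wronskian *)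

Section RecessiveSolution.
Context {R : realType}.
Local Notation C := R[i].

Lemma near_gt (a y : R) : a < y -> \forall x \near y, a < x.
Proof.
move=> ay; exists (y - a); first by rewrite /= subr_gt0.
by move=> x /=; rewrite ltr_norml => /andP[_]; lra.
Qed.

Lemma near_ln_le (A e : R) : 0 < e -> \forall y \near +oo%R, A * ln y <= e * y.
Proof.
move=> e0; near=> y.
have y0 : 1 <= y by near: y; exact/nbhs_pinfty_ge/num_real.
have y0' : 0 < y by lra.
have s0 : 0 < Num.sqrt y by rewrite sqrtr_gt0.
have sy : Num.sqrt y * Num.sqrt y = y by rewrite -expr2 sqr_sqrtr // ltW.
have l0 : 0 <= ln y by rewrite ln_ge0.
apply: le_trans (_ : `|A| * ln y <= _); first by rewrite ler_wpM2r // ler_norm.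
have l1 : ln y <= 2 * Num.sqrt y.
  have hs : ln (Num.sqrt y) <= Num.sqrt y by apply: ltW; apply: ln_sublinear.
  by rewrite -[in leLHS]sy lnM ?posrE //; lra.
apply: le_trans (_ : `|A| * (2 * Num.sqrt y) <= _); first by rewrite ler_wpM2l.
rewrite -[in leRHS]sy !mulrA ler_wpM2r ?(ltW s0) //.
rewrite mulrC -ler_pdivrMl // -[leLHS]ger0_norm; last by rewrite mulr_ge0 // ?invr_ge0 ?(ltW e0) // mulr_ge0.
rewrite -sqrtr_sqr ler_sqrt ?(ltW y0') //; near: y; exact/nbhs_pinfty_ge/num_real.
Unshelve. all: by end_near. Qed.

(** Takes the place of integrating a derivative bound from y to infinity. *)
Lemma nonincr_to0_ge0 (f f' : R -> R) (t0 : R) :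
  (forall y, t0 <= y -> is_derive y 1 f (f' y)) -> (forall y, t0 <= y -> f' y <= 0) ->
  f @ +oo%R --> (0 : R) -> forall y, t0 <= y -> 0 <= f y.
Proof.
move=> fd f0 fl y ty.
apply: (cvgr_to_le fl); near=> x.
have yx : y <= x by near: x; exact/nbhs_pinfty_ge/num_real.
have [||c cyx e] := @MVT_segment R f f' y x yx.
- by move=> u; rewrite in_itv /= => /andP[yu _]; apply: fd; apply: le_trans ty (ltW yu).
- apply: continuous_in_subspaceT => u; rewrite inE /= in_itv /= => /andP[yu _].
  by apply: is_derive_continuous (fd u _); apply: le_trans ty yu.
- rewrite -subr_le0 e mulr_le0_ge0 ?subr_ge0 //; apply: f0.
  by move: cyx; rewrite in_itv /= => /andP[yu _]; apply: le_trans ty yu.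
Unshelve. all: by end_near. Qed.

(** The expected size y^l e^(-y/2) of W; M grows like its inverse. *)
Definition whit_growth (l y : R) : R := expR (l * ln y - y / 2).

Lemma whit_growth_gt0 l y : 0 < whit_growth l y. Proof. exact: expR_gt0. Qed.

Lemma near_whit_growth_le l (e : R) : 0 < e -> \forall y \near +oo%R, whit_growth l y <= expR (- (2^-1 - e) * y).
Proof.
move=> e0; have := near_ln_le l e0; apply: filterS => y h.
by rewrite ler_expR; lra.
Qed.

Lemma near_whit_growth_ge l (e : R) : 0 < e -> \forall y \near +oo%R, expR (- (2^-1 + e) * y) <= whit_growth l y.
Proof.
move=> e0; have := near_ln_le (- l) e0; apply: filterS => y h.
by rewrite ler_expR; lra.
Qed.

Lemma whit_growth_cvg0 l : whit_growth l @ +oo%R --> (0 : R).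
Proof.
have h : (fun y => expR (- (4^-1 * y))) @ +oo%R --> (0 : R).
  apply: (@cvg_comp _ _ _ (fun x => 4^-1 * x) (fun y => expR (- y)) _ +oo%R).
    by apply: gt0_cvgMry; rewrite // invr_gt0.
  exact: cvgr_expR.
apply: squeeze_cvgr (cvg_cst 0) h.
have h4 : 0 < (4^-1 : R) by rewrite invr_gt0.
have := near_whit_growth_le l h4; apply: filterS => y hy; rewrite (ltW (whit_growth_gt0 _ _)) /=.
apply: le_trans hy _; rewrite ler_expR; lra.
Qed.

Lemma is_derive_whit_growth2 (l y : R) : 0 < y ->
  is_derive y 1 (fun y => whit_growth l y ^+ 2) ((2 * l / y - 1) * whit_growth l y ^+ 2).
Proof.
move=> y0.
have d1 : is_derive y 1 (fun y => l * ln y - y / 2) (l / y - 2^-1).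
  have d0 : is_derive y 1 (fun y => y * 2^-1) (2^-1 : R).
    have h1 : is_derive y 1 (fun x : R => x) (1 : R) by exact: is_derive_id.
    have h2 : is_derive y 1 (fun _ : R => 2^-1 : R) (0 : R) by exact: is_derive_cst.
    apply: is_derive_eq (is_deriveMr h1 h2) _.
    by rewrite mul1r mulr0 addr0.
  apply: is_deriveB.
    apply: is_derive_eq (is_deriveMr (is_derive_cst l y 1) (is_derive1_ln y0)) _.
    by rewrite mul0r add0r.
have d2 := is_derive_comp1 (is_derive_expR _) d1.
apply: is_derive_eq (is_deriveMr d2 d2) _.
by rewrite -/(whit_growth l y) expr2; field; lra.
Qed.

Lemma derivesCV_aux (h : R -> C) t d : derivesC h t d -> (\forall x \near t, h x != 0) ->
  derivesC (fun x => (h x)^-1) t (- d / h t ^+ 2).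
Proof.
move=> hd hn; have h0 := nbhs_singleton hn.
have [h1 h2] := hd.
have n0 : Re (h t) * Re (h t) + Im (h t) * Im (h t) != 0.
  by rewrite -!expr2 -normc_sqr sqrf_eq0 normc_eq0.
have d1 := is_deriveMr h1 h1; have d2 := is_deriveMr h2 h2.
have d3 := is_deriveD d1 d2.
have d4 : is_derive t 1 (fun x => (Re (h x) * Re (h x) + Im (h x) * Im (h x))^-1)
   (- (Re d * Re (h t) + Re (h t) * Re d + (Im d * Im (h t) + Im (h t) * Im d)) /
     (Re (h t) * Re (h t) + Im (h t) * Im (h t)) ^+ 2).
  apply: is_derive_eq (is_deriveV (f := (fun x => Re (h x) * Re (h x)) \+ (fun x => Im (h x) * Im (h x))) n0 d3) _.
  by rewrite /GRing.scale /= -exprVn; ring.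
have E x : (h x)^-1 = (Re (h x) * (Re (h x) * Re (h x) + Im (h x) * Im (h x))^-1) +i*
      (- (Im (h x)) * (Re (h x) * Re (h x) + Im (h x) * Im (h x))^-1).
  by case: (h x) => a b; rewrite /= -!expr2 mulNr.
have d5 := is_deriveMr h1 d4; have d6 := is_deriveMr (is_deriveN h2) d4.
apply: derivesC_ext (fun x => esym (E x)) _.
have e0 : (Re (h t))%:C ^+ 2 + (Im (h t))%:C ^+ 2 != 0 :> C.
  by rewrite -!rcX -rcD rc_eq0 !expr2.
have htE : h t = (Re (h t))%:C + 'i * (Im (h t))%:C by rewrite -complexE.
suff F : - d / h t ^+ 2 =
   (Re d * (Re (h t) * Re (h t) + Im (h t) * Im (h t))^-1 + Re (h t) * (- (Re d * Re (h t) + Re (h t) * Re d + (Im d * Im (h t) + Im (h t) * Im d)) /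
     (Re (h t) * Re (h t) + Im (h t) * Im (h t)) ^+ 2)) +i*
   ((- Im d) * (Re (h t) * Re (h t) + Im (h t) * Im (h t))^-1 + (- Im (h t)) * (- (Re d * Re (h t) + Re (h t) * Re d + (Im d * Im (h t) + Im (h t) * Im d)) /
     (Re (h t) * Re (h t) + Im (h t) * Im (h t)) ^+ 2)).
  by rewrite F; split.
have h20 : h t ^+ 2 != 0 by rewrite expf_neq0.
apply: (mulIf h20); rewrite divfK //.
move: n0; case: (h t) (d) => a b [p q] /= n0; rewrite expr2.
by apply: cplxP; rewrite ?ReMc ?ImMc /=; field.
Qed.

Section Abstract.
Variables (W m dW dm : R -> C) (om ka : C) (l : R).
Hypotheses (dWP : forall y, 0 < y -> derivesC W y (dW y)) (dmP : forall y, 0 < y -> derivesC m y (dm y)).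
Hypothesis wr : forall y, 0 < y -> dW y * m y - W y * dm y = om.
Hypotheses (ka0 : ka != 0) (mka : cvgc +oo%R (fun y => m y * (whit_growth l y)%:C) ka).
Hypothesis W0 : cvgc +oo%R (fun y => W y * (whit_growth l y)%:C) 0.

(* The Wronskian is constant, so W / m has derivative om / m^2 and tends to 0:
   W is recovered by integrating from infinity. *)
Lemma recessive_asym : cvgc +oo%R (fun y => W y / (whit_growth l y)%:C) (- om / ka).
Proof.
have een y : (whit_growth l y)%:C != 0 :> C by rewrite rc_eq0 gt_eqF // whit_growth_gt0.
pose h y := whit_growth l y ^+ 2.
have h0 y : 0 < h y by rewrite exprn_gt0 // whit_growth_gt0.
have hl : h @ +oo%R --> (0 : R).
  rewrite -[0](mulr0 0); rewrite /h; under eq_fun do rewrite expr2.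
  by apply: cvgM; exact: whit_growth_cvg0.
have [t1 [_ m0]] := cvgc_near_neq0 mka ka0.
have {}m0 y : t1 < y -> m y != 0 by move=> /m0; rewrite mulf_eq0 negb_or => /andP[].
pose G y := W y / m y.
(* (W / m)' = om / m^2 is about om h / ka^2, and - h is nearly an antiderivative of h because h' =
   (2 l / y - 1) h. So [H] is an error term, with derivative [h] times a quantity [de] that tends to
   0. *)
pose H y := G y + om / ka ^+ 2 * (h y)%:C.
pose de y := om * ((m y * (whit_growth l y)%:C) ^- 2 - ka ^- 2) + om / ka ^+ 2 * (2 * l / y)%:C.
have ka2 : ka ^+ 2 != 0 by rewrite expf_neq0.
have dH y : 0 < y -> t1 < y -> derivesC H y ((h y)%:C * de y).
  move=> y0 y1.
  have mn : \forall x \near y, m x != 0.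
    have : \forall x \near y, t1 < x by exact: near_gt.
    by apply: filterS => x; exact: m0.
  have d1 := derivesCM (dWP y0) (derivesCV_aux (dmP y0) mn).
  have d2 := derivesCZ (om / ka ^+ 2) (derivesC_real (is_derive_whit_growth2 l y0)).
  apply: derivesC_eq (derivesCD d1 d2).
  have my := m0 _ y1; have en := een y.
  have -> : dW y = (om + W y * dm y) / m y by rewrite -(wr y0) subrK mulfK.
  rewrite /de /h rcX rcM rcB real_complex1 rcX.
  move: my en ka0; move: (m y) (whit_growth l y)%:C (W y) (dm y) ((2 * l / y)%:C) => a b c d e a0 b0 k0.
  by field; rewrite a0 b0 k0.
have del : cvgc +oo%R de 0.
  have -> : 0 = om * (ka ^- 2 - ka ^- 2) + om / ka ^+ 2 * 0 by rewrite subrr !mulr0 addr0.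
  apply: cvgcD.
    apply: cvgcM; first exact: cvgc_cst.
    apply: cvgcB; last exact: cvgc_cst.
    rewrite expr2; under [X in cvgc _ X]eq_fun do rewrite expr2.
    by apply: cvgcV; [rewrite mulf_neq0 | apply: cvgcM].
  apply: cvgcM; first exact: cvgc_cst.
  rewrite -[0](mulr0 (2 * l)%:C); apply: near_eq_cvgc (cvgcM (cvgc_cst (2 * l)%:C) (@cvgc_invy R)).
  by apply: nearW => y; rewrite -rcM.
have Gl : cvgc +oo%R G 0.
  rewrite -[0](mul0r ka^-1); apply: near_eq_cvgc (cvgcM W0 (cvgcV ka0 mka)).
  exists t1; split; first exact: num_real.
  move=> y y1; rewrite /G; have := m0 _ y1; have := een y.
  move: (m y) (W y) (whit_growth l y)%:C => a b c c0 a0; by field; rewrite a0 c0.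
have Hl : cvgc +oo%R H 0.
  rewrite -[0]addr0 -[X in _ + X](mulr0 (om / ka ^+ 2)).
  by apply: cvgcD => //; apply: cvgcM; [exact: cvgc_cst | exact: cvgc_real].
have Hh : cvgc +oo%R (fun y => H y / (h y)%:C) 0.
  apply/cvgc_normc; apply/cvgrPdist_le => e e0.
  pose e' := e / 4.
  have e'0 : 0 < e' by rewrite divr_gt0.
  have [t2 [_ t2P]] : \forall y \near +oo%R, normc (de y) <= e' /\ 0 < y /\ `|2 * l / y| <= 2^-1.
    near=> y; split; last split.
    - have : normc (de y - 0) <= e'; last by rewrite subr0.
      near: y; move/cvgc_normc/cvgrPdist_le : del => /(_ e' e'0); apply: filterS => y.
      by rewrite sub0r normrN ger0_norm // normc_ge0.
    - by near: y; exact/nbhs_pinfty_gt/num_real.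
    - have y0 : 0 < y by near: y; exact/nbhs_pinfty_gt/num_real.
      have hy : 2 * `|2 * l| <= y by near: y; exact/nbhs_pinfty_ge/num_real.
      rewrite normrM normfV (gtr0_norm y0) ler_pdivrMr //; lra.
  pose t3 := Num.max t1 t2 + 1.
  have t13 : t1 < t3 by rewrite /t3 (le_lt_trans (_ : t1 <= Num.max t1 t2)) ?ltrDl // le_max lexx.
  have t23 : t2 < t3 by rewrite /t3 (le_lt_trans (_ : t2 <= Num.max t1 t2)) ?ltrDl // le_max lexx orbT.
  have P y : t3 <= y -> [/\ t1 < y, 0 < y, normc (de y) <= e' & `|2 * l / y| <= 2^-1].
    move=> ty; have [a [b c]] := t2P y (lt_le_trans t23 ty); split => //.
    exact: lt_le_trans t13 ty.
  (* Once |2 l / y| <= 1/2, the derivative of 2 e' h is at most - e' h, so 2 e' h + f(H) and 2 e' h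
     - f(H) decrease to 0 and are nonnegative. [f] will be the real or the imaginary part. *)
  have key (f : C -> R) (fH : forall y, t3 <= y -> is_derive y 1 (fun y => f (H y)) (f ((h y)%:C * de y)))
     (fl : (fun y => f (H y)) @ +oo%R --> (0 : R)) (fb : forall z, `|f z| <= normc z) :
     forall y, t3 <= y -> `|f (H y)| <= 2 * e' * h y.
    have hd y : t3 <= y -> is_derive y 1 (fun y => 2 * e' * h y) (2 * e' * ((2 * l / y - 1) * h y)).
      move=> ty; have [_ y0 _ _] := P y ty.
      apply: is_derive_eq (is_deriveMr (is_derive_cst (2 * e') y 1) (is_derive_whit_growth2 l y0)) _.
      by rewrite mul0r add0r.
    have hdl y : t3 <= y -> e' * h y <= - (2 * e' * ((2 * l / y - 1) * h y)).
      move=> ty; have [_ y0 _] := P y ty; rewrite ler_norml => /andP[_ h2].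
      have -> : - (2 * e' * ((2 * l / y - 1) * h y)) = (2 * e' * (1 - 2 * l / y)) * h y by ring.
      rewrite ler_wpM2r ?(ltW (h0 _)) //.
      have : e' * 1 <= e' * (2 * (1 - 2 * l / y)) by apply: ler_wpM2l; [exact: ltW | lra].
      by rewrite mulr1 mulrA [e' * 2]mulrC.
    have fde y : t3 <= y -> `|f ((h y)%:C * de y)| <= e' * h y.
      move=> ty; have [_ _ d1 _] := P y ty; apply: le_trans (fb _) _.
      rewrite normcM normcRE (gtr0_norm (h0 y)) mulrC ler_wpM2r ?(ltW (h0 _)) //.
    have hl2 : (fun y => 2 * e' * h y) @ +oo%R --> (0 : R).
      by rewrite -[0](mulr0 (2 * e')); apply: cvgM; [exact: cvg_cst | exact: hl].
    pose F1 y := f (H y) + 2 * e' * h y; pose F2 y := 2 * e' * h y - f (H y).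
    pose D1 y := f ((h y)%:C * de y) + (2 * e' * ((2 * l / y - 1) * h y)).
    pose D2 y := (2 * e' * ((2 * l / y - 1) * h y)) - f ((h y)%:C * de y).
    have p1 x : t3 <= x -> is_derive x 1 F1 (D1 x).
      by move=> tx; exact: (is_deriveD (fH x tx) (hd x tx)).
    have p2 x : t3 <= x -> is_derive x 1 F2 (D2 x).
      by move=> tx; exact: (is_deriveB (hd x tx) (fH x tx)).
    have q1 x : t3 <= x -> D1 x <= 0.
      by move=> tx; have := hdl x tx; have := fde x tx; rewrite /D1 ler_norml => /andP[_]; lra.
    have q2 x : t3 <= x -> D2 x <= 0.
      by move=> tx; have := hdl x tx; have := fde x tx; rewrite /D2 ler_norml => /andP[+ _]; lra.
    have l1 : F1 @ +oo%R --> (0 : R) by rewrite -[0](addr0 0); exact: cvgD fl hl2.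
    have l2 : F2 @ +oo%R --> (0 : R) by rewrite -[0](subr0 0); exact: cvgB hl2 fl.
    move=> y ty; rewrite ler_norml.
    have := nonincr_to0_ge0 p1 q1 l1 ty; have := nonincr_to0_ge0 p2 q2 l2 ty.
    by rewrite /F1 /F2 subr_ge0 => -> h3; rewrite andbT -subr_ge0 opprK.
  have [Hl1 Hl2] := Hl.
  have kr : forall y, t3 <= y -> `|Re (H y)| <= 2 * e' * h y.
    apply: (key (@complex.Re R)) => //; last exact: Re_le_normc.
    by move=> y ty; have [a b _ _] := P y ty; case: (dH y b a).
  have ki : forall y, t3 <= y -> `|Im (H y)| <= 2 * e' * h y.
    apply: (key (@complex.Im R)) => //; last exact: Im_le_normc.
    by move=> y ty; have [a b _ _] := P y ty; case: (dH y b a).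
  exists t3; split; first exact: num_real.
  move=> y /ltW ty; rewrite sub0r normrN ger0_norm ?normc_ge0 // subr0.
  rewrite normcM normcV normcRE (gtr0_norm (h0 y)) ler_pdivrMr //.
  apply: le_trans (normc_le_ReIm _) _.
  have := kr y ty; have := ki y ty; have -> : e = 2 * e' + 2 * e' by rewrite /e'; field.
  by move=> a b; rewrite [leRHS]mulrDl; apply: lerD.
have fin : cvgc +oo%R (fun y => (H y / (h y)%:C - om / ka ^+ 2) * (m y * (whit_growth l y)%:C)) (- om / ka).
  have -> : - om / ka = (0 - om / ka ^+ 2) * ka by field.
  by apply: cvgcM => //; apply: cvgcB => //; exact: cvgc_cst.
apply: near_eq_cvgc fin; exists t1; split; first exact: num_real.
move=> y y1; rewrite /H /G /h rcX; have := m0 _ y1; have := een y; move: ka0.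
move: (m y) (W y) (whit_growth l y)%:C => a b c k0 c0 a0; by field; rewrite k0 a0 c0.
Unshelve. all: by end_near. Qed.

End Abstract.

End RecessiveSolution.

(** * Whittaker's equation and the size of M and W at infinity *)

Section WhittakerAsymptotics.
Context {R : realType}.
Local Notation C := R[i].
Implicit Types (r l y : R).

(** Whittaker's equation reads u'' = [whit_pot] u; the sign of r^2 comes from mu^2 = - r^2. *)
Definition whit_pot l r y : C := (4^-1 - l / y - (4^-1 + r ^+ 2) / y ^+ 2)%:C.

Definition whit_sol l r (u du : R -> C) : Prop :=
  forall y, 0 < y -> derivesC u y (du y) /\ derivesC du y (whit_pot l r y * u y).

(** Eliminating [V] between the raising relation of [A] and the lowering relation of [V] leaves only
    the product of [p] and [q]; thus one computation covers M and W, whose individual constants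
    differ. *)
Lemma whit_sol_contiguous l r (A V : R -> C) (p q : C) :
  p * q = - ((l + 2^-1) ^+ 2 + r ^+ 2)%:C ->
  (forall y, 0 < y -> derivesC A y (((y / 2 - l)%:C * A y + p * V y) / y%:C)) ->
  (forall y, 0 < y -> derivesC V y (((l + 1 - y / 2)%:C * V y + q * A y) / y%:C)) ->
  whit_sol l r A (fun y => ((y / 2 - l)%:C * A y + p * V y) / y%:C).
Proof.
move=> pq dA dV y y0; split; first exact: dA.
have yn : y%:C != 0 :> C by rewrite rc_eq0 gt_eqF.
have d0 : derivesC (fun y => (y / 2 - l)%:C : C) y 2^-1.
  have := derivesCB (derivesCZr 2^-1 (derivesC_id y)) (derivesC_cst l%:C y); rewrite mul1r subr0.
  by apply: derivesC_ext => x; rewrite rcB rcM rcV rc_nat.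
have di : derivesC (fun y => (y%:C)^-1 : C) y (- 1 / y%:C ^+ 2).
  apply: derivesCV_aux; first exact: derivesC_id.
  have := near_gt y0; apply: filterS => x x0; by rewrite rc_eq0 gt_eqF.
apply: derivesC_eq (derivesCM (derivesCD (derivesCM d0 (dA y y0)) (derivesCZ p (dV y y0))) di).
rewrite /whit_pot !rcB !rcM !rcV !rcD !rcX ?real_complex1.
have -> : p * (((l%:C + 1 - y%:C / 2) * V y + q * A y) / y%:C) =
  (p * (l%:C + 1 - y%:C / 2) * V y + p * q * A y) / y%:C by ring.
rewrite pq rcD !rcX rcD rcV rc_nat.
have t0 : (2 : C) != 0 by rewrite pnatr_eq0.
have t4 : (4 : C) != 0 by rewrite pnatr_eq0.
move: (A y) (V y) (y%:C) yn (l%:C) (r%:C) => a v z z0 L s.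
by field; rewrite z0.
Qed.

Lemma wronskian_cst l r u du v dv : whit_sol l r u du -> whit_sol l r v dv ->
  forall a b, 0 < a -> 0 < b -> du a * v a - u a * dv a = du b * v b - u b * dv b.
Proof.
move=> hu hv a b a0 b0.
apply: (@derivesC_cst_on R (fun y => du y * v y - u y * dv y) 0) => // y y0.
have [u1 u2] := hu y y0; have [v1 v2] := hv y y0.
by apply: derivesC_eq (derivesCB (derivesCM u2 v1) (derivesCM u1 v2)); ring.
Qed.

Section Fixed.
Variables (r : R) (r0 : r != 0).
Let rN0 : - r != 0. Proof. by rewrite oppr_eq0. Qed.

Definition dwW l y : C := ((y / 2 - l)%:C * wW l r y + (- 1) * wW (l + 1) r y) / y%:C.

Lemma wW_sol l : whit_sol l r (wW l r) (dwW l).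
Proof.
apply: (@whit_sol_contiguous l r _ (wW (l + 1) r) (- 1) ((l + 2^-1) ^+ 2 + r ^+ 2)%:C).
- by rewrite mulN1r.
- by move=> y y0; apply: derivesC_eq (derivesC_wW_up l r0 y0); rewrite mulN1r.
- move=> y y0; apply: derivesC_eq (derivesC_wW_down (l + 1) r0 y0); rewrite addrK.
  by congr ((_ + (_%:C * _)) / _); congr (_ ^+ 2 + _); field.
Qed.

End Fixed.

Definition dwM l r y : C := ((y / 2 - l)%:C * wM l r y + (2^-1 + imu r + l%:C) * wM (l + 1) r y) / y%:C.

Lemma wM_sol l r : r != 0 -> whit_sol l r (wM l r) (dwM l r).
Proof.
move=> r0.
apply: (@whit_sol_contiguous l r _ (wM (l + 1) r) (2^-1 + imu r + l%:C) (2^-1 + imu r - (l + 1)%:C)).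
- rewrite !rcD real_complex1 rcX rcD rc_half rcX.
  have -> : r%:C ^+ 2 = - imu r ^+ 2 :> C by rewrite imu_sqr rcX opprK.
  have t0 : (2 : C) != 0 by rewrite pnatr_eq0.
  by move: (imu r) (l%:C) => m L; field.
- by move=> y y0; exact: derivesC_wM_up.
- move=> y y0; apply: derivesC_eq (derivesC_wM_down (l + 1) r0 y0); by rewrite addrK.
Qed.

Lemma whit_solN l r u du : whit_sol l (- r) u du -> whit_sol l r u du.
Proof. by rewrite /whit_sol /whit_pot sqrrN. Qed.

Lemma egf0 (b : nat -> C) : expseq b -> egf b 0 = b 0%N.
Proof.
move=> hb; apply: (cvgc_unique (egf_cvg 0 hb)).
apply: near_eq_cvgc (cvgc_cst (b 0%N)); exists 1%N => // -[|n] //= _.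
rewrite /series /= big_nat_recl //= expr0 divr1 mulr1 big1 ?addr0 // => i _.
by rewrite expr0n /= mul0r mulr0.
Qed.

(** The Wronskian is constant, hence equal to its limit at 0, where both Kummer functions are 1. The
    powers y^(1/2 + ir) and y^(1/2 - ir) multiply to y and cancel the pole of the derivatives. *)
Lemma wronskian_wM l r y : r != 0 -> 0 < y ->
  dwM l r y * wM l (- r) y - wM l r y * dwM l (- r) y = 2 * imu r.
Proof.
move=> r0 y0; have rN0 : - r != 0 by rewrite oppr_eq0.
pose k s := kummerR (2^-1 + imu s - l%:C) (1 + 2 * imu s).
pose e s := egf (fun n => kummer_coef (2^-1 + imu s - l%:C) (1 + 2 * imu s) n.+1).
pose g y := cexp (- y%:C) * (2 * imu r * (k r y * k (- r) y) + y%:C * (e r y * k (- r) y - k r y * e (- r) y)).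
have gE x : 0 < x -> dwM l r x * wM l (- r) x - wM l r x * dwM l (- r) x = g x.
  move=> x0; have xn : x%:C != 0 :> C by rewrite rc_eq0 gt_eqF.
  have e1 : dwM l r x = _ := derivesC_unique (derivesC_wM_up l r0 x0) (derivesC_wM_aux l r0 x0).
  have e2 : dwM l (- r) x = _ := derivesC_unique (derivesC_wM_up l rN0 x0) (derivesC_wM_aux l rN0 x0).
  rewrite e1 e2 !wME /g.
  have -> : cexp (- x%:C) = cexp (- (x / 2)%:C) * cexp (- (x / 2)%:C) :> C.
    by rewrite -cexpD -opprD -rcD -splitr.
  have hp : rpowc x (2^-1 + imu r) * rpowc x (2^-1 + imu (- r)) = x%:C.
    rewrite -rpowcD imuN -[RHS](rpowc1 x0); congr rpowc.
    have t0 : (2 : C) != 0 by rewrite pnatr_eq0.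
    by move: (imu r) => m; field.
  rewrite -/(k r) -/(k (- r)) -/(e r x) -/(e (- r) x) -/(k r x) -/(k (- r) x) imuN.
  rewrite imuN in hp.
  move: hp; move: (rpowc _ _) (rpowc _ _) (k r x) (k (- r) x) (e r x) (e (- r) x) => p q a b c d hp.
  move: (cexp _) => E; rewrite rcM rc_half.
  move: (imu r) (x%:C) xn hp => m z z0 hz; move: z0; rewrite -hz mulf_eq0 negb_or => /andP[p0 q0].
  have t0 : (2 : C) != 0 by rewrite pnatr_eq0.
  by field; rewrite p0 q0.
have gl : cvgc (0^'+) g (2 * imu r).
  have k1 s : s != 0 -> k s 0 = 1.
    move=> s0; rewrite /k /kummerR egf0; last by apply: expseq_kummer_coef; [exact: nonpole_a | exact: nonpole_b].
    by rewrite /kummer_coef /pochhammer !big_nil divr1.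
  have ck s : s != 0 -> cvgc (nbhs (0 : R)) (k s) (k s 0).
    by move=> s0; apply: derivesC_cvg; apply: derivesC_kummerR; [exact: nonpole_a | exact: nonpole_b].
  have ce s : s != 0 -> cvgc (nbhs (0 : R)) (e s) (e s 0).
    move=> s0; apply: derivesC_cvg; apply: derivesC_egf; apply: expseqS.
    by apply: expseq_kummer_coef; [exact: nonpole_a | exact: nonpole_b].
  have cx : cvgc (nbhs (0 : R)) (fun x => x%:C) 0 by apply: derivesC_cvg (derivesC_id 0).
  have cE : cvgc (nbhs (0 : R)) (fun x => cexp (- x%:C)) 1.
    rewrite -cexp0 -[X in cexp X]oppr0; apply: (derivesC_cvg (derivesC_cexp (derivesCN (derivesC_id 0)))).
  have g0 : g 0 = 2 * imu r by rewrite /g !k1 // oppr0 cexp0 mul0r addr0 !mulr1 mul1r.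
  have [ga gb] : cvgc (nbhs (0 : R)) g (2 * imu r).
    rewrite -[2 * imu r](_ : 1 * (2 * imu r * (k r 0 * k (- r) 0) + 0 * (e r 0 * k (- r) 0 - k r 0 * e (- r) 0)) = _).
      apply: cvgcM => //; apply: cvgcD.
        exact: (cvgcM (cvgc_cst (2 * imu r)) (cvgcM (ck _ r0) (ck _ rN0))).
      exact: (cvgcM cx (cvgcB (cvgcM (ce _ r0) (ck _ rN0)) (cvgcM (ck _ r0) (ce _ rN0)))).
    by rewrite !k1 // mul0r addr0 !mulr1 mul1r.
  by split; exact: cvg_at_right_filter.
have h : g y = 2 * imu r.
  have gc : cvgc (0^'+) g (g y).
    apply: near_eq_cvgc (cvgc_cst (g y)); near=> x.
    have x0 : 0 < x by [].
    by rewrite -!gE // (wronskian_cst (wM_sol l r0) (whit_solN (wM_sol l rN0)) y0 x0).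
  exact: cvgc_unique gc gl.
by rewrite gE.
Unshelve. all: by end_near. Qed.

Lemma wA_neq0 l r : r != 0 -> wA l r != 0.
Proof.
move=> r0; rewrite /wA mulf_neq0 // ?invr_eq0; apply: Gammac_neq0.
  by rewrite -mulrN -imuN; apply: nonpole_2mu; rewrite oppr_eq0.
by rewrite -imuN; apply: nonpole_a; rewrite oppr_eq0.
Qed.

Lemma whit_growthE l y : (whit_growth l y)%:C = cexp (- (y / 2)%:C) * rpowc y l%:C :> C.
Proof.
by rewrite /whit_growth addrC expRD rcM -!cexp_real rcN /rpowc -rcM.
Qed.

Lemma wM_whit_growth l r : r != 0 ->
  exists2 ka, ka != 0 & cvgc +oo%R (fun y => wM l r y * (whit_growth l y)%:C) ka.
Proof.
move=> r0; exists (Gammac (1 + 2 * imu r) / Gammac (2^-1 + imu r - l%:C)).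
  by rewrite mulf_neq0 ?invr_eq0 ?Gammac_neq0 //; [exact: nonpole_b | exact: nonpole_a].
by apply: near_eq_cvgc (wM_asym l r0); apply: nearW => y; rewrite whit_growthE.
Qed.

(* The growing parts of the two terms of W cancel, since
   Gamma(-2 mu) Gamma(1 + 2 mu) + Gamma(2 mu) Gamma(1 - 2 mu) = 0. *)
Lemma wW_whit_growth l r : r != 0 -> cvgc +oo%R (fun y => wW l r y * (whit_growth l y)%:C) 0.
Proof.
move=> r0; have rN0 : - r != 0 by rewrite oppr_eq0.
have <- : wA l r * (Gammac (1 + 2 * imu r) / Gammac (2^-1 + imu r - l%:C)) +
          wA l (- r) * (Gammac (1 + 2 * imu (- r)) / Gammac (2^-1 + imu (- r) - l%:C)) = 0.
  rewrite /wA !imuN !mulrN !opprK ![1 + _]addrC !GammacS; [|by rewrite -mulrN -imuN; exact: nonpole_2mu|exact: nonpole_2mu].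
  ring.
apply: near_eq_cvgc (cvgcD (cvgcM (cvgc_cst (wA l r)) (wM_asym l r0)) (cvgcM (cvgc_cst (wA l (- r))) (wM_asym l rN0))).
apply: nearW => y; rewrite wWE whit_growthE; move: (wM _ _ _) (wM _ _ _) (cexp _) (rpowc _ _) => a b c d; ring.
Qed.

(** W differs from [wA l (- r)] M_{-r} by a multiple of M_r, so its Wronskian with M_r is a nonzero
    constant and [recessive_asym] applies. *)
Lemma wW_asym l r : r != 0 ->
  exists2 t, t != 0 & cvgc +oo%R (fun y => wW l r y / (whit_growth l y)%:C) t.
Proof.
move=> r0; have rN0 : - r != 0 by rewrite oppr_eq0.
have [ka ka0 mka] := wM_whit_growth l r0.
exists (- (2 * imu r * wA l (- r) * - 1) / ka).
  rewrite mulf_neq0 ?invr_eq0 // oppr_eq0 mulf_neq0 ?oppr_eq0 ?oner_eq0 //.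
  rewrite mulf_neq0 ?wA_neq0 //.
  by have := nonpole_2mu r0 0%N; rewrite addr0.
apply: (@recessive_asym R (wW l r) (wM l r) (dwW r l) (dwM l r)) => //.
- by move=> y y0; case: (wW_sol r0 l y0).
- by move=> y y0; case: (wM_sol l r0 y0).
- move=> y y0.
  have E : dwW r l y = wA l r * dwM l r y + wA l (- r) * dwM l (- r) y.
    have [d1 _] := wW_sol r0 l y0; apply: (derivesC_unique d1).
    apply: derivesC_ext (fun x => esym (wWE l r x)) _.
    by apply: derivesCD; apply: derivesCZ; [case: (wM_sol l r0 y0) | case: (wM_sol l rN0 y0)].
  rewrite E wWE; have <- := wronskian_wM l r0 y0; ring.
- exact: wW_whit_growth.
Qed.

(** The margin 1/20 around the rate 1/2 swallows the power y^l. It is narrow enough for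
    [maass_coef_rigid], where the decay 9/20 of 4 pi at height 1 must beat the loss 11/20 of 2 pi at
    height 1/2. *)
Lemma wW_upper l r : r != 0 -> exists2 A : R, 0 < A &
  \forall y \near +oo%R, normc (wW l r y) <= A * expR (- (9 / 20) * y).
Proof.
move=> r0; have [t t0 h] := wW_asym l r0.
exists (normc t + 1); first by rewrite ltr_wpDl ?normc_ge0.
near=> y.
have e1 : normc (wW l r y / (whit_growth l y)%:C) <= normc t + 1.
  near: y; apply: (cvgr_le _ (cvgc_norm h)); by rewrite ltrDl.
have e2 : whit_growth l y <= expR (- (2^-1 - 20^-1) * y) by near: y; apply: near_whit_growth_le; rewrite invr_gt0.
move: e1; rewrite normcM normcV normcRE (gtr0_norm (whit_growth_gt0 l y)) ler_pdivrMr ?whit_growth_gt0 // => /le_trans; apply.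
rewrite ler_wpM2l ?addr_ge0 ?normc_ge0 //; apply: le_trans e2 _.
by rewrite ler_expR le_eqVlt; apply/orP; left; apply/eqP; field.
Unshelve. all: by end_near. Qed.

Lemma wW_lower l r : r != 0 -> exists2 A : R, 0 < A &
  \forall y \near +oo%R, A * expR (- (11 / 20) * y) <= normc (wW l r y).
Proof.
move=> r0; have [t t0 h] := wW_asym l r0.
have nt : 0 < normc t by rewrite normc_gt0.
exists (normc t / 2); first by rewrite divr_gt0.
near=> y.
have e1 : normc t / 2 <= normc (wW l r y / (whit_growth l y)%:C).
  near: y; apply: (cvgr_ge _ (cvgc_norm h)); rewrite ltr_pdivrMr // mulr_natr mulr2n ltrDl //.
have e2 : expR (- (2^-1 + 20^-1) * y) <= whit_growth l y by near: y; apply: near_whit_growth_ge; rewrite invr_gt0.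
move: e1; rewrite normcM normcV normcRE (gtr0_norm (whit_growth_gt0 l y)) ler_pdivlMr ?whit_growth_gt0 //; apply: le_trans.
rewrite ler_wpM2l ?divr_ge0 ?(ltW nt) //; apply: le_trans e2.
by rewrite ler_expR le_eqVlt; apply/orP; left; apply/eqP; field.
Unshelve. all: by end_near. Qed.

Lemma wM_lower l r : r != 0 -> exists2 A : R, 0 < A &
  \forall y \near +oo%R, A * expR (9 / 20 * y) <= normc (wM l r y).
Proof.
move=> r0; have [t t0 h] := wM_whit_growth l r0.
have nt : 0 < normc t by rewrite normc_gt0.
exists (normc t / 2); first by rewrite divr_gt0.
near=> y.
have e1 : normc t / 2 <= normc (wM l r y * (whit_growth l y)%:C).
  near: y; apply: (cvgr_ge _ (cvgc_norm h)); rewrite ltr_pdivrMr // mulr_natr mulr2n ltrDl //.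
have e2 : whit_growth l y <= expR (- (2^-1 - 20^-1) * y) by near: y; apply: near_whit_growth_le; rewrite invr_gt0.
move: e1; rewrite normcM normcRE (gtr0_norm (whit_growth_gt0 l y)) => e1.
have e3 : normc t / 2 <= normc (wM l r y) * expR (- (2^-1 - 20^-1) * y).
  by apply: le_trans e1 _; rewrite ler_wpM2l ?normc_ge0.
have -> : 9 / 20 * y = - (- (2^-1 - 20^-1) * y) by field.
by rewrite expRN ler_pdivrMr ?expR_gt0.
Unshelve. all: by end_near. Qed.

End WhittakerAsymptotics.

(** * Series over the integers *)

Section TwoSidedSums.
Context {R : realType}.
Local Notation C := R[i].

Definition sumN (u : nat -> C) : C :=
  limn (series (fun n => Re (u n))) +i* limn (series (fun n => Im (u n))).

Lemma geo_ge0 (u : nat -> C) (B q : R) : (forall n, normc (u n) <= B * q ^+ n) -> 0 <= B.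
Proof. by move=> /(_ 0%N); rewrite expr0 mulr1; apply: le_trans; exact: normc_ge0. Qed.

Lemma real_geo_cvg (f : nat -> R) (B q : R) : 0 <= q < 1 -> (forall n, `|f n| <= B * q ^+ n) ->
  cvgn (series f).
Proof.
move=> /andP[q0 q1] fB; apply: normed_cvg.
have B0 : 0 <= B by have := fB 0%N; rewrite expr0 mulr1; apply: le_trans.
apply: (@series_le_cvg _ _ (geometric B q)) => //.
- by move=> n; exact: normr_ge0.
- by move=> n; rewrite /= mulr_ge0 ?exprn_ge0.
- by apply: is_cvg_geometric_series; rewrite ger0_norm.
Qed.

Lemma sumN_cvg (u : nat -> C) (B q : R) : 0 <= q < 1 -> (forall n, normc (u n) <= B * q ^+ n) ->
  cvgc \oo (series u) (sumN u).
Proof.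
move=> q01 uB; split => /=.
  rewrite (_ : (fun n => _) = series (fun n => Re (u n))); last by apply/funext => n; rewrite /series /= Re_sum.
  by apply: (@real_geo_cvg _ B q) => // n; apply: le_trans (Re_le_normc _) _.
rewrite (_ : (fun n => _) = series (fun n => Im (u n))); last by apply/funext => n; rewrite /series /= Im_sum.
by apply: (@real_geo_cvg _ B q) => // n; apply: le_trans (Im_le_normc _) _.
Qed.

Lemma geo_sum_le (q : R) N : 0 <= q < 1 -> \sum_(0 <= i < N) q ^+ i <= (1 - q)^-1.
Proof.
move=> /andP[q0 q1]; have q1' : 0 < 1 - q by rewrite subr_gt0.
rewrite -[leRHS]mul1r ler_pdivlMr //.
have -> : (\sum_(0 <= i < N) q ^+ i) * (1 - q) = 1 - q ^+ N.
  elim: N => [|N IH]; first by rewrite big_nil mul0r subrr.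
  by rewrite big_nat_recr //= mulrDl IH exprSr; ring.
by rewrite lerBlDr lerDl exprn_ge0.
Qed.

Lemma sumN_le (u : nat -> C) (B q : R) : 0 <= q < 1 -> (forall n, normc (u n) <= B * q ^+ n) ->
  normc (sumN u) <= B / (1 - q).
Proof.
move=> q01 uB; apply: (cvgc_le_norm (sumN_cvg q01 uB)); apply: nearW => N.
apply: le_trans (normc_sum _ _ _) _.
apply: le_trans (_ : \sum_(0 <= i < N) B * q ^+ i <= _); first by apply: ler_sum => i _.
rewrite -mulr_sumr ler_wpM2l ?geo_sum_le //; exact: geo_ge0 uB.
Qed.

(** The indices n and -(n + 1) share one bound, matching the two halves of [has_sumZ]. *)
Definition geodom (u : int -> C) (B q : R) : Prop :=
  forall n : nat, normc (u n%:Z) <= B * q ^+ n /\ normc (u (- n.+1%:Z)) <= B * q ^+ n.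

Definition sumZ (u : int -> C) : C := sumN (fun n => u n%:Z) + sumN (fun n => u (- n.+1%:Z)).

Lemma eq_sumZ (u v : int -> C) : (forall n, u n = v n) -> sumZ u = sumZ v.
Proof. by move=> /funext ->. Qed.

Section Dominated.
Variables (q : R) (q01 : 0 <= q < 1).

Lemma sumZ_has (u : int -> C) B : geodom u B q -> has_sumZ u (sumZ u).
Proof.
move=> ub; exists (sumN (fun n => u n%:Z)), (sumN (fun n => u (- n.+1%:Z))); split => //.
  by apply/cvgcP; apply: (@sumN_cvg _ B q) => // n; case: (ub n).
by apply/cvgcP; apply: (@sumN_cvg _ B q) => // n; case: (ub n).
Qed.

Lemma has_sumZ_unique (u : int -> C) s t : has_sumZ u s -> has_sumZ u t -> s = t.
Proof.
move=> [a [b [/cvgcP h1 /cvgcP h2 ->]]] [a' [b' [/cvgcP h1' /cvgcP h2' ->]]].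
by rewrite (cvgc_unique h1 h1') (cvgc_unique h2 h2').
Qed.

Lemma sumZ_le (u : int -> C) B : geodom u B q -> normc (sumZ u) <= 2 * B / (1 - q).
Proof.
move=> ub; apply: le_trans (le_normcD _ _) _.
have -> : 2 * B / (1 - q) = B / (1 - q) + B / (1 - q) by ring.
by apply: lerD; apply: sumN_le => // n; case: (ub n).
Qed.

Lemma geodomD (u v : int -> C) B B' : geodom u B q -> geodom v B' q -> geodom (fun n => u n + v n) (B + B') q.
Proof.
move=> hu hv n; have [a b] := hu n; have [a' b'] := hv n.
by rewrite mulrDl; split; apply: le_trans (le_normcD _ _) _; apply: lerD.
Qed.

Lemma geodomZ (a : C) (u : int -> C) B : geodom u B q -> geodom (fun n => a * u n) (normc a * B) q.
Proof.
by move=> hu n; have [h1 h2] := hu n; rewrite !normcM -mulrA; split; rewrite ler_wpM2l ?normc_ge0.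
Qed.

Lemma sumZD (u v : int -> C) B B' : geodom u B q -> geodom v B' q ->
  sumZ (fun n => u n + v n) = sumZ u + sumZ v.
Proof.
move=> hu hv; apply: (has_sumZ_unique (sumZ_has (geodomD hu hv))).
have [a [b [/cvgcP h1 /cvgcP h2 ->]]] := sumZ_has hu.
have [a' [b' [/cvgcP h1' /cvgcP h2' ->]]] := sumZ_has hv.
exists (a + a'), (b + b'); split; last by ring.
  apply/cvgcP; apply: near_eq_cvgc (cvgcD h1 h1'); apply: nearW => n.
  by rewrite /series /= -big_split.
apply/cvgcP; apply: near_eq_cvgc (cvgcD h2 h2'); apply: nearW => n.
by rewrite /series /= -big_split.
Qed.

Lemma sumZZ (a : C) (u : int -> C) B : geodom u B q -> sumZ (fun n => a * u n) = a * sumZ u.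
Proof.
move=> hu; apply: (has_sumZ_unique (sumZ_has (geodomZ a hu))).
have [b [c [/cvgcP h1 /cvgcP h2 ->]]] := sumZ_has hu.
exists (a * b), (a * c); split; last by ring.
  apply/cvgcP; apply: near_eq_cvgc (cvgcM (cvgc_cst a) h1); apply: nearW => n.
  by rewrite /series /= mulr_sumr.
apply/cvgcP; apply: near_eq_cvgc (cvgcM (cvgc_cst a) h2); apply: nearW => n.
by rewrite /series /= mulr_sumr.
Qed.

(** The first order estimate in modulus, the form in which differentiability is proved for series
    and for compositions. *)
Lemma derivesC_of_small (f : R -> C) (t : R) (d : C) :
  (forall e : R, 0 < e -> exists2 de : R, 0 < de & forall s, `|s - t| < de ->
     normc (f s - f t - (s - t)%:C * d) <= e * `|s - t|) -> derivesC f t d.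
Proof.
move=> H.
have aux (p : C -> R) (pB : forall z w, p (z - w) = p z - p w) (pZ : forall (a : R) z, p (a%:C * z) = a * p z)
   (pn : forall z, `|p z| <= normc z) : is_derive t 1 (fun x => p (f x)) (p d).
  have cv : h^-1 *: (p (f (h *: 1 + t)) - p (f t)) @[h --> 0^'] --> p d.
    apply/cvgrPdist_le => e e0; have [de de0 strip_density] := H e e0; near=> h.
    have h0 : h != 0 by near: h; exact: nbhs_dnbhs_neq.
    have hde : `|h| < de by near: h; apply: dnbhs0_lt.
    have := strip_density (h + t); rewrite addrK => /(_ hde) {}strip_density.
    rewrite /GRing.scale /= mulr1 distrC.
    have -> : h^-1 * (p (f (h + t)) - p (f t)) - p d = h^-1 * p (f (h + t) - f t - h%:C * d).
      by rewrite !pB pZ; field.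
    by rewrite normrM normfV mulrC ler_pdivrMr ?normr_gt0 // (le_trans (pn _)).
  split; first by apply/cvg_ex; exists (p d).
  exact: cvg_lim.
split; first by apply: aux; [exact: ReB | exact: ReZ | exact: Re_le_normc].
by apply: aux; [exact: ImB | exact: ImZ | exact: Im_le_normc].
Unshelve. all: by end_near. Qed.

Lemma is_derive_small (f : R -> R) (t d e : R) : is_derive t 1 f d -> 0 < e ->
  exists2 de : R, 0 < de & forall s, `|s - t| < de -> `|f s - f t - (s - t) * d| <= e * `|s - t|.
Proof.
move=> [fd fE] e0.
have : h^-1 *: (f (h *: 1 + t) - f t) @[h --> 0^'] --> d.
  by move: fd; rewrite /derivable /= => fd; rewrite -fE; exact: fd.
move/cvgrPdist_le => /(_ e e0) [de /= de0 hde]; exists de => // s hs.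
have [->|st] := eqVneq s t; first by rewrite !subrr mul0r subrr !normr0 mulr0.
have st0 : s - t != 0 by rewrite subr_eq0.
have := hde (s - t); rewrite /= sub0r normrN => /(_ hs st0).
rewrite /GRing.scale /= mulr1 subrK distrC => h.
have -> : f s - f t - (s - t) * d = (s - t) * ((s - t)^-1 * (f s - f t) - d) by field.
by rewrite normrM mulrC ler_wpM2r.
Qed.

Lemma derivesC_small (f : R -> C) (t : R) (d : C) : derivesC f t d -> forall e : R, 0 < e ->
  exists2 de : R, 0 < de & forall s, `|s - t| < de ->
     normc (f s - f t - (s - t)%:C * d) <= e * `|s - t|.
Proof.
move=> [d1 d2] e e0; have e20 : 0 < e / 2 by rewrite divr_gt0.
have [a a0 ha] := is_derive_small d1 e20; have [b b0 hb] := is_derive_small d2 e20.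
exists (Num.min a b); first by rewrite lt_min a0 b0.
move=> s; rewrite lt_min => /andP[sa sb].
apply: le_trans (normc_le_ReIm _) _; rewrite !(ReB, ImB) ReZ ImZ.
by rewrite [in leRHS](splitr e) [leRHS]mulrDl; apply: lerD; [exact: ha | exact: hb].
Qed.

Lemma sumN_tail (u : nat -> C) (B : R) N : (forall n, normc (u n) <= B * q ^+ n) ->
  normc (sumN u - series u N) <= B * q ^+ N / (1 - q).
Proof.
move=> uB; have /andP[q0 q1] := q01.
apply: (cvgc_le_norm (cvgcB (sumN_cvg q01 uB) (cvgc_cst (series u N)))).
exists N => // M /= NM.
rewrite sub_series_geq //; apply: le_trans (normc_sum _ _ _) _.
apply: le_trans (_ : \sum_(N <= i < M) B * q ^+ i <= _); first by apply: ler_sum => i _.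
rewrite -{1}[N]add0n big_addn.
under eq_bigr do rewrite exprD.
have -> : \sum_(0 <= i < M - N) B * (q ^+ i * q ^+ N) = B * q ^+ N * \sum_(0 <= i < M - N) q ^+ i.
  by rewrite mulr_sumr; apply: eq_bigr => i _; ring.
rewrite ler_wpM2l ?geo_sum_le // mulr_ge0 ?exprn_ge0 //; exact: geo_ge0 uB.
Qed.

(** The remainder of the n-th term is at most 3 B q^n |s - t|, where 2 comes from the mean value
    bound and 1 from the linear part. So the tail is uniformly small relative to |s - t|, while the
    head is a finite sum. *)
Lemma derivesC_sumN (u u' : nat -> R -> C) (t de B : R) : 0 < de ->
  (forall n s, `|s - t| < de -> derivesC (u n) s (u' n s)) ->
  (forall n s, `|s - t| < de -> normc (u n s) <= B * q ^+ n) ->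
  (forall n s, `|s - t| < de -> normc (u' n s) <= B * q ^+ n) ->
  derivesC (fun s => sumN (fun n => u n s)) t (sumN (fun n => u' n t)).
Proof.
move=> de0 d1 b0 b1; have /andP[q0 q1] := q01.
have nfreq : `|t - t| < de by rewrite subrr normr0.
have B0 : 0 <= B by apply: (@geo_ge0 (fun n => u n t) B q) => n; exact: b0.
have D n s : `|s - t| < de -> normc (u n s - u n t - (s - t)%:C * u' n t) <= 3 * B * `|s - t| * q ^+ n.
  move=> hs.
  have inn x : Num.min s t <= x <= Num.max s t -> `|x - t| < de.
    have [st|ts] := leP s t => /andP[h1 h2]; apply: le_lt_trans hs.
      by rewrite !ler0_norm ?subr_le0 // lerN2 lerD2r.
    by rewrite !ger0_norm ?subr_ge0 ?(ltW ts) // lerD2r.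
  have h : normc (u n s - u n t) <= 2 * (B * q ^+ n) * `|s - t|.
    apply: (@derivesC_le_distW R (u n) (u' n) t s _ (Num.min s t) (Num.max s t)).
    - by rewrite ge_min le_max lexx !orbT.
    - by rewrite ge_min le_max lexx.
    - by move=> x hx; apply: d1; exact: inn.
    - by move=> x hx; apply: b1; exact: inn.
  apply: le_trans (ler_normcB _ _) _.
  have -> : 3 * B * `|s - t| * q ^+ n = 2 * (B * q ^+ n) * `|s - t| + `|s - t| * (B * q ^+ n) by ring.
  by apply: lerD => //; rewrite normcM normcRE ler_wpM2l //; exact: b1.
apply: derivesC_of_small => e e0.
have [N hN] : exists N, 3 * B * q ^+ N / (1 - q) <= e / 2.
  have : (fun N => 3 * B / (1 - q) * q ^+ N) @ \oo --> (0 : R).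
    rewrite -[0](mulr0 (3 * B / (1 - q))); apply: cvgM; first exact: cvg_cst.
    by apply: cvg_expr; rewrite ger0_norm.
  have e20 : 0 < e / 2 by rewrite divr_gt0.
  move/cvgrPdist_le => /(_ (e / 2) e20)[N _ hN]; exists N.
  have := hN N (leqnn N); rewrite sub0r normrN => /(le_trans (ler_norm _)).
  by rewrite mulrAC.
have fin : derivesC (fun s => \sum_(0 <= i < N) u i s) t (\sum_(0 <= i < N) u' i t).
  by apply: derivesC_sum => i; exact: d1.
have e20 : 0 < e / 2 by rewrite divr_gt0.
have [d2 d20 hd2] := derivesC_small fin e20.
exists (Num.min de d2); first by rewrite lt_min de0 d20.
move=> s; rewrite lt_min => /andP[s1 s2].
pose v n := u n s - u n t - (s - t)%:C * u' n t.
have vb n : normc (v n) <= 3 * B * `|s - t| * q ^+ n by exact: D.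
have E : sumN (u^~ s) - sumN (u^~ t) - (s - t)%:C * sumN (u'^~ t) = sumN v.
  have c1 := sumN_cvg q01 (fun n => b0 n s s1); have c2 := sumN_cvg q01 (fun n => b0 n t nfreq).
  have c3 := sumN_cvg q01 (fun n => b1 n t nfreq).
  apply: (cvgc_unique _ (sumN_cvg q01 vb)).
  apply: near_eq_cvgc (cvgcB (cvgcB c1 c2) (cvgcM (cvgc_cst (s - t)%:C) c3)).
  apply: nearW => n; rewrite /series /= mulr_sumr -!sumrB; exact: eq_bigr.
rewrite E -[sumN v](subrK (series v N)); apply: le_trans (le_normcD _ _) _.
rewrite [in leRHS](splitr e) mulrDl; apply: lerD.
  apply: le_trans (sumN_tail N vb) _.
  have -> : 3 * B * `|s - t| * q ^+ N / (1 - q) = 3 * B * q ^+ N / (1 - q) * `|s - t| by ring.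
  by rewrite ler_wpM2r.
have -> : series v N = \sum_(0 <= i < N) u i s - \sum_(0 <= i < N) u i t - (s - t)%:C * \sum_(0 <= i < N) u' i t.
  by rewrite /series /= mulr_sumr -!sumrB.
exact: hd2.
Qed.

Lemma derivesC_sumZ (u u' : int -> R -> C) (t de B : R) : 0 < de ->
  (forall n s, `|s - t| < de -> derivesC (u n) s (u' n s)) ->
  (forall s, `|s - t| < de -> geodom (fun n => u n s) B q) ->
  (forall s, `|s - t| < de -> geodom (fun n => u' n s) B q) ->
  derivesC (fun s => sumZ (fun n => u n s)) t (sumZ (fun n => u' n t)).
Proof.
move=> de0 d1 b0 b1; apply: derivesCD.
  apply: (@derivesC_sumN (fun n => u n%:Z) (fun n => u' n%:Z) t de B) => // [n s hs|n s hs|n s hs].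
  - exact: d1.
  - by case: (b0 s hs n).
  - by case: (b1 s hs n).
apply: (@derivesC_sumN (fun n => u (- n.+1%:Z)) (fun n => u' (- n.+1%:Z)) t de B) => // [n s hs|n s hs|n s hs].
- exact: d1.
- by case: (b0 s hs n).
- by case: (b1 s hs n).
Qed.

End Dominated.
End TwoSidedSums.

(** * Partial derivatives on the half-plane *)

Section PartialDerivatives.
Context {R : realType}.
Local Notation C := R[i].
Implicit Types (f g fx fy gx gy : C -> C) (z w : C).

Definition cts (f : C -> C) z := cvgc (nbhs (z : C^o)) f (f z).

Lemma cts_Re z : (fun w : C => Re w) @ nbhs (z : C^o) --> Re z.
Proof. by have [] : cts (fun w => w) z by apply/cvgcP; exact: cvg_id. Qed.

Lemma cts_Im z : (fun w : C => Im w) @ nbhs (z : C^o) --> Im z.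
Proof. by have [_] : cts (fun w => w) z by apply/cvgcP; exact: cvg_id. Qed.

Lemma near_uhp z (a : R) : a < Im z -> \forall w \near (z : C^o), a < Im w.
Proof. by move=> az; apply: (cvgr_gt _ (@cts_Im z)). Qed.

Lemma derivesC_deriveC (h : R -> C) t d : derivesC h t d -> derivableC h t /\ deriveC h t = d.
Proof.
move=> [h1 h2]; split; first by split; [case: h1 | case: h2].
by apply: cplxP; rewrite /deriveC /= derive1E; [case: h1 | case: h2].
Qed.

Lemma derivableC_derivesC (h : R -> C) t : derivableC h t -> derivesC h t (deriveC h t).
Proof.
by move=> [h1 h2]; split; rewrite /deriveC /= derive1E; apply: derivableP.
Qed.

Definition partials f z p q := derivesC (hslice f z) (Re z) p /\ derivesC (vslice f z) (Im z) q.

(** The partials are carried as named functions because for series they are known explicitly;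
    [uhp_C2P] returns to [dx] and [dy]. *)
Definition C1on f fx fy := forall z, uhp z ->
  [/\ partials f z (fx z) (fy z), cts fx z & cts fy z].

Lemma cts_near f g z : (\forall w \near (z : C^o), f w = g w) -> cts f z -> cts g z.
Proof.
move=> h fz; have e : f z = g z := nbhs_singleton h.
rewrite /cts -e; exact: (@near_eq_cvgc R _ (nbhs (z : C^o)) (@nbhs_pfilter _ (z : C^o)) f g (f z) h fz).
Qed.

Lemma C1on_dxdy f fx fy z : C1on f fx fy -> uhp z -> dx f z = fx z /\ dy f z = fy z.
Proof.
by move=> H zu; have [[p1 p2] _ _] := H z zu; split; [case: (derivesC_deriveC p1) | case: (derivesC_deriveC p2)].
Qed.

Lemma near_in_uhp z : uhp z -> \forall w \near (z : C^o), uhp w.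
Proof. exact: near_uhp. Qed.

Lemma C1on_uhp_C1 f fx fy : C1on f fx fy -> uhp_C1 f.
Proof.
move=> H z zu; have [[p1 p2] c1 c2] := H z zu.
split; [by case: (derivesC_deriveC p1) | by case: (derivesC_deriveC p2) | |].
  suff: cts (dx f) z by move/cvgcP.
  apply: cts_near c1; apply: filterS (near_in_uhp zu) => w wu.
  by have [-> _] := C1on_dxdy H wu.
suff: cts (dy f) z by move/cvgcP.
apply: cts_near c2; apply: filterS (near_in_uhp zu) => w wu.
by have [_ ->] := C1on_dxdy H wu.
Qed.

Lemma uhp_C1_C1on f : uhp_C1 f -> C1on f (dx f) (dy f).
Proof.
move=> H z zu; have [h1 h2 /cvgcP c1 /cvgcP c2] := H z zu.
by split; [split; exact: derivableC_derivesC|exact: c1|exact: c2].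
Qed.

Lemma partials_near f g z p q : uhp z -> (forall w, uhp w -> f w = g w) ->
  partials f z p q -> partials g z p q.
Proof.
move=> zu fg [p1 p2]; split.
  by apply: derivesC_ext p1 => x; rewrite /hslice fg.
apply: derivesC_near p2; have := near_gt zu; apply: filterS => y y0; by rewrite /vslice fg.
Qed.

Lemma C1on_eq f g fx fy gx gy : (forall w, uhp w -> f w = g w) ->
  (forall w, uhp w -> fx w = gx w) -> (forall w, uhp w -> fy w = gy w) ->
  C1on f fx fy -> C1on g gx gy.
Proof.
move=> e1 e2 e3 H z zu; have [p c1 c2] := H z zu; split.
- by rewrite -e2 // -e3 //; apply: partials_near p.
- by apply: cts_near c1; apply: filterS (near_in_uhp zu) => w; exact: e2.
- by apply: cts_near c2; apply: filterS (near_in_uhp zu) => w; exact: e3.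
Qed.

Lemma uhp_C2P f fx fy fxx fxy fyx fyy : C1on f fx fy -> C1on fx fxx fxy -> C1on fy fyx fyy ->
  uhp_C2 f /\ forall z, uhp z -> [/\ dx f z = fx z, dx (dx f) z = fxx z & dy (dy f) z = fyy z].
Proof.
move=> H Hx Hy.
have Ex : C1on (dx f) fxx fxy.
  by apply: C1on_eq Hx => // w wu; have [] := C1on_dxdy H wu.
have Ey : C1on (dy f) fyx fyy.
  by apply: C1on_eq Hy => // w wu; have [] := C1on_dxdy H wu.
split; first by split; [exact: C1on_uhp_C1 H | exact: C1on_uhp_C1 Ex | exact: C1on_uhp_C1 Ey].
move=> z zu; split.
- by case: (C1on_dxdy H zu).
- by case: (C1on_dxdy Ex zu).
- by case: (C1on_dxdy Ey zu).
Qed.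

Lemma ctsD f g z : cts f z -> cts g z -> cts (fun w => f w + g w) z.
Proof. exact: cvgcD. Qed.

Lemma ctsM f g z : cts f z -> cts g z -> cts (fun w => f w * g w) z.
Proof. exact: cvgcM. Qed.

Lemma cts_cst (a : C) z : cts (fun=> a) z. Proof. exact: cvgc_cst. Qed.

(** Move horizontally at the height of w, then vertically at the abscissa of z, with the mean value
    bound on each leg. *)
Lemma lipschitz_cts f fx fy z (e M : R) : 0 < e ->
  (forall w, `|Im w - Im z| < e -> `|Re w - Re z| < e ->
    [/\ partials f w (fx w) (fy w), normc (fx w) <= M & normc (fy w) <= M]) -> cts f z.
Proof.
move=> e0 he.
have slab w : `|Re w - Re z| < e -> `|Im w - Im z| < e ->
    normc (f w - f z) <= 2 * M * `|Re w - Re z| + 2 * M * `|Im w - Im z|.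
  move=> h1 h2.
  have -> : f w - f z = (f w - f (Re z +i* Im w)) + (f (Re z +i* Im w) - f z) by ring.
  have inn (a b x : R) : `|a - b| < e -> Num.min a b <= x <= Num.max a b -> `|x - b| < e.
    move=> ab; have [h|h] := leP a b => /andP[k1 k2].
      by apply: le_lt_trans ab; rewrite !ler0_norm ?subr_le0 // lerN2 lerD2r.
    by apply: le_lt_trans ab; rewrite !ger0_norm ?subr_ge0 ?(ltW h) // lerD2r.
  apply: le_trans (le_normcD _ _) _; apply: lerD.
    rewrite [f w](_ : _ = hslice f w (Re w)); last by rewrite /hslice -cplxE.
    have := @derivesC_le_distW R (hslice f w) (fun x => fx (x +i* Im w)) (Re z) (Re w) M
      (Num.min (Re w) (Re z)) (Num.max (Re w) (Re z)).
    apply; rewrite ?ge_min ?le_max ?lexx ?orbT //.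
      by move=> x hx; have [[p _] _ _] := he (x +i* Im w) h2 (inn _ _ _ h1 hx).
    by move=> x hx; have [] := he (x +i* Im w) h2 (inn _ _ _ h1 hx).
  rewrite [f z](_ : _ = vslice f z (Im z)); last by rewrite /vslice -cplxE.
  have := @derivesC_le_distW R (vslice f z) (fun y => fy (Re z +i* y)) (Im z) (Im w) M
      (Num.min (Im w) (Im z)) (Num.max (Im w) (Im z)).
  have zz : `|Re z - Re z| < e by rewrite subrr normr0.
  apply; rewrite ?ge_min ?le_max ?lexx ?orbT //.
    by move=> y hy; have [[_ p] _ _] := he (Re z +i* y) (inn _ _ _ h2 hy) zz.
  by move=> y hy; have [] := he (Re z +i* y) (inn _ _ _ h2 hy) zz.
have gl : (fun w => 2 * M * `|Re w - Re z| + 2 * M * `|Im w - Im z|) @ nbhs (z : C^o) --> (0 : R).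
  have aux (p : C -> R) (K : R) : p @ nbhs (z : C^o) --> p z -> (fun w => K * `|p w - p z|) @ nbhs (z : C^o) --> (0 : R).
    move=> pc; rewrite -[0 in X in _ --> X](mulr0 K) -(normr0 R) -(subrr (p z)).
    by apply: cvgM; [exact: cvg_cst | apply: cvg_norm; apply: cvgB => //; exact: cvg_cst].
  rewrite -[0 in X in _ --> X](addr0 (0 : R)); apply: cvgD; apply: aux; [exact: cts_Re | exact: cts_Im].
apply: (@squeeze_cvgc R _ (nbhs (z : C^o)) (@nbhs_pfilter _ (z : C^o)) f (f z) _ _ gl); near=> w; apply: slab; near: w.
  by have := @cts_Re z; move/cvgrPdist_lt => /(_ e e0); apply: filterS => w; rewrite distrC.
by have := @cts_Im z; move/cvgrPdist_lt => /(_ e e0); apply: filterS => w; rewrite distrC.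
Unshelve. all: by end_near. Qed.

Lemma partials_cts f fx fy z : C1on f fx fy -> uhp z -> cts f z.
Proof.
move=> H zu.
have [_ c1 c2] := H z zu.
have y0 : 0 < Im z := zu.
pose M := normc (fx z) + normc (fy z) + 1.
have n1 : \forall w \near (z : C^o), normc (fx w) <= M.
  apply: (cvgr_le _ (cvgc_norm c1)); rewrite /M; have := normc_ge0 (fy z); lra.
have n2 : \forall w \near (z : C^o), normc (fy w) <= M.
  apply: (cvgr_le _ (cvgc_norm c2)); rewrite /M; have := normc_ge0 (fx z); lra.
have : \forall w \near (z : C^o), [/\ 0 < Im w, normc (fx w) <= M & normc (fy w) <= M].
  by apply: filterS3 (near_in_uhp zu) n1 n2 => w.
move=> [e]; rewrite /= ltcE /= => /andP[/eqP ei er] he.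
apply: (@lipschitz_cts f fx fy z (Re e / 2) M); first by rewrite divr_gt0.
move=> w h2 h1; have [] := he w; last by move=> wu a b; split => //; case: (H w wu).
rewrite /= normrcE ltcE /= ei eqxx /=.
apply: le_lt_trans (normc_le_ReIm _) _; rewrite ReB ImB distrC [`|Im _ - _|]distrC.
by rewrite [ltRHS]splitr ltrD.
Qed.

Lemma C1onD f g fx fy gx gy : C1on f fx fy -> C1on g gx gy ->
  C1on (fun w => f w + g w) (fun w => fx w + gx w) (fun w => fy w + gy w).
Proof.
move=> H K z zu; have [[p1 p2] c1 c2] := H z zu; have [[q1 q2] d1 d2] := K z zu.
by split; [split; exact: derivesCD|exact: ctsD|exact: ctsD].
Qed.

Lemma C1onZ (a : C) f fx fy : C1on f fx fy ->
  C1on (fun w => a * f w) (fun w => a * fx w) (fun w => a * fy w).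
Proof.
move=> H z zu; have [[p1 p2] c1 c2] := H z zu.
by split; [split; exact: derivesCZ|apply: ctsM => //; exact: cts_cst|apply: ctsM => //; exact: cts_cst].
Qed.

Lemma C1onM f g fx fy gx gy : C1on f fx fy -> C1on g gx gy ->
  C1on (fun w => f w * g w) (fun w => fx w * g w + f w * gx w) (fun w => fy w * g w + f w * gy w).
Proof.
move=> H K z zu; have [[p1 p2] c1 c2] := H z zu; have [[q1 q2] d1 d2] := K z zu.
have cf := partials_cts H zu; have cg := partials_cts K zu.
split; [split|by apply: ctsD; exact: ctsM|by apply: ctsD; exact: ctsM].
  by apply: derivesC_eq (derivesCM p1 q1); rewrite /hslice -cplxE.
by apply: derivesC_eq (derivesCM p2 q2); rewrite /vslice -cplxE.
Qed.

Lemma C1on_invIm : C1on (fun z => (Im z)^-1%:C) (fun=> 0) (fun z => - ((Im z)^-1%:C) ^+ 2).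
Proof.
move=> z zu; have z0 : Im z != 0 by rewrite gt_eqF.
have c1 : cts (fun z => (Im z)^-1%:C) z by apply: cvgc_real; apply: cvgV => //; exact: cts_Im.
split; first split.
- by rewrite /hslice /=; exact: derivesC_cst.
- rewrite /vslice /=; have h := derivesCV_aux (derivesC_id (Im z)).
  have nz : \forall x \near Im z, x%:C != 0 :> C.
    by have := near_gt zu; apply: filterS => x x0; rewrite rc_eq0 gt_eqF.
  apply: derivesC_eq (derivesC_ext _ (h nz)); last by move=> x; rewrite rcV.
  by rewrite rcV exprVn mulN1r.
- exact: cts_cst.
- apply: cvgcN; rewrite expr2; under eq_fun do rewrite expr2.
  by apply: cvgcM.
Qed.

End PartialDerivatives.

(** * Whittaker series *)

Section Expansions.
Context {R : realType}.
Local Notation C := R[i].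
Variables (k : nat) (hk : (1 <= k <= 11)%N) (r : R) (r0 : r != 0).

Local Notation nu := (@freq R k).

Lemma pi_gt0' : 0 < (pi : R). Proof. exact: pi_gt0. Qed.

Lemma freq_pos (n : nat) : n%:R + 12^-1 <= nu n%:Z.
Proof.
have /andP[k1 _] := hk; rewrite /freq /= -pmulrn lerD2l ler_pdivlMr // mulVf //.
by rewrite ler1n.
Qed.

Lemma freq_neg (n : nat) : nu (- n.+1%:Z) <= - (n%:R + 12^-1).
Proof.
have /andP[_ k1] := hk; rewrite /freq mulrNz -pmulrn -(natr1 n).
have : (k%:R : R) <= 11 by rewrite ler_nat.
move: (k%:R) (n%:R) => a b; lra.
Qed.

Lemma freq_abs (n : nat) : n%:R + 12^-1 <= `|nu n%:Z| /\ n%:R + 12^-1 <= `|nu (- n.+1%:Z)|.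
Proof.
have n0 : 0 <= (n%:R : R) by [].
split.
  by rewrite ger0_norm ?freq_pos //; have := freq_pos n; lra.
by rewrite ler0_norm; have := freq_neg n; lra.
Qed.

Lemma freq_ge (n : int) : 12^-1 <= `|nu n|.
Proof.
have aux (m : nat) : 12^-1 <= m%:R + 12^-1 :> R by rewrite lerDr.
case: n => n; first by have [h _] := freq_abs n; apply: le_trans h.
by rewrite NegzE; have [_ h] := freq_abs n; apply: le_trans h.
Qed.

Lemma freq_neq0 (n : int) : nu n != 0.
Proof. by rewrite -normr_gt0 (lt_le_trans _ (freq_ge n)) // invr_gt0. Qed.

Lemma freq_norm_gt0 n : 0 < `|nu n|. Proof. by rewrite normr_gt0 freq_neq0. Qed.

Fact wterm_key : unit. Proof. exact: tt. Qed.

Definition wparam (w : int) (n : int) : R := w%:~R / 2 * Num.sg (nu n).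

(** The weight [w] is independent of [k], which fixes the frequencies, because raising operators
    change the weight alone. *)
Definition wterm (w : int) (n : int) (z : C) : C := locked_with wterm_key (
  (Num.sqrt `|nu n|)^-1%:C * wW (wparam w n) r (4 * pi * `|nu n| * Im z)
  * e2pi ((nu n * Re z)%:C)).

Lemma wtermE w n z : wterm w n z = (Num.sqrt `|nu n|)^-1%:C * wW (wparam w n) r (4 * pi * `|nu n| * Im z)
  * e2pi ((nu n * Re z)%:C).
Proof. by rewrite /wterm locked_withE. Qed.

Lemma whittaker_termE n z : whittaker_term n k r z = wterm k%:Z n z.
Proof. by rewrite wtermE /whittaker_term whittakerWE. Qed.

(** The factor by which the raising operator of weight w multiplies the n-th coefficient, taken from
    [derivesC_wW_up] at positive and [derivesC_wW_down] at negative frequencies. *)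
Definition raisec (w n : int) : R := if 0 < nu n then - 1 else ((w%:~R + 1) / 2) ^+ 2 + r ^+ 2.

Definition dxcoef (n : int) : C := 2 * pi%:C * 'i * (nu n)%:C.

Lemma derivesC_wterm_x w n z : derivesC (hslice (wterm w n) z) (Re z) (dxcoef n * wterm w n z).
Proof.
have d1 : derivesC (fun x : R => 2 * pi%:C * 'i * (nu n * x)%:C) (Re z) (dxcoef n).
  have E x : dxcoef n * x%:C = 2 * pi%:C * 'i * (nu n * x)%:C by rewrite /dxcoef rcM mulrA.
  by apply: derivesC_ext E _; apply: derivesC_eq (derivesCZ _ (derivesC_id _)); rewrite mulr1.
have d2 := derivesCZ ((Num.sqrt `|nu n|)^-1%:C * wW (wparam w n) r (4 * pi * `|nu n| * Im z)) (derivesC_cexp d1).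
apply: derivesC_eq (derivesC_ext _ d2); last by move=> x; rewrite /hslice wtermE.
rewrite wtermE /e2pi; move: (wW _ _ _) (cexp _) (_^-1%:C) => a b c; ring.
Qed.

Lemma tz_gt0 n (y : R) : 0 < y -> 0 < 4 * pi * `|nu n| * y.
Proof. by move=> y0; rewrite !mulr_gt0 ?freq_norm_gt0 ?pi_gt0. Qed.

Lemma is_derive_lin (a y : R) : is_derive y 1 (fun y => a * y) a.
Proof.
have h1 : is_derive y 1 (fun x : R => x) (1 : R) by exact: is_derive_id.
have h2 : is_derive y 1 (fun _ : R => a) (0 : R) by exact: is_derive_cst.
by apply: is_derive_eq (is_deriveMr h2 h1) _; rewrite mul0r add0r mulr1.
Qed.

Lemma vslice_wW (n : int) (u : R -> C) (E z d : C) : uhp z ->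
  derivesC u (4 * pi * `|nu n| * Im z) d ->
  derivesC (fun y => (Num.sqrt `|nu n|)^-1%:C * u (4 * pi * `|nu n| * y) * E) (Im z)
    ((Num.sqrt `|nu n|)^-1%:C * ((4 * pi * `|nu n|)%:C * d) * E).
Proof.
move=> zu hd; apply: derivesCZr; apply: derivesCZ.
exact: (derivesC_comp hd (is_derive_lin _ _)).
Qed.

(** The parameter of W is w/2 times the sign of the frequency, so passing from w to w + 2 raises it
    at positive and lowers it at negative frequencies; [raisec] gives both cases one formula. *)
Lemma derivesC_wterm_y w n z : uhp z ->
  derivesC (vslice (wterm w n) z) (Im z)
   ((2 * pi * nu n)%:C * wterm w n z +
    (Im z)^-1%:C * ((- (w%:~R / 2))%:C * wterm w n z + (raisec w n)%:C * wterm (w + 2) n z)).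
Proof.
move=> zu; have t0 := tz_gt0 n zu.
have [a Ea] : exists a, a = 4 * pi * `|nu n| by eexists.
rewrite -Ea in t0.
have yn : (Im z)%:C != 0 :> C by rewrite rc_eq0 gt_eqF.
have an : a%:C != 0 :> C by rewrite rc_eq0 gt_eqF // Ea !mulr_gt0 ?freq_norm_gt0 ?pi_gt0.
have E y : vslice (wterm w n) z y = (Num.sqrt `|nu n|)^-1%:C * wW (wparam w n) r (a * y) * e2pi ((nu n * Re z)%:C).
  by rewrite /vslice wtermE Ea.
apply: derivesC_ext (fun y => esym (E y)) _.
rewrite !wtermE -Ea.
have n0 := freq_neq0 n.
have [np|nn] := ltP 0 (nu n).
  have d := derivesC_wW_up (wparam w n) r0 t0; rewrite Ea in d.
  have d' := vslice_wW (e2pi (nu n * Re z)%:C) zu d; rewrite -Ea in d'; apply: derivesC_eq d' => {d}.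
  have e1 : wparam (w + 2) n = wparam w n + 1 by rewrite /wparam gtr0_sg // rmorphD /= mulrDl divff ?pnatr_eq0 // !mulr1.
  rewrite e1 /raisec np; have -> : wparam w n = w%:~R / 2 by rewrite /wparam gtr0_sg // mulr1.
  have -> : (2 * pi * nu n)%:C = a%:C / 2 :> C.
    by rewrite -rc_nat -rcV -rcM Ea gtr0_norm //; congr (_%:C); field.
  move: (wW _ _ _) (wW _ _ _) (e2pi _) (_^-1%:C) => A B X Y.
  rewrite rcB !rcM !rcV rcN rcM rcV rcN !rc_nat.
  have t2 : (2 : C) != 0 by rewrite pnatr_eq0.
  move: yn an; move: (Im z)%:C a%:C (w%:~R)%:C => y b u y0 b0.
  by field; rewrite y0 b0.
have {}nn : nu n < 0 by rewrite lt_neqAle n0.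
have d := derivesC_wW_down (wparam w n) r0 t0; rewrite Ea in d.
have d' := vslice_wW (e2pi (nu n * Re z)%:C) zu d; rewrite -Ea in d'; apply: derivesC_eq d' => {d}.
have e1 : wparam (w + 2) n = wparam w n - 1.
  by rewrite /wparam ltr0_sg // rmorphD /= mulrDl divff ?pnatr_eq0 // mulrN1 mulrN1 opprD.
have e2 : wparam w n = - (w%:~R / 2) by rewrite /wparam ltr0_sg // mulrN1.
rewrite e1 /raisec ltNge (ltW nn) /= e2.
have -> : (- (w%:~R / 2) - 2^-1) ^+ 2 = ((w%:~R + 1) / 2) ^+ 2 :> R by field.
have -> : (2 * pi * nu n)%:C = - (a%:C / 2) :> C.
  by rewrite -rc_nat -rcV -rcM -rcN Ea ltr0_norm //; congr (_%:C); field.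
move: (wW _ _ _) (wW _ _ _) (e2pi _) (_^-1%:C) ((_ + r ^+ 2)%:C) => A B X Y K.
rewrite rcB !rcM !rcV rcN rcM rcV !rc_nat.
have t2 : (2 : C) != 0 by rewrite pnatr_eq0.
move: yn an; move: (Im z)%:C a%:C (w%:~R)%:C => y b u y0 b0.
by field; rewrite y0 b0.
Qed.

Definition wterm_yy (w n : int) (z : C) : C :=
  (4 * pi ^+ 2 * nu n ^+ 2 - 2 * pi * w%:~R * nu n / Im z - (4^-1 + r ^+ 2) / Im z ^+ 2)%:C * wterm w n z.

(** A second form of the y-derivative, whose own derivative is given by Whittaker's equation;
    [wterm_yE] identifies it with the form in which the weights w and w + 2 appear. *)
Definition wterm_y (w n : int) (z : C) : C :=
  (Num.sqrt `|nu n|)^-1%:C * ((4 * pi * `|nu n|)%:C * dwW r (wparam w n) (4 * pi * `|nu n| * Im z)) *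
  e2pi ((nu n * Re z)%:C).

Lemma derivesC_wterm_y' w n z : uhp z -> derivesC (vslice (wterm w n) z) (Im z) (wterm_y w n z).
Proof.
move=> zu; have t0 := tz_gt0 n zu.
have [d _] := wW_sol r0 (wparam w n) t0.
apply: derivesC_ext (vslice_wW (e2pi (nu n * Re z)%:C) zu d) => y.
by rewrite /vslice wtermE.
Qed.

Lemma wterm_yE w n z : uhp z -> wterm_y w n z = (2 * pi * nu n)%:C * wterm w n z +
    (Im z)^-1%:C * ((- (w%:~R / 2))%:C * wterm w n z + (raisec w n)%:C * wterm (w + 2) n z).
Proof. by move=> zu; exact: derivesC_unique (derivesC_wterm_y' w n zu) (derivesC_wterm_y w n zu). Qed.

Lemma derivesC_wterm_yy w n z : uhp z -> derivesC (vslice (wterm_y w n) z) (Im z) (wterm_yy w n z).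
Proof.
move=> zu; have t0 := tz_gt0 n zu.
have [_ d] := wW_sol r0 (wparam w n) t0.
have d2 := vslice_wW (e2pi ((nu n * Re z)%:C)) zu (derivesCZ (4 * pi * `|nu n|)%:C d).
apply: derivesC_eq d2.
rewrite /wterm_yy wtermE /whit_pot; set a := 4 * pi * `|nu n|.
have y0 : Im z != 0 by rewrite gt_eqF.
have a0 : a != 0 by rewrite gt_eqF // /a !mulr_gt0 ?freq_norm_gt0 ?pi_gt0.
have -> : 4 * pi ^+ 2 * nu n ^+ 2 - 2 * pi * w%:~R * nu n / Im z - (4^-1 + r ^+ 2) / Im z ^+ 2 =
   a * (a * (4^-1 - wparam w n / (a * Im z) - (4^-1 + r ^+ 2) / (a * Im z) ^+ 2)).
  have -> : 4 * pi ^+ 2 * nu n ^+ 2 = a ^+ 2 / 4.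
    by rewrite /a -[nu n ^+ 2]real_normK ?num_real //; field.
  have -> : 2 * pi * w%:~R * nu n = a * wparam w n.
    by rewrite /a /wparam [nu n in LHS]numEsg; field.
  by field; rewrite y0 a0.
rewrite !rcM; move: (wW _ _ _) (e2pi _) (_^-1%:C) => A X Y; ring.
Qed.

(** Beyond some point the asymptotics apply, and on the compact interval before it W is bounded by
    continuity. *)
Lemma wW_bound (l t1 : R) : 0 < t1 ->
  exists2 A : R, 0 <= A & forall t, t1 <= t -> normc (wW l r t) <= A * expR (- (9 / 20) * t).
Proof.
move=> t10; have [A0 A00 [t0 [_ hA]]] := wW_upper l r0.
pose t2 := Num.max t0 t1 + 1.
have t12 : t1 <= t2 by apply: le_trans (_ : Num.max t0 t1 <= _); rewrite ?le_max ?lexx ?orbT // lerDl.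
have cont : {within `[t1, t2], continuous (fun t => normc (wW l r t))}.
  apply: continuous_in_subspaceT => t; rewrite inE /= in_itv /= => /andP[h _].
  have tp : 0 < t := lt_le_trans t10 h.
  have [d _] := wW_sol r0 l tp.
  exact: cvgc_norm (derivesC_cvg d).
have [c _ hc] := EVT_max t12 cont.
pose B := normc (wW l r c) * expR (9 / 20 * t2).
have B0 : 0 <= B by rewrite mulr_ge0 ?normc_ge0 ?expR_ge0.
exists (A0 + B); first by rewrite addr_ge0 // ltW.
move=> t h; have [nfreq|nfreq] := leP t t2.
  apply: le_trans (hc t _) _; first by rewrite in_itv /= h nfreq.
  rewrite mulrDl; apply: le_trans (_ : B * expR (- (9 / 20) * t) <= _); last first.
    by rewrite lerDr mulr_ge0 ?expR_ge0 // ltW.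
  have e1 : 1 <= expR (9 / 20 * t2 + - (9 / 20) * t) by apply: le_trans (expR_ge1Dx _); rewrite mulNr -mulrBr lerDl mulr_ge0 // subr_ge0.
  by rewrite /B -[leRHS]mulrA -expRD ler_peMr ?normc_ge0.
rewrite mulrDl; apply: le_trans (_ : A0 * expR (- (9 / 20) * t) <= _); last first.
  by rewrite lerDl mulr_ge0 ?expR_ge0.
apply: hA; apply: lt_trans nfreq; apply: le_lt_trans (_ : Num.max t0 t1 < _); last by rewrite ltrDl.
by rewrite le_max lexx.
Qed.

Lemma wparam_cases w n : wparam w n = w%:~R / 2 \/ wparam w n = - (w%:~R / 2).
Proof.
rewrite /wparam; have [h|h|/eqP h] := ltrgtP (nu n) 0.
- by right; rewrite ltr0_sg // mulrN1.
- by left; rewrite gtr0_sg // mulr1.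
- by move: h; rewrite (negbTE (freq_neq0 n)).
Qed.

Lemma sqrt_freq_inv n : 0 <= (Num.sqrt `|nu n|)^-1 <= 4.
Proof.
rewrite invr_ge0 sqrtr_ge0 /= -[4]invrK lef_pV2 ?posrE ?invr_gt0 ?sqrtr_gt0 ?freq_norm_gt0 //.
rewrite -[4^-1]ger0_norm ?invr_ge0 // -sqrtr_sqr ler_sqrt ?(ltW (freq_norm_gt0 _)) //.
apply: le_trans (freq_ge n); lra.
Qed.

Lemma wterm_bound w (y1 : R) : 0 < y1 -> exists2 A : R, 0 <= A &
  forall n z, y1 <= Im z -> normc (wterm w n z) <= A * expR (- (9 / 5 * pi) * (`|nu n| * Im z)).
Proof.
move=> y10; have p0 := pi_gt0'.
(* Every frequency has modulus at least 1/12, since 1 <= k <= 11; so the arguments of W stay away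
   from 0. *)
have t10 : 0 < 4 * pi * (12^-1 * y1) by rewrite !mulr_gt0 // invr_gt0.
have [A A0 hA] := wW_bound (w%:~R / 2) t10; have [B B0 hB] := wW_bound (- (w%:~R / 2)) t10.
exists (4 * (A + B)); first by rewrite mulr_ge0 // addr_ge0.
move=> n z yz; rewrite wtermE.
have tge : 4 * pi * (12^-1 * y1) <= 4 * pi * `|nu n| * Im z.
  rewrite -[leRHS]mulrA ler_wpM2l ?mulr_ge0 ?(ltW p0) //.
  by apply: ler_pM; rewrite ?invr_ge0 ?(ltW y10) ?freq_ge.
have E : - (9 / 5 * pi) * (`|nu n| * Im z) = - (9 / 20) * (4 * pi * `|nu n| * Im z) by field.
have W : normc (wW (wparam w n) r (4 * pi * `|nu n| * Im z)) <= (A + B) * expR (- (9 / 5 * pi) * (`|nu n| * Im z)).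
  rewrite E [(A + B) * _]mulrDl; case: (wparam_cases w n) => ->.
    by apply: le_trans (hA _ tge) _; rewrite lerDl mulr_ge0 ?expR_ge0.
  by apply: le_trans (hB _ tge) _; rewrite lerDr mulr_ge0 ?expR_ge0.
rewrite normcM normc_e2pi_real mulr1 normcM normcRE -[leRHS]mulrA.
have /andP[s0 s4] := sqrt_freq_inv n.
by rewrite ger0_norm //; apply: ler_pM => //; exact: normc_ge0.
Qed.

Definition subexp (c : int -> C) : Prop :=
  forall e : R, 0 < e -> exists A : R, forall n, normc (c n) <= A * expR (e * `|nu n|).

Lemma subexp_ge0 c (A e : R) : (forall n, normc (c n) <= A * expR (e * `|nu n|)) -> 0 <= A.
Proof.
move=> /(_ 0); move=> h; have := le_trans (normc_ge0 _) h.
by rewrite pmulr_lge0 ?expR_gt0.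
Qed.

Lemma subexpM (b : int -> C) c : subexp b -> subexp c -> subexp (fun n => b n * c n).
Proof.
move=> hb hc e e0; have e2 : 0 < e / 2 by rewrite divr_gt0.
have [A hA] := hb _ e2; have [B hB] := hc _ e2.
exists (A * B) => n; rewrite normcM [in leRHS](splitr e) [(_ + _) * `|_|]mulrDl expRD mulrACA.
by apply: ler_pM; rewrite ?normc_ge0.
Qed.

Lemma subexpD b c : subexp b -> subexp c -> subexp (fun n => b n + c n).
Proof.
move=> hb hc e e0; have [A hA] := hb _ e0; have [B hB] := hc _ e0.
by exists (A + B) => n; apply: le_trans (le_normcD _ _) _; rewrite mulrDl lerD.
Qed.

Lemma subexp_bounded (b : int -> C) (M : R) : (forall n, normc (b n) <= M) -> subexp b.
Proof.
move=> hb e e0; exists M => n; apply: le_trans (hb n) _.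
rewrite ler_peMr //; first exact: le_trans (normc_ge0 _) (hb n).
by rewrite -expR0 ler_expR mulr_ge0 // ltW.
Qed.

Lemma subexpZ a c : subexp c -> subexp (fun n => a * c n).
Proof. by move=> hc; apply: subexpM => //; apply: (@subexp_bounded _ (normc a)). Qed.

Lemma subexp_freq : subexp (fun n => (nu n)%:C).
Proof.
move=> e e0; exists e^-1 => n; rewrite normcRE.
rewrite mulrC ler_pdivlMr //; have := expR_ge1Dx (e * `|nu n|); rewrite mulrC; lra.
Qed.

Lemma subexp_raisec w : subexp (fun n => (raisec w n)%:C).
Proof.
apply: (@subexp_bounded _ (1 + `|((w%:~R + 1) / 2) ^+ 2 + r ^+ 2|)) => n.
rewrite normcRE /raisec; case: ifP => _; first by rewrite normrN1 lerDl.
by rewrite lerDr.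
Qed.

Lemma subexp_dxcoef c : subexp c -> subexp (fun n => dxcoef n * c n).
Proof.
move=> hc; apply: subexpM => //; rewrite /dxcoef; apply: subexpZ; exact: subexp_freq.
Qed.

Lemma expR_q_bound (a : R) (n : nat) : 0 <= a -> expR (- a * `|nu n%:Z|) <= expR (- a) ^+ n /\
  expR (- a * `|nu (- n.+1%:Z)|) <= expR (- a) ^+ n.
Proof.
move=> a0; have [h1 h2] := freq_abs n; have t : 0 < (12^-1 : R) by rewrite invr_gt0.
split; rewrite -expRM_natl ler_expR mulNr mulrN lerN2 mulrC ler_wpM2l //; lra.
Qed.

Lemma subexp_geodom w c (y1 : R) : subexp c -> 0 < y1 ->
  exists B q : R, 0 <= q < 1 /\ forall z, y1 <= Im z -> geodom (fun n => c n * wterm w n z) B q.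
Proof.
move=> hc y10; have p0 := pi_gt0'; have [A A0 hA] := wterm_bound w y10.
(* Of the decay rate 9/5 pi y1 of the terms, 4/5 pi y1 pays for the coefficients and pi y1 is left
   for the geometric ratio. *)
have e0 : 0 < 4 / 5 * pi * y1 by rewrite !mulr_gt0 // ?invr_gt0.
have [D hD] := hc _ e0; have D0 := subexp_ge0 hD.
pose q := expR (- (pi * y1)).
exists (D * A), q; split.
  by rewrite expR_ge0 /= expR_lt1 oppr_lt0 mulr_gt0.
move=> z yz.
have bnd n : normc (c n * wterm w n z) <= D * A * expR (- (pi * y1) * `|nu n|).
  rewrite normcM; apply: le_trans (_ : (D * expR (4 / 5 * pi * y1 * `|nu n|)) * (A * expR (- (9 / 5 * pi) * (`|nu n| * Im z))) <= _).
    by apply: ler_pM; rewrite ?normc_ge0 //; exact: hA.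
  rewrite mulrACA -expRD ler_wpM2l ?mulr_ge0 // ler_expR.
  have : `|nu n| * y1 <= `|nu n| * Im z by rewrite ler_wpM2l.
  have -> : 4 / 5 * pi * y1 * `|nu n| + - (9 / 5 * pi) * (`|nu n| * Im z) =
     4 / 5 * pi * (`|nu n| * y1) + - (9 / 5 * pi) * (`|nu n| * Im z) by ring.
  have -> : - (pi * y1) * `|nu n| = - pi * (`|nu n| * y1) by ring.
  move: (`|nu n| * y1) (`|nu n| * Im z) => a b ab.
  have : pi * a <= pi * b by rewrite ler_wpM2l // ltW.
  lra.
move=> n; have a0 : 0 <= pi * y1 by rewrite mulr_ge0 // ltW.
have [h1 h2] := expR_q_bound n a0.
by split; apply: le_trans (bnd _) _; rewrite ler_wpM2l ?mulr_ge0.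
Qed.

Definition wser (w : int) (c : int -> C) (z : C) : C := sumZ (fun n => c n * wterm w n z).

Lemma wser_has w c z : subexp c -> uhp z -> has_sumZ (fun n => c n * wterm w n z) (wser w c z).
Proof.
move=> hc zu; have [B [q [q01 h]]] := subexp_geodom w hc zu.
exact: (sumZ_has q01 (h z (lexx _))).
Qed.

Lemma wserD w b c z : subexp b -> subexp c -> uhp z ->
  wser w (fun n => b n + c n) z = wser w b z + wser w c z.
Proof.
move=> hb hc zu.
have [a [d [/cvgcP h1 /cvgcP h2 e1]]] := wser_has w hb zu.
have [a' [d' [/cvgcP h1' /cvgcP h2' e2]]] := wser_has w hc zu.
apply: has_sumZ_unique (wser_has w (subexpD hb hc) zu) _.
exists (a + a'), (d + d'); split; last by rewrite e1 e2; ring.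
  apply/cvgcP; apply: near_eq_cvgc (cvgcD h1 h1'); apply: nearW => n.
  by rewrite /series /= -big_split; apply: eq_bigr => i _; rewrite mulrDl.
apply/cvgcP; apply: near_eq_cvgc (cvgcD h2 h2'); apply: nearW => n.
by rewrite /series /= -big_split; apply: eq_bigr => i _; rewrite mulrDl.
Qed.

Lemma wserZ w a c z : subexp c -> uhp z -> wser w (fun n => a * c n) z = a * wser w c z.
Proof.
move=> hc zu; have [B [q [q01 h]]] := subexp_geodom w hc zu.
rewrite /wser -(sumZZ q01 a (h z (lexx _))); apply: eq_sumZ => n; by rewrite mulrA.
Qed.

Lemma eq_wser w b c z : (forall n, b n = c n) -> wser w b z = wser w c z.
Proof. by move=> e; apply: eq_sumZ => n; rewrite e. Qed.

Lemma wser_bounded w c (y1 : R) : subexp c -> 0 < y1 ->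
  exists2 M : R, 0 <= M & forall z, y1 <= Im z -> normc (wser w c z) <= M.
Proof.
move=> hc y10; have [B [q [q01 h]]] := subexp_geodom w hc y10.
exists (2 * B / (1 - q)) => [|z yz]; last by apply: sumZ_le; [exact: q01 | exact: h].
apply: le_trans (normc_ge0 (wser w c (0 +i* y1))) _; apply: sumZ_le; [exact: q01 | exact: h].
Qed.

Definition wser_y (w : int) (c : int -> C) (z : C) : C :=
  wser w (fun n => (2 * pi * nu n)%:C * c n) z +
  (Im z)^-1%:C * ((- (w%:~R / 2))%:C * wser w c z + wser (w + 2) (fun n => (raisec w n)%:C * c n) z).

Lemma subexp_2pinu c : subexp c -> subexp (fun n => (2 * pi * nu n)%:C * c n).
Proof.
move=> hc; apply: subexpM => // e e0; have [A hA] := (subexpZ (2 * pi)%:C subexp_freq) e e0.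
by exists A => n; rewrite rcM; exact: hA.
Qed.

Lemma wser_y_sumZ w c z : subexp c -> uhp z -> wser_y w c z = sumZ (fun n => c n * wterm_y w n z).
Proof.
move=> hc zu; rewrite /wser_y.
have h1 := subexp_2pinu hc; have h2 := subexpM (subexp_raisec w) hc.
have [B1 [q1 [q1P g1]]] := subexp_geodom w h1 zu.
have [B2 [q2 [q2P g2]]] := subexp_geodom w hc zu.
have [B3 [q3 [q3P g3]]] := subexp_geodom (w + 2) h2 zu.
have mono (u : int -> C) B q q' : 0 <= q <= q' -> geodom u B q -> geodom u B q'.
  move=> /andP[q0 qq] hu n; have [a b] := hu n.
  have B0 : 0 <= B by have [+ _] := hu 0%N; rewrite expr0 mulr1; apply: le_trans; exact: normc_ge0.
  by split; [apply: le_trans a _|apply: le_trans b _]; rewrite ler_wpM2l // lerXn2r // nnegrE // (le_trans q0).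
pose q := Num.max q1 (Num.max q2 q3).
have /andP[q10 q11] := q1P; have /andP[q20 q21] := q2P; have /andP[q30 q31] := q3P.
have qP : 0 <= q < 1 by rewrite le_max q10 /= !gt_max q11 q21.
have G1 := mono _ _ _ q _ (g1 z (lexx _)); have G2 := mono _ _ _ q _ (g2 z (lexx _)).
have G3 := mono _ _ _ q _ (g3 z (lexx _)).
have {}G1 := G1 (_ : 0 <= q1 <= q); have {}G2 := G2 (_ : 0 <= q2 <= q); have {}G3 := G3 (_ : 0 <= q3 <= q).
have {}G1 : geodom (fun n => (2 * pi * nu n)%:C * c n * wterm w n z) B1 q by apply: G1; rewrite q10 le_max lexx.
have {}G2 : geodom (fun n => c n * wterm w n z) B2 q by apply: G2; rewrite q20 !le_max lexx orbT.
have {}G3 : geodom (fun n => (raisec w n)%:C * c n * wterm (w + 2) n z) B3 q by apply: G3; rewrite q30 !le_max lexx !orbT.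
have G4 := geodomZ (- (w%:~R / 2))%:C G2; have G5 := geodomD G4 G3; have G6 := geodomZ (Im z)^-1%:C G5.
rewrite /wser -(sumZZ qP (- (w%:~R / 2))%:C G2) -(sumZD qP G4 G3) -(sumZZ qP (Im z)^-1%:C G5) -(sumZD qP G1 G6).
by apply: eq_sumZ => n; rewrite (wterm_yE w n zu); ring.
Qed.

Lemma wser_y_geodom w c (y1 : R) : subexp c -> 0 < y1 ->
  exists B q : R, 0 <= q < 1 /\ forall z, y1 <= Im z -> geodom (fun n => c n * wterm_y w n z) B q.
Proof.
move=> hc y10.
have h1 := subexp_2pinu hc; have h2 := subexpM (subexp_raisec w) hc.
have [B1 [q1 [q1P g1]]] := subexp_geodom w h1 y10.
have [B2 [q2 [q2P g2]]] := subexp_geodom w hc y10.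
have [B3 [q3 [q3P g3]]] := subexp_geodom (w + 2) h2 y10.
have /andP[q10 q11] := q1P; have /andP[q20 q21] := q2P; have /andP[q30 q31] := q3P.
pose q := Num.max q1 (Num.max q2 q3).
have qP : 0 <= q < 1 by rewrite le_max q10 /= !gt_max q11 q21.
exists (B1 + y1^-1 * (`|w%:~R / 2| * B2 + B3)), q; split => // z yz.
have zu : uhp z := lt_le_trans y10 yz.
have yV : 0 <= (Im z)^-1 <= y1^-1 by rewrite invr_ge0 (ltW zu) lef_pV2 ?posrE.
have Bge0 (u : int -> C) B q' : geodom u B q' -> 0 <= B.
  by move=> hu; have [+ _] := hu 0%N; rewrite expr0 mulr1; apply: le_trans; exact: normc_ge0.
have B10 := Bge0 _ _ _ (g1 z yz); have B20 := Bge0 _ _ _ (g2 z yz); have B30 := Bge0 _ _ _ (g3 z yz).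
have key (j : int) (m : nat) : normc ((2 * pi * nu j)%:C * c j * wterm w j z) <= B1 * q1 ^+ m ->
   normc (c j * wterm w j z) <= B2 * q2 ^+ m -> normc ((raisec w j)%:C * c j * wterm (w + 2) j z) <= B3 * q3 ^+ m ->
   normc (c j * wterm_y w j z) <= (B1 + y1^-1 * (`|w%:~R / 2| * B2 + B3)) * q ^+ m.
  move=> k1 k2 k3.
  have k1' : normc ((2 * pi * nu j)%:C * c j * wterm w j z) <= B1 * q ^+ m.
    by apply: le_trans k1 _; rewrite ler_wpM2l // lerXn2r ?nnegrE // le_max ?q10 ?lexx.
  have k2' : normc (c j * wterm w j z) <= B2 * q ^+ m.
    by apply: le_trans k2 _; rewrite ler_wpM2l // lerXn2r ?nnegrE // !le_max ?q10 ?lexx ?orbT.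
  have k3' : normc ((raisec w j)%:C * c j * wterm (w + 2) j z) <= B3 * q ^+ m.
    by apply: le_trans k3 _; rewrite ler_wpM2l // lerXn2r ?nnegrE // !le_max ?q10 ?lexx ?orbT.
  have -> : c j * wterm_y w j z = (2 * pi * nu j)%:C * c j * wterm w j z + (Im z)^-1%:C *
     ((- (w%:~R / 2))%:C * (c j * wterm w j z) + (raisec w j)%:C * c j * wterm (w + 2) j z).
    by rewrite (wterm_yE w j zu); ring.
  apply: le_trans (le_normcD _ _) _; rewrite [leRHS]mulrDl lerD // normcM normcRE -[leRHS]mulrA.
  have /andP[yV0 yV1] := yV; rewrite ger0_norm //.
  apply: ler_pM => //; first exact: normc_ge0.
  apply: le_trans (le_normcD _ _) _; rewrite [leRHS]mulrDl lerD // normcM normcRE normrN -[leRHS]mulrA.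
  by rewrite ler_wpM2l.
move=> m; have [a1 b1] := g1 z yz m; have [a2 b2] := g2 z yz m; have [a3 b3] := g3 z yz m.
by split; apply: key.
Qed.

(** The partials exist by differentiation term by term. They are again built from Whittaker series,
    of weights w and w + 2, and each such series is continuous because its own partials are locally
    bounded. *)
Lemma wser_C1 w c : subexp c -> C1on (wser w c) (wser w (fun n => dxcoef n * c n)) (wser_y w c).
Proof.
have bnd w' c' z : subexp c' -> uhp z -> exists2 M : R, 0 <= M & forall z', Im z / 2 <= Im z' -> normc (wser w' c' z') <= M.
  by move=> hc' zu; apply: wser_bounded => //; rewrite divr_gt0.
have P c' w' : subexp c' -> forall z, uhp z -> partials (wser w' c') z (wser w' (fun n => dxcoef n * c' n) z) (wser_y w' c' z).
  move=> hc z zu; have hx := subexp_dxcoef hc; split.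
    have [B [q [q01 g]]] := subexp_geodom w' hc zu; have [B' [q' [q01' g']]] := subexp_geodom w' hx zu.
    pose q2 := Num.max q q'; pose B2 := Num.max B B'.
    have /andP[q0 q1] := q01; have /andP[q0' q1'] := q01'.
    have q2P : 0 <= q2 < 1 by rewrite le_max q0 /= gt_max q1 q1'.
    have mono (u : int -> C) BB qq : 0 <= qq -> BB <= B2 -> qq <= q2 -> geodom u BB qq -> geodom u B2 q2.
      move=> p0 p1 p2 hu n; have [a b] := hu n.
      have BB0 : 0 <= BB by have [+ _] := hu 0%N; rewrite expr0 mulr1; apply: le_trans; exact: normc_ge0.
      by split; [apply: le_trans a _|apply: le_trans b _]; apply: ler_pM; rewrite ?exprn_ge0 // lerXn2r // nnegrE // (le_trans p0).
    have := @derivesC_sumZ R q2 q2P (fun n x => c' n * wterm w' n (x +i* Im z))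
       (fun n x => dxcoef n * c' n * wterm w' n (x +i* Im z)) (Re z) 1 B2 ltr01.
    rewrite -cplxE; apply.
    - move=> n s _; have := derivesCZ (c' n) (derivesC_wterm_x w' n (s +i* Im z)); rewrite /= mulrA [c' n * _]mulrC.
      exact.
    - by move=> s _; apply: (mono _ B q) => //; rewrite ?le_max ?lexx //; exact: g.
    - by move=> s _; apply: (mono _ B' q') => //; rewrite ?le_max ?lexx ?orbT //; exact: g'.
  have y2 : 0 < Im z / 2 by rewrite divr_gt0.
  have [B [q [q01 g]]] := subexp_geodom w' hc y2; have [B' [q' [q01' g']]] := wser_y_geodom w' hc y2.
  pose q2 := Num.max q q'; pose B2 := Num.max B B'.
  have /andP[q0 q1] := q01; have /andP[q0' q1'] := q01'.
  have q2P : 0 <= q2 < 1 by rewrite le_max q0 /= gt_max q1 q1'.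
  have mono (u : int -> C) BB qq : 0 <= qq -> BB <= B2 -> qq <= q2 -> geodom u BB qq -> geodom u B2 q2.
    move=> p0 p1 p2 hu n; have [a b] := hu n.
    have BB0 : 0 <= BB by have [+ _] := hu 0%N; rewrite expr0 mulr1; apply: le_trans; exact: normc_ge0.
    by split; [apply: le_trans a _|apply: le_trans b _]; apply: ler_pM; rewrite ?exprn_ge0 // lerXn2r // nnegrE // (le_trans p0).
  have near_y s : `|s - Im z| < Im z / 2 -> Im z / 2 <= s.
    by rewrite ltr_norml => /andP[h _]; lra.
  have := @derivesC_sumZ R q2 q2P (fun n y => c' n * wterm w' n (Re z +i* y))
     (fun n y => c' n * wterm_y w' n (Re z +i* y)) (Im z) (Im z / 2) B2 y2.
  rewrite -cplxE -wser_y_sumZ //; apply.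
  - move=> n s hs; apply: derivesCZ; apply: (derivesC_wterm_y' w' n (z := Re z +i* s)).
    exact: lt_le_trans y2 (near_y s hs).
  - by move=> s hs; apply: (mono _ B q) => //; rewrite ?le_max ?lexx //; apply: g; exact: near_y.
  - by move=> s hs; apply: (mono _ B' q') => //; rewrite ?le_max ?lexx ?orbT //; apply: g'; exact: near_y.
have Sy_bnd c' w' z : subexp c' -> uhp z -> exists2 M : R, 0 <= M & forall z', Im z / 2 <= Im z' -> normc (wser_y w' c' z') <= M.
  move=> hc' zu; have y2 : 0 < Im z / 2 by rewrite divr_gt0.
  have [B [q [q01 g]]] := wser_y_geodom w' hc' y2.
  have M (z' : C) : Im z / 2 <= Im z' -> normc (wser_y w' c' z') <= 2 * B / (1 - q).
    move=> hz'; rewrite wser_y_sumZ //; last exact: lt_le_trans y2 hz'.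
    by apply: sumZ_le; [exact: q01 | exact: g].
  exists (2 * B / (1 - q)) => //; apply: le_trans (M z _); first exact: normc_ge0.
  by rewrite ler_pdivrMr // mulr_natr mulr2n lerDl ltW.
have ctsS c' w' z : subexp c' -> uhp z -> cts (wser w' c') z.
  move=> hc' zu.
  have [M M0 hM] := bnd w' _ z (subexp_dxcoef hc') zu.
  have [M' M'0 hM'] := Sy_bnd c' w' z hc' zu.
  have y2 : 0 < Im z / 2 by rewrite divr_gt0.
  apply: (@lipschitz_cts _ (wser w' c') (wser w' (fun n => dxcoef n * c' n)) (wser_y w' c') z (Im z / 2) (M + M')) => //.
    move=> w0 h1; have h2 : Im z / 2 <= Im w0 by move: h1; rewrite ltr_norml => /andP[h _]; lra.
    split; first by apply: P => //; exact: lt_le_trans y2 h2.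
      by apply: le_trans (hM _ h2) _; rewrite lerDl.
    by apply: le_trans (hM' _ h2) _; rewrite lerDr.
move=> hc z zu; split; first exact: P.
  by apply: ctsS => //; exact: subexp_dxcoef.
apply: ctsD; first by apply: ctsS => //; exact: subexp_2pinu.
apply: ctsM.
  by apply: cvgc_real; apply: cvgV; [rewrite gt_eqF | exact: cts_Im].
apply: ctsD; last by apply: ctsS => //; apply: subexpM => //; exact: subexp_raisec.
by apply: ctsM; [exact: cts_cst | exact: ctsS].
Qed.

End Expansions.

Section Summable.
Context {R : realType}.
Local Notation C := R[i].

Definition summableZ (u : int -> C) := exists B q : R, 0 <= q < 1 /\ geodom u B q.

Lemma geodom_ge0 (u : int -> C) B q : geodom u B q -> 0 <= B.
Proof. by move=> /(_ 0%N)[+ _]; rewrite expr0 mulr1; apply: le_trans; exact: normc_ge0. Qed.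

Lemma geodom_mono (u : int -> C) B q q' : 0 <= q -> q <= q' -> geodom u B q -> geodom u B q'.
Proof.
move=> q0 qq hu n; have [a b] := hu n; have B0 := geodom_ge0 hu.
by split; [apply: le_trans a _|apply: le_trans b _]; rewrite ler_wpM2l // lerXn2r // nnegrE // (le_trans q0).
Qed.

Lemma summableZ2 (u v : int -> C) : summableZ u -> summableZ v -> exists B B' q : R,
  [/\ 0 <= q < 1, geodom u B q & geodom v B' q].
Proof.
move=> [B [q [/andP[q0 q1] h]]] [B' [q' [/andP[q0' q1'] h']]].
exists B, B', (Num.max q q'); split; first by rewrite le_max q0 gt_max q1.
  by apply: geodom_mono h => //; rewrite le_max lexx.
by apply: geodom_mono h' => //; rewrite le_max lexx orbT.
Qed.

Lemma summableZD u v : summableZ u -> summableZ v -> summableZ (fun n => u n + v n).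
Proof.
by move=> hu hv; have [B [B' [q [q01 h1 h2]]]] := summableZ2 hu hv; exists (B + B'), q; split => //; exact: geodomD.
Qed.

Lemma summableZZ a u : summableZ u -> summableZ (fun n => a * u n).
Proof. by move=> [B [q [q01 h]]]; exists (normc a * B), q; split => //; exact: geodomZ. Qed.

Lemma summableZ_sumD u v : summableZ u -> summableZ v -> sumZ (fun n => u n + v n) = sumZ u + sumZ v.
Proof.
by move=> hu hv; have [B [B' [q [q01 h1 h2]]]] := summableZ2 hu hv; exact: (sumZD q01 h1 h2).
Qed.

Lemma summableZ_sumZ a u : summableZ u -> sumZ (fun n => a * u n) = a * sumZ u.
Proof. by move=> [B [q [q01 h]]]; exact: (sumZZ q01 a h). Qed.

Lemma summableZ_has u : summableZ u -> has_sumZ u (sumZ u).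
Proof. by move=> [B [q [q01 h]]]; exact: (sumZ_has q01 h). Qed.

Lemma eq_summableZ u v : (forall n, u n = v n) -> summableZ u -> summableZ v.
Proof. by move=> e [B [q [q01 h]]]; exists B, q; split => // n; rewrite -!e. Qed.

Lemma sumZ0 : sumZ (fun=> 0) = 0 :> C.
Proof.
have h : summableZ (fun=> 0 : C) by exists 0, 0; rewrite lexx ltr01; split => // n; rewrite normc0 mul0r.
have := summableZ_sumD h h; rewrite (eq_sumZ (v := fun=> 0)); last by move=> n; rewrite addr0.
by move/eqP; rewrite -subr_eq0 opprD addrA subrr sub0r oppr_eq0 => /eqP.
Qed.

End Summable.

Section Laplace.
Context {R : realType}.
Local Notation C := R[i].
Variables (k : nat) (hk : (1 <= k <= 11)%N) (r : R) (r0 : r != 0).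
Local Notation nu := (@freq R k).
Local Notation wser := (@wser R k r).
Local Notation wser_y := (@wser_y R k r).
Local Notation wterm := (@wterm R k r).
Local Notation wterm_y := (@wterm_y R k r).
Local Notation wterm_yy := (@wterm_yy R k r).
Local Notation raisec := (@raisec R k r).
Local Notation dxcoef := (@dxcoef R k).
Local Notation subexp := (@subexp R k).

Lemma summableZ_wterm w c z : subexp c -> uhp z -> summableZ (fun n => c n * wterm w n z).
Proof. by move=> hc zu; have [B [q [q01 h]]] := subexp_geodom hk r0 w hc zu; exists B, q; split => //; exact: h. Qed.

Lemma summableZ_wterm_y w c z : subexp c -> uhp z -> summableZ (fun n => c n * wterm_y w n z).
Proof. by move=> hc zu; have [B [q [q01 h]]] := wser_y_geodom hk r0 w hc zu; exists B, q; split => //; exact: h. Qed.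

Definition wser_yy (w : int) (c : int -> C) (z : C) : C :=
  wser_y w (fun n => (2 * pi * nu n)%:C * c n) z +
  (- ((Im z)^-1%:C) ^+ 2 * ((- (w%:~R / 2))%:C * wser w c z + wser (w + 2) (fun n => (raisec w n)%:C * c n) z) +
  (Im z)^-1%:C * ((- (w%:~R / 2))%:C * wser_y w c z + wser_y (w + 2) (fun n => (raisec w n)%:C * c n) z)).

Lemma subexp_raisecM w c : subexp c -> subexp (fun n => (raisec w n)%:C * c n).
Proof. by move=> hc; apply: subexpM => //; exact: subexp_raisec. Qed.

Lemma wser_y_C1 w c : subexp c -> C1on (wser_y w c) (wser_y w (fun n => dxcoef n * c n)) (wser_yy w c).
Proof.
move=> hc.
have h1 := subexp_2pinu hc; have h2 := subexp_raisecM w hc.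
have P1 := wser_C1 hk r0 w h1; have P2 := wser_C1 hk r0 w hc; have P3 := wser_C1 hk r0 (w + 2) h2.
have := C1onD P1 (C1onM (@C1on_invIm R) (C1onD (C1onZ (- (w%:~R / 2))%:C P2) P3)).
apply: C1on_eq => z zu //.
rewrite /wser_y mul0r add0r; congr (_ + _ * (_ + _)).
  by apply: eq_wser => n; rewrite mulrCA.
by apply: eq_wser => n; rewrite mulrCA.
Qed.

Lemma wterm_yyE w n z : uhp z -> wterm_yy w n z = (2 * pi * nu n)%:C * wterm_y w n z +
  (- ((Im z)^-1%:C) ^+ 2 * ((- (w%:~R / 2))%:C * wterm w n z + (raisec w n)%:C * wterm (w + 2) n z) +
  (Im z)^-1%:C * ((- (w%:~R / 2))%:C * wterm_y w n z + (raisec w n)%:C * wterm_y (w + 2) n z)).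
Proof.
move=> zu; apply: derivesC_unique (derivesC_wterm_yy hk r0 w n zu) _.
have d1 := derivesC_wterm_y' hk r0 w n zu; have d2 := derivesC_wterm_y' hk r0 (w + 2) n zu.
have [[_ d3] _ _] := @C1on_invIm R z zu.
have d4 := derivesCD (derivesCZ (2 * pi * nu n)%:C d1) (derivesCM d3 (derivesCD (derivesCZ (- (w%:~R / 2))%:C d1) (derivesCZ (raisec w n)%:C d2))).
apply: derivesC_near (derivesC_eq _ d4); last by rewrite /vslice -cplxE.
have h : \forall y \near Im z, 0 < y by apply: lt_nbhsr.
by apply: filterS h => y y0; rewrite /vslice wterm_yE.
Qed.

(** Everything is collected into one series, each term of which vanishes by Whittaker's equation. *)
Lemma wser_maass c : subexp c -> uhp_C2 (wser k%:Z c) /\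
  forall z, uhp z -> laplacian k (wser k%:Z c) z + (4^-1 + r ^+ 2)%:C * wser k%:Z c z = 0.
Proof.
move=> hc; have hx := subexp_dxcoef hc; have hxx := subexp_dxcoef hx.
have [C2 D] := uhp_C2P (wser_C1 hk r0 k%:Z hc) (wser_C1 hk r0 k%:Z hx) (wser_y_C1 k%:Z hc).
split => // z zu; have [e1 e2 e3] := D z zu; rewrite /laplacian e1 e2 e3 /wser_yy.
have h1 := subexp_2pinu hc; have h2 := subexp_raisecM k%:Z hc.
rewrite !wser_y_sumZ //; rewrite /wser.
set w := k%:Z in h1 h2 *.
have s1 := summableZ_wterm w hxx zu; have s2 := summableZ_wterm w hx zu; have s3 := summableZ_wterm w hc zu.
have s4 := summableZ_wterm_y w h1 zu; have s5 := summableZ_wterm_y w hc zu; have s6 := summableZ_wterm_y (w + 2) h2 zu.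
have s7 := summableZ_wterm (w + 2) h2 zu.
set y1 := (Im z)^-1%:C.
pose B := (- (w%:~R / 2))%:C : C.
have t1 := summableZD (summableZZ B s3) s7; have t2 := summableZD (summableZZ B s5) s6.
have t3 := summableZD (summableZZ (- y1 ^+ 2) t1) (summableZZ y1 t2).
have t4 := summableZD s4 t3; have t5 := summableZD s1 t4.
have t6 := summableZZ ((Im z)%:C ^+ 2) t5; have t7 := summableZZ (- ('i * k%:R * (Im z)%:C)) s2.
have t8 := summableZZ (4^-1 + r ^+ 2)%:C s3.
rewrite -[- ('i * _ * _ * sumZ _)]mulNr -/B.
rewrite -(summableZ_sumZ B s3) -(summableZ_sumD (summableZZ B s3) s7) -(summableZ_sumZ _ t1).
rewrite -(summableZ_sumZ B s5) -(summableZ_sumD (summableZZ B s5) s6) -(summableZ_sumZ _ t2).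
rewrite -(summableZ_sumD (summableZZ (- y1 ^+ 2) t1) (summableZZ y1 t2)) -(summableZ_sumD s4 t3) -(summableZ_sumD s1 t4).
rewrite -(summableZ_sumZ _ t5) -(summableZ_sumZ _ s2) -(summableZ_sumD t6 t7) -(summableZ_sumZ _ s3) -(summableZ_sumD (summableZD t6 t7) t8).
rewrite -[RHS]sumZ0; apply: eq_sumZ => n.
have E := wterm_yyE w n zu; rewrite -/y1 -/B in E.
have -> : (2 * pi * nu n)%:C * c n * wterm_y w n z + (- y1 ^+ 2 * (B * (c n * wterm w n z) + (raisec w n)%:C * c n * wterm (w + 2) n z) +
  y1 * (B * (c n * wterm_y w n z) + (raisec w n)%:C * c n * wterm_y (w + 2) n z)) = c n * wterm_yy w n z.
  by rewrite E; ring.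
have yn : (Im z)%:C != 0 :> C by rewrite rc_eq0 gt_eqF.
rewrite /wterm_yy /dxcoef {s1 s2 s3 s4 s5 s6 s7 t1 t2 t3 t4 t5 t6 t7 t8 E}.
move: (wterm w n z) (c n) => W c0.
have -> : (4 * pi ^+ 2 * nu n ^+ 2 - 2 * pi * w%:~R * nu n / Im z - (4^-1 + r ^+ 2) / Im z ^+ 2)%:C =
  4 * pi%:C ^+ 2 * (nu n)%:C ^+ 2 - 2 * pi%:C * k%:R * (nu n)%:C / (Im z)%:C - (4^-1 + r ^+ 2)%:C / (Im z)%:C ^+ 2 :> C.
  by rewrite /w -pmulrn !rcB !rcM !rcV !rcX !rc_nat.
have [i [ei i2]] : exists i : C, i = Num.imaginary /\ i * i = -1.
  by eexists; split; [reflexivity | rewrite -expr2 sqrCi].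
rewrite -!ei.
move: (Im z)%:C yn (nu n)%:C pi%:C (4^-1 + r ^+ 2)%:C (k%:R : C) => y yn v p la kk.
transitivity ((i * i + 1) * (4 * y ^+ 2 * p ^+ 2 * v ^+ 2 - 2 * kk * y * p * v) * c0 * W); last by rewrite i2; ring.
by field.
Qed.

End Laplace.

(** * Fourier expansion of Maass waveforms *)

Section UnitIntegral.
Context {R : realType}.
Local Notation C := R[i].
Local Notation mu := (@lebesgue_measure R).

Definition unit_int (h : R -> R) : R := \int[mu]_(x in `[- 2^-1, 2^-1]) h x.

Lemma half_lt : - 2^-1 < 2^-1 :> R. Proof. lra. Qed.

Lemma unit_int_int (h : R -> R) : continuous h -> mu.-integrable `[- 2^-1, 2^-1] (EFin \o h).
Proof.
move=> ch; apply: continuous_compact_integrable; first exact: segment_compact.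
exact: continuous_subspaceT.
Qed.

Lemma unit_intD (h g : R -> R) : continuous h -> continuous g -> unit_int (fun x => h x + g x) = unit_int h + unit_int g.
Proof. by move=> ch cg; rewrite /unit_int RintegralD //; exact: unit_int_int. Qed.

Lemma unit_intZ (a : R) (h : R -> R) : continuous h -> unit_int (fun x => a * h x) = a * unit_int h.
Proof. by move=> ch; rewrite /unit_int RintegralZl //; exact: unit_int_int. Qed.

Lemma unit_int_le (h g : R -> R) : continuous h -> continuous g -> (forall x : R, - 2^-1 <= x <= 2^-1 -> h x <= g x) -> unit_int h <= unit_int g.
Proof.
move=> ch cg hg; apply: le_Rintegral; [exact: measurable_itv|exact: unit_int_int|exact: unit_int_int|].
by move=> x; rewrite /= in_itv /=; exact: hg.
Qed.

Lemma unit_int_cst a : unit_int (fun=> a) = a.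
Proof.
have m1 : mu `[- 2^-1, 2^-1] = 1%:E.
  rewrite lebesgue_measure_itv /= lte_fin half_lt /= -EFinB opprK; congr _%:E; lra.
by rewrite /unit_int Rintegral_cst //= m1 mulr1.
Qed.

Lemma unit_int_abs (h g : R -> R) : continuous h -> continuous g -> (forall x : R, - 2^-1 <= x <= 2^-1 -> `|h x| <= g x) -> `|unit_int h| <= unit_int g.
Proof.
move=> ch cg hg; rewrite ler_norml; apply/andP; split.
  have -> : - unit_int g = unit_int (fun x => - 1 * g x) by rewrite unit_intZ // mulN1r.
  have cN : continuous (fun x => - 1 * g x) by move=> x; apply: (@continuousM R R (fun=> -1) g x); [exact: cst_continuous|exact: cg].
  apply: unit_int_le => // x /hg.
  by rewrite ler_norml mulN1r => /andP[].
by apply: unit_int_le => // x /hg; rewrite ler_norml => /andP[].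
Qed.

Lemma eq_unit_int (h g : R -> R) : (forall x : R, - 2^-1 <= x <= 2^-1 -> h x = g x) -> unit_int h = unit_int g.
Proof. by move=> e; apply: eq_Rintegral => x; rewrite inE /= in_itv /=; exact: e. Qed.

Lemma unit_int_ftc (F f : R -> R) : continuous f -> (forall x : R, is_derive x 1 F (f x)) -> unit_int f = F 2^-1 - F (- 2^-1).
Proof.
move=> cf dF; rewrite /unit_int /Rintegral (continuous_FTC2 (F := F)) //; first exact: half_lt.
- exact: continuous_subspaceT.
- have c x : {for x, continuous F} := is_derive_continuous (dF x).
  split; first by move=> x _; have [] := dF x.
    by apply: cvg_at_right_filter; exact: c.
  by apply: cvg_at_left_filter; exact: c.
- by move=> x _; rewrite derive1E; have [_ ->] := dF x.
Qed.

Lemma unit_int_under (H H' : R -> R -> R) (a u v G : R) : u < a < v ->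
  (forall s t : R, u < s < v -> is_derive s 1 (H ^~ t) (H' s t)) ->
  (forall s, u < s < v -> continuous (H s)) ->
  (forall s t : R, u < s < v -> - 2^-1 <= t <= 2^-1 -> `|H' s t| <= G) ->
  is_derive a 1 (fun s => unit_int (H s)) (unit_int (H' a)).
Proof.
move=> auv dH cH bH.
have Ia : `]u, v[%classic a by rewrite /= in_itv.
have mB : measurable (`[- 2^-1, 2^-1]%classic : set R) by exact: measurable_itv.
have intf x : `]u, v[%classic x -> mu.-integrable `[- 2^-1, 2^-1] (EFin \o H x).
  by rewrite /= in_itv /= => xuv; apply: unit_int_int; exact: cH.
have der1 x y : `]u, v[%classic x -> `[- 2^-1, 2^-1]%classic y -> derivable (H ^~ y) x 1.
  by rewrite /= in_itv /= => xuv _; have [] := dH x y xuv.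
have E x y : u < x < v -> partial1of2 H x y = H' x y.
  by move=> xuv; rewrite partial1of2E; have [_ ->] := dH x y xuv.
have G0 : 0 <= G.
  by apply: le_trans (bH a 0 auv _); rewrite // oppr_le0 invr_ge0 ler0n.
have intG : mu.-integrable `[- 2^-1, 2^-1] (EFin \o (fun=> G)).
  by apply: unit_int_int; exact: cst_continuous.
have Gub x y : `]u, v[%classic x -> `[- 2^-1, 2^-1]%classic y -> `|partial1of2 H x y| <= G.
  by rewrite /= !in_itv /= => xuv yy; rewrite E //; exact: bH.
split.
  apply: (@derivable_under_integral R _ _ mu H _ mB a u v Ia intf der1 (fun=> G) (fun=> G0) intG Gub).
rewrite -derive1E (@differentiation_under_integral R _ _ mu H _ mB a u v Ia intf der1 (fun=> G) (fun=> G0) intG Gub).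
by apply: eq_Rintegral => y _; rewrite E.
Qed.

Definition cint (h : R -> C) : C := unit_int (fun x => Re (h x)) +i* unit_int (fun x => Im (h x)).

Definition ctsR (h : R -> C) := forall x, cvgc (nbhs x) h (h x).

Lemma ctsR_Re h : ctsR h -> continuous (fun x => Re (h x)). Proof. by move=> c x; have [] := c x. Qed.
Lemma ctsR_Im h : ctsR h -> continuous (fun x => Im (h x)). Proof. by move=> c x; have [] := c x. Qed.

Lemma ctsRD h g : ctsR h -> ctsR g -> ctsR (fun x => h x + g x).
Proof. by move=> ch cg x; apply: cvgcD; [exact: ch|exact: cg]. Qed.
Lemma ctsRM h g : ctsR h -> ctsR g -> ctsR (fun x => h x * g x).
Proof. by move=> ch cg x; apply: cvgcM; [exact: ch|exact: cg]. Qed.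
Lemma ctsR_cst a : ctsR (fun=> a). Proof. by move=> x; exact: cvgc_cst. Qed.
Lemma ctsR_real (h : R -> R) : continuous h -> ctsR (fun x => (h x)%:C).
Proof. by move=> c x; apply: cvgc_real; exact: c. Qed.
Lemma ctsR_sum I (r : seq I) (h : I -> R -> C) : (forall i, ctsR (h i)) -> ctsR (fun x => \sum_(i <- r) h i x).
Proof.
move=> ch; elim: r => [|i r IH].
  have -> : (fun x => \sum_(i <- [::]) h i x) = fun=> 0 by apply/funext => y; rewrite big_nil.
  exact: ctsR_cst.
have -> : (fun x => \sum_(i0 <- i :: r) h i0 x) = fun x => h i x + \sum_(i0 <- r) h i0 x.
  by apply/funext => y; rewrite big_cons.
exact: ctsRD.
Qed.
Lemma derivesC_ctsR h (h' : R -> C) : (forall x, derivesC h x (h' x)) -> ctsR h.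
Proof. by move=> d x; exact: derivesC_cvg (d x). Qed.

Lemma eq_cint h g : (forall x : R, - 2^-1 <= x <= 2^-1 -> h x = g x) -> cint h = cint g.
Proof. by move=> e; rewrite /cint; congr (_ +i* _); apply: eq_unit_int => x /e ->. Qed.

Lemma cintD h g : ctsR h -> ctsR g -> cint (fun x => h x + g x) = cint h + cint g.
Proof.
move=> ch cg; apply: cplxP; rewrite ?ReD ?ImD /cint /=.
  rewrite -(unit_intD (ctsR_Re ch) (ctsR_Re cg)); apply: eq_unit_int => x _; exact: ReD.
rewrite -(unit_intD (ctsR_Im ch) (ctsR_Im cg)); apply: eq_unit_int => x _; exact: ImD.
Qed.

Lemma cintZ a h : ctsR h -> cint (fun x => a * h x) = a * cint h.
Proof.
move=> ch; have cr := ctsR_Re ch; have ci := ctsR_Im ch.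
have cZ (b : R) (g : R -> R) : continuous g -> continuous (fun x => b * g x).
  by move=> cg x; apply: continuousM; [exact: cst_continuous|exact: cg].
apply: cplxP; rewrite ?ReMc ?ImMc /cint /=.
  rewrite -(unit_intZ _ cr) -mulNr -(unit_intZ _ ci) -unit_intD; [|exact: cZ|exact: cZ].
  by apply: eq_unit_int => x _; rewrite ReMc mulNr.
rewrite -(unit_intZ _ cr) -(unit_intZ _ ci) -unit_intD; [|exact: cZ|exact: cZ].
by apply: eq_unit_int => x _; rewrite ImMc.
Qed.

Lemma cint_cst a : cint (fun=> a) = a.
Proof. by rewrite /cint !unit_int_cst -cplxE. Qed.

Lemma cint_sum I (r : seq I) (h : I -> R -> C) : (forall i, ctsR (h i)) ->
  cint (fun x => \sum_(i <- r) h i x) = \sum_(i <- r) cint (h i).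
Proof.
move=> ch; elim: r => [|i r IH].
  by rewrite big_nil -[RHS]cint_cst; apply: eq_cint => x _; rewrite big_nil.
rewrite big_cons -IH -cintD //; last exact: ctsR_sum.
by apply: eq_cint => x _; rewrite big_cons.
Qed.

Lemma cint_le h (g : R -> R) : ctsR h -> continuous g ->
  (forall x : R, - 2^-1 <= x <= 2^-1 -> normc (h x) <= g x) -> normc (cint h) <= 2 * unit_int g.
Proof.
move=> ch cg hg; apply: le_trans (normc_le_ReIm _) _; rewrite mulr_natl mulr2n.
by apply: lerD; apply: unit_int_abs => //; [exact: ctsR_Re | move=> x /hg; apply: le_trans; exact: Re_le_normc
  | exact: ctsR_Im | move=> x /hg; apply: le_trans; exact: Im_le_normc].
Qed.

Lemma cint_le_cst h (M : R) : ctsR h ->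
  (forall x : R, - 2^-1 <= x <= 2^-1 -> normc (h x) <= M) -> normc (cint h) <= 2 * M.
Proof. by move=> ch hM; apply: le_trans (cint_le ch _ hM) _; [exact: cst_continuous | rewrite unit_int_cst]. Qed.

Lemma cint_ftc (F f : R -> C) : ctsR f -> (forall x, derivesC F x (f x)) -> cint f = F 2^-1 - F (- 2^-1).
Proof.
move=> cf dF; apply: cplxP; rewrite ?ReB ?ImB /cint /=.
  by apply: (@unit_int_ftc (fun x => Re (F x))); [exact: ctsR_Re | move=> x; have [] := dF x].
by apply: (@unit_int_ftc (fun x => Im (F x))); [exact: ctsR_Im | move=> x; have [] := dF x].
Qed.

Lemma cint_under (H H' : R -> R -> C) (a u v G : R) : u < a < v ->
  (forall s t : R, u < s < v -> derivesC (H ^~ t) s (H' s t)) ->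
  (forall s, u < s < v -> ctsR (H s)) ->
  (forall s t : R, u < s < v -> - 2^-1 <= t <= 2^-1 -> normc (H' s t) <= G) ->
  derivesC (fun s => cint (H s)) a (cint (H' a)).
Proof.
move=> auv dH cH bH; split.
  apply: (unit_int_under (H := fun s t => Re (H s t)) (H' := fun s t => Re (H' s t)) (G := G) auv).
  - by move=> s t /(dH s t)[].
  - by move=> s /cH; exact: ctsR_Re.
  - by move=> s t hs ht; apply: le_trans (bH s t hs ht); exact: Re_le_normc.
apply: (unit_int_under (H := fun s t => Im (H s t)) (H' := fun s t => Im (H' s t)) (G := G) auv).
- by move=> s t /(dH s t)[].
- by move=> s /cH; exact: ctsR_Im.
- by move=> s t hs ht; apply: le_trans (bH s t hs ht); exact: Im_le_normc.
Qed.

Definition expi (a t : R) : C := e2pi (a * t)%:C.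

Lemma derivesC_expi a t : derivesC (expi a) t (2 * pi%:C * Num.imaginary * a%:C * expi a t).
Proof.
have E x : 2 * pi%:C * Num.imaginary * a%:C * x%:C = 2 * pi%:C * Num.imaginary * (a * x)%:C :> C.
  by rewrite rcM [RHS]mulrA.
have d : derivesC (fun x : R => 2 * pi%:C * Num.imaginary * (a * x)%:C) t (2 * pi%:C * Num.imaginary * a%:C).
  by apply: derivesC_ext E _; apply: derivesC_eq (derivesCZ _ (derivesC_id _)); rewrite mulr1.
exact: derivesC_cexp d.
Qed.

Lemma ctsR_expi a : ctsR (expi a). Proof. exact: derivesC_ctsR (derivesC_expi a). Qed.
Lemma normc_expi a t : normc (expi a t) = 1. Proof. exact: normc_e2pi_real. Qed.
Lemma expiD a b t : expi (a + b) t = expi a t * expi b t.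
Proof. by rewrite /expi mulrDl rcD e2piD. Qed.
Lemma expi0 t : expi 0 t = 1. Proof. by rewrite /expi mul0r e2pi0. Qed.
Lemma expiN a t : expi (- a) t = conjc (expi a t).
Proof. by rewrite /expi e2pi_conj mulNr rcN. Qed.
Lemma cint_expi (n : int) : cint (expi n%:~R) = (n == 0)%:R.
Proof.
case: eqP => [->|/eqP n0].
  by rewrite (eq_cint (g := fun=> 1)) ?cint_cst // => x _; rewrite mulr0z expi0.
set k := 2 * pi%:C * Num.imaginary * (n%:~R : R)%:C.
have k0 : k != 0 by rewrite /k !mulf_neq0 ?pnatr_eq0 ?rc_eq0 ?intr_eq0 ?neq0Ci // gt_eqF ?pi_gt0.
have cc : ctsR (expi n%:~R) := ctsR_expi _.
have := cint_ftc (ctsRM (ctsR_cst k) cc) (derivesC_expi n%:~R).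
rewrite cintZ //.
have -> : expi n%:~R 2^-1 = expi n%:~R (- 2^-1).
  rewrite /expi; have -> : n%:~R * 2^-1 = n%:~R * - 2^-1 + n%:~R :> R by lra.
  rewrite rcD e2piD; have -> : (n%:~R : R)%:C = n%:~R :> C by exact: (rmorph_int (@real_complex R)).
  by rewrite e2pi_int mulr1.
by rewrite subrr => /eqP; rewrite mulf_eq0 (negbTE k0) => /eqP.
Qed.

End UnitIntegral.

Lemma ctsR_norm (R : realType) (h : R -> R[i]) : ctsR h -> continuous (fun x => normc (h x)).
Proof. by move=> c x; exact: (@cvgc_norm R R (nbhs x) _ h _ (c x)). Qed.

Lemma intr_subn (R : realType) (j l : nat) : (j%:Z - l%:Z)%:~R = j%:R - l%:R :> R.
Proof. by rewrite intrD mulrNz -!pmulrn. Qed.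

(** * Fejer's theorem *)

Section Fejer.
Context {R : realType}.
Local Notation C := R[i].
Variables (F : R -> C) (cF : ctsR F).

Definition fejer_coef (n : int) : C := cint (fun t => F t * expi (- n%:~R) t).

Definition dirichlet (N : nat) (t : R) : C := \sum_(0 <= j < N) expi j%:R t.
(** N times the usual Fejer kernel, whence the integral N. *)
Definition fejer_kernel (N : nat) (t : R) : R := normc (dirichlet N t) ^+ 2.

Lemma ctsR_dirichlet N : ctsR (dirichlet N).
Proof. by apply: ctsR_sum => j; exact: ctsR_expi. Qed.

Lemma fejer_kernel_cts N : continuous (fejer_kernel N).
Proof.
move=> t; rewrite /fejer_kernel; have h : {for t, continuous (fun x => normc (dirichlet N x))} by exact: (ctsR_norm (@ctsR_dirichlet N)).
exact: (continuousM h h).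
Qed.

Lemma fejer_kernelE N t : (fejer_kernel N t)%:C = \sum_(0 <= j < N) \sum_(0 <= l < N) expi (- (j%:Z - l%:Z)%:~R) t.
Proof.
rewrite /fejer_kernel -mulc_conj mulrC /dirichlet [conjc _](_ : _ = \sum_(0 <= j < N) conjc (expi j%:R t)); last exact: rmorph_sum.
rewrite big_distrl; apply: eq_bigr => j _; rewrite big_distrr; apply: eq_bigr => l _.
have E : conjc (expi j%:R t) * expi l%:R t = expi (- (j%:Z - l%:Z)%:~R) t.
  by rewrite -expiN -expiD intr_subn opprB [- _ + _]addrC.
exact: E.
Qed.

Lemma cint_fejer_kernel N : cint (fun t => F t * (fejer_kernel N t)%:C) = \sum_(0 <= j < N) \sum_(0 <= l < N) fejer_coef (j%:Z - l%:Z).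
Proof.
have cc (n : int) : ctsR (fun t => F t * expi (- n%:~R) t) by apply: ctsRM cF _; exact: ctsR_expi.
rewrite [LHS](eq_cint (g := fun t => \sum_(0 <= j < N) \sum_(0 <= l < N) F t * expi (- (j%:Z - l%:Z)%:~R) t)); last first.
  by move=> t _; rewrite fejer_kernelE big_distrr; apply: eq_bigr => j _; rewrite big_distrr.
rewrite cint_sum; last by move=> j; apply: ctsR_sum => l; exact: cc.
by apply: eq_bigr => j _; rewrite cint_sum // => l; exact: cc.
Qed.

Lemma unit_int_fejer_kernel N : unit_int (fejer_kernel N) = N%:R.
Proof.
have h : cint (fun t => (fejer_kernel N t)%:C) = N%:R.
  rewrite [LHS](eq_cint (g := fun t => \sum_(0 <= j < N) \sum_(0 <= l < N) expi ((l%:Z - j%:Z)%:~R) t)); last first.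
    move=> t _; rewrite fejer_kernelE; apply: eq_bigr => j _; apply: eq_bigr => l _.
    by rewrite -mulrNz opprB.
  rewrite cint_sum; last by move=> j; apply: ctsR_sum => l; exact: ctsR_expi.
  rewrite [RHS](_ : _ = \sum_(0 <= j < N) 1); last by rewrite big_const_nat subn0 iter_addr_0.
  rewrite !big_mkord; apply: eq_bigr => j _.
  rewrite cint_sum; last by move=> l; exact: ctsR_expi.
  rewrite big_mkord (bigD1 j) //= cint_expi subrr eqxx big1 ?addr0 // => l lj.
  by rewrite cint_expi subr_eq0 eqz_nat val_eqE (negbTE lj).
by have := congr1 (@complex.Re R) h; rewrite /cint /= Re_nat.
Qed.

Lemma cos_le_delta (de t : R) : 0 < de -> de <= `|t| <= 2^-1 -> cos (2 * pi * t) <= cos (2 * pi * de).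
Proof.
move=> d0 /andP[h1 h2]; have p0 := pi_gt0 R.
rewrite -cos_norm normrM (ger0_norm (_ : 0 <= 2 * pi)); last by rewrite mulr_ge0 // ltW.
have a1 : 2 * pi * `|t| <= pi.
  have : pi * `|t| <= pi * 2^-1 by rewrite ler_wpM2l // ltW.
  lra.
have a2 : 2 * pi * de <= 2 * pi * `|t| by rewrite ler_wpM2l // mulr_ge0 // ltW.
move: a2; rewrite le_eqVlt => /predU1P[->|h]; first exact: lexx.
have a3 : 0 <= 2 * pi * de by rewrite !mulr_ge0 // ltW.
by rewrite ltW // ltr_cos // in_itv /=; apply/andP; split => //; lra.
Qed.

Lemma cos_delta_lt1 (de : R) : 0 < de -> de <= 2^-1 -> cos (2 * pi * de) < 1.
Proof.
move=> d0 d1; have p0 := pi_gt0 R; rewrite -[X in _ < X]cos0.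
have : pi * de <= pi * 2^-1 by rewrite ler_wpM2l // ltW.
have : 0 < pi * de by rewrite mulr_gt0.
move=> h1 h2; rewrite ltr_cos ?in_itv /=; lra.
Qed.

(** With q = e(t), the geometric sum satisfies |q - 1| |D_N| = |q^N - 1| <= 2, and |q - 1|^2 = 2 (1
    - cos 2 pi t). *)
Lemma fejer_kernel_le (de : R) N t : 0 < de -> de <= `|t| <= 2^-1 -> fejer_kernel N t <= 4 / (2 * (1 - cos (2 * pi * de))).
Proof.
move=> d0 dt; have d1 : de <= 2^-1 by case/andP: dt; exact: le_trans.
have c1 := cos_delta_lt1 d0 d1; have c2 := cos_le_delta d0 dt.
set q := expi 1 t.
have Eq : dirichlet N t = \sum_(j < N) q ^+ j.
  by rewrite /dirichlet big_mkord; apply: eq_bigr => j _; rewrite /q /expi mul1r rcM rc_nat e2piMn.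
have qq : normc (q - 1) ^+ 2 = 2 * (1 - cos (2 * pi * t)).
  rewrite normc_sqr ReB ImB /q /expi mul1r e2pi_real /= subr0.
  by have := cos2Dsin2 (2 * pi * t); move: (cos _) (sin _) => a b; rewrite sqrrB => h; lra.
have h : normc (q - 1) * normc (dirichlet N t) <= 2.
  rewrite Eq -normcM -subrX1; apply: le_trans (ler_normcB _ _) _.
  by rewrite normcX /q normc_expi expr1n normc1.
rewrite /fejer_kernel ler_pdivlMr; last by lra.
apply: le_trans (_ : normc (dirichlet N t) ^+ 2 * normc (q - 1) ^+ 2 <= _).
  by rewrite ler_wpM2l ?sqr_ge0 // qq; lra.
rewrite -exprMn mulrC (_ : 4 = 2 ^+ 2 :> R); last by ring.
by rewrite lerXn2r ?nnegrE // ?mulr_ge0 ?normc_ge0.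
Qed.

(** Convergence at 0 suffices, as any other point is translated there. For |t| < de continuity of
    [F] is used; elsewhere the kernel is bounded uniformly in N and the factor 1/N wins. *)
Lemma fejer_cvg : cvgc \oo (fun n => (n.+1%:R^-1 : R)%:C * cint (fun t => F t * (fejer_kernel n.+1 t)%:C)) (F 0).
Proof.
have [M0 M00 hM] : exists2 M : R, 0 <= M & forall t, - 2^-1 <= t <= 2^-1 -> normc (F t - F 0) <= M.
  have c : {within `[- 2^-1, 2^-1], continuous (fun t => normc (F t - F 0))}.
    apply: continuous_subspaceT; apply: (@ctsR_norm _ (fun t => F t - F 0)).
    exact: (ctsRD cF (@ctsR_cst R (- F 0))).
  have [x _ hx] := EVT_max (ltW (@half_lt R)) c.
  exists (normc (F x - F 0)); first exact: normc_ge0.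
  by move=> t ht; apply: hx; rewrite in_itv.
apply/cvgc_normc/cvgrPdist_le => e e0.
have e4 : 0 < e / 4 by rewrite divr_gt0.
have c0 : (fun t => normc (F t - F 0)) @ (0 : R) --> (0 : R) by apply/(@cvgc_normc R R (nbhs (0 : R)) _ F (F 0)); exact: cF.
move/cvgrPdist_le: c0 => /(_ _ e4) [d0 /= d00 hd].
pose de := Num.min (d0 / 2) 2^-1.
have de0 : 0 < de by rewrite lt_min divr_gt0 //= invr_gt0.
have hde t : `|t| < de -> normc (F t - F 0) <= e / 4.
  move=> h; have := hd t; rewrite sub0r normrN ger0_norm ?normc_ge0 //; apply.
  rewrite /= sub0r normrN (lt_le_trans h) // /de ge_min; apply/orP; left; lra.
have de1 : de <= 2^-1 by rewrite /de ge_min lexx orbT.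
have c1 := cos_delta_lt1 de0 de1.
pose K := 4 / (2 * (1 - cos (2 * pi * de))).
have K0 : 0 <= K by rewrite divr_ge0 // mulr_ge0 // subr_ge0 ltW.
have : (fun n => 2 * M0 * K * (n.+1%:R^-1 : R)) @ \oo --> (0 : R).
  by rewrite -(mulr0 (2 * M0 * K)); apply: cvgM; [exact: cvg_cst | exact: cvg_harmonic].
move=> /cvgrPdist_le /(_ _ (divr_gt0 e0 (ltr0n _ 2))) [n0 _ hn0].
exists n0 => // n nn; have := hn0 n nn; rewrite /= !sub0r !normrN !ger0_norm ?normc_ge0 ?mulr_ge0 ?invr_ge0 // => hn.
set N := n.+1 in hn *.
have N0 : (N%:R : R) != 0 by rewrite pnatr_eq0.
have cK : ctsR (fun t => (fejer_kernel N t)%:C) by apply: ctsR_real; exact: fejer_kernel_cts.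
have cD : ctsR (fun t => (F t - F 0) * (fejer_kernel N t)%:C).
  by apply: ctsRM cK; exact: (ctsRD cF (@ctsR_cst R (- F 0))).
have -> : (N%:R^-1)%:C * cint (fun t => F t * (fejer_kernel N t)%:C) - F 0 = (N%:R^-1)%:C * cint (fun t => (F t - F 0) * (fejer_kernel N t)%:C).
  rewrite [in RHS](eq_cint (g := fun t => F t * (fejer_kernel N t)%:C + (- F 0) * (fejer_kernel N t)%:C)); last by move=> t _; rewrite mulrDl.
  rewrite cintD; [|exact: ctsRM|by apply: ctsRM cK; exact: ctsR_cst].
  rewrite cintZ // [cint (fun t => (fejer_kernel N t)%:C)](_ : _ = N%:R%:C); last first.
    rewrite /cint /= (unit_int_fejer_kernel N); apply: cplxP => //=; exact: unit_int_cst.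
  by rewrite mulrDr; congr (_ + _); rewrite mulrCA -rcM mulVf // mulr1.
rewrite normcM normcRE ger0_norm ?invr_ge0 // mulrC ler_pdivrMr ?ltr0n //.
pose g t := e / 4 * fejer_kernel N t + M0 * K.
have cg : continuous g.
  move=> t; apply: cvgD; last exact: cvg_cst.
  by apply: cvgM; [exact: cvg_cst|exact: fejer_kernel_cts].
have kp t : 0 <= fejer_kernel N t by exact: sqr_ge0.
apply: le_trans (cint_le cD cg _) _.
  move=> t ht; rewrite normcM normcRE ger0_norm // /g.
  have [h|h] := ltP `|t| de.
    apply: le_trans (_ : e / 4 * fejer_kernel N t <= _); last by rewrite lerDl mulr_ge0.
    by rewrite ler_wpM2r // hde.
  apply: le_trans (_ : M0 * K <= _); last by rewrite lerDr mulr_ge0 // ltW.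
  apply: ler_pM => //; [exact: normc_ge0|exact: hM|apply: fejer_kernel_le => //].
  by rewrite h /= ler_norml.
have ce : continuous (fun t => e / 4 * fejer_kernel N t).
  by move=> t; apply: cvgM; [exact: cvg_cst|exact: fejer_kernel_cts].
rewrite unit_intD //; last by move=> t; exact: cvg_cst.
rewrite (unit_intZ _ (@fejer_kernel_cts N)) unit_int_cst unit_int_fejer_kernel.
have := ler_wpM2r (ler0n R N) hn; rewrite -[2 * M0 * K / _ * _]mulrA mulVf // mulr1.
move: (N%:R : R) => x; lra.
Qed.

Definition symsum (b : int -> C) (M : nat) : C := series (fun n => b n%:Z) M.+1 + series (fun n => b (- n.+1%:Z)) M.

(** Going from N to N + 1 adds a last row and a last column of differences j - l, which together
    form one symmetric partial sum. *)
Lemma cesaro_double_sum (b : int -> C) N :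
  \sum_(0 <= j < N) \sum_(0 <= l < N) b (j%:Z - l%:Z) = \sum_(0 <= M < N) symsum b M.
Proof.
elim: N => [|N IH]; first by rewrite !big_nil.
rewrite [RHS]big_nat_recr //= -IH big_nat_recr //=.
under eq_big_nat do rewrite big_nat_recr //=.
rewrite big_split /= -!addrA; congr (_ + _); rewrite addrC /symsum; congr (_ + _).
  rewrite /series /= [RHS]big_nat_rev /=; apply: eq_big_nat => l /andP[_ h].
  by congr b; lia.
rewrite /series /= [RHS]big_nat_rev /=; apply: eq_big_nat => l /andP[_ h].
by congr b; lia.
Qed.

(** The Cesaro means tend to [F 0] by Fejer's theorem, and to the sum of the series because it
    converges. *)
Lemma fejer_sumZ : summableZ fejer_coef -> F 0 = sumZ fejer_coef.
Proof.
move=> /summableZ_has [a [b [/cvgcP ha /cvgcP hb ->]]].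
have hs : cvgc \oo (symsum fejer_coef) (a + b).
  apply: cvgcD hb; case: ha => h1 h2; split.
    by rewrite -(cvg_shiftS (fun n => complex.Re (series (fun n : nat => fejer_coef n) n))) in h1.
  by rewrite -(cvg_shiftS (fun n => complex.Im (series (fun n : nat => fejer_coef n) n))) in h2.
apply: cvgc_unique fejer_cvg _.
have [h1 h2] := hs.
have k1 := cesaro h1; have k2 := cesaro h2.
have E n : (n.+1%:R^-1 : R)%:C * cint (fun t => F t * (fejer_kernel n.+1 t)%:C) =
   arithmetic_mean (fun x => Re (symsum fejer_coef x)) n +i* arithmetic_mean (fun x => Im (symsum fejer_coef x)) n.
  rewrite cint_fejer_kernel cesaro_double_sum; apply: cplxP; rewrite ?ReZ ?ImZ /arithmetic_mean /= ?Re_sum ?Im_sum; by rewrite /series.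
split.
  by apply: cvg_trans k1; apply: near_eq_cvg; apply: nearW => n; rewrite E.
by apply: cvg_trans k2; apply: near_eq_cvg; apply: nearW => n; rewrite E.
Qed.

End Fejer.

(** * Measurability and integrals over the fundamental domain *)

Section StripIntegral.
Context {R : realType}.
Local Notation C := R[i].
Local Notation mu := (@lebesgue_measure R).
Local Notation mR := (measurableTypeR R).

Definition upperR2 : set (mR * mR) := setT `*` `[0, +oo[%classic.

Lemma upperR2_meas : measurable upperR2.
Proof. by apply: measurableX => //; exact: measurable_itv. Qed.

(** Rounding y down to a multiple of 1 / (n + 1) gives functions that depend continuously on x in
    each of countably many strips; they converge to [H] by continuity in y. *)
Lemma caratheodory_measurable (H : R -> R -> R) : (forall y, continuous (H ^~ y)) -> (forall x, continuous (H x)) ->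
  measurable_fun upperR2 (fun p : mR * mR => (H p.1 p.2)).
Proof.
move=> cx cy.
pose h (n : nat) (p : mR * mR) : R := H p.1 ((Num.truncn (n.+1%:R * (p.2 : R)))%:R / n.+1%:R).
apply: (@measurable_fun_cvg _ _ _ _ h).
  move=> n mD Y mY.
  pose I (j : nat) : set R := `[j%:R / n.+1%:R, j.+1%:R / n.+1%:R[%classic.
  have -> : upperR2 `&` h n @^-1` Y = \bigcup_j ((H ^~ (j%:R / n.+1%:R) @^-1` Y) `*` I j).
    apply/seteqP; split => [[x y] [[_ /=]]|[x y] [j _ [/= hY]]].
      rewrite in_itv /= andbT => y0 hY.
      have ny : 0 <= n.+1%:R * y :> R by rewrite mulr_ge0.
      exists (Num.truncn (n.+1%:R * y)) => //; split => //=.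
      have /andP[h1 h2] := truncn_itv ny.
      by rewrite /I /= in_itv /= ler_pdivrMr // ltr_pdivlMr // [y * _]mulrC h1.
    rewrite /I /= in_itv /= ler_pdivrMr // ltr_pdivlMr // => /andP[h1 h2].
    have y0 : 0 <= y.
      by have : 0 <= y * n.+1%:R := le_trans (ler0n _ _) h1; rewrite pmulr_lge0.
    split; first by split => //=; rewrite in_itv /= y0.
    have -> : h n (x, y) = H x (j%:R / n.+1%:R).
      rewrite /h /=; congr (H x (_%:R / _)); apply/eqP; rewrite truncn_eq ?mulr_ge0 //.
      by rewrite [n.+1%:R * y]mulrC h1.
    exact: hY.
  apply: bigcup_measurable => j _; apply: measurableX; last exact: measurable_itv.
  by rewrite -[_ @^-1` _]setTI; apply: continuous_measurable_fun.
move=> [x y] [_ /=]; rewrite in_itv /= andbT => y0.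
pose s (n : nat) : R := (Num.truncn (n.+1%:R * y))%:R / n.+1%:R.
have : s @ \oo --> y.
  apply/cvgrPdist_le => e e0.
  have := @cvg_harmonic R; move=> /cvgrPdist_le /(_ e e0) [n0 _ hn].
  exists n0 => // n nn; have := hn n nn; rewrite /= sub0r normrN ger0_norm ?invr_ge0 //; apply: le_trans.
  have ny : 0 <= n.+1%:R * y :> R by rewrite mulr_ge0.
  have /andP[h1 h2] := truncn_itv ny.
  have s1 : s n <= y by rewrite /s ler_pdivrMr // [y * _]mulrC.
  rewrite ger0_norm ?subr_ge0 // lerBlDr (_ : _ + s n = (1 + (Num.truncn (n.+1%:R * y))%:R) / n.+1%:R); last by rewrite mulrDl mul1r.
  rewrite ler_pdivlMr //.
  by rewrite [y * _]mulrC (le_trans (ltW h2)) // -(natr1 (Num.truncn _)) addrC.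
by move=> cs; apply: (cvg_comp s (H x) cs); exact: cy.
Qed.

Lemma FD_meas : measurable (@fundamental_domain R : set (mR * mR)).
Proof.
have m1 : measurable_fun setT (fun p : mR * mR => `|p.1|).
  by apply: (measurableT_comp (f := fun x : mR => (`|x| : mR))); [exact: normr_measurable | exact: measurable_fst].
have mx : measurable_fun setT (fun p : mR * mR => p.1) by exact: measurable_fst.
have my : measurable_fun setT (fun p : mR * mR => p.2) by exact: measurable_snd.
have m2 : measurable_fun setT (fun p : mR * mR => (p.1 ^+ 2 + p.2 ^+ 2)).
  by apply: measurable_funD; apply: measurable_funX.
have -> : (@fundamental_domain R : set (mR * mR)) = (setT `&` [set p : mR * mR | `|p.1| <= 2^-1]) `&`
   ((setT `*` `]0, +oo[%classic) `&` (setT `&` [set p : mR * mR | 1 <= p.1 ^+ 2 + p.2 ^+ 2])).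
  apply/seteqP; split => [[x y] /= [h1 h2 h3]|[x y] /= [[_ h1] [[_ h2] [_ h3]]]].
    by rewrite !in_itv /= andbT.
  by move: h2; rewrite in_itv /= andbT.
apply: measurableI.
  by apply: (@measurable_fun_le _ _ _ setT (fun p : mR * mR => `|p.1|) (fun=> 2^-1)) => //; exact: measurable_cst.
apply: measurableI; first by apply: measurableX => //; exact: measurable_itv.
by apply: (@measurable_fun_le _ _ _ setT (fun=> 1) (fun p : mR * mR => p.1 ^+ 2 + p.2 ^+ 2)) => //; exact: measurable_cst.
Qed.

Lemma FD_y (p : mR * mR) : (@fundamental_domain R) p -> 2^-1 <= p.2.
Proof.
case: p => x y [/= h1 h2 h3]; rewrite leNgt; apply/negP => h.
have x2 : x ^+ 2 <= 2^-1 ^+ 2 by rewrite -[x ^+ 2]real_normK ?num_real // lerXn2r ?nnegrE // invr_ge0.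
have y2 : y ^+ 2 <= 2^-1 ^+ 2 by rewrite lerXn2r ?nnegrE ?invr_ge0 // ltW.
have : (2^-1 : R) ^+ 2 + 2^-1 ^+ 2 < 1 by rewrite expr2; lra.
lra.
Qed.

Lemma FD_sub : (@fundamental_domain R : set (mR * mR)) `<=` upperR2.
Proof. by move=> p hp; split => //=; rewrite in_itv /= andbT (le_trans _ (FD_y hp)) ?invr_ge0. Qed.

Section Bounds.
Variable H : R -> R -> R.
Hypotheses (H0 : forall x y, 0 <= H x y) (cx : forall y, continuous (H ^~ y)) (cy : forall x, continuous (H x)).

Let mH : measurable_fun upperR2 (fun p : mR * mR => (H p.1 p.2)%:E).
Proof. by apply/measurable_EFinP; exact: caratheodory_measurable. Qed.

(** The domain contains the rectangles |x| <= 1/2, Y0 <= y <= Y0 + N, over which Tonelli makes the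
    integral at least N. *)
Lemma strip_contra (Y0 : R) : 1 <= Y0 ->
  (\int[mu \x mu]_(p in (@fundamental_domain R : set (mR * mR))) (H p.1 p.2)%:E < +oo)%E ->
  (forall y, Y0 <= y -> 1 <= unit_int (H ^~ y)) -> False.
Proof.
move=> Y1 fin large.
pose A0 : set mR := `[- 2^-1, 2^-1]%classic.
have aux (y : R) : Y0 <= y -> (1 <= \int[mu]_(x in A0) (H x y)%:E)%E.
  move=> yY; have ii : mu.-integrable A0 (EFin \o (H ^~ y)) by apply: unit_int_int; exact: cx.
  have -> : (\int[mu]_(x in A0) (H x y)%:E = (unit_int (H ^~ y))%:E)%E.
    by rewrite /unit_int /Rintegral fineK //; exact: integrable_fin_num.
  by rewrite lee_fin; exact: large.
have key (N : nat) : (N%:R%:E <= \int[mu \x mu]_(p in (@fundamental_domain R : set (mR * mR))) (H p.1 p.2)%:E)%E.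
  pose A : set mR := `[- 2^-1, 2^-1]%classic; pose B : set mR := `[Y0, Y0 + N%:R]%classic.
  have mA : measurable A by exact: measurable_itv.
  have mB : measurable B by exact: measurable_itv.
  have sub : A `*` B `<=` (@fundamental_domain R : set (mR * mR)).
    move=> [x y] []; rewrite /A /B /= !in_itv /= => /andP[a1 a2] /andP[b1 b2]; split => //=.
    - by rewrite ler_norml a1 a2.
    - by apply: lt_le_trans b1; apply: lt_le_trans Y1.
    - have : 1 <= y ^+ 2 by rewrite expr_ge1 ?(le_trans _ b1) // ?(le_trans Y1 b1) // (le_trans _ Y1).
      by have := sqr_ge0 x; lra.
  have mAB : measurable (A `*` B) by exact: measurableX.
  apply: le_trans (ge0_subset_integral _ mAB FD_meas _ _ sub); last 2 first.
  - exact: measurable_funS upperR2_meas FD_sub mH.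
  - by move=> p _; rewrite lee_fin.
  rewrite integral_mkcond fubini_tonelli2; last 2 first.
  - apply/(measurable_restrictT _ mAB); apply: measurable_funS mH; first exact: upperR2_meas.
    exact: subset_trans sub FD_sub.
  - by move=> p; apply: erestrict_ge0 => q _; rewrite lee_fin.
  have -> : (N%:R%:E = \int[mu]_(y in B) (1 : R)%:E)%E.
    have m1 : mu B = (N%:R)%:E.
      rewrite /B lebesgue_measure_itv /= lte_fin ltrDl ltr0n.
      by case: N {B mB sub mAB} => [|N] //=; rewrite -EFinB addrAC subrr add0r.
    by rewrite integral_cst // mul1e; exact: esym m1.
  rewrite integral_mkcond; apply: ge0_le_integral => //.
  - by move=> y _; apply: erestrict_ge0 => q _; rewrite lee_fin.
  - by apply/(measurable_restrictT _ mB); exact: measurable_cst.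
  - apply: measurable_fun_fubini_tonelli_G.
    + apply/(measurable_restrictT _ mAB); apply: measurable_funS mH; first exact: upperR2_meas.
      exact: subset_trans sub FD_sub.
    + by move=> p; apply: erestrict_ge0 => q _; rewrite lee_fin.
  move=> y _; rewrite /fubini_G /patch; case: ifPn => [/set_mem yB|_]; last first.
    by apply: integral_ge0 => x _; case: ifP => // _; rewrite lee_fin.
  have yY : Y0 <= y by move: yB; rewrite /B /= in_itv /= => /andP[].
  have E : (\int[mu]_x (if (x, y) \in A `*` B then (H x y)%:E else point) = \int[mu]_(x in A) (H x y)%:E)%E.
    rewrite [RHS]integral_mkcond; apply: eq_integral => x _; rewrite /patch.
    by congr (if _ then _ else _); apply/idP/idP; rewrite !inE /= => h; [case: h | split].
  rewrite /= E.
  exact: aux.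
case: (integral _ _ _) fin key => [x| |] // fin key.
  have := key (Num.bound `|x|); rewrite lee_fin leNgt => /negP; apply.
  exact: le_lt_trans (ler_norm x) (archi_boundP (normr_ge0 _)).
by have := key 0%N.
Qed.

(** The domain lies in the strip |x| <= 1/2, y >= 1/2, and M / y^2 is integrable there. *)
Lemma strip_finite (M : R) : (forall x y, 2^-1 <= y -> H x y <= M / y ^+ 2) ->
  (\int[mu \x mu]_(p in (@fundamental_domain R : set (mR * mR))) (H p.1 p.2)%:E < +oo)%E.
Proof.
move=> bnd.
have M0 : 0 <= M.
  have := le_trans (H0 0 1) (bnd 0 1 _); rewrite expr1n divr1; apply; lra.
pose A : set mR := `[- 2^-1, 2^-1]%classic; pose B : set mR := `[2^-1, +oo[%classic.
have mA : measurable A by exact: measurable_itv.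
have mB : measurable B by exact: measurable_itv.
have mAB : measurable (A `*` B) by exact: measurableX.
have h0 : 0 < 2^-1 :> R by rewrite invr_gt0.
pose g (y : R) := M / y ^+ 2.
(* Continuous on the whole line and equal to M / y^2 for y >= 1/2. *)
pose g' (y : R) := M / (Num.max y 2^-1) ^+ 2.
have cg' : continuous g'.
  move=> y; apply: cvgM; first exact: cvg_cst.
  have c1 : {for y, continuous (fun y : R => Num.max y 2^-1)} by apply: continuous_max; [exact: cvg_id|exact: cvg_cst].
  have n0 : Num.max y 2^-1 ^+ 2 != 0 :> R by rewrite expf_neq0 // gt_eqF // lt_max h0 orbT.
  by apply: cvgV => //; exact: (continuousM c1 c1).
have sub : (@fundamental_domain R : set (mR * mR)) `<=` A `*` B.
  move=> p hp; have := FD_y hp; case: p hp => x y [/= h1 _ _] h2.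
  by split; rewrite /A /B /= in_itv /= ?andbT // -ler_norml.
have mg : measurable_fun setT (fun p : mR * mR => (g' p.2)%:E).
  apply/measurable_EFinP; apply: (measurableT_comp (f := g')); last exact: measurable_snd.
  exact: continuous_measurable_fun.
have g'0 y : 0 <= g' y by rewrite divr_ge0 // sqr_ge0.
apply: le_lt_trans (_ : (\int[mu \x mu]_(p in A `*` B) (g' p.2)%:E < +oo)%E); last first.
  rewrite integral_mkcond fubini_tonelli2; last 2 first.
  - by apply/(measurable_restrictT _ mAB); apply: measurable_funS mg.
  - by move=> p; apply: erestrict_ge0 => q _; rewrite lee_fin.
  have -> : (\int[mu]_y fubini_G mu ((fun p : mR * mR => (g' p.2)%:E) \_ (A `*` B)) y = \int[mu]_(y in B) (g' y)%:E)%E.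
    rewrite [RHS]integral_mkcond; apply: eq_integral => y _; rewrite /fubini_G /patch.
    case: ifPn => [/set_mem yB|/negP yB]; last first.
      apply: integral0_eq => x _; case: ifPn => // /set_mem [_ /= h]; case: yB.
      by rewrite inE.
    rewrite (eq_integral ((cst (g' y)%:E) \_ A)); last first.
      move=> x _; rewrite /patch /=.
      by congr (if _ then _ else _); apply/idP/idP; rewrite !inE /= => h; [case: h | split].
    have m1 : mu A = 1%:E.
      by rewrite /A lebesgue_measure_itv /= lte_fin half_lt /= -EFinB opprK; congr _%:E; lra.
    rewrite -integral_mkcond integral_cst //.
    by transitivity ((g' y)%:E * mu A)%E => //; rewrite m1 mule1.
  rewrite (@ge0_continuous_FTC2y R g' (fun y => - M / y) 2^-1 0) //.
  - exact: ltry.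
  - exact: continuous_subspaceT.
  - rewrite -(mulr0 (- M)); apply: cvgM; first exact: cvg_cst.
    by apply/gtr0_cvgV0; [exact: nbhs_pinfty_gt | exact: cvg_id].
  - move=> y hy; have y0 : y != 0 by rewrite gt_eqF // (lt_trans h0).
    by apply: derivableM => //; apply: derivableV.
  - apply: cvg_at_right_filter; apply: cvgM; first exact: cvg_cst.
    by apply: cvgV; [rewrite gt_eqF | exact: cvg_id].
  - move=> y; rewrite in_itv /= andbT => hy; have y0 : y != 0 by rewrite gt_eqF // (lt_trans h0).
    rewrite derive1E deriveM //; last exact: derivableV.
    rewrite derive_cst scaler0 addr0 deriveV // derive_id /g' max_l ?(ltW hy) //.
    by rewrite /GRing.scale /= mulr1 mulrN mulNr opprK.
apply: (@le_trans _ _ (\int[mu \x mu]_(p in (@fundamental_domain R : set (mR * mR))) (g' p.2)%:E)%E).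
  apply: ge0_le_integral; first exact: FD_meas.
  - by move=> p _; rewrite lee_fin.
  - exact: measurable_funS upperR2_meas FD_sub mH.
  - exact: measurable_funS mg.
  - by move=> p hp; rewrite lee_fin /g' max_l ?FD_y // bnd // FD_y.
apply: ge0_subset_integral => //; [exact: FD_meas|exact: measurable_funS mg|].
by move=> p _; rewrite lee_fin.
Qed.

End Bounds.

End StripIntegral.

Section Rect.
Context {R : realType}.
Local Notation C := R[i].
Implicit Types (G Gx Gy : C -> C).

Lemma cts_comp {T} (F : set_system T) {FF : ProperFilter F} G (p : T -> C) z :
  cts G z -> cvgc F p z -> cvgc F (fun x => G (p x)) (G z).
Proof. by move=> [h1 h2] /cvgcP hp; split; [exact: (cvg_comp p _ hp h1) | exact: (cvg_comp p _ hp h2)]. Qed.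

Lemma cont_norm_comp (T : topologicalType) G (p : T -> C) (t : T) :
  cts G (p t) -> cvgc (nbhs t) p (p t) -> {for t, continuous (fun x => normc (G (p x)))}.
Proof.
move=> cG hp; have h := @cts_comp T (nbhs t) (@nbhs_pfilter T t) G p (p t) cG hp.
exact: (@cvgc_norm R T (nbhs t) (@nbhs_pfilter T t) (fun x => G (p x)) _ h).
Qed.

Lemma rect_bound G (a b c d : R) : (forall z, uhp z -> cts G z) -> a <= b -> 0 < c -> c <= d ->
  exists2 M : R, 0 <= M & forall x y, a <= x <= b -> c <= y <= d -> normc (G (x +i* y)) <= M.
Proof.
move=> cG ab c0 cd.
pose A : set (R * R) := `[a, b]%classic `*` `[c, d]%classic.
have A0 : A !=set0 by exists (a, c); split; rewrite /= in_itv /= ?lexx ?ab ?cd.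
have cA : compact A by apply: compact_setX; exact: segment_compact.
have cc : {within A, continuous (fun p : R * R => normc (G (p.1 +i* p.2)))}.
  apply: continuous_in_subspaceT => -[x y] /set_mem [_ /=]; rewrite in_itv /= => /andP[cy _].
  have y0 : 0 < y := lt_le_trans c0 cy.
  have h : cvgc (nbhs (x, y)) (fun p : R * R => p.1 +i* p.2) (x +i* y).
    by split; [exact: cvg_fst | exact: cvg_snd].
  exact: (@cont_norm_comp _ G (fun p : R * R => p.1 +i* p.2) (x, y) (cG (x +i* y) y0) h).
have [p _ hp] := compact_EVT_max A0 cA cc.
exists (normc (G (p.1 +i* p.2))); first exact: normc_ge0.
move=> x y hx hy; apply: (hp (x, y)); rewrite inE; split; rewrite /= in_itv //.
Qed.

Lemma ctsR_h G x0 (y : R) : (forall z, uhp z -> cts G z) -> 0 < y -> ctsR (fun t => G ((x0 + t) +i* y)).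
Proof.
move=> cG y0 t; apply: (@cts_comp _ (nbhs t) _ G (fun t => (x0 + t) +i* y)); first exact: cG.
by split => /=; [apply: cvgD; [exact: cvg_cst|exact: cvg_id] | exact: cvg_cst].
Qed.

End Rect.

(** * Fourier coefficients of a Maass waveform *)

Section Fourier.
Context {R : realType}.
Local Notation C := R[i].
Variables (k : nat) (hk : (1 <= k <= 11)%N) (r : R) (r0 : r != 0).
Local Notation nu := (@freq R k).
Local Notation dxcoef := (@dxcoef R k).
Local Notation subexp := (@subexp R k).
Local Notation wterm := (@wterm R k r).
Local Notation wparam := (@wparam R k).
Implicit Types (G Gx Gy : C -> C).

(** The base point [x0] is a variable, so that derivatives in x can be taken under the integral;
    [fcoef_shift] recovers the dependence on it. *)
Definition fcoef G (n : int) (x0 y : R) : C := cint (fun t => G ((x0 + t) +i* y) * expi (- nu n) t).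

Lemma is_derive_shift (a t : R) : is_derive t 1 (fun s => s + a) (1 : R).
Proof.
have h1 : is_derive t 1 (fun x : R => x) (1 : R) by exact: is_derive_id.
have h2 : is_derive t 1 (fun _ : R => a) (0 : R) by exact: is_derive_cst.
by have := is_deriveD h1 h2; rewrite addr0.
Qed.

Lemma C1on_ctsx G Gx Gy : C1on G Gx Gy -> forall z, uhp z -> cts Gx z.
Proof. by move=> h z zu; have [] := h z zu. Qed.
Lemma C1on_ctsy G Gx Gy : C1on G Gx Gy -> forall z, uhp z -> cts Gy z.
Proof. by move=> h z zu; have [] := h z zu. Qed.
Lemma C1on_cts G Gx Gy : C1on G Gx Gy -> forall z, uhp z -> cts G z.
Proof. by move=> h z zu; exact: partials_cts h zu. Qed.

Lemma ctsR_fcoef G n x0 (y : R) : (forall z, uhp z -> cts G z) -> 0 < y -> ctsR (fun t => G ((x0 + t) +i* y) * expi (- nu n) t).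
Proof. by move=> cG y0; apply: ctsRM; [exact: ctsR_h | exact: ctsR_expi]. Qed.

Lemma fcoef_dy G Gx Gy n x0 (y : R) : C1on G Gx Gy -> 0 < y -> derivesC (fcoef G n x0) y (fcoef Gy n x0 y).
Proof.
move=> hG y0.
have y2 : 0 < y / 2 by rewrite divr_gt0.
have ab : x0 - 2^-1 <= x0 + 2^-1 by lra.
have cd : y / 2 <= 2 * y by lra.
have [M _ hM] := rect_bound (C1on_ctsy hG) ab y2 cd.
apply: (@cint_under R (fun s t => G ((x0 + t) +i* s) * expi (- nu n) t) (fun s t => Gy ((x0 + t) +i* s) * expi (- nu n) t) y (y / 2) (2 * y) M).
- by apply/andP; split; lra.
- move=> s t /andP[h _]; have s0 := lt_trans y2 h.
  by apply: derivesCZr; have [[_ d] _ _] := hG ((x0 + t) +i* s) s0.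
- by move=> s /andP[h _]; apply: ctsR_fcoef; [exact: C1on_cts hG | exact: lt_trans h].
- move=> s t /andP[h1 h2] /andP[t1 t2]; rewrite normcM normc_expi mulr1; apply: hM; apply/andP; split; lra.
Qed.

Lemma derivesC_hshift G Gx Gy t (s y : R) : C1on G Gx Gy -> 0 < y -> derivesC (fun s => G ((s + t) +i* y)) s (Gx ((s + t) +i* y)).
Proof.
move=> hG y0; have [[d _] _ _] := hG ((s + t) +i* y) y0.
by have := @derivesC_comp R (hslice G ((s + t) +i* y)) (fun s => s + t) s _ _ d (is_derive_shift t s); rewrite real_complex1 mul1r.
Qed.

Lemma fcoef_dx G Gx Gy n x0 (y : R) : C1on G Gx Gy -> 0 < y -> derivesC (fun x0 => fcoef G n x0 y) x0 (fcoef Gx n x0 y).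
Proof.
move=> hG y0.
have ab : x0 - 2 <= x0 + 2 by lra.
have [M _ hM] := rect_bound (C1on_ctsx hG) ab y0 (lexx y).
apply: (@cint_under R (fun s t => G ((s + t) +i* y) * expi (- nu n) t) (fun s t => Gx ((s + t) +i* y) * expi (- nu n) t) x0 (x0 - 1) (x0 + 1) M).
- by apply/andP; split; lra.
- by move=> s t _; apply: derivesCZr; exact: derivesC_hshift hG y0.
- by move=> s _; apply: ctsR_fcoef => //; exact: C1on_cts hG.
- move=> s t /andP[h1 h2] /andP[t1 t2]; rewrite normcM normc_expi mulr1; apply: hM; rewrite ?lexx //.
  by apply/andP; split; lra.
Qed.

Definition qper G := forall z, uhp z -> G (z + 1) = e2pi (k%:R / 12)%:C * G z.

Lemma qper_dx G Gx Gy : C1on G Gx Gy -> qper G -> qper Gx.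
Proof.
move=> hG pG z zu; have y0 : 0 < Im z := zu.
have E (x : R) : (x +i* Im z) + 1 = (x + 1) +i* Im z by apply: cplxP; rewrite ?ReD ?ImD /= ?addr0.
have d1 := derivesC_hshift 1 (Re z) hG y0.
have [[d2 _] _ _] := hG z zu.
have d3 := derivesCZ (e2pi (k%:R / 12)%:C) d2.
have := derivesC_unique d1 (derivesC_ext _ d3); rewrite -E -cplxE; apply => x.
by rewrite -E pG.
Qed.

(** Integration by parts: the boundary terms cancel because the factors e(k/12) and e(- n - k/12)
    between the two ends multiply to e(- n) = 1. *)
Lemma fcoef_parts G Gx Gy n x0 (y : R) : C1on G Gx Gy -> qper G -> 0 < y -> fcoef Gx n x0 y = dxcoef n * fcoef G n x0 y.
Proof.
move=> hG pG y0.
pose F t := G ((t + x0) +i* y) * expi (- nu n) t.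
have sw (H : C -> C) t : H ((x0 + t) +i* y) = H ((t + x0) +i* y) by rewrite addrC.
have c1 := ctsR_fcoef n x0 (C1on_ctsx hG) y0; have c2 := ctsR_fcoef n x0 (C1on_cts hG) y0.
have d t : derivesC F t (Gx ((x0 + t) +i* y) * expi (- nu n) t + (- dxcoef n) * (G ((x0 + t) +i* y) * expi (- nu n) t)).
  apply: derivesC_eq (derivesCM (derivesC_hshift x0 t hG y0) (derivesC_expi (- nu n) t)).
  rewrite !sw; congr (_ + _); rewrite /dxcoef rcN; move: (expi _ _) (G _) => a b; ring.
have := cint_ftc (ctsRD c1 (ctsRM (ctsR_cst (- dxcoef n)) c2)) d.
rewrite cintD //; last by apply: ctsRM => //; exact: ctsR_cst.
rewrite cintZ //.
have -> : F 2^-1 = F (- 2^-1).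
  rewrite /F; have -> : (2^-1 + x0) +i* y = ((- 2^-1 + x0) +i* y) + 1.
    apply: cplxP; rewrite ?ReD ?ImD /= ?addr0 //; lra.
  rewrite pG //.
  have -> : expi (- nu n) 2^-1 = expi (- nu n) (- 2^-1) * e2pi (- nu n)%:C.
    by rewrite /expi -e2piD -rcD; congr (e2pi _%:C); lra.
  rewrite -mulrA mulrCA [e2pi _ * _]mulrC -[expi _ _ * _ * _]mulrA -e2piD -rcD.
  have -> : - nu n + k%:R / 12 = - n%:~R by rewrite /freq; lra.
  by rewrite rcN e2piN [_%:C](_ : _ = n%:~R) ?e2pi_int ?invr1 ?mulr1 //; exact: (rmorph_int (@real_complex R)).
by rewrite subrr mulNr => /eqP; rewrite subr_eq0 => /eqP.
Qed.

(** By [fcoef_parts], the product with e(- nu x0) has derivative 0 in x0. *)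
Lemma fcoef_shift G Gx Gy n x0 (y : R) : C1on G Gx Gy -> qper G -> 0 < y -> fcoef G n x0 y = fcoef G n 0 y * expi (nu n) x0.
Proof.
move=> hG pG y0.
pose h (x : R) := fcoef G n x y * expi (- nu n) x.
have d x : Num.min 0 x0 - 1 < x -> derivesC h x 0.
  move=> _; apply: derivesC_eq (derivesCM (fcoef_dx n x hG y0) (derivesC_expi (- nu n) x)).
  rewrite (fcoef_parts n x hG pG y0) /dxcoef rcN; move: (fcoef _ _ _ _) (expi _ _) => a b; ring.
have m1 : Num.min 0 x0 - 1 < 0.
  by apply: lt_le_trans (_ : Num.min 0 x0 <= _); [rewrite ltrBlDr ltrDl | rewrite ge_min lexx].
have m2 : Num.min 0 x0 - 1 < x0.
  by apply: lt_le_trans (_ : Num.min 0 x0 <= _); [rewrite ltrBlDr ltrDl | rewrite ge_min lexx orbT].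
have := derivesC_cst_on d m2 m1; rewrite /h.
have -> : expi (- nu n) 0 = 1 :> C by rewrite /expi mulr0 e2pi0.
rewrite mulr1 => <-; rewrite -mulrA -expiD addNr expi0 mulr1 //.
Qed.

(** Let w1 and w2 be the constant Wronskians of u with M_{-r} and M_r. By Cramer's rule 2 i r u = w1
    M_r - w2 M_{-r}, and M_{-r} is then expressed through W and M_r because [wA l (- r)] is
    nonzero. *)
Lemma whit_sol_decomp l u du : whit_sol l r u du -> exists al be : C, forall t, 0 < t -> u t = al * wM l r t + be * wW l r t.
Proof.
move=> hu.
have hM := wM_sol l r0; have rN : - r != 0 by rewrite oppr_eq0.
have hM' := whit_solN (wM_sol l rN).
pose w1 := du 1 * wM l (- r) 1 - u 1 * dwM l (- r) 1.
pose w2 := du 1 * wM l r 1 - u 1 * dwM l r 1.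
have i0 : 2 * imu r != 0 by apply/eqP => h; have := Im_2imu r; rewrite h /= => /esym/eqP; rewrite mulf_eq0 pnatr_eq0 (negbTE r0).
have A0 := wA_neq0 l rN.
exists ((w1 + w2 * wA l r / wA l (- r)) / (2 * imu r)), (- w2 / wA l (- r) / (2 * imu r)) => t t0.
have e1 : du t * wM l (- r) t - u t * dwM l (- r) t = w1 by apply: wronskian_cst hu hM' _ _ _ _.
have e2 : du t * wM l r t - u t * dwM l r t = w2 by apply: wronskian_cst hu hM _ _ _ _.
have e3 := wronskian_wM l r0 t0.
rewrite wWE -e1 -e2; apply: (mulIf i0); rewrite -{1}e3.
move: (wA l r) (wA l (- r)) A0 (2 * imu r) i0 => a b b0 c c0.
move: (wM l r t) (wM l (- r) t) (dwM l r t) (dwM l (- r) t) (u t) (du t) => m m' d d' x y.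
by field; rewrite b0 c0.
Qed.

Section Form.
Variables (f fx fy fxx fxy fyx fyy : C -> C).
Hypotheses (hf : C1on f fx fy) (hfx : C1on fx fxx fxy) (hfy : C1on fy fyx fyy).
Hypothesis lap : forall z, uhp z -> (Im z)%:C ^+ 2 * (fxx z + fyy z)
  - Num.imaginary * k%:R * (Im z)%:C * fx z + (4^-1 + r ^+ 2)%:C * f z = 0.
Hypothesis per : qper f.
Hypothesis L2 : square_integrable f.

(** The eigenvalue equation is integrated against the exponential; the derivatives in x turn into
    factors by [fcoef_parts]. *)
Lemma fcoef_fyy n x0 (y : R) : 0 < y -> fcoef fyy n x0 y =
  (4 * pi ^+ 2 * nu n ^+ 2 - 2 * pi * k%:R * nu n / y - (4^-1 + r ^+ 2) / y ^+ 2)%:C * fcoef f n x0 y.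
Proof.
move=> y0; have yn : y%:C != 0 :> C by rewrite rc_eq0 gt_eqF.
have c1 := ctsR_fcoef n x0 (C1on_ctsx hfx) y0; have c2 := ctsR_fcoef n x0 (C1on_ctsx hf) y0.
have c3 := ctsR_fcoef n x0 (C1on_cts hf) y0.
have E : fcoef fyy n x0 y = - fcoef fxx n x0 y + (Num.imaginary * k%:R / y%:C * fcoef fx n x0 y + - ((4^-1 + r ^+ 2)%:C / y%:C ^+ 2) * fcoef f n x0 y).
  have c4 := ctsRM (ctsR_cst (Num.imaginary * k%:R / y%:C)) c2.
  have c5 := ctsRM (ctsR_cst (- ((4^-1 + r ^+ 2)%:C / y%:C ^+ 2))) c3; have c6 := ctsRM (ctsR_cst (- 1)) c1.
  rewrite -mulN1r /fcoef -(cintZ (- 1) c1) -(cintZ _ c2) -(cintZ _ c3) -(cintD c4 c5) -(cintD c6 (ctsRD c4 c5)).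
  apply: eq_cint => t _; have := lap (z := (x0 + t) +i* y) y0; rewrite /=.
  move: (expi _ _) (f _) (fx _) (fxx _) (fyy _) => e a b c d h.
  have -> : d = - c + Num.imaginary * k%:R / y%:C * b - (4^-1 + r ^+ 2)%:C / y%:C ^+ 2 * a.
    apply/eqP; rewrite -subr_eq0; apply/eqP; apply: (mulfI (expf_neq0 2 yn)).
    rewrite mulr0 -[RHS]h; move: (4^-1 + r ^+ 2)%:C Num.imaginary => la i.
    by field.
  ring.
rewrite E (fcoef_parts n x0 hfx (qper_dx hf per) y0) (fcoef_parts n x0 hf per y0) /dxcoef.
have i2 : Num.imaginary * Num.imaginary = -1 :> C by rewrite -expr2 sqrCi.
have -> : (4 * pi ^+ 2 * nu n ^+ 2 - 2 * pi * k%:R * nu n / y - (4^-1 + r ^+ 2) / y ^+ 2)%:C =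
  4 * pi%:C ^+ 2 * (nu n)%:C ^+ 2 - 2 * pi%:C * k%:R * (nu n)%:C / y%:C - (4^-1 + r ^+ 2)%:C / y%:C ^+ 2 :> C.
  by rewrite !rcB !rcM !rcV !rcX !rc_nat.
move: Num.imaginary i2 => i i2.
move: (fcoef f n x0 y) (y%:C) yn (nu n)%:C pi%:C (4^-1 + r ^+ 2)%:C (k%:R : C) => g w wn v p la kk.
apply/eqP; rewrite -subr_eq0; apply/eqP.
transitivity ((i * i + 1) * (2 * kk * p * v / w - 4 * p ^+ 2 * v ^+ 2) * g); last by rewrite i2; ring.
by field.
Qed.

Lemma fcoef_whit_sol n x0 : whit_sol (wparam k n) r (fun t => fcoef f n x0 (t / (4 * pi * `|nu n|)))
   (fun t => (4 * pi * `|nu n|)^-1%:C * fcoef fy n x0 (t / (4 * pi * `|nu n|))).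
Proof.
have a0 : 0 < 4 * pi * `|nu n| :> R by rewrite !mulr_gt0 ?(freq_norm_gt0 hk) ?pi_gt0.
have EA : exists a, a = 4 * pi * `|nu n| by eexists.
have [a Ea] := EA; rewrite -Ea in a0 *.
move=> t t0; have ta : 0 < t / a by rewrite divr_gt0.
have D (h : R -> C) (d : C) : derivesC h (t / a) d -> derivesC (fun t => h (t / a)) t (a^-1%:C * d).
  move=> dh; have := derivesC_comp (g := fun t => a^-1 * t) (t := t) (h := h) (d := d).
  rewrite mulrC in dh; move=> /(_ _ dh (is_derive_lin a^-1 t)).
  by apply: derivesC_ext => x; rewrite mulrC.
split; first by apply: D; exact: fcoef_dy hf ta.
have := derivesCZ a^-1%:C (D _ _ (fcoef_dy n x0 hfy ta)); apply: derivesC_eq.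
rewrite fcoef_fyy // /whit_pot.
have -> : 4^-1 - wparam k n / t - (4^-1 + r ^+ 2) / t ^+ 2 =
  a^-1 * (a^-1 * (4 * pi ^+ 2 * nu n ^+ 2 - 2 * pi * k%:R * nu n / (t / a) - (4^-1 + r ^+ 2) / (t / a) ^+ 2)).
  have an : a != 0 by rewrite gt_eqF.
  have tn : t != 0 by rewrite gt_eqF.
  have -> : 4 * pi ^+ 2 * nu n ^+ 2 = a ^+ 2 / 4.
    by rewrite Ea -[nu n ^+ 2]real_normK ?num_real //; field.
  have -> : 2 * pi * k%:R * nu n = a * wparam k n.
    by rewrite Ea /wparam [nu n in LHS]numEsg -pmulrn; field.
  by field; rewrite an tn.
rewrite !rcM; move: (fcoef _ _ _ _) => g; ring.
Qed.

(** The integrand |f|^2 / y^2 with y replaced by max(y, 1/2): it is continuous in each variable over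
    the whole plane and unchanged on the fundamental domain, where y >= 1/2. *)
Definition strip_density (x y : R) : R := normc (f (x +i* Num.max y 2^-1)) ^+ 2 / (Num.max y 2^-1) ^+ 2.

Lemma max_gt0 (y : R) : 0 < Num.max y 2^-1. Proof. by rewrite lt_max invr_gt0 ltr0n orbT. Qed.

Lemma strip_density_ge0 x y : 0 <= strip_density x y. Proof. by rewrite divr_ge0 // sqr_ge0. Qed.

Lemma strip_density_ctsx y : continuous (strip_density ^~ y).
Proof.
move=> x; apply: cvgM; last exact: cvg_cst.
have h : cvgc (nbhs x) (fun x => x +i* Num.max y 2^-1) (x +i* Num.max y 2^-1).
  by split => /=; [exact: cvg_id | exact: cvg_cst].
have c : {for x, continuous (fun x => normc (f (x +i* Num.max y 2^-1)))}.
  exact: (@cont_norm_comp R R f (fun x => x +i* Num.max y 2^-1) x (C1on_cts hf (z := x +i* Num.max y 2^-1) (max_gt0 y)) h).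
exact: (continuousM c c).
Qed.

Lemma strip_density_ctsy x : continuous (strip_density x).
Proof.
move=> y; have cm : {for y, continuous (fun y : R => Num.max y 2^-1)} by apply: continuous_max; [exact: cvg_id|exact: cvg_cst].
have n0 : Num.max y 2^-1 ^+ 2 != 0 :> R by rewrite expf_neq0 // gt_eqF // max_gt0.
apply: cvgM; last by apply: cvgV => //; exact: (continuousM cm cm).
have h : cvgc (nbhs y) (fun y => x +i* Num.max y 2^-1) (x +i* Num.max y 2^-1).
  by split => /=; [exact: cvg_cst | exact: cm].
have c : {for y, continuous (fun y : R => normc (f (x +i* Num.max y 2^-1)))}.
  exact: (@cont_norm_comp R R f (fun y => x +i* Num.max y 2^-1) y (C1on_cts hf (z := x +i* Num.max y 2^-1) (max_gt0 y)) h).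
exact: (continuousM c c).
Qed.

Lemma strip_density_fin : (\int[@lebesgue_measure R \x @lebesgue_measure R]_(p in (@fundamental_domain R : set (measurableTypeR R * measurableTypeR R))) (strip_density p.1 p.2)%:E < +oo)%E.
Proof.
rewrite (le_lt_trans _ L2) // le_eqVlt; apply/orP; left; apply/eqP; apply: eq_integral => p /set_mem hp.
by rewrite /strip_density max_l // FD_y.
Qed.

(** From |f| <= (1 + |f|^2) / 2, in place of the Cauchy-Schwarz inequality; the factor 2 of
    [cint_le] removes the halves. *)
Lemma fcoef_le n (y : R) : 2^-1 <= y -> normc (fcoef f n 0 y) <= 1 + y ^+ 2 * unit_int (strip_density ^~ y).
Proof.
move=> hy; have y0 : 0 < y by apply: lt_le_trans hy; rewrite invr_gt0.
have ch : continuous (fun x => 2^-1 + y ^+ 2 / 2 * strip_density x y).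
  move=> x; apply: cvgD; first exact: cvg_cst.
  by apply: cvgM; [exact: cvg_cst | exact: strip_density_ctsx].
have cz : continuous (fun x => y ^+ 2 / 2 * strip_density x y).
  by move=> x; apply: cvgM; [exact: cvg_cst | exact: strip_density_ctsx].
apply: le_trans (cint_le (ctsR_fcoef n 0 (C1on_cts hf) y0) ch _) _.
  move=> x _; rewrite normcM normc_expi mulr1 add0r /strip_density max_l //.
  have -> : y ^+ 2 / 2 * (normc (f (x +i* y)) ^+ 2 / y ^+ 2) = normc (f (x +i* y)) ^+ 2 / 2.
    by field; rewrite gt_eqF.
  have := sqr_ge0 (normc (f (x +i* y)) - 1); rewrite sqrrB1; lra.
rewrite unit_intD //; last by move=> x; exact: cvg_cst.
rewrite (unit_intZ _ (@strip_density_ctsx y)) unit_int_cst; move: (unit_int _) => w; lra.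
Qed.

(** Cube of exp(x/3) >= x/3. The third power is what beats the y^2 of [fcoef_le]. *)
Lemma expR_cube (x : R) : 0 <= x -> x ^+ 3 / 27 <= expR x.
Proof.
move=> x0; pose u := x / 3.
have -> : x ^+ 3 / 27 = u ^+ 3 by rewrite /u; field.
have -> : expR x = expR u ^+ 3 by rewrite -expRM_natl; congr expR; rewrite /u; field.
have u0 : 0 <= u by rewrite divr_ge0.
apply: lerXn2r; rewrite ?nnegrE ?expR_ge0 //.
by apply: le_trans (expR_ge1Dx _); lra.
Qed.

(** A component along M grows exponentially, hence at least like K y^3; then by [fcoef_le] the mean
    of |f|^2 / y^2 over the segment at height y is at least 1 for all large y, and its integral is
    infinite. *)
Lemma fcoef_W n : exists be : C, forall y, 0 < y -> fcoef f n 0 y = be * wW (wparam k n) r (4 * pi * `|nu n| * y).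
Proof.
have [al [be hab]] := whit_sol_decomp (fcoef_whit_sol n 0).
have a0 : 0 < 4 * pi * `|nu n| :> R by rewrite !mulr_gt0 ?(freq_norm_gt0 hk) ?pi_gt0.
have [a Ea] : exists a, a = 4 * pi * `|nu n| by eexists.
rewrite -Ea in a0 hab *.
have hg y : 0 < y -> fcoef f n 0 y = al * wM (wparam k n) r (a * y) + be * wW (wparam k n) r (a * y).
  by move=> y0; rewrite -hab ?mulr_gt0 //; congr fcoef; field; rewrite gt_eqF.
suff al0 : al = 0 by exists be => y /hg ->; rewrite al0 mul0r add0r.
apply/eqP; apply/negP => /negP al0.
have [A A0 [t1 [_ h1]]] := wM_lower (wparam k n) r0.
have [B B0 [t2 [_ h2]]] := wW_upper (wparam k n) r0.
have na : 0 < normc al by rewrite normc_gt0.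
pose D := normc be * B; have D0 : 0 <= D by rewrite mulr_ge0 ?normc_ge0 // ltW.
pose K := normc al * A * ((9 / 20 * a) ^+ 3 / 27).
have K0 : 0 < K by rewrite !mulr_gt0 ?exprn_gt0 ?mulr_gt0 ?invr_gt0.
(* Large enough for both asymptotic bounds and for K y >= 3 + D, where [D] bounds the contribution
   of W. *)
pose Y0 := 1 + `|t1| / a + `|t2| / a + (3 + D) / K.
have p1 : 0 <= `|t1| / a by rewrite divr_ge0 // ltW.
have p2 : 0 <= `|t2| / a by rewrite divr_ge0 // ltW.
have p3 : 0 <= (3 + D) / K by rewrite divr_ge0 ?addr_ge0 // ltW.
have Y1 : 1 <= Y0 by rewrite /Y0; lra.
apply: (strip_contra strip_density_ge0 strip_density_ctsx strip_density_ctsy Y1 strip_density_fin) => y yY.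
have y1 : 1 <= y by rewrite (le_trans Y1).
have y0 : 0 < y by rewrite (lt_le_trans _ y1).
have yh : 2^-1 <= y by lra.
have ay1 : t1 < a * y.
  apply: le_lt_trans (ler_norm t1) _; rewrite mulrC -ltr_pdivrMr //; move: yY; rewrite /Y0; lra.
have ay2 : t2 < a * y.
  apply: le_lt_trans (ler_norm t2) _; rewrite mulrC -ltr_pdivrMr //; move: yY; rewrite /Y0; lra.
have Ky : 3 + D <= K * y by rewrite mulrC -ler_pdivrMr //; move: yY; rewrite /Y0; lra.
have lowM : K * y ^+ 3 <= normc (al * wM (wparam k n) r (a * y)).
  rewrite normcM /K -!mulrA ler_pM2l //; apply: le_trans (h1 _ ay1); rewrite ler_pM2l //.
  have t0 : 0 <= 9 / 20 * (a * y) by rewrite !mulr_ge0 // ltW.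
  apply: le_trans (expR_cube t0); rewrite le_eqVlt; apply/orP; left; apply/eqP; ring.
have upW : normc (be * wW (wparam k n) r (a * y)) <= D.
  rewrite normcM ler_wpM2l ?normc_ge0 //; apply: le_trans (h2 _ ay2) _.
  rewrite ler_piMr ?(ltW B0) // -[leRHS]expR0 ler_expR mulNr oppr_le0 !mulr_ge0 // ltW //.
have := fcoef_le n yh; rewrite hg //.
have := lerB_normc (al * wM (wparam k n) r (a * y)) (- (be * wW (wparam k n) r (a * y))).
rewrite opprK normcN => b1 b2.
have yy : 1 <= y ^+ 2 by rewrite expr_ge1 // ltW.
have Ky3 : (3 + D) * y ^+ 2 <= K * y ^+ 3.
  have -> : K * y ^+ 3 = K * y * y ^+ 2 by ring.
  by apply: ler_wpM2r => //; exact: sqr_ge0.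
have DD : D <= D * y ^+ 2 by rewrite ler_peMr.
have : y ^+ 2 * 1 <= y ^+ 2 * unit_int (strip_density ^~ y).
  move: (unit_int (strip_density ^~ y)) b2 => w b2.
  have := le_trans b1 b2; lra.
by rewrite ler_pM2l // exprn_gt0.
Qed.

Lemma wW_lower2 : exists A t0 : R, 0 < A /\ forall n t, t0 < t -> A * expR (- (11 / 20) * t) <= normc (wW (wparam k n) r t).
Proof.
have [A A0 [t1 [_ h1]]] := wW_lower (k%:Z%:~R / 2) r0.
have [B B0 [t2 [_ h2]]] := wW_lower (- (k%:Z%:~R / 2)) r0.
exists (Num.min A B), (Num.max t1 t2); split; first by rewrite lt_min A0.
move=> n t; rewrite gt_max => /andP[g1 g2].
case: (@wparam_cases R k hk k n) => ->.
  by apply: le_trans (h1 _ g1); rewrite ler_wpM2r ?expR_ge0 // ge_min lexx.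
by apply: le_trans (h2 _ g2); rewrite ler_wpM2r ?expR_ge0 // ge_min lexx orbT.
Qed.

Lemma finite_bound (c : int -> C) (B : R) : exists D : R, 0 <= D /\ forall n, `|nu n| <= B -> normc (c n) <= D.
Proof.
pose N := (Num.bound `|B|).+1.
exists (\sum_(i < N) (normc (c i%:Z) + normc (c (- i.+1%:Z)))); split.
  by apply: sumr_ge0 => i _; rewrite addr_ge0 ?normc_ge0.
move=> n hn.
have bb : B < (Num.bound `|B|)%:R := le_lt_trans (ler_norm B) (archi_boundP (normr_ge0 _)).
have part (i : 'I_N) : normc (c i%:Z) + normc (c (- i.+1%:Z)) <= \sum_(i < N) (normc (c i%:Z) + normc (c (- i.+1%:Z))).
  rewrite (bigD1 i) //= lerDl; apply: sumr_ge0 => j _; by rewrite addr_ge0 ?normc_ge0.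
have lt_N (m : nat) : m%:R + 12^-1 <= `|nu n| -> (m < N)%N.
  move=> h; have : (m%:R : R) < (Num.bound `|B|)%:R.
    apply: le_lt_trans bb; apply: le_trans hn; apply: le_trans h; rewrite lerDl invr_ge0 //.
  by rewrite ltr_nat => /ltnW; rewrite ltnS.
case: n hn lt_N => m hn lt_N.
  have mN : (m < N)%N by apply: lt_N; have [] := @freq_abs R k hk m.
  by apply: le_trans (part (Ordinal mN)); rewrite /= lerDl normc_ge0.
rewrite NegzE in hn lt_N *.
have mN : (m < N)%N by apply: lt_N; have [] := @freq_abs R k hk m.
by apply: le_trans (part (Ordinal mN)); rewrite /= lerDr normc_ge0.
Qed.

Lemma wterm_iy n (y : R) : wterm k%:Z n (0 +i* y) = (Num.sqrt `|nu n|)^-1%:C * wW (wparam k n) r (4 * pi * `|nu n| * y).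
Proof. by rewrite wtermE /= mulr0 e2pi0 mulr1. Qed.

Lemma coef_subexp (c : int -> C) : (forall n y, 0 < y -> c n * wterm k%:Z n (0 +i* y) = fcoef f n 0 y) -> subexp c.
Proof.
move=> hc e e0; have p0 := pi_gt0 R.
have [A [t0 [A0 hA]]] := wW_lower2.
(* At this height the lower bound of W costs exp(11/25 e |nu|). The square root of |nu| takes exp(e
   |nu| / 2), and 11/25 + 1/2 < 1. *)
pose y := e / (5 * pi).
have y0 : 0 < y by rewrite divr_gt0 // mulr_gt0.
have hhalf : - 2^-1 <= 2^-1 :> R by lra.
have [M M0 hM] := rect_bound (C1on_cts hf) hhalf y0 (lexx y).
have [D [D0 hD]] := finite_bound c (`|t0| / (4 * pi * y)).
have fpy : 0 < 4 * pi * y by rewrite mulr_gt0 // mulr_gt0.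
exists (D + 2 * M / A * (1 + 2 / e)) => n.
have [h|h] := leP `|nu n| (`|t0| / (4 * pi * y)).
  apply: le_trans (hD n h) _; rewrite mulrDl.
  apply: le_trans (_ : D * expR (e * `|nu n|) <= _).
    by rewrite ler_peMr // -[leLHS]expR0 ler_expR mulr_ge0 // ltW.
  by rewrite lerDl !mulr_ge0 ?expR_ge0 ?invr_ge0 ?addr_ge0 ?mulr_ge0 ?invr_ge0 // ltW.
have nfreq : t0 < 4 * pi * `|nu n| * y.
  apply: le_lt_trans (ler_norm t0) _; move: h; rewrite ltr_pdivrMr //.
  by have -> : `|nu n| * (4 * pi * y) = 4 * pi * `|nu n| * y by ring.
have b1 : normc (fcoef f n 0 y) <= 2 * M.
  apply: cint_le_cst; first by apply: ctsR_fcoef; [exact: C1on_cts hf|].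
  by move=> x hx; rewrite normcM normc_expi mulr1 add0r; apply: hM; rewrite ?lexx.
move: b1; rewrite -hc // wterm_iy !normcM normcRE ger0_norm ?invr_ge0 ?sqrtr_ge0 // => b1.
have s0 : 0 < Num.sqrt `|nu n| by rewrite sqrtr_gt0 (freq_norm_gt0 hk).
have W := hA n _ nfreq.
have nc := normc_ge0 (c n).
have b2 : normc (c n) * (A * expR (- (11 / 20) * (4 * pi * `|nu n| * y))) <= 2 * M * Num.sqrt `|nu n|.
  rewrite -ler_pdivrMr // -[leLHS]mulrA; apply: le_trans b1; rewrite ler_wpM2l //.
  by rewrite mulrC ler_wpM2l // invr_ge0 ltW.
have E : - (11 / 20) * (4 * pi * `|nu n| * y) = - (11 / 25 * (e * `|nu n|)) by rewrite /y; have := lt0r_neq0 p0; move: (pi : R) => p pp; field.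
rewrite E in b2.
have sq : Num.sqrt `|nu n| <= (1 + 2 / e) * expR (e / 2 * `|nu n|).
  apply: le_trans (_ : 1 + `|nu n| <= _).
    have := sqr_ge0 (Num.sqrt `|nu n| - 1); rewrite sqrrB1 sqr_sqrtr // => q.
    have := normr_ge0 (nu n); have := ltW s0; lra.
  have ex := expR_ge1Dx (e / 2 * `|nu n|).
  have e2 : 0 <= 2 / e by rewrite divr_ge0 // ltW.
  rewrite mulrDl mul1r; apply: lerD; first by rewrite -[leLHS]expR0 ler_expR mulr_ge0 // divr_ge0 // ltW.
  apply: le_trans (_ : 2 / e * (e / 2 * `|nu n|) <= _); last by rewrite ler_wpM2l //; lra.
  by rewrite mulrA (_ : 2 / e * (e / 2) = 1) ?mul1r //; field; rewrite gt_eqF.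
have b3 : normc (c n) <= 2 * M * Num.sqrt `|nu n| / A * expR (11 / 25 * (e * `|nu n|)).
  move: b2; rewrite mulrA expRN -ler_pdivlMr ?invr_gt0 ?expR_gt0 // invrK -ler_pdivlMr //.
  by move=> b2; apply: le_trans b2 _; rewrite le_eqVlt; apply/orP; left; apply/eqP; ring.
apply: le_trans b3 _; rewrite [leRHS]mulrDl; apply: le_trans (_ : 2 * M / A * (1 + 2 / e) * expR (e * `|nu n|) <= _); last first.
  by rewrite lerDr mulr_ge0 ?expR_ge0.
have AV : 0 <= 2 * M / A by rewrite !mulr_ge0 ?invr_ge0 // ltW.
have -> : 2 * M * Num.sqrt `|nu n| / A * expR (11 / 25 * (e * `|nu n|)) = 2 * M / A * (Num.sqrt `|nu n| * expR (11 / 25 * (e * `|nu n|))) by ring.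
rewrite -[leRHS]mulrA ler_wpM2l //.
apply: le_trans (_ : (1 + 2 / e) * expR (e / 2 * `|nu n|) * expR (11 / 25 * (e * `|nu n|)) <= _).
  by rewrite ler_wpM2r ?expR_ge0.
rewrite -[leLHS]mulrA ler_wpM2l ?addr_ge0 ?divr_ge0 ?(ltW e0) // -expRD ler_expR.
have : 0 <= e * `|nu n| by rewrite mulr_ge0 // ltW.
lra.
Qed.

(* Square integrability excludes the growing solution of Whittaker's equation,
   and Fejer's theorem sums the Fourier series. *)
Lemma fourier_main : exists c : int -> C, [/\ subexp c,
  forall z, uhp z -> f z = wser k r k%:Z c z
  & forall n y, 0 < y -> c n * wterm k%:Z n (0 +i* y) = fcoef f n 0 y].
Proof.
have [be hbe] := choice fcoef_W.
pose c n := be n * (Num.sqrt `|nu n|)%:C.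
have hc n y : 0 < y -> c n * wterm k%:Z n (0 +i* y) = fcoef f n 0 y.
  move=> y0; rewrite wterm_iy hbe // /c rcV.
  have s0 : (Num.sqrt `|nu n|)%:C != 0 :> C by rewrite rc_eq0 gt_eqF // sqrtr_gt0 (freq_norm_gt0 hk).
  by move: (wW _ _ _) (_%:C) s0 (be n) => w s s0 b; field.
have sc := coef_subexp hc.
exists c; split => // z zu; have y0 : 0 < Im z := zu.
(* The factor e(- k t / 12) turns frequencies n + k/12 into integers, so the Fejer coefficients of
   [F] are the [fcoef] of f at the base point Re z. *)
pose F t := f ((Re z + t) +i* Im z) * expi (- (k%:R / 12)) t.
have cF : ctsR F by apply: ctsRM; [exact: ctsR_h (C1on_cts hf) y0 | exact: ctsR_expi].
have eF n : fejer_coef F n = c n * wterm k%:Z n z.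
  transitivity (fcoef f n (Re z) (Im z)).
    have En : - nu n = - (k%:R / 12) + - n%:~R by rewrite /freq opprD addrC.
    by rewrite /fejer_coef /fcoef; apply: eq_cint => t _; rewrite /F -mulrA -expiD En.
  rewrite (fcoef_shift n (Re z) hf per y0) -hc // -mulrA; congr (_ * _).
  by rewrite wterm_iy wtermE.
have E0 : F 0 = f z by rewrite /F addr0 -cplxE /expi mulr0 e2pi0 mulr1.
rewrite -E0 (fejer_sumZ cF); first exact: eq_sumZ.
exact: eq_summableZ (fun n => esym (eF n)) (summableZ_wterm hk r0 k%:Z sc zu).
Qed.

End Form.
End Fourier.

(* Petersson's exponent for eta^2, modulo 12, in a form without case
   distinction on c; it still makes sense when the determinant is only 1 mod N. *)
Definition etaexp0 (R : comRingType) (a b c d : R) : R :=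
  (1 - c ^+ 2) * (b * d + 3 * (c - 1) * d + c + 3) + c * (a + d - 3).

Fact etaexp_key : unit. Proof. exact: tt. Qed.
Definition etaexp (R : comRingType) (a b c d : R) : R := locked_with etaexp_key (etaexp0 a b c d).
Lemma etaexpE (R : comRingType) (a b c d : R) : etaexp a b c d = etaexp0 a b c d.
Proof. by rewrite /etaexp locked_withE. Qed.

(** * The eta multiplier *)

Section ModularGroup.

(** Euclid's algorithm on the first column: powers of T reduce a modulo c, S exchanges the rows up
    to sign, and |c| decreases. *)
Lemma gen_ind (Q : int -> int -> int -> int -> Prop) :
  Q 1 0 0 1 ->
  (forall a b c d, Q a b c d -> Q (- c) (- d) a b) ->
  (forall a b c d, Q a b c d -> Q (a + c) (b + d) c d) ->
  (forall a b c d, Q a b c d -> Q (a - c) (b - d) c d) ->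
  forall a b c d, a * d - b * c = 1 -> Q a b c d.
Proof.
move=> Q1 QS QT QT'.
have QTn (n : nat) a b c d : Q a b c d -> Q (a + n%:Z * c) (b + n%:Z * d) c d.
  elim: n => [|n IH] h; first by rewrite !mul0r !addr0.
  have := QT _ _ _ _ (IH h); congr Q; rewrite !intS; ring.
have QTn' (n : nat) a b c d : Q a b c d -> Q (a - n%:Z * c) (b - n%:Z * d) c d.
  elim: n => [|n IH] h; first by rewrite !mul0r !subr0.
  have := QT' _ _ _ _ (IH h); congr Q; rewrite !intS; ring.
have QTz (n : int) a b c d : Q a b c d -> Q (a + n * c) (b + n * d) c d.
  case: n => n; first exact: QTn.
  by move=> /(QTn' n.+1); rewrite NegzE !mulNr.
(* S has order 4, so three applications of the rule for S undo one. *)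
have QS' a b c d : Q (- c) (- d) a b -> Q a b c d.
  by move=> /QS/QS/QS; rewrite !opprK.
have QN a b c d : Q a b c d -> Q (- a) (- b) (- c) (- d) by move=> /QS/QS.
suff: forall n (a b c d : int), (`|c| < n)%N -> a * d - b * c = 1 -> Q a b c d.
  by move=> h a b c d; apply: (h `|c|.+1).
elim=> // n IH a b c d cn e.
have [c0|c0] := eqVneq c 0.
  have ad : a * d = 1 by rewrite -e c0; ring.
  have hb : forall b' : int, Q 1 b' 0 1.
    by move=> b'; have := QTz b' _ _ _ _ Q1; rewrite mulr0 addr0 mulr1 add0r.
  have [[-> ->]|[-> ->]] : (a = 1 /\ d = 1) \/ (a = - 1 /\ d = - 1).
    have /eqP : (`|a| * `|d|)%N = 1%N by rewrite -abszM ad.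
    rewrite muln_eq1 => /andP[/eqP ha /eqP hd].
    have [h|h] : a = 1 \/ a = - 1 by lia.
      by left; split => //; move: ad; rewrite h mul1r.
    by right; split => //; move: ad; rewrite h mulN1r => <-; rewrite opprK.
  - by rewrite c0.
  - by have := QN _ _ _ _ (hb (- b)); rewrite c0 opprK oppr0.
have := divz_eq a c; set q := (a %/ c)%Z; set s := (a %% c)%Z => ea.
have s0 : 0 <= s by rewrite modz_ge0.
have sc : s < `|c| by rewrite ltz_mod.
have : Q s (b - q * d) c d.
  apply: QS'; apply: IH.
    by move: s0 sc cn; lia.
  by rewrite -e ea; ring.
by move=> /(QTz q); congr Q; rewrite ?ea; ring.
Qed.

End ModularGroup.

(** * Congruences for Petersson's exponent *)

Section Congruences.

Lemma dvdz_Zp (p : nat) (x : int) : (1 < p)%N -> (p %| x)%Z = (x%:~R == 0 :> 'Z_p).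
Proof.
move=> p1; rewrite {2}(divz_eq x p) rmorphD rmorphM /=.
have -> : (p%:Z%:~R : 'Z_p) = 0 by rewrite -pmulrn; exact: (pchar_Zp p1).
rewrite mulr0 add0r.
have m0 : 0 <= (x %% p)%Z by rewrite modz_ge0 //; case: (p) p1.
have mp : (x %% p)%Z < p by rewrite ltz_pmod //; case: (p) p1.
have -> : (p %| x)%Z = ((x %% p)%Z == 0) by apply/dvdz_mod0P/eqP.
move: (x %% p)%Z m0 mp => [m|//] _ mp; rewrite -pmulrn.
rewrite -[RHS](inj_eq val_inj) /= val_Zp_nat // modn_small //.
Qed.

(** The effect of multiplying by T and S from the left, then by T and S from the right: T adds 1 and
    S subtracts 3. *)
Definition etaexp_rules (R : comRingType) (a b c d : R) : Prop :=
  [/\ etaexp (a + c) (b + d) c d - etaexp a b c d - 1 = 0, etaexp (- c) (- d) a b - etaexp a b c d + 3 = 0,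
      etaexp a (a + b) c (c + d) - etaexp a b c d - 1 = 0 & etaexp b (- a) d (- c) - etaexp a b c d + 3 = 0].

Definition etaexp_rules_mod (p : nat) : Prop := forall a b c d : 'Z_p, a * d - b * c = 1 -> etaexp_rules a b c d.

(** Reduces the rules modulo p to a finite computation over all quadruples, run on the unlocked
    [etaexp0]. *)
Lemma etaexp_rules_mod_bool p : all (fun a => all (fun b => all (fun c => all (fun d =>
   (a * d - b * c == 1 :> 'Z_p) ==> [&& etaexp0 (a + c) (b + d) c d - etaexp0 a b c d - 1 == 0, etaexp0 (- c) (- d) a b - etaexp0 a b c d + 3 == 0,
      etaexp0 a (a + b) c (c + d) - etaexp0 a b c d - 1 == 0 & etaexp0 b (- a) d (- c) - etaexp0 a b c d + 3 == 0])
   (map inZp (iota 0 (Zp_trunc p).+2))) (map inZp (iota 0 (Zp_trunc p).+2))) (map inZp (iota 0 (Zp_trunc p).+2))) (map inZp (iota 0 (Zp_trunc p).+2)) -> etaexp_rules_mod p.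
Proof.
have io (x : 'Z_p) : x \in map inZp (iota 0 (Zp_trunc p).+2).
  by apply/mapP; exists (x : nat); rewrite ?mem_iota ?ltn_ord // valZpK.
move=> /allP h a b c d e.
have /allP/(_ b (io b))/allP/(_ c (io c))/allP/(_ d (io d)) := h a (io a).
by rewrite e eqxx -!etaexpE => /and4P[/eqP ? /eqP ? /eqP ? /eqP ?]; split.
Qed.

Lemma etaexp_rules_mod2 : etaexp_rules_mod 2. Proof. by apply: etaexp_rules_mod_bool; vm_compute. Qed.
Lemma etaexp_rules_mod3 : etaexp_rules_mod 3. Proof. by apply: etaexp_rules_mod_bool; vm_compute. Qed.
Lemma etaexp_rules_mod4 : etaexp_rules_mod 4. Proof. by apply: etaexp_rules_mod_bool; vm_compute. Qed.

Lemma etaexp_intr (R : comRingType) (a b c d : int) : (etaexp a b c d)%:~R = etaexp (a%:~R : R) b%:~R c%:~R d%:~R.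
Proof.
have e3 : (3 : int)%:~R = 3 :> R by [].
by rewrite !etaexpE /etaexp0 !expr2 !(intrD, intrM, mulrNz, e3).
Qed.

Lemma etaexp_rules_Zp (p : nat) (a b c d : int) : (1 < p)%N -> etaexp_rules_mod p -> (p %| a * d - b * c - 1)%Z ->
  [/\ (p %| etaexp (a + c) (b + d) c d - etaexp a b c d - 1)%Z, (p %| etaexp (- c) (- d) a b - etaexp a b c d + 3)%Z,
      (p %| etaexp a (a + b) c (c + d) - etaexp a b c d - 1)%Z & (p %| etaexp b (- a) d (- c) - etaexp a b c d + 3)%Z].
Proof.
move=> p1 chk; rewrite !dvdz_Zp //.
have e3 : 1 + (1 + 1) = 3 :> 'Z_p by [].
rewrite !intrD !mulrNz !intrM subr_eq0 => /eqP /chk[h1 h2 h3 h4].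
by rewrite !etaexp_intr !intrD !mulrNz !mulr1z e3 h1 h2 h3 h4.
Qed.

Lemma dvd12 (k : nat) (x : int) : (12 %| k%:Z * x)%Z = (4 %| k%:Z * x)%Z && (3 %| k%:Z * x)%Z.
Proof. by rewrite (Gauss_dvdz (m := 4) (n := 3)). Qed.

Lemma dvd3k (k : nat) (x : int) : (3 %| k%:Z * x)%Z = (3 %| k)%N || (3 %| x)%Z.
Proof. by rewrite !dvdzE abszM Euclid_dvdM. Qed.

Lemma dvd4k (k : nat) (x : int) : (4 %| k%:Z * x)%Z = (4 %| k)%N || ((2 %| k)%N && (2 %| x)%Z) || (4 %| x)%Z.
Proof.
rewrite !dvdzE abszM /=; move: `|x|%N => {x}y.
have red (m n : nat) : (4 %| m * n)%N = (4 %| (m %% 4) * (n %% 4))%N by rewrite /dvdn modnMm.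
have r2 (m : nat) : (2 %| m)%N = (2 %| m %% 4)%N by rewrite /dvdn modn_dvdm.
have r4 (m : nat) : (4 %| m)%N = (4 %| m %% 4)%N by rewrite /dvdn modn_mod.
rewrite red (r2 k) (r2 y) (r4 k) (r4 y).
have : (k %% 4 < 4)%N by rewrite ltn_mod.
have : (y %% 4 < 4)%N by rewrite ltn_mod.
by move: (y %% 4)%N (k %% 4)%N => [|[|[|[|//]]]] [|[|[|[|//]]]].
Qed.

(** After multiplication by k, divisibility by 12 splits into the moduli 3 and 4, either of which
    disappears when it divides k, while 4 weakens to 2 when k is even. In each case the hypothesis
    gives determinant 1 for exactly the modulus that remains. *)
Lemma etaexp_rules12 (k : nat) (a b c d : int) : (12 %| k%:Z * (a * d - b * c - 1))%Z ->
  [/\ (12 %| k%:Z * (etaexp (a + c) (b + d) c d - etaexp a b c d - 1))%Z, (12 %| k%:Z * (etaexp (- c) (- d) a b - etaexp a b c d + 3))%Z,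
      (12 %| k%:Z * (etaexp a (a + b) c (c + d) - etaexp a b c d - 1))%Z & (12 %| k%:Z * (etaexp b (- a) d (- c) - etaexp a b c d + 3))%Z].
Proof.
rewrite !dvd12 !dvd3k !dvd4k => /andP[h4 h3].
have H3 : [/\ (3 %| k)%N || (3 %| etaexp (a + c) (b + d) c d - etaexp a b c d - 1)%Z, (3 %| k)%N || (3 %| etaexp (- c) (- d) a b - etaexp a b c d + 3)%Z,
      (3 %| k)%N || (3 %| etaexp a (a + b) c (c + d) - etaexp a b c d - 1)%Z & (3 %| k)%N || (3 %| etaexp b (- a) d (- c) - etaexp a b c d + 3)%Z].
  case/orP: h3 => [->//|h]; have [a1 a2 a3 a4] := @etaexp_rules_Zp 3 a b c d isT etaexp_rules_mod3 h.
  by rewrite a1 a2 a3 a4 !orbT.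
have H4 : let t (x : int) := (4 %| k)%N || ((2 %| k)%N && (2 %| x)%Z) || (4 %| x)%Z in
   [/\ t (etaexp (a + c) (b + d) c d - etaexp a b c d - 1), t (etaexp (- c) (- d) a b - etaexp a b c d + 3),
      t (etaexp a (a + b) c (c + d) - etaexp a b c d - 1) & t (etaexp b (- a) d (- c) - etaexp a b c d + 3)].
  case/orP: h4 => [/orP[->//|/andP[k2 h]]|h] /=.
    have [a1 a2 a3 a4] := @etaexp_rules_Zp 2 a b c d isT etaexp_rules_mod2 h.
    by rewrite k2 a1 a2 a3 a4 !orbT.
  have [a1 a2 a3 a4] := @etaexp_rules_Zp 4 a b c d isT etaexp_rules_mod4 h.
  by rewrite a1 a2 a3 a4 !orbT.
by case: H3 => -> -> -> ->; case: H4 => -> -> -> ->.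
Qed.

End Congruences.

(** * The multiplier on matrices of determinant 1 modulo N *)

Section Multiplier.
Context {R : realType}.
Local Notation C := R[i].
Variable k : nat.

Definition root12 (x : int) : C := locked_with etaexp_key (e2pi (x%:~R / 12 : R)%:C).
Lemma root12E x : root12 x = e2pi (x%:~R / 12 : R)%:C.
Proof. by rewrite /root12 locked_withE. Qed.

Lemma root12D x y : root12 (x + y) = root12 x * root12 y.
Proof. by rewrite !root12E rmorphD /= mulrDl rcD e2piD. Qed.

Lemma root12_dvd (x y : int) : (12 %| x - y)%Z -> root12 x = root12 y.
Proof.
move=> /dvdzP[q e]; have -> : x = y + q * 12 by rewrite -e; ring.
have h : root12 (q * 12) = 1.
  rewrite root12E intrM mulfK // [_%:C](_ : _ = q%:~R) ?e2pi_int //; exact: (rmorph_int (@real_complex R)).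
by rewrite root12D h mulr1.
Qed.

Lemma root12_0 : root12 0 = 1. Proof. by rewrite root12E mul0r e2pi0. Qed.
Lemma normc_root12 x : normc (root12 x) = 1. Proof. by rewrite root12E; exact: normc_e2pi_real. Qed.
Lemma root12_neq0 x : root12 x != 0. Proof. by rewrite root12E; exact: e2pi_neq0. Qed.
Lemma root12N x : root12 (- x) = (root12 x)^-1.
Proof. by apply: (mulfI (root12_neq0 x)); rewrite -root12D subrr root12_0 divff ?root12_neq0. Qed.
Lemma root12X x n : root12 (x *+ n) = root12 x ^+ n.
Proof. by elim: n => [|n IH]; rewrite ?root12_0 // mulrS exprS root12D IH. Qed.

(** Agrees with the eta multiplier on SL(2,Z) by [v_etav], and still makes sense on the matrices of
    the Hecke operators. *)
Definition etav (a b c d : int) : C := locked_with etaexp_key (root12 (k%:Z * etaexp a b c d)).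
Lemma etavE a b c d : etav a b c d = root12 (k%:Z * etaexp a b c d).
Proof. by rewrite /etav locked_withE. Qed.

(* That is, the determinant is 1 mod N. *)
Definition det_mod (a b c d : int) := (12 %| k%:Z * (a * d - b * c - 1))%Z.

Lemma etav_rules a b c d : det_mod a b c d ->
  [/\ etav (a + c) (b + d) c d = root12 k%:Z * etav a b c d, etav (- c) (- d) a b = root12 (- (k%:Z * 3)) * etav a b c d,
      etav a (a + b) c (c + d) = root12 k%:Z * etav a b c d & etav b (- a) d (- c) = root12 (- (k%:Z * 3)) * etav a b c d].
Proof.
move=> /etaexp_rules12[h1 h2 h3 h4]; rewrite !etavE -!root12D; split; apply: root12_dvd.
- by move: h1; congr (12 %| _)%Z; ring.
- by move: h2; congr (12 %| _)%Z; ring.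
- by move: h3; congr (12 %| _)%Z; ring.
- by move: h4; congr (12 %| _)%Z; ring.
Qed.

Lemma det_det_mod a b c d : a * d - b * c = 1 -> det_mod a b c d.
Proof. by rewrite /det_mod => ->; rewrite subrr mulr0 dvdz0. Qed.

Lemma etav1 : etav 1 0 0 1 = 1.
Proof. by rewrite etavE (_ : etaexp _ _ _ _ = 0) ?mulr0 ?root12_0 // etaexpE /etaexp0; ring. Qed.

(** Induction on the left factor through generators; the rules ask of the right factor just the
    congruence of its determinant, which the left factor preserves. *)
Lemma etav_mul a b c d a' b' c' d' : a * d - b * c = 1 -> det_mod a' b' c' d' ->
  etav (a * a' + b * c') (a * b' + b * d') (c * a' + d * c') (c * b' + d * d') = etav a b c d * etav a' b' c' d'.
Proof.
move=> h h'.
pose Q a b c d := etav (a * a' + b * c') (a * b' + b * d') (c * a' + d * c') (c * b' + d * d') = etav a b c d * etav a' b' c' d' /\ a * d - b * c = 1.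
have dk x y u w : x * w - y * u = 1 -> det_mod (x * a' + y * c') (x * b' + y * d') (u * a' + w * c') (u * b' + w * d').
  move=> e; rewrite /det_mod [X in _ * (X - 1)](_ : _ = (x * w - y * u) * (a' * d' - b' * c')); last by ring.
  by rewrite e mul1r.
suff [] : Q a b c d by [].
move: a b c d h; apply: gen_ind; rewrite /Q.
- by rewrite !mul1r !mul0r !addr0 !add0r etav1 mul1r; split.
- move=> a b c d [e dt]; split; last by rewrite -dt; ring.
  have [_ r1 _ _] := etav_rules (dk _ _ _ _ dt); have [_ r2 _ _] := etav_rules (det_det_mod dt).
  have e1 x y : - c * x + - d * y = - (c * x + d * y) by ring.
  by rewrite r2 -mulrA -e -r1 !e1.
- move=> a b c d [e dt]; split; last by rewrite -dt; ring.
  have [r1 _ _ _] := etav_rules (dk _ _ _ _ dt); have [r2 _ _ _] := etav_rules (det_det_mod dt).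
  have e1 x y : (a + c) * x + (b + d) * y = (a * x + b * y) + (c * x + d * y) by ring.
  by rewrite r2 -mulrA -e -r1 !e1.
- move=> a b c d [e dt]; have dt' : (a - c) * d - (b - d) * c = 1 by rewrite -dt; ring.
  split => //; apply: (mulfI (root12_neq0 k%:Z)).
  have [r1 _ _ _] := etav_rules (dk _ _ _ _ dt'); have [r2 _ _ _] := etav_rules (det_det_mod dt').
  have e1 x y : (a - c) * x + (b - d) * y + (c * x + d * y) = a * x + b * y by ring.
  by rewrite mulrA -r1 -r2 !subrK -e !e1.
Qed.

End Multiplier.

(** * Moebius transformations, phases and the value eta(i) *)

Section Moebius.
Context {R : realType}.
Local Notation C := R[i].
Implicit Types (a b c d : int) (z : C).

Definition cdfac c d z : C := c%:~R * z + d%:~R.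
Definition mob a b c d z : C := (a%:~R * z + b%:~R) / cdfac c d z.

Lemma Im_cdfac c d z : Im (cdfac c d z) = c%:~R * Im z.
Proof. by rewrite /cdfac -!rc_int ImD ImZ /= addr0. Qed.
Lemma Re_cdfac c d z : Re (cdfac c d z) = c%:~R * Re z + d%:~R.
Proof. by rewrite /cdfac -!rc_int ReD ReZ. Qed.

Lemma cdfac_neq0 c d z : uhp z -> (c != 0) || (d != 0) -> cdfac c d z != 0.
Proof.
move=> zu cd; apply/eqP => h.
have := Im_cdfac c d z; rewrite h /= => /esym/eqP; rewrite mulf_eq0 intr_eq0 (gt_eqF zu) orbF => /eqP c0.
have := Re_cdfac c d z; rewrite h c0 /= mul0r add0r => /esym/eqP; rewrite intr_eq0 => d0.
by move: cd; rewrite c0 d0 eqxx.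
Qed.

Lemma det_cd a b c d : a * d - b * c != 0 -> (c != 0) || (d != 0).
Proof. by apply: contraNT; rewrite negb_or !negbK => /andP[/eqP -> /eqP ->]; rewrite !mulr0 subrr. Qed.

Lemma Im_divc (u w : C) : w != 0 -> Im (u / w) = (Im u * Re w - Re u * Im w) / normc w ^+ 2.
Proof.
move=> w0; have n0 : normc w ^+ 2 != 0 by rewrite expf_neq0 // normc_eq0.
have -> : u / w = (normc w ^+ 2)^-1%:C * (u * conjc w).
  rewrite rcV -mulc_conj; have c0 : conjc w != 0 by rewrite conjc_eq0.
  by field; rewrite w0 c0.
rewrite ImZ ImMc mulrC; congr (_ / _); case: (u) (w) => ? ? [? ?] /=; ring.
Qed.

Lemma Im_mob a b c d z : uhp z -> (c != 0) || (d != 0) ->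
  Im (mob a b c d z) = (a * d - b * c)%:~R * Im z / normc (cdfac c d z) ^+ 2.
Proof.
move=> zu cd; rewrite Im_divc ?cdfac_neq0 //; congr (_ / _).
rewrite Re_cdfac Im_cdfac -!rc_int ImD ReD ImZ ReZ /= addr0 rmorphB !rmorphM /=; ring.
Qed.

Lemma mob_uhp a b c d z : uhp z -> 0 < a * d - b * c -> uhp (mob a b c d z).
Proof.
move=> zu h; have cd := det_cd (lt0r_neq0 h).
rewrite /uhp /= Im_mob // divr_gt0 ?exprn_gt0 ?normc_gt0 ?cdfac_neq0 // mulr_gt0 // ltr0z //.
Qed.

Lemma cdfac_comp c d a' b' c' d' z : cdfac c' d' z != 0 ->
  cdfac (c * a' + d * c') (c * b' + d * d') z = cdfac c d (mob a' b' c' d' z) * cdfac c' d' z.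
Proof.
rewrite /cdfac /mob /cdfac => h; rewrite !intrD !intrM.
by field.
Qed.

Lemma mob_comp a b c d a' b' c' d' z : cdfac c' d' z != 0 -> cdfac c d (mob a' b' c' d' z) != 0 ->
  mob (a * a' + b * c') (a * b' + b * d') (c * a' + d * c') (c * b' + d * d') z = mob a b c d (mob a' b' c' d' z).
Proof.
move=> h1 h2; have E := cdfac_comp c d a' b' h1.
rewrite {1}/mob E /(mob a b); apply: (mulIf (mulf_neq0 h2 h1)); rewrite divfK ?mulf_neq0 //.
rewrite mulrA divfK // /mob mulrDl -mulrA divfK // !intrD !intrM /cdfac; ring.
Qed.

Lemma mob_T z : mob 1 1 0 1 z = z + 1.
Proof. by rewrite /mob /cdfac !mul1r mul0r add0r divr1. Qed.

(** This is e^(i Arg(c z + d)) by [cexp_Arg]; being algebraic it obeys the cocycle relation without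
    any choice of branch. *)
Definition phase c d z : C := cdfac c d z / (normc (cdfac c d z))%:C.

Lemma normc_phase c d z : cdfac c d z != 0 -> normc (phase c d z) = 1.
Proof.
by move=> h; rewrite /phase normcM normcV normcRE ger0_norm ?normc_ge0 // divff // normc_eq0.
Qed.

Lemma phase_neq0 c d z : cdfac c d z != 0 -> phase c d z != 0.
Proof. by move=> h; rewrite -normc_gt0 normc_phase. Qed.

Lemma phase_comp c d a' b' c' d' z : cdfac c' d' z != 0 ->
  phase (c * a' + d * c') (c * b' + d * d') z = phase c d (mob a' b' c' d' z) * phase c' d' z.
Proof. by move=> h; rewrite /phase cdfac_comp // normcM rcM; rewrite invfM; ring. Qed.

Lemma cexp_Arg (w : C) : w != 0 -> cexp (Num.imaginary * (Arg w)%:C) = w / (normc w)%:C.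
Proof.
move=> w0; have n0 : 0 < normc w by rewrite normc_gt0.
set x := Re w / normc w; set y := Im w / normc w.
have E : w / (normc w)%:C = x +i* y.
  by rewrite mulrC -rcV; apply: cplxP; rewrite ?ReZ ?ImZ /= mulrC.
have xy : x ^+ 2 + y ^+ 2 = 1.
  by rewrite /x /y !expr_div_n -mulrDl -normc_sqr divff // expf_neq0 // gt_eqF.
have x1 : -1 <= x <= 1.
  rewrite -ler_norml -(@expr_le1 _ 2) // -normrX ger0_norm ?sqr_ge0 //.
  by rewrite -xy lerDl sqr_ge0.
rewrite E [_ * _%:C](_ : _ = 0 +i* Arg w); last first.
  by rewrite -[Num.imaginary]/(0 +i* 1); apply: cplxP; rewrite ?ReMc ?ImMc /=; ring.
rewrite cexp_imag /Arg.
have c1 : cos (acos x) = x by rewrite acosK // in_itv.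
have s1 : sin (acos x) = `|y|.
  by rewrite sin_acos // -xy addrAC subrr add0r sqrtr_sqr.
case: ifPn => h; apply: cplxP => /=; rewrite ?cosN ?sinN ?c1 ?s1 //.
  by rewrite ger0_norm // divr_ge0 // normc_ge0.
rewrite -ltNge in h; rewrite ler0_norm ?opprK // mulr_le0_ge0 ?invr_ge0 ?normc_ge0 //; exact: ltW.
Qed.

Lemma cexp_kArg (k : nat) (w : C) : w != 0 -> cexp (Num.imaginary * k%:R * (Arg w)%:C) = (w / (normc w)%:C) ^+ k.
Proof. by move=> w0; rewrite -cexp_Arg // -cexpMn; congr cexp; ring. Qed.

Definition mx2 a b c d : 'M[int]_2 := \matrix_(i, j) (if i == 0 then if j == 0 then a else b else if j == 0 then c else d).

Lemma mx2E (g : 'M[int]_2) : g = mx2 (g 0 0) (g 0 1) (g 1 0) (g 1 1).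
Proof.
apply/matrixP => i j; rewrite mxE.
have h (x : 'I_2) : x = 0 \/ x = 1.
  by case: x => [[|[|//]] p]; [left|right]; apply: val_inj.
by case: (h i) => ->; case: (h j) => ->.
Qed.

Lemma det_mx2 a b c d : \det (mx2 a b c d) = a * d - b * c.
Proof.
rewrite (expand_det_row _ 0) !big_ord_recl big_ord0 addr0 /cofactor !det_mx11 !mxE /= !expr0 !expr1.
rewrite /bump /=; ring.
Qed.

Lemma mul_mx2 a b c d a' b' c' d' : mx2 a b c d *m mx2 a' b' c' d' =
  mx2 (a * a' + b * c') (a * b' + b * d') (c * a' + d * c') (c * b' + d * d').
Proof.
apply/matrixP => i j; rewrite !mxE !big_ord_recl big_ord0 addr0 !mxE /=.
have h (x : 'I_2) : x = 0 \/ x = 1.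
  by case: x => [[|[|//]] p]; [left|right]; apply: val_inj.
by case: (h i) => ->; case: (h j) => ->.
Qed.

Lemma moebius_mx2 a b c d z : moebius (mx2 a b c d) z = mob a b c d z.
Proof. by rewrite /moebius /autj !mxE. Qed.
Lemma autj_mx2 a b c d z : autj (mx2 a b c d) z = cdfac c d z.
Proof. by rewrite /autj !mxE. Qed.

Lemma eta_shift z : dedekind_eta (z + 1) = e2pi (24^-1 : R)%:C * dedekind_eta z.
Proof.
rewrite /dedekind_eta; have -> : (z + 1) / 24 = (24^-1 : R)%:C + z / 24.
  by rewrite rcV rc_nat mulrDl mul1r addrC.
have -> : (fun N : nat => \prod_(1 <= n < N.+1) (1 - e2pi (n%:R * (z + 1))) : C^o) = (fun N : nat => \prod_(1 <= n < N.+1) (1 - e2pi (n%:R * z)) : C^o).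
  by apply/funext => N; apply: eq_bigr => n _; rewrite mulrDr mulr1 e2piD e2pi_nat mulr1.
by rewrite e2piD -mulrA.
Qed.

(** Allows eta(i) to be cancelled from transformation laws. At i the product is real with q = e^(-2
    pi) <= 1/3, and its partial products are at least 1 - q / (1 - q) >= 1/2. *)
Lemma eta_imag_neq0 : dedekind_eta (0 +i* 1 : C) != 0.
Proof.
rewrite /dedekind_eta mulf_neq0 ?e2pi_neq0 //.
set q := expR (- (2 * pi)) : R.
have p2 : 2 <= (pi : R) by exact: pi_ge2.
have q0 : 0 < q by exact: expR_gt0.
have q3 : q <= 3^-1.
  rewrite /q expRN lef_pV2 ?posrE ?expR_gt0 //.
  by apply: le_trans (expR_ge1Dx _); lra.
have E n : e2pi (n%:R * (0 +i* 1)) = (q ^+ n)%:C :> C.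
  rewrite e2piMn rcX; congr (_ ^+ n); rewrite /e2pi -cexp_real; congr cexp.
  have -> : (0 +i* 1 : C) = Num.imaginary by [].
  have i2 : Num.imaginary * Num.imaginary = -1 :> C by rewrite -expr2 sqrCi.
  by rewrite -mulrA i2 mulrN1 rcN rcM rc_nat.
pose p N : R := \prod_(1 <= n < N.+1) (1 - q ^+ n).
have EP N : \prod_(1 <= n < N.+1) (1 - e2pi (n%:R * (0 +i* 1))) = (p N)%:C :> C.
  have o1 : (1 : R)%:C = 1 :> C by [].
  by rewrite /p rmorph_prod; apply: eq_bigr => n _; rewrite E -o1 -rcB.
have q1 : q < 1 by lra.
have f0 n : (0 < n)%N -> 0 <= 1 - q ^+ n <= 1.
  move=> n0; rewrite subr_ge0 exprn_ile1 ?(ltW q0) ?(ltW q1) //= lerBlDr lerDl exprn_ge0 // ltW //.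
have pS N : p N.+1 = p N * (1 - q ^+ N.+1) by rewrite /p big_nat_recr.
have p0 N : 0 <= p N.
  elim: N => [|N IH]; first by rewrite /p big_geq.
  by rewrite pS mulr_ge0 //; have /andP[] := f0 N.+1 isT.
have dec : nonincreasing_seq p.
  apply/nonincreasing_seqP => N; rewrite pS ler_piMr //; by have /andP[] := f0 N.+1 isT.
have low N : 1 - (q - q ^+ N.+1) / (1 - q) <= p N /\ p N <= 1.
  elim: N => [|N [IH1 IH2]]; first by rewrite /p big_geq // expr1 subrr mul0r subr0.
  split; last by apply: le_trans IH2; apply: dec.
  rewrite pS mulrBr mulr1; have : p N * q ^+ N.+1 <= q ^+ N.+1 by rewrite ler_piMl // exprn_ge0 // ltW.
  have -> : 1 - (q - q ^+ N.+2) / (1 - q) = 1 - (q - q ^+ N.+1) / (1 - q) - q ^+ N.+1.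
    by rewrite (exprS _ N.+1); field; lra.
  lra.
have low2 N : 2^-1 <= p N.
  apply: le_trans (low N).1; have : (q - q ^+ N.+1) / (1 - q) <= 2^-1; last by lra.
  rewrite ler_pdivrMr; last by lra.
  have : 0 <= q ^+ N.+1 by rewrite exprn_ge0 // ltW.
  lra.
have cv : cvgn p.
  apply: nonincreasing_is_cvgn => //; exists 0 => _ [N _ <-]; exact: p0.
have cc : cvgc \oo (fun N => (p N)%:C) (limn p)%:C by apply: cvgc_real; exact: cv.
rewrite (limn_cvgc (a := (limn p)%:C)); last first.
  by apply: near_eq_cvgc cc; apply: nearW => N; rewrite EP.
rewrite rc_eq0 gt_eqF //; apply: lt_le_trans (_ : 2^-1 <= _); first by rewrite invr_gt0.
by apply: limr_ge => //; apply: nearW.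
Qed.

End Moebius.

(** * The values of the eta multiplier *)

Section EtaMultiplier.
Context {R : realType}.
Local Notation C := R[i].
Variables (k : nat) (v : 'M[int]_2 -> C) (hv : eta_multiplier k v).

Let u_i : uhp (0 +i* 1 : C). Proof. by rewrite /uhp /= ltr01. Qed.

Lemma v_eta a b c d z : a * d - b * c = 1 -> uhp z ->
  dedekind_eta (mob a b c d z) ^+ (2 * k) = v (mx2 a b c d) * cdfac c d z ^+ k * dedekind_eta z ^+ (2 * k).
Proof.
move=> h zu; have dt : \det (mx2 a b c d) = 1 by rewrite det_mx2.
by have [_ /(_ z zu)] := hv dt; rewrite moebius_mx2 autj_mx2.
Qed.

Let det_ne (a b c d : int) : a * d - b * c = 1 -> (c != 0) || (d != 0).
Proof. by move=> h; apply: (@det_cd a b); rewrite h. Qed.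

(** The weight is an integer, so the factors (c z + d)^k multiply exactly; they are cancelled at z =
    i together with eta(i). *)
Lemma v_mul a b c d a' b' c' d' : a * d - b * c = 1 -> a' * d' - b' * c' = 1 ->
  v (mx2 (a * a' + b * c') (a * b' + b * d') (c * a' + d * c') (c * b' + d * d')) = v (mx2 a b c d) * v (mx2 a' b' c' d').
Proof.
move=> h h'; have h'' : (a * a' + b * c') * (c * b' + d * d') - (a * b' + b * d') * (c * a' + d * c') = 1.
  by rewrite -[RHS](mul1r 1) -{1}h -h'; ring.
have j1 := cdfac_neq0 u_i (det_ne h').
have zu' : uhp (mob a' b' c' d' (0 +i* 1 : C)) by apply: mob_uhp => //; rewrite h'.
have j2 := cdfac_neq0 zu' (det_ne h).
have e0 : dedekind_eta (0 +i* 1 : C) ^+ (2 * k) != 0 by rewrite expf_neq0 // eta_imag_neq0.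
have := v_eta h'' u_i; rewrite mob_comp // (v_eta h zu') (v_eta h' u_i) cdfac_comp // [(_ * cdfac c' d' _) ^+ k]exprMn => E.
apply: (mulIf e0); apply: (mulIf (expf_neq0 k j1)); apply: (mulIf (expf_neq0 k j2)).
move: E; generalize (dedekind_eta (0 +i* 1 : C) ^+ (2 * k)) => x.
move: (cdfac c d _ ^+ k) (cdfac c' d' _ ^+ k) (v _) (v _) (v _) => y w p q s E.
transitivity (p * (y * w) * x); first by ring.
by rewrite -E; ring.
Qed.

Lemma v_T : v (mx2 1 1 0 1) = root12 k%:Z.
Proof.
have dt : 1 * 1 - 1 * 0 = 1 :> int by [].
have := v_eta dt u_i; rewrite mob_T eta_shift exprMn -e2piMn.
have -> : cdfac 0 1 (0 +i* 1 : C) = 1 by rewrite /cdfac mul0r add0r.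
rewrite expr1n mulr1 => /mulIf <-; last by rewrite expf_neq0 // eta_imag_neq0.
rewrite root12E; congr e2pi; rewrite -rc_nat -rcM -pmulrn natrM; congr (_%:C); by field.
Qed.

Lemma v_N1 : v (mx2 (-1) 0 0 (-1)) = (-1) ^+ k.
Proof.
have dt : (-1) * (-1) - 0 * 0 = 1 :> int by [].
have := v_eta dt u_i.
have -> : cdfac 0 (-1) (0 +i* 1 : C) = -1 by rewrite /cdfac mul0r add0r mulrNz.
have -> : mob (-1) 0 0 (-1) (0 +i* 1 : C) = 0 +i* 1.
  by rewrite /mob /cdfac mul0r add0r addr0 mulrNz mulN1r invrN1 mulrN1 opprK.
have e0 : dedekind_eta (0 +i* 1 : C) ^+ (2 * k) != 0 by rewrite expf_neq0 // eta_imag_neq0.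
rewrite -{1}[_ ^+ (2 * k)]mul1r => /(mulIf e0) E.
have s : (-1) ^+ k * (-1) ^+ k = 1 :> C by rewrite -exprMn mulrNN mulr1 expr1n.
transitivity (v (mx2 (-1) 0 0 (-1)) * (-1) ^+ k * (-1) ^+ k); first by rewrite -mulrA s mulr1.
by rewrite -E mul1r.
Qed.

(** From S^2 = (S T)^3 = -1: with s and t the values at S and T one has s^2 = (s t)^3, hence s =
    t^(-3). *)
Lemma v_S : v (mx2 0 (-1) 1 0) = root12 (- (k%:Z * 3)).
Proof.
have dS : 0 * 0 - (-1) * 1 = 1 :> int by [].
have dT : 1 * 1 - 1 * 0 = 1 :> int by [].
have d1 : 0 * 1 - (-1) * 1 = 1 :> int by [].
have d2 : (-1) * 0 - (-1) * 1 = 1 :> int by [].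
have s2 : v (mx2 0 (-1) 1 0) * v (mx2 0 (-1) 1 0) = (-1) ^+ k.
  by rewrite -(v_mul dS dS) -v_N1; congr (v (mx2 _ _ _ _)).
have st : v (mx2 0 (-1) 1 1) = v (mx2 0 (-1) 1 0) * v (mx2 1 1 0 1).
  by rewrite -(v_mul dS dT); congr (v (mx2 _ _ _ _)).
have st2 : v (mx2 (-1) (-1) 1 0) = v (mx2 0 (-1) 1 1) * v (mx2 0 (-1) 1 1).
  by rewrite -(v_mul d1 d1); congr (v (mx2 _ _ _ _)).
have st3 : (-1) ^+ k = v (mx2 (-1) (-1) 1 0) * v (mx2 0 (-1) 1 1).
  by rewrite -(v_mul d2 d1) -v_N1; congr (v (mx2 _ _ _ _)).
move: st3; rewrite st2 st v_T -s2 root12N.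
have vS0 : v (mx2 0 (-1) 1 0) != 0.
  apply/eqP => h; move: s2; rewrite h mul0r => /esym/eqP; rewrite expf_eq0 oppr_eq0 oner_eq0 andbF //.
have -> : root12 (k%:Z * 3) = root12 k%:Z ^+ 3 :> C by rewrite -root12X; congr root12; ring.
have z0 := root12_neq0 (R := R) k%:Z.
move: (v _) vS0 (root12 _) z0 => s s0 t t0 E.
apply: (mulIf (expf_neq0 3 t0)); rewrite mulVf ?expf_neq0 //.
by apply: (mulfI (mulf_neq0 s0 s0)); rewrite mulr1 {2}E; ring.
Qed.

Lemma v_etav a b c d : a * d - b * c = 1 -> v (mx2 a b c d) = etav k a b c d.
Proof.
move=> h.
have dS : 0 * 0 - (-1) * 1 = 1 :> int by [].
have dT : 1 * 1 - 1 * 0 = 1 :> int by [].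
suff [] : v (mx2 a b c d) = etav k a b c d /\ a * d - b * c = 1 by [].
move: a b c d h; apply: gen_ind.
- split => //; rewrite etav1.
  have d1 : 1 * 1 - 0 * 0 = 1 :> int by [].
  have := v_mul d1 d1; have -> : mx2 (1 * 1 + 0 * 0) (1 * 0 + 0 * 1) (0 * 1 + 1 * 0) (0 * 0 + 1 * 1) = mx2 1 0 0 1 by [].
  have e0 : v (mx2 1 0 0 1) != 0.
    rewrite -normc_gt0; have dt : \det (mx2 1 0 0 1) = 1 by rewrite det_mx2.
    by have [-> _] := hv dt; rewrite ltr01.
  by rewrite -[LHS]mul1r => /(mulIf e0) <-.
- move=> a b c d [e dt]; split; last by rewrite -dt; ring.
  have [_ r2 _ _] := etav_rules (R := R) (det_det_mod k dt).
  rewrite r2 -e -v_S -(v_mul dS dt); congr (v (mx2 _ _ _ _)); ring.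
- move=> a b c d [e dt]; split; last by rewrite -dt; ring.
  have [r1 _ _ _] := etav_rules (R := R) (det_det_mod k dt).
  rewrite r1 -e -v_T -(v_mul dT dt); congr (v (mx2 _ _ _ _)); ring.
- move=> a b c d [e dt]; have dt' : (a - c) * d - (b - d) * c = 1 by rewrite -dt; ring.
  split => //; apply: (mulfI (root12_neq0 k%:Z)).
  have [r1 _ _ _] := etav_rules (R := R) (det_det_mod k dt').
  rewrite -r1 !subrK -e -{1}v_T -(v_mul dT dt'); congr (v (mx2 _ _ _ _)); ring.
Qed.

(** The multiplier stays that of eta^(2k) while the weight [w] varies, as raising and conjugation
    require. *)
Definition automorphic (w : int) (f : C -> C) : Prop := forall a b c d, a * d - b * c = 1 ->
  forall z, uhp z -> f (mob a b c d z) = etav k a b c d * phase c d z ^ w * f z.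

Lemma automorphicP (f : C -> C) :
  (forall g : 'M[int]_2, \det g = 1 -> forall z, uhp z ->
          f (moebius g z) = v g * cexp (Num.imaginary * k%:R * (Arg (autj g z))%:C) * f z) <-> automorphic k%:Z f.
Proof.
split=> H.
  move=> a b c d h z zu; have dt : \det (mx2 a b c d) = 1 by rewrite det_mx2.
  have j0 := cdfac_neq0 zu (det_ne h).
  by have := H _ dt z zu; rewrite moebius_mx2 autj_mx2 (cexp_kArg _ j0) (v_etav h).
move=> g; move: (mx2E g); move: (g 0 0) (g 0 1) (g 1 0) (g 1 1) => a b c d ->.
rewrite det_mx2 => h z zu; have j0 := cdfac_neq0 zu (det_ne h).
by rewrite moebius_mx2 autj_mx2 (cexp_kArg _ j0) (v_etav h); exact: H.
Qed.

End EtaMultiplier.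

(** * Raising operators *)

Section ChainRule.
Context {R : realType}.
Local Notation C := R[i].

Lemma sq_nbhs (Q : C -> Prop) (z : C) : (\forall w \near (z : C^o), Q w) ->
  exists2 de : R, 0 < de & forall w, `|Re w - Re z| < de -> `|Im w - Im z| < de -> Q w.
Proof.
move=> [e]; rewrite /= ltcE /= => /andP[/eqP ei er] he.
exists (Re e / 2); first by rewrite divr_gt0.
move=> w h1 h2; apply: he; rewrite /ball_ /= normrcE ltcE /= -ei eqxx /=.
apply: le_lt_trans (normc_le_ReIm _) _; rewrite ReB ImB -!(distrC (complex.Re w)) -!(distrC (complex.Im w)); lra.
Qed.

(** The increment is split into a horizontal leg, controlled by the mean value bound and the
    continuity of [fx], and a vertical leg through z, controlled by the derivative at z. *)
Lemma derivesC_chain (f fx fy : C -> C) (P : R -> C) (t : R) (d : C) : C1on f fx fy -> derivesC P t d -> uhp (P t) ->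
  derivesC (fun s => f (P s)) t ((Re d)%:C * fx (P t) + (Im d)%:C * fy (P t)).
Proof.
move=> hf hP zu; set z := P t in zu *.
have [[px py] cx _] := hf z zu.
apply: derivesC_of_small => e e0.
pose N := normc d + 1; pose K := 3 * N + normc (fx z) + normc (fy z).
have N1 : 1 <= N by rewrite /N lerDr normc_ge0.
have K0 : 0 < K by rewrite /K; have := normc_ge0 (fx z); have := normc_ge0 (fy z); lra.
pose e1 := Num.min 1 (e / K).
have e10 : 0 < e1 by rewrite lt_min ltr01 divr_gt0.
have e11 : e1 <= 1 by rewrite ge_min lexx.
have eK : e1 * K <= e by rewrite -ler_pdivlMr // ge_min lexx orbT.
have [d1 d10 h1] : exists2 de : R, 0 < de & forall w, `|Re w - Re z| < de -> `|Im w - Im z| < de -> uhp w /\ normc (fx w - fx z) <= e1.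
  apply: sq_nbhs; have n1 := near_in_uhp zu.
  have n2 : \forall w \near (z : C^o), normc (fx w - fx z) <= e1.
    have /cvgc_normc c1 := cx; apply: (cvgr_le _ c1); exact: e10.
  by apply: filterS2 n1 n2 => w.
have [d2 d20 h2] := derivesC_small py e10.
have [d3 d30 h3] := derivesC_small hP e10.
pose de := Num.min d3 (Num.min d1 d2 / N).
have N0 : 0 < N by rewrite (lt_le_trans _ N1).
have m0 : 0 < Num.min d1 d2 by rewrite lt_min d10.
exists de; first by rewrite lt_min d30 divr_gt0.
move=> s; rewrite lt_min ltr_pdivlMr // lt_min => /andP[s3 /andP[s1 s2]].
have b3 := h3 s s3; rewrite -/z in b3.
have bP : normc (P s - z) <= N * `|s - t|.
  have -> : P s - z = (P s - z - (s - t)%:C * d) + (s - t)%:C * d by ring.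
  apply: le_trans (le_normcD _ _) _; rewrite normcM normcRE /N.
  have : e1 * `|s - t| <= 1 * `|s - t| by rewrite ler_wpM2r.
  move: b3; move: (normc _) (`|s - t|) (normc d) => x y w; lra.
have bre : `|Re (P s) - Re z| <= N * `|s - t| by apply: le_trans bP; rewrite -ReB; exact: Re_le_normc.
have bim : `|Im (P s) - Im z| <= N * `|s - t| by apply: le_trans bP; rewrite -ImB; exact: Im_le_normc.
have r1 : `|Re (P s) - Re z| < d1 by apply: le_lt_trans bre _; rewrite mulrC.
have i1 : `|Im (P s) - Im z| < d1 by apply: le_lt_trans bim _; rewrite mulrC.
have i2 : `|Im (P s) - Im z| < d2 by apply: le_lt_trans bim _; rewrite mulrC.
set p := Re (P s); set q := Im (P s).
have E : f (P s) - f z - (s - t)%:C * ((Re d)%:C * fx z + (Im d)%:C * fy z) =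
  ((f (p +i* q) - p%:C * fx z) - (f (Re z +i* q) - (Re z)%:C * fx z)) +
  (f (Re z +i* q) - f (Re z +i* Im z) - (q - Im z)%:C * fy z) +
  ((p - Re z - (s - t) * Re d)%:C * fx z + (q - Im z - (s - t) * Im d)%:C * fy z).
  rewrite /p /q -!cplxE !rcB !rcM !rcB.
  move: (f _) (f _) (f _) (_%:C) (_%:C) (_%:C) (_%:C) (_%:C) (_%:C) (_%:C) (_%:C) => *; ring.
rewrite E; apply: le_trans (_ : (2 * e1 * (N * `|s - t|) + e1 * (N * `|s - t|)) + (e1 * `|s - t| * normc (fx z) + e1 * `|s - t| * normc (fy z)) <= _); last first.
  have -> : 2 * e1 * (N * `|s - t|) + e1 * (N * `|s - t|) + (e1 * `|s - t| * normc (fx z) + e1 * `|s - t| * normc (fy z)) = e1 * K * `|s - t|.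
    by rewrite /K; ring.
  by rewrite ler_wpM2r.
apply: le_trans (le_normcD _ _) _; apply: lerD.
  apply: le_trans (le_normcD _ _) _; apply: lerD.
    have bet x : Num.min (Re z) p <= x <= Num.max (Re z) p -> `|x - Re z| < d1.
      move=> /andP[x1 x2]; apply: le_lt_trans r1; rewrite -/p.
      have [h|h] := leP (Re z) p; first by rewrite !ger0_norm ?subr_ge0 ?lerD2r //; move: x1 x2; rewrite ?(min_l h) ?(max_r h).
      by rewrite !ler0_norm ?subr_le0 ?(ltW h) // ?lerN2 ?lerD2r //; move: x1 x2; rewrite ?(min_r (ltW h)) ?(max_l (ltW h)).
    apply: le_trans (_ : 2 * e1 * `|p - Re z| <= _); last by rewrite ler_wpM2l // mulr_ge0 // ltW.
    apply: (@derivesC_le_distW R (fun x => f (x +i* q) - x%:C * fx z) (fun x => fx (x +i* q) - fx z) (Re z) p e1 (Num.min (Re z) p) (Num.max (Re z) p)).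
    - by rewrite ge_min lexx le_max lexx.
    - by rewrite ge_min lexx orbT le_max lexx orbT.
    - move=> x hx; have [wu _] := h1 (x +i* q) (bet x hx) i1.
      have [[dx1 _] _ _] := hf _ wu.
      by have := derivesCB dx1 (derivesCZr (fx z) (derivesC_id x)); rewrite mul1r.
    - by move=> x hx; have [] := h1 (x +i* q) (bet x hx) i1.
  apply: le_trans (h2 q i2) _; by rewrite ler_wpM2l // ltW.
apply: le_trans (le_normcD _ _) _; rewrite !normcM !normcRE; apply: lerD; rewrite ler_wpM2r ?normc_ge0 //.
  by apply: le_trans b3; rewrite [X in `|X|](_ : _ = Re (P s - z - (s - t)%:C * d)) ?Re_le_normc // !ReB ReZ.
by apply: le_trans b3; rewrite [X in `|X|](_ : _ = Im (P s - z - (s - t)%:C * d)) ?Im_le_normc // !ImB ImZ.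
Qed.

Lemma derivesC_nz (h : R -> C) t d : derivesC h t d -> h t != 0 -> \forall x \near t, h x != 0.
Proof. by move=> hd h0; apply: (@cvgc_near_neq0 R _ _ _ _ _ (derivesC_cvg hd)). Qed.

Lemma derivesCX (h : R -> C) t d n : derivesC h t d -> h t != 0 -> derivesC (fun x => h x ^+ n) t (n%:R * (d / h t) * h t ^+ n).
Proof.
move=> hd h0; elim: n => [|n IH].
  by apply: derivesC_eq (derivesC_cst 1 t); rewrite mul0r mul0r.
apply: derivesC_ext (fun x => esym (exprS _ _)) (derivesC_eq _ (derivesCM hd IH)).
rewrite exprS -(natr1 n); move: (h t ^+ n) (n%:R : C) => a b; by field.
Qed.

Lemma derivesC_exprz (h : R -> C) t d (w : int) : derivesC h t d -> h t != 0 -> derivesC (fun x => h x ^ w) t (w%:~R * (d / h t) * h t ^ w).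
Proof.
move=> hd h0; case: w => n; first exact: derivesCX.
have hn := derivesC_nz hd h0.
have hV := derivesCV_aux hd hn.
have := derivesCX n.+1 hV (_ : (h t)^-1 != 0); rewrite invr_eq0 => /(_ h0).
have E x : (h x)^-1 ^+ n.+1 = h x ^ Negz n by rewrite exprVn.
move=> hh; apply: (derivesC_ext E (derivesC_eq _ hh)).
rewrite E NegzE mulrNz -pmulrn; move: (h t ^ _) (n.+1%:R : C) => a b; by field.
Qed.

Lemma derivesC_normc (h : R -> C) t d : derivesC h t d -> h t != 0 ->
  is_derive t 1 (fun x => normc (h x)) (Re (d * conjc (h t)) / normc (h t)).
Proof.
move=> [d1 d2] h0.
have s1 := is_deriveD (is_deriveMr d1 d1) (is_deriveMr d2 d2).
have E x : Re (h x) * Re (h x) + Im (h x) * Im (h x) = normc (h x) ^+ 2 by rewrite normc_sqr !expr2.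
have p0 : 0 < Re (h t) * Re (h t) + Im (h t) * Im (h t) by rewrite E exprn_gt0 // normc_gt0.
have := @is_derive_comp1 R Num.sqrt ((fun x => Re (h x) * Re (h x)) \+ (fun x => Im (h x) * Im (h x))) t _ _ (is_derive1_sqrt p0) s1.
have -> : (fun x => Num.sqrt (((fun x => Re (h x) * Re (h x)) \+ (fun x => Im (h x) * Im (h x))) x)) = (fun x => normc (h x)).
  by apply/funext => x /=; rewrite E sqrtr_sqr ger0_norm // normc_ge0.
move=> hd; apply: is_derive_eq hd _; rewrite E sqrtr_sqr ger0_norm ?normc_ge0 //.
have n0 : normc (h t) != 0 by rewrite normc_eq0.
rewrite ReMc; case: (h t) n0 => u v n0 /=; field; exact: n0.
Qed.

Lemma derivesC_phase (h : R -> C) t d : derivesC h t d -> h t != 0 ->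
  derivesC (fun x => h x / (normc (h x))%:C) t ((d / h t - (Re (d * conjc (h t)) / normc (h t) ^+ 2)%:C) * (h t / (normc (h t))%:C)).
Proof.
move=> hd h0; have n0 : (normc (h t))%:C != 0 :> C by rewrite rc_eq0 normc_eq0.
have dn := derivesC_real (derivesC_normc hd h0).
have hn : \forall x \near t, (normc (h x))%:C != 0 :> C by exact: derivesC_nz dn n0.
apply: derivesC_eq (derivesCM hd (derivesCV_aux dn hn)).
move: (Re (d * conjc (h t))) (normc (h t)) n0 => rr nn n0.
rewrite !rcM !rcV rcX; move: rr%:C nn%:C n0 (h t) h0 => a b b0 c c0; by field; rewrite b0 c0.
Qed.

End ChainRule.

(** * Maass' raising operator and automorphy *)

Section Raising.
Context {R : realType}.
Local Notation C := R[i].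
Variables (k : nat).
Local Notation ii := (Num.imaginary : C).

Lemma imaginary_sq : ii * ii = -1. Proof. by rewrite -expr2 sqrCi. Qed.
Lemma imaginaryE : ii = 0 +i* 1. Proof. by []. Qed.

(** Maass' raising operator of weight w; the partials are arguments because [C1on] names them. *)
Definition raising (w : int) (f fx fy : C -> C) (z : C) : C :=
  ii * (Im z)%:C * fx z + (Im z)%:C * fy z + (w%:~R / 2 : R)%:C * f z.

Lemma partials_affine (a b : C) z : partials (fun z => a * z + b) z a (a * ii).
Proof.
have d x : derivesC (fun x : R => x%:C) x 1 := derivesC_id x.
split.
  have := derivesCD (derivesCZ a (derivesCD (d (Re z)) (derivesC_cst (0 +i* Im z) (Re z)))) (derivesC_cst b (Re z)).
  rewrite !addr0 mulr1; apply: derivesC_ext => x; rewrite /hslice; congr (_ * _ + _).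
  by apply: cplxP; rewrite ?ReD ?ImD /= ?addr0 ?add0r.
have := derivesCD (derivesCZ a (derivesCD (derivesCZ ii (d (Im z))) (derivesC_cst (Re z)%:C (Im z)))) (derivesC_cst b (Im z)).
rewrite !addr0 mulr1; apply: derivesC_ext => x; rewrite /vslice; congr (_ * _ + _).
by rewrite imaginaryE; apply: cplxP; rewrite ?ReD ?ImD ?ReMc ?ImMc /=; ring.
Qed.

(** The transformation law is differentiated in x and in y, once through the image point and once as
    a product; the two results agree by uniqueness of derivatives. The derivative of the phase then
    accounts for the shift of the term w/2. *)
Lemma automorphic_raise (w : int) (f fx fy : C -> C) : C1on f fx fy -> automorphic k w f -> automorphic k (w + 2) (raising w f fx fy).
Proof.
move=> hf aut a b c d dt z zu.
have cd : (c != 0) || (d != 0) by apply: (@det_cd a b); rewrite dt.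
have j0 := cdfac_neq0 zu cd.
have mu : uhp (mob a b c d z) by apply: mob_uhp => //; rewrite dt.
have [jx jy] := partials_affine c%:~R d%:~R z.
have [nx ny] := partials_affine a%:~R b%:~R z.
have jxn : \forall x \near Re z, hslice (fun z => c%:~R * z + d%:~R) z x != 0.
  by apply: derivesC_nz jx _; rewrite /hslice -cplxE.
have jyn : \forall x \near Im z, vslice (fun z => c%:~R * z + d%:~R) z x != 0.
  by apply: derivesC_nz jy _; rewrite /vslice -cplxE.
have hz (g : C -> C) : hslice g z (Re z) = g z by rewrite /hslice -cplxE.
have vz (g : C -> C) : vslice g z (Im z) = g z by rewrite /vslice -cplxE.
have dtC : a%:~R * d%:~R - b%:~R * c%:~R = 1 :> C by rewrite -!intrM -mulrNz -intrD dt.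
set j := cdfac c d z in j0.
have mx : derivesC (hslice (mob a b c d) z) (Re z) (j^-1 ^+ 2).
  apply: derivesC_eq (derivesCM nx (derivesCV_aux jx jxn)); rewrite !hz -[c%:~R * z + d%:~R]/j.
  have -> : j^-1 ^+ 2 = (a%:~R * d%:~R - b%:~R * c%:~R) / j ^+ 2 by rewrite dtC mul1r exprVn.
  by move: j0; rewrite /j /cdfac => j0; field.
have my : derivesC (vslice (mob a b c d) z) (Im z) (ii * j^-1 ^+ 2).
  apply: derivesC_eq (derivesCM ny (derivesCV_aux jy jyn)); rewrite !vz -[c%:~R * z + d%:~R]/j.
  have -> : ii * j^-1 ^+ 2 = (a%:~R * d%:~R - b%:~R * c%:~R) * ii / j ^+ 2 by rewrite dtC mul1r exprVn.
  by move: j0; rewrite /j /cdfac => j0; field.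
have muh : uhp (hslice (mob a b c d) z (Re z)) by rewrite hz.
have muv : uhp (vslice (mob a b c d) z (Im z)) by rewrite vz.
have Fx := derivesC_chain hf mx muh; have Fy := derivesC_chain hf my muv.
rewrite hz in Fx; rewrite vz in Fy.
have jjx : hslice (fun z => c%:~R * z + d%:~R) z (Re z) != 0 by rewrite hz.
have jjy : vslice (fun z => c%:~R * z + d%:~R) z (Im z) != 0 by rewrite vz.
have px := derivesC_phase jx jjx; have py := derivesC_phase jy jjy.
have phx := derivesC_exprz w px; have phy := derivesC_exprz w py.
rewrite !hz -[c%:~R * z + d%:~R]/j -[j / _]/(phase c d z) in px phx.
rewrite !vz -[c%:~R * z + d%:~R]/j -[j / _]/(phase c d z) in py phy.
have p0 : phase c d z != 0 by exact: phase_neq0.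
have {}phx := phx p0; have {}phy := phy p0.
have [[fxz fyz] _ _] := hf z zu.
have Gx := derivesCZ (etav k a b c d) (derivesCM phx fxz); have Gy := derivesCZ (etav k a b c d) (derivesCM phy fyz).
have y0 : 0 < Im z := zu.
have nx0 x : etav k a b c d * ((hslice (fun z => c%:~R * z + d%:~R) z x / (normc (hslice (fun z => c%:~R * z + d%:~R) z x))%:C) ^ w * hslice f z x) = f (hslice (mob a b c d) z x).
  by rewrite /hslice (aut a b c d dt (x +i* Im z) y0) mulrA.
have ny0 : \forall x \near Im z, etav k a b c d * ((vslice (fun z => c%:~R * z + d%:~R) z x / (normc (vslice (fun z => c%:~R * z + d%:~R) z x))%:C) ^ w * vslice f z x) = f (vslice (mob a b c d) z x).
  have h : \forall x \near Im z, 0 < x by apply: lt_nbhsr.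
  by apply: filterS h => x x0; rewrite /vslice (aut a b c d dt (Re z +i* x) x0) mulrA.
have {}Gx := derivesC_ext nx0 Gx; have {}Gy := derivesC_near ny0 Gy.
have Ex := derivesC_unique Fx Gx; have Ey := derivesC_unique Fy Gy.
rewrite !hz -[c%:~R * z + d%:~R]/j -[j / _]/(phase c d z) in Ex.
rewrite !vz -[c%:~R * z + d%:~R]/j -[j / _]/(phase c d z) in Ey.
rewrite /raising (aut a b c d dt z zu) (Im_mob a b zu cd) dt mulr1z mul1r -/j expfzDr //.
set N := normc j in Ex Ey *; set c1 := (c%:~R : C) in Ex Ey *.
have N0 : N%:C != 0 :> C by rewrite rc_eq0 normc_eq0.
pose j' := conjc j.
have jj' : j * j' = N%:C ^+ 2 by rewrite /j' mulc_conj rcX.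
have j'0 : j' != 0 by rewrite /j' conjc_eq0.
(* With j = c z + d this is conj j = j - 2 i c y; it lets the derivative of the phase combine with
   the term w/2. *)
have ejj : j' = j - 2 * ii * (c1 * (Im z)%:C).
  have -> : c1 * (Im z)%:C = (Im j)%:C by rewrite /j Im_cdfac rcM rc_int.
  by rewrite /j' imaginaryE; case: (j) => u v; apply: cplxP; rewrite ?ReB ?ImB ?ReMc ?ImMc /=; ring.
have rx : (Re (c1 * conjc j))%:C = c1 * (j + j') / 2.
  rewrite /c1 -rc_int ReZ rcM -mulrA; congr (_ * _).
  by rewrite /j' mulrC -rc_half; case: (j) => u v; apply: cplxP; rewrite ?ReZ ?ImZ ?ReD ?ImD /=; lra.
have ry : (Re (c1 * ii * conjc j))%:C = c1 * ((j - j') * (- ii) / 2).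
  rewrite /c1 -rc_int -mulrA ReZ rcM; congr (_ * _).
  by rewrite /j' [_ / 2]mulrC -rc_half imaginaryE; case: (j) => u v; apply: cplxP; rewrite ?ReZ ?ImZ ?ReMc ?ImMc ?ReB ?ImB ?ReMc ?ImMc /=; lra.
rewrite !rcM !rcV !rcX rx in Ex; rewrite !rcM !rcV !rcX ry in Ey.
set U := j^-1 ^+ 2 in Ex Ey.
have U1 : (Re U)%:C + ii * (Im U)%:C = U.
  by rewrite imaginaryE; case: (U) => u v; apply: cplxP; rewrite ?ReD ?ImD ?ReMc ?ImMc /=; ring.
have U2 : (Re (ii * U))%:C = - (Im U)%:C /\ (Im (ii * U))%:C = (Re U)%:C.
  by rewrite imaginaryE ReMc ImMc /= -rcN; split; congr (_%:C); ring.
rewrite U2.1 U2.2 in Ey.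
have p2 : phase c d z ^ 2 = j / j'.
  by rewrite -[phase c d z ^ 2]/(phase c d z ^+ 2) /phase -/j -/N exprMn exprVn -jj'; field; rewrite j0 j'0.
rewrite p2 rcM rcV rcX.
set X := phase c d z ^ w in Ex Ey *; set V := etav k a b c d in Ex Ey *.
(* The combination i d/dx + d/dy is 2 i d/dz, so along the holomorphic Moebius map it is just
   multiplied by the complex derivative [U], equal to j^(-2). *)
have S : ii * fx (mob a b c d z) + fy (mob a b c d z) = j ^+ 2 * (V * X * (w%:~R * (ii * c1 / j) * f z + (ii * fx z + fy z))).
  apply: (mulfI (_ : U != 0)); first by rewrite /U expf_neq0 // invr_eq0.
  have -> : U * (ii * fx (mob a b c d z) + fy (mob a b c d z)) = ii * ((Re U)%:C * fx (mob a b c d z) + (Im U)%:C * fy (mob a b c d z)) +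
     (- (Im U)%:C * fx (mob a b c d z) + (Re U)%:C * fy (mob a b c d z)).
    rewrite -{1}U1; have := imaginary_sq; move: (ii) (Re U)%:C (Im U)%:C (fx _) (fy _) => i u v x y h.
    transitivity (i * u * x + u * y + (i * i) * v * x + i * v * y); first by ring.
    by rewrite h; ring.
  rewrite Ex Ey /U -jj'; have := imaginary_sq; move: (phase c d z) p0 j0 j'0 => p p0 j0 j'0.
  move: (ii) (fx z) (fy z) (f z) (X) (V) (w%:~R : C) (c1) (j) (j') j0 j'0 => i x y g X1 V1 w1 cc a1 a2 a10 a20 h.
  by field; rewrite a10 a20 p0.
have -> : ii * ((Im z)%:C / N%:C ^+ 2) * fx (mob a b c d z) + (Im z)%:C / N%:C ^+ 2 * fy (mob a b c d z) =
   (Im z)%:C / N%:C ^+ 2 * (ii * fx (mob a b c d z) + fy (mob a b c d z)) by ring.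
rewrite S -jj' rcM rcV rc_nat rc_int.
have Y : ii * c1 * (Im z)%:C = (j - j') / 2 by rewrite ejj; field.
have -> : (Im z)%:C / (j * j') * (j ^+ 2 * (V * X * (w%:~R * (ii * c1 / j) * f z + (ii * fx z + fy z)))) =
  V * X * (w%:~R * (ii * c1 * (Im z)%:C) / j' * f z + (Im z)%:C * j / j' * (ii * fx z + fy z)).
  by field; rewrite j0 j'0.
by rewrite Y; field.
Qed.

End Raising.

(** * Raising operators on Whittaker series and the factor Lambda *)

Section RaisingExpansions.
Context {R : realType}.
Local Notation C := R[i].
Variables (k : nat) (hk : (1 <= k <= 11)%N) (r : R) (r0 : r != 0).
Local Notation nu := (@freq R k).
Local Notation raisec := (@raisec R k r).
Local Notation subexp := (@subexp R k).
Local Notation wser := (@wser R k r).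
Local Notation wser_y := (@wser_y R k r).

(** The x-derivative cancels the part 2 pi nu of the y-derivative and w/2 cancels - w/2; what is
    left is the series of weight w + 2. *)
Lemma raising_wser (w : int) c z : subexp c -> uhp z ->
  raising w (wser w c) (wser w (fun n => dxcoef k n * c n)) (wser_y w c) z = wser (w + 2) (fun n => (raisec w n)%:C * c n) z.
Proof.
move=> hc zu; have h1 := subexp_2pinu hc; rewrite /raising.
have -> : wser w (fun n => dxcoef k n * c n) z = Num.imaginary * wser w (fun n => (2 * pi * nu n)%:C * c n) z.
  rewrite -(wserZ hk r0 w Num.imaginary h1 zu); apply: eq_wser => n.
  by rewrite /dxcoef !rcM rc_nat; move: Num.imaginary (pi%:C) (nu n)%:C => i p x; ring.
rewrite /wser_y; have := @imaginary_sq R; have y0 : (Im z)%:C != 0 :> C by rewrite rc_eq0 gt_eqF.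
rewrite rcN rcV; move: (wser _ _ _) (wser _ _ _) (wser _ _ _) Num.imaginary (_ / 2)%:C (Im z)%:C y0 => a b c' i w1 y y0 h.
transitivity ((i * i + 1) * y * c' + a); last by rewrite h; ring.
by field.
Qed.

Lemma automorphic_eq w (f g : C -> C) : (forall z, uhp z -> f z = g z) -> automorphic k w f -> automorphic k w g.
Proof.
move=> e h a b c d dt z zu; have mu : uhp (mob a b c d z) by apply: mob_uhp => //; rewrite dt.
by rewrite -!e //; exact: h.
Qed.

Lemma automorphic_raise_wser (w : int) c : subexp c -> automorphic k w (wser w c) -> automorphic k (w + 2) (wser (w + 2) (fun n => (raisec w n)%:C * c n)).
Proof.
move=> hc h; apply: automorphic_eq (automorphic_raise (wser_C1 hk r0 w hc) h) => z zu.
exact: raising_wser.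
Qed.

(** The factors met on the way from weight - k to weight k, in k steps of 2. *)
Definition raisec_k (n : int) : C := (\prod_(0 <= j < k) raisec (- k%:Z + j%:Z *+ 2) n)%:C.

Lemma automorphic_raise_k c : subexp c -> automorphic k (- k%:Z) (wser (- k%:Z) c) -> automorphic k k%:Z (wser k%:Z (fun n => raisec_k n * c n)).
Proof.
move=> hc h.
pose P m (n : int) : C := (\prod_(0 <= j < m) raisec (- k%:Z + j%:Z *+ 2) n)%:C.
have H m : subexp (fun n => P m n * c n) /\ automorphic k (- k%:Z + m%:Z *+ 2) (wser (- k%:Z + m%:Z *+ 2) (fun n => P m n * c n)).
  elim: m => [|m [IH1 IH2]].
    have E n : P 0%N n * c n = c n by rewrite /P big_nil real_complex1 mul1r.
    split; first by move=> e e0; have [A hA] := hc e e0; exists A => n; rewrite E.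
    by rewrite mul0rn addr0; apply: automorphic_eq h => z zu; apply: eq_wser => n; rewrite E.
  have E n : (raisec (- k%:Z + m%:Z *+ 2) n)%:C * (P m n * c n) = P m.+1 n * c n.
    by rewrite /P big_nat_recr //= rcM; ring.
  split.
    move=> e e0; have [A hA] := @subexp_raisecM R k r (- k%:Z + m%:Z *+ 2) _ IH1 e e0.
    by exists A => n; rewrite -E.
  have -> : - k%:Z + m.+1%:Z *+ 2 = - k%:Z + m%:Z *+ 2 + 2 by lia.
  by apply: automorphic_eq (automorphic_raise_wser IH1 IH2) => z zu; apply: eq_wser => n; rewrite E.
have := (H k).2; have -> : - k%:Z + k%:Z *+ 2 = k%:Z by lia.
by [].
Qed.

Lemma raisec_k_pos n : 0 < nu n -> raisec_k n = (-1) ^+ k.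
Proof.
move=> h; rewrite /raisec_k; under eq_big_nat do rewrite /raisec h.
rewrite big_const_nat subn0; have -> : iter k ( *%R (-1)) 1 = (-1) ^+ k :> R.
  by elim: (k) => [|m IH] //=; rewrite IH exprS.
by rewrite rcX rcN.
Qed.

(** The weights met are symmetric, so the factors pair into squares, and the induction from m to m +
    2 strips the outermost pair. For odd k the middle factor r^2 stays single; the sign of [Lambda]
    is then that of (-1)^k. *)
Lemma raisec_k_neg n : nu n < 0 -> (-1) ^+ k * raisec_k n = (Lambda k r)%:C.
Proof.
move=> h; have h' : (0 < nu n) = false by rewrite ltNge (ltW h).
have E m : \prod_(0 <= j < m) raisec (- m%:Z + j%:Z *+ 2) n = (-1) ^+ m * Lambda m r.
  elim/ltn_ind: m => [[|[|m]]] IH.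
  - by rewrite big_nil expr0 mul1r /Lambda /= big_geq.
  - rewrite big_nat1 /raisec h' /Lambda /= big_geq // expr1 mulN1r mulr1 opprK.
    by rewrite mul0rn addr0 rmorphN /= addNr mul0r expr0n add0r.
  rewrite big_nat_recl // big_nat_recr //=.
  have Es : \prod_(0 <= i < m) raisec (- m.+2%:Z + i.+1%:Z *+ 2) n = \prod_(0 <= j < m) raisec (- m%:Z + j%:Z *+ 2) n.
    by apply: eq_bigr => i _; congr (raisec _ n); lia.
  rewrite Es IH //.
  have k1 : raisec (- m.+2%:Z + 0%:Z *+ 2) n = ((m.+1%:R : R) / 2) ^+ 2 + r ^+ 2.
    rewrite /raisec h' mul0rn addr0; congr (_ + _); rewrite -[in RHS]sqrrN -mulNr; congr ((_ / 2) ^+ 2).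
    by rewrite rmorphN /= -pmulrn -(natr1 m.+1); ring.
  have k2 : raisec (- m.+2%:Z + m.+1%:Z *+ 2) n = ((m.+1%:R : R) / 2) ^+ 2 + r ^+ 2.
    rewrite /raisec h'; congr ((_ / 2) ^+ 2 + _).
    have -> : - m.+2%:Z + m.+1%:Z *+ 2 = m%:Z by lia.
    by rewrite -pmulrn natr1.
  rewrite k1 k2 !exprS /Lambda /= negbK; case: (boolP (odd m)) => om.
    have em : m = (m./2).*2.+1 by rewrite -[LHS]odd_double_half om.
    rewrite [in RHS]big_nat_recr //=.
    have -> : (m.+1%:R : R) / 2 = (m./2).+1%:R.
      by rewrite {1}em -doubleS -muln2 natrM mulfK // pnatr_eq0.
    ring.
  have em : m = (m./2).*2 by rewrite -[LHS]odd_double_half (negbTE om).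
  rewrite [in RHS]big_nat_recr //=.
  have -> : (m.+1%:R : R) / 2 = (m./2).+1%:R - 2^-1.
    by rewrite {1}em -(natr1 (_.*2)) -muln2 natrM -(natr1 m./2); field.
  by move: ((m./2).+1%:R : R) (\prod_(_ <= _ < _) _) => x y; field.
by rewrite /raisec_k E rcM rcX rcN real_complex1 mulrA -exprMn mulrNN mulr1 expr1n mul1r.
Qed.

End RaisingExpansions.

(** * Hecke operators on functions *)

Section Slash.
Context {R : realType}.
Local Notation C := R[i].
Variables (k : nat) (neg : bool).
Implicit Types (a b c d : int) (z : C).
Local Notation etav := (@etav R k).
Local Notation det_mod := (det_mod k).

(* Matrices of negative determinant act through conj z, which reverses the
   weight. *)
Definition conj_if (z : C) : C := if neg then conjc z else z.
Definition sgn_if : int := (-1) ^+ neg.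

Lemma sgn_if_sq : sgn_if * sgn_if = 1. Proof. by rewrite /sgn_if; case: neg. Qed.
Lemma Im_conj_if z : Im (conj_if z) = sgn_if%:~R * Im z.
Proof. by rewrite /conj_if /sgn_if; case: neg; case: z => x y /=; rewrite ?expr1 ?mulN1r ?expr0 ?mul1r. Qed.
Lemma Re_conj_if z : Re (conj_if z) = Re z.
Proof. by rewrite /conj_if; case: neg; case: z. Qed.
Lemma conj_ifD z z' : conj_if (z + z') = conj_if z + conj_if z'.
Proof. by rewrite /conj_if; case: neg => //; exact: rmorphD. Qed.
Lemma conj_ifM z z' : conj_if (z * z') = conj_if z * conj_if z'.
Proof. by rewrite /conj_if; case: neg => //; exact: rmorphM. Qed.
Lemma conj_ifV z : conj_if z^-1 = (conj_if z)^-1.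
Proof. by rewrite /conj_if; case: neg => //; exact: fmorphV. Qed.
Lemma conj_if_int (n : int) : conj_if n%:~R = n%:~R.
Proof. by rewrite /conj_if; case: neg => //; exact: rmorph_int. Qed.
Lemma conj_if_eq0 z : (conj_if z == 0) = (z == 0).
Proof. by rewrite /conj_if; case: neg => //; exact: fmorph_eq0. Qed.
Lemma normc_conj_if z : normc (conj_if z) = normc z.
Proof. by rewrite /conj_if; case: neg => //; rewrite normc_conj. Qed.

Lemma cdfac_conj_if c d z : cdfac c d (conj_if z) = conj_if (cdfac c d z).
Proof. by rewrite /cdfac conj_ifD conj_ifM !conj_if_int. Qed.
Lemma mob_conj_if a b c d z : mob a b c d (conj_if z) = conj_if (mob a b c d z).
Proof. by rewrite /mob cdfac_conj_if [RHS]conj_ifM conj_ifV; congr (_ / _); rewrite conj_ifD conj_ifM !conj_if_int. Qed.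

Lemma cdfac_conj_if_neq0 c d z : uhp z -> (c != 0) || (d != 0) -> cdfac c d (conj_if z) != 0.
Proof. by move=> zu h; rewrite cdfac_conj_if conj_if_eq0 cdfac_neq0. Qed.

Lemma mob_conj_if_uhp a b c d z : uhp z -> 0 < sgn_if * (a * d - b * c) -> uhp (mob a b c d (conj_if z)).
Proof.
move=> zu h; have cd : (c != 0) || (d != 0).
  by apply: (@det_cd a b); apply: contraTneq h => ->; rewrite mulr0 ltxx.
have j0 := cdfac_neq0 zu cd.
rewrite /uhp /= mob_conj_if Im_conj_if (Im_mob a b zu cd) mulrA [_ * (_ * Im z)]mulrA -intrM divr_gt0 ?exprn_gt0 ?normc_gt0 //.
by rewrite mulr_gt0 ?ltr0z.
Qed.

Lemma phase_conj_if c d z (w : int) : cdfac c d z != 0 -> phase c d (conj_if z) ^ w = phase c d z ^ (sgn_if * w).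
Proof.
move=> j0; rewrite /phase cdfac_conj_if normc_conj_if /conj_if /sgn_if; case: neg; last by rewrite expr0 mul1r.
rewrite /= expr1 mulN1r -exprz_inv; congr (_ ^ _).
have n0 : (normc (cdfac c d z))%:C != 0 :> C by rewrite rc_eq0 normc_eq0.
rewrite invfM invrK; apply: (mulfI j0).
by rewrite mulrA mulc_conj rcX expr2 mulfK // mulrA divff // mul1r.
Qed.

Lemma etav_eq a b c d a' b' c' d' : a = a' -> b = b' -> c = c' -> d = d' -> etav a b c d = etav a' b' c' d'.
Proof. by move=> -> -> -> ->. Qed.

(** Mirror image of [etav_mul]: a Hecke matrix is multiplied by SL(2,Z) on the left to change the
    representative and on the right to test automorphy. *)
Lemma etav_mulr a b c d a' b' c' d' : det_mod a b c d -> a' * d' - b' * c' = 1 ->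
  etav (a * a' + b * c') (a * b' + b * d') (c * a' + d * c') (c * b' + d * d') = etav a b c d * etav a' b' c' d'.
Proof.
move=> h h'.
pose Q a' b' c' d' := (forall a b c d, det_mod a b c d ->
  etav (a * a' + b * c') (a * b' + b * d') (c * a' + d * c') (c * b' + d * d') = etav a b c d * etav a' b' c' d') /\ a' * d' - b' * c' = 1.
suff [] : Q a' b' c' d' by move=> H _; exact: H.
have dk x y u w x' y' u' w' : det_mod x y u w -> x' * w' - y' * u' = 1 ->
   det_mod (x * x' + y * u') (x * y' + y * w') (u * x' + w * u') (u * y' + w * w').
  move=> e e'; rewrite /det_mod [X in _ * (X - 1)](_ : _ = (x * w - y * u) * (x' * w' - y' * u')); last by ring.
  by rewrite e' mulr1.
move: a' b' c' d' h'; apply: gen_ind; rewrite /Q.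
- by split => // {}a {}b {}c {}d {}h; rewrite etav1 !mulr1 !mulr0 !addr0 !add0r.
- move=> a' b' c' d' [IH dt]; split; last by rewrite -dt; ring.
  move=> x y u w e; have [_ r2 _ _] := etav_rules (R := R) (det_det_mod k dt); rewrite r2.
  have e' : det_mod y (- x) w (- u) by move: e; rewrite /det_mod; congr (12 %| _ * (_ - 1))%Z; ring.
  have [_ _ _ r1] := etav_rules (R := R) e; rewrite mulrCA mulrA -r1 -IH //.
  by apply: etav_eq; ring.
- move=> a' b' c' d' [IH dt]; split; last by rewrite -dt; ring.
  move=> x y u w e; have [r2 _ _ _] := etav_rules (R := R) (det_det_mod k dt); rewrite r2.
  have e' : det_mod x (x + y) u (u + w) by move: e; rewrite /det_mod; congr (12 %| _ * (_ - 1))%Z; ring.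
  have [_ _ r1 _] := etav_rules (R := R) e; rewrite mulrCA mulrA -r1 -IH //.
  by apply: etav_eq; ring.
- move=> a' b' c' d' [IH dt]; have dt' : (a' - c') * d' - (b' - d') * c' = 1 by rewrite -dt; ring.
  split => // x y u w e; apply: (mulfI (root12_neq0 (R := R) k%:Z)).
  have e' : det_mod x (y - x) u (w - u) by move: e; rewrite /det_mod; congr (12 %| _ * (_ - 1))%Z; ring.
  have [r2 _ _ _] := etav_rules (R := R) (det_det_mod k dt'); have [_ _ r1 _] := etav_rules (R := R) e'.
  have -> : etav x y u w = root12 k%:Z * etav x (y - x) u (w - u).
    by rewrite -r1; apply: etav_eq; ring.
  congr (_ * _).
  have E : etav a' b' c' d' = root12 k%:Z * etav (a' - c') (b' - d') c' d'.
    by rewrite -r2; apply: etav_eq; ring.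
  have -> : root12 k%:Z * etav x (y - x) u (w - u) * etav (a' - c') (b' - d') c' d' = etav x (y - x) u (w - u) * etav a' b' c' d'.
    by rewrite E; ring.
  by rewrite -IH //; apply: etav_eq; ring.
Qed.

Lemma etav_neq0 a b c d : etav a b c d != 0. Proof. by rewrite etavE root12_neq0. Qed.

Variable w : int.

Definition slash (F : C -> C) a b c d (z : C) : C :=
  (etav a b c d)^-1 * phase c d (conj_if z) ^ (- w) * F (mob a b c d (conj_if z)).

(** Makes the Hecke sum independent of the representatives of the cosets of SL(2,Z) from the
    left. *)
Lemma slash_left F a b c d a' b' c' d' z : automorphic k w F -> uhp z -> a * d - b * c = 1 -> det_mod a' b' c' d' ->
  0 < sgn_if * (a' * d' - b' * c') ->
  slash F (a * a' + b * c') (a * b' + b * d') (c * a' + d * c') (c * b' + d * d') z = slash F a' b' c' d' z.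
Proof.
move=> hF zu h h' hp; have cd' : (c' != 0) || (d' != 0).
  by apply: (@det_cd a' b'); apply: contraTneq hp => ->; rewrite mulr0 ltxx.
have j' := cdfac_conj_if_neq0 zu cd'; have mu := mob_conj_if_uhp zu hp.
have cd : (c != 0) || (d != 0) by apply: (@det_cd a b); rewrite h.
have j0 := cdfac_neq0 mu cd.
rewrite /slash mob_comp // hF // etav_mul // phase_comp // [(phase _ _ _ * phase _ _ _) ^ _]expfzMl invfM.
have p0 : phase c d (mob a' b' c' d' (conj_if z)) ^ w != 0 by rewrite expfz_neq0 // phase_neq0.
move: (F _) (etav_neq0 a b c d) => f v0.
rewrite -!invr_expz; move: (phase c d _ ^ w) (phase c' d' _ ^ w)^-1 (etav a b c d) (etav a' b' c' d')^-1 p0 v0 => p p' x x' p0 x0.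
by field; rewrite p0 x0.
Qed.

Lemma slash_right F a b c d a' b' c' d' z : uhp z -> det_mod a b c d -> 0 < sgn_if * (a * d - b * c) ->
  a' * d' - b' * c' = 1 ->
  slash F a b c d (mob a' b' c' d' z) = etav a' b' c' d' * phase c' d' z ^ (sgn_if * w) *
    slash F (a * a' + b * c') (a * b' + b * d') (c * a' + d * c') (c * b' + d * d') z.
Proof.
move=> zu h hp h'.
have cd' : (c' != 0) || (d' != 0) by apply: (@det_cd a' b'); rewrite h'.
have cd : (c != 0) || (d != 0).
  by apply: (@det_cd a b); apply: contraTneq hp => ->; rewrite mulr0 ltxx.
have j' := cdfac_conj_if_neq0 zu cd'; have j'' := cdfac_neq0 zu cd'.
have mu : uhp (mob a' b' c' d' z) by apply: mob_uhp; rewrite // h'.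
have j0 := cdfac_conj_if_neq0 mu cd.
rewrite /slash -!mob_conj_if mob_comp //; last by rewrite mob_conj_if.
rewrite etav_mulr // phase_comp // [(phase _ _ _ * phase _ _ _) ^ _]expfzMl invfM -(phase_conj_if _ j'').
have p0 : phase c' d' (conj_if z) ^ w != 0 by rewrite expfz_neq0 // phase_neq0.
move: (F _) (etav_neq0 a' b' c' d') => f v0.
rewrite -!invr_expz; move: (phase c' d' _ ^ w) (phase c d _ ^ w)^-1 (etav a' b' c' d') (etav a b c d)^-1 p0 v0 => p p' x x' p0 x0.
by field; rewrite p0 x0.
Qed.

End Slash.

Section HeckeSum.
Context {R : realType}.
Local Notation C := R[i].
Variables (k : nat) (neg : bool) (w : int) (q : nat) (q0 : (0 < q)%N).
Implicit Types (a b c d : int) (z : C).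
Local Notation sgn_ := (sgn_if neg).
Hypothesis hq : (12 %| k%:Z * (sgn_ * q%:Z - 1))%Z.

(** [p.1] is the lower diagonal entry d and [p.2] the upper right entry b of a triangular
    representative; ordinals keep the index type finite. *)
Definition hecke_rep (p : 'I_q.+1 * 'I_q.+1) := (p.1 %| q)%N && (p.2 < p.1)%N.
Definition hecke_codiv (p : 'I_q.+1 * 'I_q.+1) : int := sgn_ * (q %/ p.1)%:Z.

Lemma hecke_rep_gt0 p : hecke_rep p -> (0 < p.1)%N.
Proof. by move=> /andP[_]; apply: leq_ltn_trans. Qed.

Lemma hecke_rep_det p : hecke_rep p -> hecke_codiv p * p.1%:Z = sgn_ * q%:Z.
Proof. by move=> /andP[h _]; rewrite /hecke_codiv -mulrA -PoszM divnK. Qed.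

(** Hermite normal form: Bezout for the first column, then b is reduced modulo d. The lower diagonal
    entry is kept positive, so the sign of the determinant goes to the upper one. *)
Lemma hnf_exists a b c d : a * d - b * c = sgn_ * q%:Z -> exists x y u v p,
  [/\ x * v - y * u = 1, hecke_rep p, a = x * hecke_codiv p, c = u * hecke_codiv p & b = x * p.2%:Z + y * p.1%:Z /\ d = u * p.2%:Z + v * p.1%:Z].
Proof.
move=> h; have s2 := sgn_if_sq neg.
have g0 : gcdz a c != 0.
  apply: contraTneq q0 => /eqP; rewrite gcdz_eq0 => /andP[/eqP ea /eqP ec].
  by move: h s2; rewrite ea ec mul0r mulr0 subrr; case: neg; rewrite /sgn_if ?expr1 ?expr0 ?mulN1r ?mul1r; lia.
have [u [v e]] := Bezoutz a c.
have /dvdzP[a1 ea] := dvdz_gcdl a c; have /dvdzP[c1 ec] := dvdz_gcdr a c.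
have gp : 0 < gcdz a c by rewrite lt_def g0 /= /gcdz.
move: (gcdz a c) g0 gp e ea ec => g g0 gp e ea ec.
have e1 : u * a1 + v * c1 = 1 by apply: (mulfI g0); rewrite mulr1 -[RHS]e ea ec; ring.
pose D0 := sgn_ * (a1 * d - b * c1).
have gD : g * D0 = q%:Z.
  transitivity (sgn_ * (a * d - b * c)); first by rewrite /D0 ea ec; ring.
  by rewrite h mulrA s2 mul1r.
have D0p : 0 < D0 by rewrite -(pmulr_rgt0 _ gp) gD ltz_nat.
have [dn eD] : exists dn : nat, D0 = dn%:Z by exists `|D0|%N; rewrite gez0_abs // ltW.
have [gn eg] : exists gn : nat, g = gn%:Z by exists `|g|%N; rewrite gez0_abs // ltW.
have eq : (gn * dn)%N = q by apply: (can_inj absz_nat); move: gD; rewrite eD eg => <-; rewrite PoszM.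
have dn0 : (0 < dn)%N by rewrite -ltz_nat -eD.
pose B0 := sgn_ * (u * b + v * d).
pose B1 := (B0 %% dn%:Z)%Z; pose t := (B0 %/ dn%:Z)%Z.
have B1p : 0 <= B1 by rewrite modz_ge0 // eqz_nat -lt0n.
have B1l : B1 < dn%:Z by rewrite ltz_pmod // ltz_nat.
have [bn eb] : exists bn : nat, B1 = bn%:Z by exists `|B1|%N; rewrite gez0_abs.
have bl : (bn < dn)%N by rewrite -ltz_nat -eb.
have dq : (dn <= q)%N by rewrite dvdn_leq // -eq dvdn_mull.
have l1 : (dn < q.+1)%N by [].
have l2 : (bn < q.+1)%N by apply: ltn_trans bl _.
pose p : 'I_q.+1 * 'I_q.+1 := (Ordinal l1, Ordinal l2).
have rp : hecke_rep p by rewrite /hecke_rep /= bl -eq dvdn_mull.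
have hp : hecke_codiv p = sgn_ * g by rewrite /hecke_codiv /= -eq mulnK // eg.
exists (sgn_ * a1), (sgn_ * (a1 * t - v)), (sgn_ * c1), (sgn_ * (c1 * t + u)), p.
have e1' : u * a1 = 1 - v * c1 by rewrite -e1 addrK.
have eB : B1 + t * dn%:Z = B0 by rewrite addrC /t /B1 -divz_eq.
have eD' : dn%:Z = sgn_ * (a1 * d - b * c1) by rewrite -eD.
rewrite hp /=; split => //.
- transitivity ((sgn_ * sgn_) * (u * a1 + v * c1)); first by ring.
  by rewrite s2 e1.
- by rewrite mulrACA s2 mul1r.
- by rewrite mulrACA s2 mul1r.
rewrite -eb; split.
  transitivity (sgn_ * (a1 * (B1 + t * dn%:Z) - v * dn%:Z)); last by ring.
  rewrite eB eD' /B0; transitivity ((sgn_ * sgn_) * (u * a1 + v * c1) * b); last by ring.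
  by rewrite s2 e1 !mul1r.
transitivity (sgn_ * (c1 * (B1 + t * dn%:Z) + u * dn%:Z)); last by ring.
rewrite eB eD' /B0; transitivity ((sgn_ * sgn_) * (u * a1 + v * c1) * d); last by ring.
by rewrite s2 e1 !mul1r.
Qed.

(** The unimodular factor between two triangular matrices is triangular, with diagonal 1 since the
    lower entries are positive; reduction of b modulo d then makes it the identity. *)
Lemma hnf_unique p p' (x y u v : int) : hecke_rep p -> hecke_rep p' -> x * v - y * u = 1 ->
  hecke_codiv p = x * hecke_codiv p' -> 0 = u * hecke_codiv p' -> (p.2%:Z = x * p'.2%:Z + y * p'.1%:Z) -> (p.1%:Z = u * p'.2%:Z + v * p'.1%:Z) -> p = p'.
Proof.
move=> rp rp' dt e1 e2 e3 e4; have h' : hecke_codiv p' != 0.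
  apply: contraTneq q0 => h; have := hecke_rep_det rp'; rewrite h mul0r.
  by rewrite /sgn_if; case: neg; rewrite ?expr1 ?expr0 ?mulN1r ?mul1r; lia.
have u0 : u = 0 by move/esym/eqP: e2; rewrite mulf_eq0 (negbTE h') orbF => /eqP.
have d0 := hecke_rep_gt0 rp; have d0' := hecke_rep_gt0 rp'.
have [/andP[_ l] /andP[_ l']] := (rp, rp').
rewrite u0 mulr0 subr0 in dt; rewrite u0 mul0r add0r in e4.
have v1 : v = 1.
  move: e4 d0 d0' dt; move: (p.1 : nat) (p'.1 : nat) => A B e4 A0 B0 dt.
  have vp : 0 < v by rewrite -(pmulr_lgt0 _ (_ : 0 < B%:Z)) -?e4 ltz_nat.
  have xp : 0 < x by rewrite -(pmulr_lgt0 _ vp) dt.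
  by nia.
rewrite v1 mulr1 in dt; rewrite v1 mul1r in e4.
have E1 : p.1 = p'.1 by apply: val_inj; move: e4 => [].
have E2 : p.2 = p'.2.
  apply: val_inj; have : (p.2%:Z = p'.2%:Z + y * p'.1%:Z) by rewrite e3 dt mul1r.
  move: l; rewrite E1; move: l' => /=; move: (p'.1 : nat) (p.2 : nat) (p'.2 : nat) => A B B' l1 l2 l3.
  have : y = 0 by nia.
  by move=> y0; move: l3; rewrite y0 mul0r addr0 => -[].
by case: p p' E1 E2 {rp rp' e1 e2 e3 e4 d0 d0' l l' h'} => [? ?] [? ?] /= -> ->.
Qed.

Definition hecke_fun (F : C -> C) (z : C) : C := \sum_(p | hecke_rep p) slash k neg w F (hecke_codiv p) p.2%:Z 0 p.1%:Z z.

Lemma hecke_rep_det_mod p : hecke_rep p -> det_mod k (hecke_codiv p) p.2%:Z 0 p.1%:Z.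
Proof. by move=> h; rewrite /det_mod mulr0 subr0 hecke_rep_det. Qed.

Lemma mx2_inj a b c d a' b' c' d' : mx2 a b c d = mx2 a' b' c' d' -> [/\ a = a', b = b', c = c' & d = d'].
Proof.
by move=> /matrixP e; split; [have := e 0 0|have := e 0 1|have := e 1 0|have := e 1 1]; rewrite !mxE.
Qed.

Lemma mx2_inv a b c d : a * d - b * c = 1 -> mx2 a b c d *m mx2 d (- b) (- c) a = 1%:M /\ mx2 d (- b) (- c) a *m mx2 a b c d = 1%:M.
Proof.
move=> h; have -> : 1%:M = mx2 1 0 0 1 by rewrite [LHS]mx2E !mxE.
by rewrite !mul_mx2; split; congr mx2; rewrite -?h; ring.
Qed.

Lemma automorphic_hecke_fun F : automorphic k w F -> automorphic k (sgn_ * w) (hecke_fun F).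
Proof.
move=> hF a b c d dt z zu.
(* Right multiplication sends each representative to a coset with its own representative. Elsewhere
   the map is the identity, so that it permutes the whole finite type. *)
have /boolp.choice[f hf] (p : 'I_q.+1 * 'I_q.+1) : exists p', if hecke_rep p then hecke_rep p' /\ exists x y u v, x * v - y * u = 1 /\
    mx2 (hecke_codiv p) p.2%:Z 0 p.1%:Z *m mx2 a b c d = mx2 x y u v *m mx2 (hecke_codiv p') p'.2%:Z 0 p'.1%:Z else p' = p.
  case: (boolP (hecke_rep p)) => [rp|_]; last by exists p.
  have D1 : (hecke_codiv p * a + p.2%:Z * c) * (p.1%:Z * d) - (hecke_codiv p * b + p.2%:Z * d) * (p.1%:Z * c) = sgn_ * q%:Z.
    by rewrite -(hecke_rep_det rp) -[RHS]mulr1 -dt; ring.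
  have [x [y [u [v [p' [e1 rp' e2 e3 [e4 e5]]]]]]] := hnf_exists D1.
  exists p'; split => //; exists x, y, u, v; split => //.
  by rewrite !mul_mx2 !mul0r !mulr0 !add0r !addr0; congr mx2.
have hf1 p : hecke_rep p -> hecke_rep (f p) by move=> rp; have := hf p; rewrite rp => -[].
have injf : injective f.
  move=> p p' e; have := hf p; have := hf p'.
  case: (boolP (hecke_rep p)) => rp; case: (boolP (hecke_rep p')) => rp'.
  - rewrite -e => -[r' [x' [y' [u' [v' [dt' E']]]]]] [r [x [y [u [v [dt1 E]]]]]].
    have [Gi _] := mx2_inv dt; have [_ Xi] := mx2_inv dt'.
    have EE : mx2 (hecke_codiv p) p.2%:Z 0 p.1%:Z = mx2 x y u v *m mx2 v' (- y') (- u') x' *m mx2 (hecke_codiv p') p'.2%:Z 0 p'.1%:Z.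
      rewrite -[LHS]mulmx1 -Gi mulmxA E -!mulmxA.
      rewrite -[in RHS](mulmx1 (mx2 (hecke_codiv p') _ _ _)) -Gi [in RHS](mulmxA _ (mx2 a b c d)) E'.
      by rewrite !(mulmxA (mx2 v' _ _ _)) Xi mul1mx.
    move: EE; rewrite !mul_mx2 !mulr0 !addr0 => /mx2_inj[f1 f2 f3 f4].
    apply: (hnf_unique rp rp' _ f1 f3 f2 f4).
    by transitivity ((x * v - y * u) * (x' * v' - y' * u')); [ring|rewrite dt1 dt' mulr1].
  - by move=> e2 _; have := hf1 _ rp; rewrite e e2 (negbTE rp').
  - by move=> _ e1; have := hf1 _ rp'; rewrite -e e1 (negbTE rp).
  - by move=> <- <-.
have hfE p : hecke_rep (f p) = hecke_rep p.
  apply/idP/idP => [|/hf1//]; case: (boolP (hecke_rep p)) => // rp.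
  by have := hf p; rewrite (negbTE rp) => ->; rewrite (negbTE rp).
rewrite /hecke_fun mulr_sumr [in RHS](reindex_inj injf) /=.
apply: eq_big => [p|p rp]; first by rewrite hfE.
have := hf p; rewrite rp => -[rp' [x [y [u [v [dt1]]]]]].
rewrite !mul_mx2 => /mx2_inj[f1 f2 f3 f4].
have pos p' : hecke_rep p' -> 0 < sgn_ * (hecke_codiv p' * p'.1%:Z - p'.2%:Z * 0).
  by move=> r'; rewrite mulr0 subr0 hecke_rep_det // mulrA sgn_if_sq mul1r ltz_nat.
rewrite slash_right ?hecke_rep_det_mod ?pos //; congr (_ * _).
by rewrite f1 f2 f3 f4 slash_left ?hecke_rep_det_mod ?pos.
Qed.

End HeckeSum.

(** * Hecke operators on coefficients *)

Section Level.
Variables (k : nat) (hk : (1 <= k <= 11)%N).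

Definition Nk : nat := (12 %/ gcdn 12 k)%N.
Local Notation D := (Dk k).

Lemma gcd12_gt0 : (0 < gcdn 12 k)%N. Proof. by rewrite gcdn_gt0. Qed.
Lemma Nk_mul : (Nk * gcdn 12 k)%N = 12%N. Proof. by rewrite divnK // dvdn_gcdl. Qed.
Lemma Dk_mul : (D * gcdn 12 k)%N = k. Proof. by rewrite divnK // dvdn_gcdr. Qed.
Lemma Nk_gt0 : (0 < Nk)%N. Proof. by have := Nk_mul; case: Nk. Qed.
Lemma Dk_gt0 : (0 < D)%N. Proof. by have := Dk_mul; case: D => // /esym; case/andP: hk; case: k. Qed.
Lemma Dk_lt : (D < Nk)%N.
Proof. by rewrite -(ltn_pmul2r gcd12_gt0) Nk_mul Dk_mul; case/andP: hk. Qed.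
Lemma coprime_ND : coprime Nk D.
Proof.
by rewrite /coprime -(eqn_pmul2r gcd12_gt0) mul1n muln_gcdl Nk_mul Dk_mul.
Qed.

Lemma dvd12k (x : int) : (12 %| k%:Z * x)%Z = (Nk %| x)%Z.
Proof.
rewrite !dvdzE abszM absz_nat (_ : `|12%Z|%N = (Nk * gcdn 12 k)%N); last by rewrite Nk_mul.
by rewrite -{2}Dk_mul mulnAC dvdn_pmul2r ?gcd12_gt0 // Gauss_dvdr // coprime_ND.
Qed.

(** N divides 12, and every unit modulo a divisor of 12 has square 1; all divisors are checked. *)
Lemma coprime_sq d : coprime d Nk -> (Nk %| (d * d)%N%:Z - 1)%Z.
Proof.
have h : Nk \in divisors 12 by rewrite -dvdn_divisors // -Nk_mul dvdn_mulr.
pose P n d := coprime d n ==> ((d * d) %% n == 1 %% n)%N.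
have /allP chk : all (fun n => all (P n) (iota 0 n)) (divisors 12) by vm_compute.
have N0 := Nk_gt0; have /allP/(_ (d %% Nk)%N) := chk _ h.
rewrite mem_iota add0n ltn_mod N0 /= => /(_ isT) /implyP; rewrite coprime_modl modnMml modnMmr => H /H /eqP e.
rewrite -eqz_mod_dvd; apply/eqP; rewrite !modz_nat; congr Posz; exact: e.
Qed.

Lemma coprime_odd d : coprime d Nk -> (4 %| k)%N \/ odd d.
Proof.
move=> cd; case: (boolP (odd d)) => od; [by right|left].
have : ~~ (2 %| Nk)%N.
  apply/negP => h2; have : (2 %| gcdn d Nk)%N by rewrite dvdn_gcd h2 dvdn2 od.
  by rewrite (eqP cd).
have h : (gcdn 12 k %| k)%N := dvdn_gcdr _ _; have e := Nk_mul.
move: h e; move: (gcdn 12 k) Nk => g n h e o.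
have hn : (n %| 12)%N by rewrite -e dvdn_mulr.
have : n \in divisors 12 by rewrite -dvdn_divisors.
rewrite !inE => /orP[|/orP[|/orP[|/orP[|/orP[|]]]]] /eqP en; move: o e; rewrite en // => _ e.
  by apply: dvdn_trans h; rewrite (_ : g = 12%N) //; lia.
by apply: dvdn_trans h; rewrite (_ : g = 4%N) //; lia.
Qed.

(** Makes [chi], a power of i with exponent k (d - 1), multiplicative on integers prime to N: either
    4 divides k or both integers are odd. *)
Lemma coprime_prod4 a b : coprime a Nk -> coprime b Nk -> (4 %| k%:Z * (a%:Z - 1) * (b%:Z - 1))%Z.
Proof.
move=> /coprime_odd[h _|oa]; first by rewrite -mulrA dvdz_mulr.
move=> /coprime_odd[h|ob]; first by rewrite -mulrA dvdz_mulr.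
rewrite -(odd_double_half a) -(odd_double_half b) oa ob; apply/dvdzP.
by exists (k%:Z * a./2%:Z * b./2%:Z); rewrite -!muln2; lia.
Qed.

(** The integer t for which t/N is the frequency; Hecke operators are described by multiplication of
    t, not of n. [nindex] inverts it when t is D modulo N, by a division that is then exact. *)
Definition nfreq (n : int) : int := Nk%:Z * n + D%:Z.
Definition nindex (t : int) : int := ((t - D%:Z) %/ Nk%:Z)%Z.

Lemma nindexK n : nindex (nfreq n) = n.
Proof. by rewrite /nindex /nfreq addrK mulKz // eqz_nat -lt0n Nk_gt0. Qed.

Lemma nfreqK t : (Nk %| t - D%:Z)%Z -> nfreq (nindex t) = t.
Proof. by move=> h; rewrite /nfreq /nindex mulrC divzK // subrK. Qed.

Lemma nfreq_mod n : (Nk %| nfreq n - D%:Z)%Z.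
Proof. by rewrite /nfreq addrK dvdz_mulr. Qed.

End Level.

(** * Sums along arithmetic progressions and sums of roots of unity *)

Section HalfReindex.
Context {R : realType}.
Local Notation C := R[i].

(** The partial sums of [u] at multiples of d are the partial sums of the subsequence. *)
Lemma sumN_subseq (u : nat -> C) (d e : nat) (B x : R) : (e < d)%N -> 0 <= x < 1 ->
  (forall n, normc (u n) <= B * x ^+ n) ->
  (forall n, u n != 0 -> exists j, n = (d * j + e)%N) ->
  sumN u = sumN (fun j => u (d * j + e)%N).
Proof.
move=> ed x01 h hs; have d0 : (0 < d)%N by apply: leq_ltn_trans ed.
have B0 : 0 <= B by have := h 0%N; rewrite expr0 mulr1; apply: le_trans (normc_ge0 _).
have h' j : normc (u (d * j + e)%N) <= B * x ^+ j.
  apply: le_trans (h _) _; rewrite ler_wpM2l // ler_wiXn2l //; try by case/andP: x01 => // _ /ltW.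
  by rewrite (leq_trans _ (leq_addr _ _)) // leq_pmull.
have c1 := sumN_cvg x01 h; have c2 := sumN_cvg x01 h'.
have E j : series u (d * j)%N = series (fun j => u (d * j + e)%N) j.
  elim: j => [|j IH]; first by rewrite muln0 !seriesEnat /= !big_geq.
  rewrite !seriesEnat /= in IH *; rewrite big_nat_recr //= -IH.
  rewrite (@big_cat_nat _ _ _ (d * j)%N) ?leq_mul //=; congr (_ + _).
  rewrite (bigD1_seq (d * j + e)%N) ?iota_uniq //=; last first.
    by rewrite mem_index_iota leq_addr mulnS addnC ltn_add2r.
  rewrite big_nat_cond big1 ?addr0 // => i /andP[/andP[l1 l2] ne].
  apply/eqP; apply: contraNT ne => /hs[j' ej]; apply/eqP.
  by rewrite ej; congr (d * _ + _)%N; move: l1 l2; rewrite ej; nia.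
apply: cvgc_unique c2.
have -> : series (fun j => u (d * j + e)%N) = series u \o muln d by apply/funext => j; rewrite /= E.
have lim : (muln d) @ \oo --> \oo.
  by apply/cvgnyPge => A; exists A => // n /= An; rewrite (leq_trans An) // leq_pmull.
by case: c1 => a b; split; [exact: (cvg_comp _ _ lim a)|exact: (cvg_comp _ _ lim b)].
Qed.

(* Both supports are arithmetic progressions, parametrised by the common
   quotient u. *)
Lemma half_reindex (N d a E E' : nat) (U V : nat -> C) (g : C) (B x B' x' : R) :
  (0 < d)%N -> (0 < a)%N -> (0 < E < N)%N -> (0 < E' < N)%N -> coprime d N -> coprime a N -> (N %| d%:Z * E'%:Z - a%:Z * E%:Z)%Z ->
  0 <= x < 1 -> 0 <= x' < 1 ->
  (forall n, normc (U n) <= B * x ^+ n) -> (forall n, normc (V n) <= B' * x' ^+ n) ->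
  (forall n, U n != 0 -> (d %| N * n + E)%N) -> (forall n, V n != 0 -> (a %| N * n + E')%N) ->
  (forall n n' u, (N * n + E = d * u)%N -> (N * n' + E' = a * u)%N -> U n = g * V n') ->
  sumN U = g * sumN V.
Proof.
move=> d0 a0 /andP[E0 EN] /andP[E0' EN'] cd ca hc x01 x01' hU hV sU sV hm.
have N0 : (0 < N)%N by apply: ltn_trans EN.
(* The solution u0 in ]0, N[ of d u = E modulo N also solves a u = E', by the congruence between d
   E' and a E; so both progressions start at the quotient u0. *)
have [u0 u0p hu0] : exists2 u0 : nat, (0 < u0 < N)%N & (N %| d%:Z * u0%:Z - E%:Z)%Z.
  have [s [t e]] := Bezoutz d N; rewrite [gcdz _ _](_ : _ = 1) in e; last by congr Posz; exact/eqP.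
  pose v := ((s * E%:Z) %% N)%Z.
  have v0 : 0 <= v by rewrite modz_ge0 // eqz_nat -lt0n.
  have vN : v < N%:Z by rewrite ltz_pmod // ltz_nat.
  have hv : (N %| d%:Z * v - E%:Z)%Z.
    apply/dvdzP; exists (- (t * E%:Z) - d%:Z * (s * E%:Z %/ N)%Z).
    have := divz_eq (s * E%:Z) N; rewrite -/v; set y := (_ %/ _)%Z => ey.
    have -> : v = s * E%:Z - y * N%:Z by rewrite ey addrAC subrr add0r.
    clearbody y.
    transitivity ((s * d%:Z + t * N%:Z - 1) * E%:Z + (- (t * E%:Z) - d%:Z * y) * N%:Z); first by ring.
    by rewrite e subrr mul0r add0r.
  have [m em] : exists m : nat, v = m%:Z by exists `|v|%N; rewrite gez0_abs.
  exists m; last by rewrite -em.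
  rewrite -!ltz_nat -em vN andbT lt_def v0 andbT; apply: contraTneq hv => ->.
  by rewrite mulr0 sub0r dvdzE abszN /= gtnNdvd.
have [e he] : exists e : nat, (N * e + E = d * u0)%N.
  have /dvdzP[y ey] := hu0.
  have y0 : 0 <= y by nia.
  by exists `|y|%N; lia.
have [e' he'] : exists e' : nat, (N * e' + E' = a * u0)%N.
  have : (N %| a%:Z * u0%:Z - E'%:Z)%Z.
    rewrite -(Gauss_dvdzr (n := d)); last by rewrite coprimezE /= coprime_sym.
    have -> : d%:Z * (a%:Z * u0%:Z - E'%:Z) = a%:Z * (d%:Z * u0%:Z - E%:Z) - (d%:Z * E'%:Z - a%:Z * E%:Z) by ring.
    by rewrite rpredB ?dvdz_mull.
  move=> /dvdzP[y ey]; have y0 : 0 <= y by nia.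
  by exists `|y|%N; lia.
have supp (f : nat) (F F' : nat) (W : nat -> C) : (0 < f)%N -> coprime f N -> (0 < F)%N -> (N * F' + F = f * u0)%N ->
    (forall n, W n != 0 -> (f %| N * n + F)%N) -> (F' < f)%N /\ forall n, W n != 0 -> exists j, n = (f * j + F')%N.
  move=> f0 cf F0 eF h; have lt : (F' < f)%N by move: u0p => /andP[_ l]; nia.
  split => // n /h /dvdnP[y ey].
  have : (f %| N%:Z * (n%:Z - F'%:Z))%Z by apply/dvdzP; exists (y%:Z - u0%:Z); lia.
  rewrite Gauss_dvdzr ?coprimezE //= => /dvdzP[j ej].
  have j0 : 0 <= j by nia.
  by exists `|j|%N; lia.
have [l1 s1] := supp _ _ _ _ d0 cd E0 he sU.
have [l2 s2] := supp _ _ _ _ a0 ca E0' he' sV.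
rewrite (sumN_subseq l1 x01 hU s1) (sumN_subseq l2 x01' hV s2).
have V0 : 0 <= B' by have := hV 0%N; rewrite expr0 mulr1; apply: le_trans (normc_ge0 _).
have hV' j : normc (V (a * j + e')%N) <= B' * x' ^+ j.
  apply: le_trans (hV _) _; rewrite ler_wpM2l // ler_wiXn2l //; try by case/andP: x01' => // _ /ltW.
  by rewrite (leq_trans _ (leq_addr _ _)) // leq_pmull.
have U0 : 0 <= B by have := hU 0%N; rewrite expr0 mulr1; apply: le_trans (normc_ge0 _).
have hU' j : normc (U (d * j + e)%N) <= B * x ^+ j.
  apply: le_trans (hU _) _; rewrite ler_wpM2l // ler_wiXn2l //; try by case/andP: x01 => // _ /ltW.
  by rewrite (leq_trans _ (leq_addr _ _)) // leq_pmull.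
apply: (cvgc_unique (sumN_cvg x01 hU')).
have -> : series (fun j => U (d * j + e)%N) = (fun n => g * series (fun j => V (a * j + e')%N) n).
  apply/funext => n; rewrite !seriesEnat /= mulr_sumr; apply: eq_bigr => j _.
  apply: (hm _ _ (N * j + u0)%N).
    by rewrite mulnDr -addnA he mulnDr; congr (_ + _)%N; rewrite mulnCA.
  by rewrite mulnDr -addnA he' mulnDr; congr (_ + _)%N; rewrite mulnCA.
by apply: cvgcM; [exact: cvgc_cst|exact: sumN_cvg x01' hV'].
Qed.

(** The real part differs from 1 because 1 - cos(2 pi u) = 2 sin(pi u)^2 > 0 for 0 < u < 1. *)
Lemma e2pi_ratio_neq1 (m d : nat) : (0 < m < d)%N -> e2pi (m%:R / d%:R : R)%:C != 1 :> C.
Proof.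
move=> /andP[m0 md]; have d0 : (0 < d)%N by apply: ltn_trans md.
rewrite e2pi_real; apply/eqP => -[h _]; move: h.
set u : R := m%:R / d%:R; have u0 : 0 < u by rewrite divr_gt0 ?ltr0n.
have u1 : u < 1 by rewrite ltr_pdivrMr ?ltr0n // mul1r ltr_nat.
have s0 : 0 < sin (pi * u).
  by apply: sin_gt0_pi; rewrite mulr_gt0 ?pi_gt0 //= -[ltRHS]mulr1 ltr_pM2l ?pi_gt0.
have -> : 2 * pi * u = (pi * u) *+ 2 by rewrite -mulrA mulr_natl.
rewrite mulr2n cosD -!expr2 => h; have : sin (pi * u) ^+ 2 = 0.
  have := cos2Dsin2 (pi * u); move: h; move: (sin _ ^+ 2) (cos _ ^+ 2) => S T; lra.
by move=> /eqP; rewrite sqrf_eq0 gt_eqF.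
Qed.

Lemma root_sum (d : nat) (M : int) : (0 < d)%N ->
  \sum_(0 <= b < d) e2pi (b%:R * (M%:~R / d%:R) : R)%:C = if (d %| M)%Z then d%:R else 0 :> C.
Proof.
move=> d0; set w := e2pi (M%:~R / d%:R : R)%:C.
have dR : d%:R != 0 :> R by rewrite pnatr_eq0 -lt0n.
have -> : \sum_(0 <= b < d) e2pi (b%:R * (M%:~R / d%:R) : R)%:C = \sum_(0 <= b < d) w ^+ b.
  by apply: eq_bigr => b _; rewrite rcM rc_nat e2piMn.
have wd : w ^+ d = 1.
  by rewrite -e2piMn -rc_nat -rcM mulrC divfK // rc_int e2pi_int.
case: ifPn => h.
  have -> : w = 1.
    have /dvdzP[y ey] := h.
    by rewrite /w ey (_ : (y * d%:Z)%:~R = y%:~R * d%:R :> R) ?intrM // mulfK // rc_int e2pi_int.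
  by under eq_bigr do rewrite expr1n; rewrite big_const_nat subn0 iter_addr_0.
have w1 : w != 1.
  have := divz_eq M d; set m := (M %% d)%Z; set y := (M %/ d)%Z => eM.
  have m0 : 0 <= m by rewrite modz_ge0 // eqz_nat -lt0n.
  have ml : m < d%:Z by rewrite ltz_pmod // ltz_nat.
  have [n en] : exists n : nat, m = n%:Z by exists `|m|%N; rewrite gez0_abs.
  have n0 : (0 < n < d)%N.
    rewrite -!ltz_nat -en ml andbT lt_def m0 andbT; apply: contraNneq h => e.
    by rewrite eM e addr0 dvdz_mull.
  have := e2pi_ratio_neq1 n0; congr (_ != _).
  rewrite /w eM en (_ : (y * d%:Z + n%:Z)%:~R = y%:~R * d%:R + n%:R :> R) ?intrD ?intrM // mulrDl mulfK // rcD e2piD rc_int e2pi_int mul1r.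
  by [].
apply: (mulfI (_ : w - 1 != 0)); first by rewrite subr_eq0.
by rewrite big_mkord -subrX1 wd subrr mulr0.
Qed.

End HalfReindex.

(** * The character chi and Hecke operators on single Whittaker terms *)

Section HeckeCoefficients.
Context {R : realType}.
Local Notation C := R[i].
Variables (k : nat) (hk : (1 <= k <= 11)%N) (r : R) (r0 : r != 0).
Local Notation nu := (@freq R k).
Local Notation wser := (@wser R k r).
Local Notation wterm := (@wterm R k r).
Local Notation subexp := (@subexp R k).
Local Notation N := (Nk k).
Local Notation D := (Dk k).
Local Notation nfreq := (nfreq k).
Local Notation nindex := (nindex k).

Lemma summableZ_big (I : Type) (l : seq I) (u : I -> int -> C) : (forall i, summableZ (u i)) ->
  summableZ (fun n => \sum_(i <- l) u i n) /\ sumZ (fun n => \sum_(i <- l) u i n) = \sum_(i <- l) sumZ (u i).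
Proof.
move=> h; elim: l => [|i l [IH1 IH2]].
  split; last by rewrite big_nil -[RHS]sumZ0; apply: eq_sumZ => n; rewrite big_nil.
  by exists 0, 0; rewrite lexx ltr01; split => // n; rewrite !big_nil normc0 mul0r.
have e n : u i n + \sum_(j <- l) u j n = \sum_(j <- i :: l) u j n by rewrite big_cons.
split; first by apply: (eq_summableZ e); exact: summableZD.
by rewrite big_cons -IH2 -(eq_sumZ e) summableZ_sumD.
Qed.

Lemma nu_nfreq n : nu n = (nfreq n)%:~R / N%:R.
Proof.
have g0 : (gcdn 12 k)%:R != 0 :> R by rewrite pnatr_eq0 -lt0n gcd12_gt0.
have N0 : N%:R != 0 :> R by rewrite pnatr_eq0 -lt0n Nk_gt0.
have eN : N%:R * (gcdn 12 k)%:R = 12 :> R by rewrite -natrM Nk_mul.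
have eD : D%:R * (gcdn 12 k)%:R = k%:R :> R by rewrite -natrM Dk_mul.
rewrite /freq /nfreq intrD intrM -!pmulrn -eD -eN.
by move: g0 N0; move: (gcdn 12 k)%:R N%:R D%:R n%:~R => g a b m g0 a0; field; rewrite a0 g0.
Qed.

Lemma root12_3 (x : int) : root12 (x * 3) = Num.imaginary ^ x :> C.
Proof.
have e : root12 3 = Num.imaginary :> C.
  rewrite root12E (_ : (3 : int)%:~R / 12 = 4^-1 :> R); last first.
    by rewrite (_ : (3 : int)%:~R = 3 :> R) //; lra.
  rewrite e2pi_real (_ : 2 * pi * 4^-1 = pi / 2 :> R); last by move: (pi : R) => p; lra.
  by rewrite cos_pihalf sin_pihalf.
have en n : root12 (n%:Z * 3) = Num.imaginary ^+ n :> C.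
  by rewrite -e -root12X -[3 *+ n]mulr_natr mulrC !natz.
case: x => n; first exact: en.
by rewrite NegzE mulNr root12N en -exprnN.
Qed.

Lemma chiE (d : int) : chi k d = root12 (k%:Z * (d - 1) * 3) :> C.
Proof. by rewrite root12_3. Qed.

Lemma chi_neq0 d : chi k d != 0 :> C. Proof. by rewrite chiE root12_neq0. Qed.
Lemma normc_chi d : normc (chi k d : C) = 1. Proof. by rewrite chiE normc_root12. Qed.

Lemma chiM a b : coprime a N -> coprime b N -> chi k (a * b)%N%:Z = chi k a%:Z * chi k b%:Z :> C.
Proof.
move=> ca cb; rewrite !chiE -root12D; apply: root12_dvd.
have /dvdzP[y ey] := coprime_prod4 hk ca cb.
apply/dvdzP; exists y; transitivity (3 * (k%:Z * (a%:Z - 1) * (b%:Z - 1))); last by rewrite ey; ring.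
by rewrite PoszM; ring.
Qed.

Lemma chi_sq a : coprime a N -> chi k a%:Z * chi k a%:Z = 1 :> C.
Proof.
move=> ca; rewrite -chiM // chiE -(@root12_0 R); apply: root12_dvd; rewrite subr0.
have ca2 : coprime (a * a) N by rewrite coprimeMl ca.
have : (12 %| k%:Z * ((a * a)%N%:Z - 1))%Z by rewrite dvd12k //; exact: coprime_sq.
by move/(dvdz_mulr 3).
Qed.

Variables (neg : bool) (w : int).
Local Notation sgn_ := (sgn_if neg).

Lemma sgnR_sq : sgn_%:~R * sgn_%:~R = 1 :> R.
Proof. by rewrite -intrM sgn_if_sq. Qed.

Lemma wterm_shift n (x y h : R) : wterm w n ((x + h) +i* y) = wterm w n (x +i* y) * e2pi (nu n * h)%:C.
Proof. by rewrite !wtermE /= [nu n * (x + h)]mulrDr rcD e2piD; ring. Qed.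

(** Scaling by a/d, with reflection when the sign is -1, leaves the argument of W and the
    exponential unchanged when t is multiplied accordingly. The normalisation 1 / sqrt|nu| turns the
    factor d, the number of translates, into sqrt(a d). *)
Lemma wterm_match n n' (a d : nat) z : (0 < a)%N -> (0 < d)%N -> uhp z -> nfreq n * (sgn_ * a%:Z) = d%:Z * nfreq n' ->
  d%:R%:C * wterm w n ((sgn_%:~R * a%:R * Re z / d%:R) +i* (a%:R * Im z / d%:R)) = (Num.sqrt (a * d)%N%:R)%:C * wterm (sgn_ * w) n' z.
Proof.
move=> a0 d0 zu e; have aR : 0 < a%:R :> R by rewrite ltr0n.
have dR : 0 < d%:R :> R by rewrite ltr0n.
have N0 : 0 < N%:R :> R by rewrite ltr0n Nk_gt0.
have s2 := sgnR_sq; have hn : nu n = d%:R / a%:R * (sgn_%:~R * nu n').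
  rewrite !nu_nfreq; have := congr1 (fun x : int => x%:~R : R) e; rewrite !intrM -!pmulrn => e'.
  have e2 : (nfreq n)%:~R * a%:R = sgn_%:~R * d%:R * (nfreq n')%:~R :> R.
    transitivity (sgn_%:~R * ((nfreq n)%:~R * (sgn_%:~R * a%:R)) : R); last by rewrite e' mulrA.
    transitivity ((sgn_%:~R * sgn_%:~R) * ((nfreq n)%:~R * a%:R) : R); first by rewrite s2 mul1r.
    by move: (sgn_%:~R : R) (_%:~R : R) (a%:R : R) => x y t; ring.
  have -> : (nfreq n)%:~R = sgn_%:~R * d%:R * (nfreq n')%:~R / a%:R :> R by rewrite -e2 mulfK ?gt_eqF.
  by move: (gt_eqF N0) (gt_eqF aR) => h1 h2; field; rewrite h1 h2.
have hs : `|sgn_%:~R : R| = 1 by rewrite /sgn_if; case: (neg); rewrite ?expr1 ?expr0 ?normrN1 ?normr1.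
have han : `|nu n| = d%:R / a%:R * `|nu n'|.
  by rewrite hn normrM (normrM _ (nu n')) hs mul1r ger0_norm // divr_ge0 // ltW.
rewrite !wtermE /= han.
have -> : @wparam R k w n = @wparam R k (sgn_ * w) n'.
  rewrite /wparam hn sgrM gtr0_sg ?divr_gt0 // mul1r sgrM intrM.
  have -> : Num.sg (sgn_%:~R : R) = sgn_%:~R.
    by rewrite /sgn_if; case: (neg); rewrite ?expr1 ?expr0 ?sgrN1 ?sgr1.
  by ring.
have ad : 0 < a%:R * d%:R^-1 :> R by rewrite mulr_gt0 ?invr_gt0.
have -> : 4 * pi * (d%:R / a%:R * `|nu n'|) * (a%:R * Im z / d%:R) = 4 * pi * `|nu n'| * Im z.
  by move: (gt_eqF dR) (gt_eqF aR) => h1 h2; move: (pi : R) => p; field; rewrite h1 h2.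
have -> : nu n * (sgn_%:~R * a%:R * Re z / d%:R) = nu n' * Re z.
  rewrite hn; transitivity ((sgn_%:~R * sgn_%:~R) * nu n' * Re z); last by rewrite s2 mul1r.
  by move: (gt_eqF dR) (gt_eqF aR) => h1 h2; field; rewrite h1 h2.
move: (wW _ _ _) (e2pi _) => G e1; rewrite !mulrA -!rcM; congr (_ * _ * _); congr (_%:C).
rewrite natrM !sqrtrM ?divr_ge0 ?ltW // sqrtrV ?ltW //.
have sa : Num.sqrt a%:R != 0 :> R by rewrite gt_eqF // sqrtr_gt0.
have sd : Num.sqrt d%:R != 0 :> R by rewrite gt_eqF // sqrtr_gt0.
have sn : Num.sqrt `|nu n'| != 0 by rewrite gt_eqF // sqrtr_gt0 freq_norm_gt0.
rewrite -[X in X / _ = _](sqr_sqrtr (ltW dR)).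
by move: sa sd sn; move: (Num.sqrt _) (Num.sqrt _) (Num.sqrt _) => x y t x0 y0 t0; field; rewrite x0 y0 t0.
Qed.

Variables (q : nat) (q0 : (0 < q)%N) (hq : (12 %| k%:Z * (sgn_ * q%:Z - 1))%Z).

Lemma coprime_q : coprime q N.
Proof.
move: hq; rewrite dvd12k // => /dvdzP[y ey].
rewrite -[coprime _ _]/(coprimez q%:Z N%:Z); apply/coprimezP; exists (sgn_, - y) => /=.
by rewrite mulNr -ey; ring.
Qed.

Lemma coprime_dvdq d : (d %| q)%N -> coprime d N.
Proof. by move=> h; apply: coprime_dvdl h coprime_q. Qed.

(** The coefficient A(m t / a^2) of the divisor a, with m = q up to sign, written as m/a times t/a
    so that both divisions are exact. *)
Definition hecke_term (a : nat) (c : int -> C) (n : int) : C :=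
  if (a %| nfreq n)%Z then c (nindex (sgn_ * (q %/ a)%:Z * (nfreq n %/ a)%Z)) else 0.

(** The new t is again D modulo N: multiply by a^2, which is 1 modulo N, and use that the
    determinant is 1 modulo N. *)
Lemma nfreq_move a n : (a %| q)%N -> (a %| nfreq n)%Z ->
  nfreq (nindex (sgn_ * (q %/ a)%:Z * (nfreq n %/ a)%Z)) = sgn_ * (q %/ a)%:Z * (nfreq n %/ a)%Z.
Proof.
move=> aq /dvdzP[u eu]; rewrite nfreqK //.
have a0 : (0 < a)%N by apply: dvdn_gt0 aq.
rewrite eu mulzK ?eqz_nat -?lt0n //.
have /dvdzP[y1 e1] := nfreq_mod k n; have := hq; rewrite dvd12k // => /dvdzP[y2 e2].
have /dvdzP[y3 e3] := coprime_sq (coprime_dvdq aq).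
have := divnK aq; move: (q %/ a)%N => d ed.
have e2' : sgn_ * (d%:Z * a%:Z) - 1 = y2 * N%:Z by rewrite -e2 -ed PoszM.
rewrite -(Gauss_dvdzr (n := (a * a)%N)); last by rewrite coprimezE /= coprime_sym coprimeMl coprime_dvdq.
apply/dvdzP; exists (y2 * (u * a%:Z) - y3 * D%:Z + y1).
rewrite eu in e1.
transitivity ((sgn_ * (d%:Z * a%:Z) - 1) * (u * a%:Z) - ((a * a)%N%:Z - 1) * D%:Z + (u * a%:Z - D%:Z)).
  by rewrite PoszM; ring.
by rewrite e1 e2' e3; ring.
Qed.

Lemma subexp_hecke_term a c : (a %| q)%N -> subexp c -> subexp (hecke_term a c).
Proof.
move=> aq hc e e0; have a0 : (0 < a)%N by apply: dvdn_gt0 aq.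
have d0 : (0 < q %/ a)%N by rewrite divn_gt0 // dvdn_leq.
have aR : 0 < a%:R :> R by rewrite ltr0n.
have dR : 0 < (q %/ a)%N%:R :> R by rewrite ltr0n.
have [A hA] := hc (e * (a%:R / (q %/ a)%N%:R)) (mulr_gt0 e0 (divr_gt0 aR dR)).
have A0 := subexp_ge0 hA; exists A => n; rewrite /hecke_term; case: ifP => h; last first.
  by rewrite normc0 mulr_ge0 ?expR_ge0.
apply: le_trans (hA _) _; rewrite ler_wpM2l // ler_expR -mulrA ler_wpM2l ?(ltW e0) //.
have hs : `|sgn_%:~R : R| = 1 by rewrite /sgn_if; case: (neg); rewrite ?expr1 ?expr0 ?normrN1 ?normr1.
have /dvdzP[u eu] := h.
have E1 : nu n = a%:R * (u%:~R / N%:R) by rewrite nu_nfreq eu intrM mulrAC mulrC.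
have -> : nu (nindex (sgn_ * (q %/ a)%:Z * (nfreq n %/ a)%Z)) = sgn_%:~R * ((q %/ a)%N%:R * (u%:~R / N%:R)).
  by rewrite nu_nfreq nfreq_move // eu mulzK ?eqz_nat -?lt0n // !intrM -!mulrA.
rewrite E1 normrM (normrM _ (u%:~R / N%:R)) (normrM a%:R) hs mul1r (ger0_norm (ltW aR)) (ger0_norm (ltW dR)).
by rewrite (mulrA (a%:R / _)) divfK ?gt_eqF.
Qed.
End HeckeCoefficients.

(** * Fourier expansion of a Hecke sum *)

Section HeckeExpansion.
Context {R : realType}.
Local Notation C := R[i].
Variables (k : nat) (hk : (1 <= k <= 11)%N) (r : R) (r0 : r != 0).
Local Notation nu := (@freq R k).
Local Notation wser := (@wser R k r).
Local Notation wterm := (@wterm R k r).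
Local Notation subexp := (@subexp R k).
Local Notation N := (Nk k).
Local Notation D := (Dk k).
Local Notation nfreq := (nfreq k).
Local Notation nindex := (nindex k).
Variables (neg : bool) (w : int).
Local Notation sgn_ := (sgn_if neg).
Variables (q : nat) (q0 : (0 < q)%N) (hq : (12 %| k%:Z * (sgn_ * q%:Z - 1))%Z).
Local Notation hecke_term := (hecke_term k neg q).

(** For c = 0 the exponent is b d - 3 d + 3, and its part 3 - 3 d produces chi(d). *)
Lemma etav_upper (a b d : int) : (etav k a b 0 d : C)^-1 = chi k d * root12 (- (k%:Z * b * d)).
Proof.
rewrite etavE chiE -root12N -root12D; apply: congr1; rewrite etaexpE /etaexp0; ring.
Qed.

Lemma mob_upper (a b : int) (d : nat) (z : C) : (0 < d)%N -> mob a b 0 d%:Z (conj_if neg z) =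
  (a%:~R * Re z / d%:R + b%:~R * d%:R^-1) +i* ((a * sgn_)%:~R * Im z / d%:R).
Proof.
move=> d0; have dR : d%:R != 0 :> R by rewrite pnatr_eq0 -lt0n.
rewrite /mob /cdfac mul0r add0r -!rc_int -pmulrn -rcV; set x := (_ + _) * _.
have eR : Re x = (a%:~R * Re z + b%:~R) / d%:R.
  by rewrite /x mulrC ReZ ReD ReZ Re_conj_if /= mulrC.
have eI : Im x = (a * sgn_)%:~R * Im z / d%:R.
  by rewrite /x mulrC ImZ ImD ImZ Im_conj_if /= addr0 mulrC intrM -!mulrA.
by rewrite -mulrDl -eR -eI; case: x {eR eI}.
Qed.

Lemma phase_upper (d : nat) (z : C) : (0 < d)%N -> phase 0 d%:Z z = 1.
Proof.
move=> d0; rewrite /phase /cdfac mul0r add0r -rc_int -pmulrn normcRE ger0_norm //.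
by rewrite divff // rc_eq0 pnatr_eq0 -lt0n.
Qed.

Lemma nfreq_negS (n : nat) : nfreq (- n.+1%:Z) = - (N * n + (N - D))%N%:Z.
Proof.
have := Dk_lt hk; rewrite /nfreq; move: N D => x y h.
by rewrite PoszD PoszM -(subzn (ltnW h)) -[n.+1]addn1 PoszD; ring.
Qed.

(** The sum over b is a sum of roots of unity that selects the t divisible by d. The surviving term
    at t = d u matches the one at t' = a u, up to the sign of the determinant, and [half_reindex]
    carries one series to the other. *)
Lemma hecke_d (d : nat) c z : (d %| q)%N -> subexp c -> uhp z ->
  \sum_(0 <= b < d) slash k neg w (wser w c) (sgn_ * (q %/ d)%N%:Z) b%:Z 0 d%:Z z =
  (Num.sqrt q%:R)%:C * chi k d%:Z * wser (sgn_ * w) (hecke_term (q %/ d) c) z.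
Proof.
move=> dq hc zu; have d0 : (0 < d)%N by apply: dvdn_gt0 dq.
set a := (q %/ d)%N; have ad : (a * d = q)%N by rewrite divnK.
have a0 : (0 < a)%N by rewrite divn_gt0 // dvdn_leq.
have aq : (a %| q)%N by rewrite -ad dvdn_mulr.
have qa : (q %/ a = d)%N by rewrite -ad mulKn.
have dR : d%:R != 0 :> R by rewrite pnatr_eq0 -lt0n.
have cdN := coprime_dvdq hq dq; have caN := coprime_dvdq hq aq.
(* [y] is k (d^2 - 1) / 12. It makes nu - k d^2 / 12 the integer n - y, so the phases of the
   translates by b/d are d-th roots of unity. *)
have /dvdzP[y ey] : (12 %| k%:Z * ((d * d)%N%:Z - 1))%Z by rewrite dvd12k //; exact: coprime_sq.
have eNy : N%:Z * y = D%:Z * ((d * d)%N%:Z - 1).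
  have g0 : (gcdn 12 k)%:Z != 0 by rewrite eqz_nat -lt0n gcd12_gt0.
  have e12 : 12 = N%:Z * (gcdn 12 k)%:Z by rewrite -PoszM Nk_mul.
  have ekg : k%:Z = D%:Z * (gcdn 12 k)%:Z by rewrite -PoszM Dk_mul.
  apply: (mulfI g0); transitivity (y * 12); first by rewrite e12; ring.
  by rewrite -ey ekg; ring.
have hdM n : (d %| n - y)%Z = (d %| nfreq n)%Z.
  rewrite -(Gauss_dvdzr (n := N)) ?coprimezE //.
  have -> : N%:Z * (n - y) = nfreq n - D%:Z * d%:Z * d%:Z by rewrite mulrBr eNy /nfreq PoszM; ring.
  by rewrite rpredBr ?dvdz_mull.
pose X0 : R := sgn_%:~R * a%:R * Re z / d%:R; pose Y0 : R := a%:R * Im z / d%:R.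
have Y0p : 0 < Y0 by rewrite divr_gt0 ?mulr_gt0 ?ltr0n.
have mbE b : mob (sgn_ * a%:Z) b%:Z 0 d%:Z (conj_if neg z) = (X0 + b%:R * d%:R^-1) +i* Y0.
  have ss : sgn_ * a%:Z * sgn_ = a%:Z by rewrite mulrAC sgn_if_sq mul1r.
  by rewrite mob_upper // ss intrM -!pmulrn.
have zb b : uhp ((X0 + b%:R * d%:R^-1) +i* Y0) by [].
have z0 : uhp (X0 +i* Y0) by [].
pose U n : C := chi k d%:Z * (c n * wterm w n (X0 +i* Y0)) * (if (d %| nfreq n)%Z then d%:R else 0).
have -> : \sum_(0 <= b < d) slash k neg w (wser w c) (sgn_ * a%:Z) b%:Z 0 d%:Z z = sumZ U.
  under eq_bigr => b _.
    rewrite /slash phase_upper // exp1rz mulr1 mbE etav_upper.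
    rewrite /wser -(summableZ_sumZ _ (summableZ_wterm hk r0 w hc (zb b))).
    over.
  rewrite -(summableZ_big _ (fun b => summableZZ _ (summableZ_wterm hk r0 w hc (zb b)))).2.
  apply: eq_sumZ => n; rewrite /U -hdM -(@root_sum R d (n - y) d0) mulr_sumr; apply: eq_bigr => b _.
  rewrite wterm_shift -!mulrA; congr (_ * _); rewrite mulrCA; congr (_ * _); rewrite mulrCA; congr (_ * _).
  rewrite root12E -e2piD -rcD; congr (e2pi _%:C).
  have e1 : (n - y)%:~R = nu n - k%:R * d%:R * d%:R / 12 :> R.
    have ey2 : k%:Z * (d%:Z * d%:Z + - 1) = y * 12 by rewrite -ey PoszM.
    have e1 : k%:R * (d%:R * d%:R - 1) = y%:~R * 12 :> R.
      have := congr1 (fun x : int => x%:~R : R) ey2; rewrite !intrM intrD intrM mulrNz mulr1z -!pmulrn => ->.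
      by [].
    have -> : (n - y)%:~R = n%:~R - y%:~R :> R by rewrite intrD mulrNz.
    have -> : y%:~R = k%:R * (d%:R * d%:R - 1) / 12 :> R by rewrite e1 mulfK.
    rewrite /freq; move: (n%:~R : R) (k%:R : R) (d%:R : R) => u v x; lra.
  rewrite e1 mulrNz !intrM -!pmulrn.
  by move: dR; move: (nu n) (d%:R : R) (b%:R : R) (k%:R : R) => u v x s v0; field.
pose V n : C := hecke_term a c n * wterm (sgn_ * w) n z.
have sV : summableZ V by apply: summableZ_wterm => //; apply: subexp_hecke_term.
have sU : summableZ U.
  have hU : subexp (fun n => (chi k d%:Z * (if (d %| nfreq n)%Z then d%:R else 0)) * c n).
    apply: subexpM => //; apply: (@subexp_bounded _ _ _ d%:R) => n.
    rewrite normcM normc_chi mul1r; case: ifP => _; last by rewrite normc0 ler0n.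
    by rewrite -rc_nat normcRE ger0_norm.
  by apply: eq_summableZ (summableZ_wterm hk r0 w hU z0) => n; rewrite /U; ring.
have match_ n n' (u : int) : nfreq n = d%:Z * u -> nfreq n' = sgn_ * (a%:Z * u) -> U n = (Num.sqrt q%:R)%:C * chi k d%:Z * V n'.
  move=> en en'; have e : nfreq n * (sgn_ * a%:Z) = d%:Z * nfreq n' by rewrite en en'; ring.
  have := wterm_match hk r w a0 d0 zu e; rewrite ad -/X0 -/Y0 => ew.
  have h1 : (a %| nfreq n')%Z by rewrite en' dvdz_mull // dvdz_mulr.
  have h2 : (d %| nfreq n)%Z by rewrite en dvdz_mulr.
  have h3 : (nfreq n' %/ a)%Z = sgn_ * u.
    by rewrite en' (_ : sgn_ * (a%:Z * u) = sgn_ * u * a%:Z) ?mulzK ?eqz_nat -?lt0n //; ring.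
  have h4 : nindex (sgn_ * (q %/ a)%:Z * (nfreq n' %/ a)%Z) = n.
    rewrite h3 qa -[RHS](nindexK k) en; apply: congr1.
    by transitivity ((sgn_ * sgn_) * (d%:Z * u)); [ring|rewrite sgn_if_sq mul1r].
  rewrite /U /V /hecke_term h1 h2 h4.
  transitivity (chi k d%:Z * c n * (d%:R%:C * wterm w n (X0 +i* Y0))); first by rewrite rc_nat; ring.
  by rewrite ew; ring.
have tp (n : nat) : nfreq n%:Z = (N * n + D)%N%:Z by rewrite /nfreq; lia.
have Dl := Dk_lt hk; have D0 := Dk_gt0 hk.
have tn (n : nat) : nfreq (- n.+1%:Z) = - (N * n + (N - D))%N%:Z.
  by rewrite nfreq_negS.
have sE : (0 < D < N)%N by rewrite D0.
have sE' : (0 < N - D < N)%N by rewrite subn_gt0 Dl ltn_subrL D0 (ltn_trans D0).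
have [BU [xU [xU1 gU]]] := sU; have [BV [xV [xV1 gV]]] := sV.
have sU1 n : U n != 0 -> (d %| nfreq n)%Z by rewrite /U; case: ifP => //; rewrite mulr0 eqxx.
have sV1 n : V n != 0 -> (a %| nfreq n)%Z by rewrite /V /hecke_term; case: ifP => //; rewrite mul0r eqxx.
(* As a d = q is the sign modulo N and d^2 is 1, d equals a up to the sign modulo N; this compares
   the residues of the two progressions. *)
have cong : (N %| d%:Z - sgn_ * a%:Z)%Z.
  have := hq; rewrite dvd12k // -ad PoszM => h1; have h2 := coprime_sq cdN.
  have -> : d%:Z - sgn_ * a%:Z = sgn_ * a%:Z * ((d * d)%N%:Z - 1) - d%:Z * (sgn_ * (a%:Z * d%:Z) - 1) by rewrite PoszM; ring.
  by rewrite rpredB ?dvdz_mull.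
have half E E' (f f' : nat -> int) (s s' : int) : (0 < E < N)%N -> (0 < E' < N)%N ->
    (forall n, nfreq (f n) = s * (N * n + E)%N%:Z) -> (forall n, nfreq (f' n) = s' * (N * n + E')%N%:Z) ->
    s' = sgn_ * s -> `|s|%N = 1%N -> `|s'|%N = 1%N ->
    (N %| d%:Z * E'%:Z - a%:Z * E%:Z)%Z ->
    (forall n, normc (U (f n)) <= BU * xU ^+ n) -> (forall n, normc (V (f' n)) <= BV * xV ^+ n) ->
    sumN (fun n => U (f n)) = (Num.sqrt q%:R)%:C * chi k d%:Z * sumN (fun n => V (f' n)).
  move=> hE hE' tf tf' ss s1 s1' hc' bU bV.
  apply: (half_reindex d0 a0 hE hE' cdN caN hc' xU1 xV1 bU bV).
  - by move=> n /sU1; rewrite tf dvdzE abszM s1 mul1n.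
  - by move=> n /sV1; rewrite tf' dvdzE abszM s1' mul1n.
  - move=> n n' u e1 e2; apply: (match_ _ _ (s * u%:Z)).
      by rewrite tf e1 PoszM; ring.
    by rewrite tf' e2 PoszM ss; ring.
have bU1 n : normc (U n%:Z) <= BU * xU ^+ n := (gU n).1.
have bU2 n : normc (U (- n.+1%:Z)) <= BU * xU ^+ n := (gU n).2.
have bV1 n : normc (V n%:Z) <= BV * xV ^+ n := (gV n).1.
have bV2 n : normc (V (- n.+1%:Z)) <= BV * xV ^+ n := (gV n).2.
have tp1 (n : nat) : nfreq n%:Z = 1 * (N * n + D)%N%:Z by rewrite mul1r.
have tn1 (n : nat) : nfreq (- n.+1%:Z) = -1 * (N * n + (N - D))%N%:Z by rewrite mulN1r.
have NDE : (N - D)%N%:Z = N%:Z - D%:Z by rewrite subzn // ltnW.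
rewrite /wser -/V [in RHS]/sumZ /sumZ mulrDr.
move: half cong; rewrite /sgn_if; case: (neg) => /= half cong.
  (* A negative determinant exchanges positive and negative frequencies, hence the two halves of the
     series. *)
  rewrite expr1 mulN1r opprK in half cong.
  rewrite [in RHS]addrC; congr (_ + _).
    apply: (half _ _ _ _ _ _ sE sE' tp1 tn1) => //.
    rewrite NDE; have -> : d%:Z * (N%:Z - D%:Z) - a%:Z * D%:Z = d%:Z * N%:Z - D%:Z * (d%:Z + a%:Z) by ring.
    by rewrite rpredB ?dvdz_mull.
  apply: (half _ _ _ _ _ _ sE' sE tn1 tp1) => //.
  rewrite NDE; have -> : d%:Z * D%:Z - a%:Z * (N%:Z - D%:Z) = D%:Z * (d%:Z + a%:Z) - a%:Z * N%:Z by ring.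
  by rewrite rpredB ?dvdz_mull.
rewrite expr0 mul1r in half cong; congr (_ + _).
  apply: (half _ _ _ _ _ _ sE sE tp1 tp1) => //.
  have -> : d%:Z * D%:Z - a%:Z * D%:Z = D%:Z * (d%:Z - a%:Z) by ring.
  by rewrite dvdz_mull.
apply: (half _ _ _ _ _ _ sE' sE' tn1 tn1) => //.
have -> : d%:Z * (N - D)%N%:Z - a%:Z * (N - D)%N%:Z = (N - D)%N%:Z * (d%:Z - a%:Z) by ring.
by rewrite dvdz_mull.
Qed.

End HeckeExpansion.

(** * Hecke operators on coefficient sequences *)

Section HeckeOperator.
Context {R : realType}.
Local Notation C := R[i].
Variables (k : nat) (hk : (1 <= k <= 11)%N) (r : R) (r0 : r != 0).
Local Notation nu := (@freq R k).
Local Notation wser := (@wser R k r).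
Local Notation wterm := (@wterm R k r).
Local Notation subexp := (@subexp R k).
Local Notation N := (Nk k).
Local Notation D := (Dk k).
Local Notation nfreq := (nfreq k).
Local Notation nindex := (nindex k).

Lemma subexp_sum (I : Type) (l : seq I) (c : I -> int -> C) : (forall i, subexp (c i)) -> subexp (fun n => \sum_(i <- l) c i n).
Proof.
move=> h; elim: l => [|i l IH].
  by apply: (@subexp_bounded _ _ _ 0) => n; rewrite big_nil normc0.
move=> e e0; have [A hA] := subexpD (h i) IH e0.
by exists A => n; rewrite big_cons.
Qed.

Lemma wser_sum (I : Type) (l : seq I) w (c : I -> int -> C) z : (forall i, subexp (c i)) -> uhp z ->
  wser w (fun n => \sum_(i <- l) c i n) z = \sum_(i <- l) wser w (c i) z.
Proof.
move=> h zu; rewrite /wser -(summableZ_big _ (fun i => summableZ_wterm hk r0 w (h i) zu)).2.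
by apply: eq_sumZ => n; rewrite mulr_suml.
Qed.

Section Fixed.
Variables (neg : bool) (w : int).
Local Notation sgn_ := (sgn_if neg).
Variables (q : nat) (q0 : (0 < q)%N) (hq : (12 %| k%:Z * (sgn_ * q%:Z - 1))%Z).

Definition hecke_formal (c : int -> C) (n : int) : C := \sum_(a <- divisors q) chi k a%:Z * hecke_term k neg q a c n.

(** Zero unless a divides q, so that the growth bound holds for every value of the summation
    index. *)
Definition hecke_formal_term (c : int -> C) (a : nat) (n : int) : C :=
  if (a %| q)%N then chi k a%:Z * hecke_term k neg q a c n else 0.

Lemma subexp_hecke_formal_term c a : subexp c -> subexp (hecke_formal_term c a).
Proof.
move=> hc; rewrite /hecke_formal_term; case: (boolP (a %| q)%N) => aq; first by apply: subexpZ; exact: subexp_hecke_term.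
by apply: (@subexp_bounded _ _ _ 0) => n; rewrite normc0.
Qed.

Lemma subexp_hecke_formal c : subexp c -> subexp (hecke_formal c).
Proof.
move=> hc e e0.
have H := subexp_sum (divisors q) (fun a => subexp_hecke_formal_term a hc).
have [A hA] := H e e0; exists A => n; have := hA n; congr (normc _ <= _).
by apply: eq_big_seq => a; rewrite -dvdn_divisors // /hecke_formal_term => ->.
Qed.

Lemma perm_divisors : perm_eq [seq (q %/ d)%N | d <- divisors q] (divisors q).
Proof.
have inv d : (d %| q)%N -> (q %/ (q %/ d))%N = d.
  by move=> /dvdnP[x ex]; move: q0; rewrite ex muln_gt0 => /andP[x0 d0]; rewrite mulnK // mulKn.
apply: uniq_perm; rewrite ?divisors_uniq //.
  rewrite map_inj_in_uniq ?divisors_uniq // => d d'; rewrite -!dvdn_divisors // => h h' e.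
  by rewrite -(inv _ h) e inv.
move=> x; rewrite -dvdn_divisors //; apply/mapP/idP => [[d]|h].
  by rewrite -dvdn_divisors // => h ->; rewrite -{2}(divnK h) dvdn_mulr.
exists (q %/ x)%N; last by rewrite inv.
by rewrite -dvdn_divisors // -{2}(divnK h) dvdn_mulr.
Qed.

Lemma hecke_fun_divisors (F : C -> C) (z : C) : hecke_fun k neg w q F z =
  \sum_(d <- divisors q) \sum_(0 <= b < d) slash k neg w F (sgn_ * (q %/ d)%N%:Z) b%:Z 0 d%:Z z.
Proof.
rewrite /hecke_fun /hecke_rep /hecke_codiv -(pair_big_dep (fun d : 'I_q.+1 => (d %| q)%N) (fun (d b : 'I_q.+1) => (b < d)%N)
  (fun d b : 'I_q.+1 => slash k neg w F (sgn_ * (q %/ d)%N%:Z) b%:Z 0 d%:Z z)) /=.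
under eq_bigr => d _.
  rewrite -(big_ord_widen q.+1 (fun b => slash k neg w F (sgn_ * (q %/ d)%N%:Z) b%:Z 0 d%:Z z)); last by rewrite ltnW.
  over.
rewrite -(big_mkord (fun d => (d %| q)%N) (fun d => \sum_(b < d) slash k neg w F (sgn_ * (q %/ d)%N%:Z) b%:Z 0 d%:Z z)).
rewrite -big_filter (perm_big (divisors q)); first by apply: eq_bigr => d _; rewrite big_mkord.
apply: uniq_perm; rewrite ?divisors_uniq ?filter_uniq ?iota_uniq // => d.
rewrite mem_filter mem_index_iota -dvdn_divisors //=.
by case: (boolP (d %| q)%N) => //= h; rewrite ltnS dvdn_leq.
Qed.

(** The divisors are reversed by d -> q / d, and chi(d) = chi(q) chi(q / d) because chi is
    multiplicative with square 1 on divisors of q. *)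
Lemma hecke_fun_wser c z : subexp c -> uhp z ->
  hecke_fun k neg w q (wser w c) z = (Num.sqrt q%:R)%:C * chi k q%:Z * wser (sgn_ * w) (hecke_formal c) z.
Proof.
move=> hc zu; rewrite hecke_fun_divisors.
pose G := hecke_formal_term c.
have sG a : subexp (G a) by exact: subexp_hecke_formal_term.
have -> : wser (sgn_ * w) (hecke_formal c) z = \sum_(a <- divisors q) wser (sgn_ * w) (G a) z.
  rewrite -wser_sum //; apply: eq_wser => n.
  by apply: eq_big_seq => a; rewrite -dvdn_divisors // /G /hecke_formal_term => ->.
rewrite -[in RHS](perm_big _ perm_divisors) big_map /= mulr_sumr; apply: eq_big_seq => d.
rewrite -dvdn_divisors // => dq; rewrite hecke_d //.
have aq : (q %/ d %| q)%N by rewrite -{2}(divnK dq) dvdn_mulr.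
have -> : wser (sgn_ * w) (G (q %/ d)%N) z = chi k (q %/ d)%N%:Z * wser (sgn_ * w) (hecke_term k neg q (q %/ d) c) z.
  by rewrite -wserZ //; [apply: eq_wser => n; rewrite /G /hecke_formal_term aq|exact: subexp_hecke_term].
have cd := coprime_dvdq hq dq; have ca := coprime_dvdq hq aq.
have e : chi k q%:Z = chi k (q %/ d)%N%:Z * chi k d%:Z :> C by rewrite -chiM // divnK.
have e2 : chi k (q %/ d)%N%:Z * chi k (q %/ d)%N%:Z = 1 :> C by exact: chi_sq.
rewrite e; move: (wser _ _ _) (chi k (q %/ d)%N%:Z) (chi k d%:Z) (Num.sqrt _)%:C e2 => s x y t e2.
by transitivity (t * y * s * (x * x)); [rewrite e2 mulr1|ring].
Qed.

End Fixed.

Lemma automorphicZ w (x : C) (f : C -> C) : automorphic k w f -> automorphic k w (fun z => x * f z).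
Proof. by move=> h a b c d dt z zu; rewrite h //; ring. Qed.

(** The model of the space of waveforms by coefficients; the two are identified by
    [wser_maass_space] and [maass_space_wser]. *)
Definition maass_coef (c : int -> C) : Prop := subexp c /\ automorphic k k%:Z (wser k%:Z c).

(** What k raising operators leave on the coefficients after multiplication by (-1)^k. *)
Definition hecke_twist (neg : bool) (n : int) : C := if neg then if 0 < nu n then 1 else (Lambda k r)%:C else 1.

Definition hecke (neg : bool) (q : nat) (c : int -> C) (n : int) : C := hecke_twist neg n * hecke_formal neg q c n.

Lemma subexp_hecke_twist neg : subexp (hecke_twist neg).
Proof.
apply: (@subexp_bounded _ _ _ (1 + normc ((Lambda k r)%:C : C))) => n; rewrite /hecke_twist.
have h1 : normc (1 : C) = 1 by rewrite -real_complex1 normcRE normr1.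
by case: neg; [case: ifP|]; rewrite ?h1 ?lerDl ?lerDr ?normc_ge0.
Qed.

Lemma subexp_raisec_k : subexp (@raisec_k R k r).
Proof.
have h1 : normc ((-1) ^+ k : C) = 1 by rewrite -real_complex1 -rcN -rcX normcRE normrX normrN1 expr1n.
apply: (@subexp_bounded _ _ _ (1 + normc ((Lambda k r)%:C : C))) => n.
have [h|h|h] := ltgtP (nu n) 0.
- by rewrite -[normc _]mul1r -{1}h1 -normcM raisec_k_neg // lerDr.
- by rewrite raisec_k_pos // h1 lerDl normc_ge0.
- by have := @freq_neq0 R k hk n; rewrite h eqxx.
Qed.

(** The scalar sqrt(q) chi(q) is divided out; for negative determinant the Hecke sum has weight - k,
    and [automorphic_raise_k] brings it back. *)
Lemma maass_coef_hecke neg q c : (0 < q)%N -> (12 %| k%:Z * (sgn_if neg * q%:Z - 1))%Z -> maass_coef c -> maass_coef (hecke neg q c).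
Proof.
move=> q0 hq [hc ha]; have sh := subexp_hecke_formal q0 hq hc.
split; first by apply: subexpM => //; exact: subexp_hecke_twist.
have x0 : (Num.sqrt q%:R)%:C * chi k q%:Z != 0 :> C.
  by rewrite mulf_neq0 ?chi_neq0 // rc_eq0 gt_eqF // sqrtr_gt0 ltr0n.
have H : automorphic k (sgn_if neg * k%:Z) (wser (sgn_if neg * k%:Z) (hecke_formal neg q c)).
  have := automorphicZ ((Num.sqrt q%:R)%:C * chi k q%:Z)^-1 (automorphic_hecke_fun q0 hq ha).
  by apply: automorphic_eq => z zu; rewrite hecke_fun_wser // mulKf.
move: H; rewrite /hecke /hecke_twist /sgn_if; case: (neg) sh => /= sh.
  rewrite expr1 mulN1r => H; have := automorphicZ ((-1) ^+ k) (automorphic_raise_k hk r0 sh H).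
  apply: automorphic_eq => z zu; rewrite -wserZ //; last first.
    by apply: subexpM => //; apply: subexp_raisec_k.
  apply: eq_wser => n; rewrite mulrA; congr (_ * _); case: ifPn => h.
    by rewrite raisec_k_pos // -exprMn mulrNN mulr1 expr1n.
  by rewrite raisec_k_neg // lt_neqAle leNgt h freq_neq0.
by rewrite expr0 mul1r; apply: automorphic_eq => z zu; apply: eq_wser => n; rewrite mul1r.
Qed.

End HeckeOperator.

(** * Commutation of Hecke operators *)

Section HeckeCount.
Implicit Types (a f q t x : nat).

(** With b = f / a, these are the conditions under which the divisor a of the outer and b of the
    inner operator contribute to the term of f = a b. *)
Definition hecke_pairs q q' t f a : bool :=
  [&& (a %| t)%N, (a %| f)%N, (f %/ a %| q')%N & (f %/ a %| (q %/ a) * (t %/ a))%N].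

Lemma gcd_quot f q : (0 < f)%N -> exists y, [/\ q = (gcdn f q * y)%N & coprime (f %/ gcdn f q) y].
Proof.
move=> f0; have g0 : (0 < gcdn f q)%N by rewrite gcdn_gt0 f0.
exists (q %/ gcdn f q)%N; split; first by rewrite mulnC divnK // dvdn_gcdr.
rewrite /coprime -(eqn_pmul2r g0) mul1n muln_gcdl !divnK ?dvdn_gcdl ?dvdn_gcdr //.
Qed.

Lemma hecke_pairsP q q' t f a : (0 < f)%N -> (0 < q)%N -> (0 < t)%N ->
  ((a %| q)%N && hecke_pairs q q' t f a) = (f %/ gcdn f q' %| a)%N && (a * (f %/ gcdn f q) %| gcdn f t)%N.
Proof.
move=> f0 q0 t0.
have [y [eq cy]] := gcd_quot q f0; have [y' [eq' cy']] := gcd_quot q' f0.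
have g0 : (0 < gcdn f q)%N by rewrite gcdn_gt0 f0.
have g0' : (0 < gcdn f q')%N by rewrite gcdn_gt0 f0.
have eL : ((f %/ gcdn f q) * gcdn f q)%N = f by rewrite divnK // dvdn_gcdl.
have eL' : ((f %/ gcdn f q') * gcdn f q')%N = f by rewrite divnK // dvdn_gcdl.
set L' := (f %/ gcdn f q)%N in cy eL *; set L := (f %/ gcdn f q')%N in cy' eL' *.
have h1 : (a %| f)%N -> (f %/ a %| q')%N = (L %| a)%N.
  move=> af; have a0 : (0 < a)%N by apply: dvdn_gt0 af.
  rewrite dvdn_divLR // [in LHS]eq' -[X in (X %| _)%N]eL' mulnC -mulnA dvdn_pmul2l //.
  by rewrite Gauss_dvdr.
apply/and5P/andP => [[aq at_ af bq bt]|[La h]].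
  have a0 : (0 < a)%N by apply: dvdn_gt0 af.
  split; first by rewrite -h1.
  have [x ex] := dvdnP at_.
  have fx : (f %| q * x)%N.
    move: bt; rewrite ex mulnK // dvdn_divLR //.
    by rewrite mulnAC divnK.
  have Lx : (L' %| x)%N.
    have : (gcdn f q * L' %| gcdn f q * (y * x))%N by rewrite mulnC eL mulnA -eq.
    by rewrite dvdn_pmul2l // Gauss_dvdr.
  rewrite dvdn_gcd; apply/andP; split; last by rewrite ex mulnC dvdn_pmul2r.
  by rewrite -eL mulnC dvdn_pmul2l ?dvdn_gcd ?af ?aq // (dvdn_gt0 f0) // -eL dvdn_mulr.
have := h; rewrite dvdn_gcd => /andP[hf ht].
have af : (a %| f)%N by apply: dvdn_trans hf; exact: dvdn_mulr.
have a0 : (0 < a)%N by apply: dvdn_gt0 af.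
have L0 : (0 < L')%N by rewrite (dvdn_gt0 f0) // -eL dvdn_mulr.
have ag : (a %| gcdn f q)%N by move: hf; rewrite -{1}eL mulnC dvdn_pmul2l.
have aq : (a %| q)%N by apply: dvdn_trans ag (dvdn_gcdr _ _).
have at_ : (a %| t)%N by apply: dvdn_trans ht; exact: dvdn_mulr.
split => //; first by rewrite h1.
rewrite dvdn_divLR // mulnAC divnK //.
suff : (gcdn f q * L' %| gcdn f q * (y * (t %/ a)))%N by rewrite mulnC eL mulnA -eq.
by rewrite dvdn_pmul2l // dvdn_mull // dvdn_divRL // mulnC.
Qed.

(* With L = f / (f,q') and L' = f / (f,q), the admissible a are the x L with
   x L L' dividing (f,t). *)
Lemma hecke_count_sym q q' t f : (0 < f)%N -> (0 < q)%N -> (0 < q')%N -> (0 < t)%N ->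
  count (hecke_pairs q q' t f) (divisors q) = count (hecke_pairs q' q t f) (divisors q').
Proof.
move=> f0 q0 q0' t0.
pose K q q' := count (fun x => x * (f %/ gcdn f q') * (f %/ gcdn f q) %| gcdn f t)%N (divisors f).
suff H p p' : (0 < p)%N -> (0 < p')%N -> count (hecke_pairs p p' t f) (divisors p) = K p p'.
  rewrite !H //; apply: eq_count => x; congr (_ %| _)%N; exact: mulnAC.
move=> p0 p0'; rewrite /K -!size_filter; set L := (f %/ gcdn f p')%N.
have L0 : (0 < L)%N by rewrite divn_gt0 ?gcdn_gt0 ?f0 // dvdn_leq // dvdn_gcdl.
rewrite -[RHS](size_map (muln^~ L)); apply: perm_size; apply: uniq_perm.
- by rewrite filter_uniq // divisors_uniq.
- rewrite map_inj_uniq; first by rewrite filter_uniq // divisors_uniq.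
  by move=> x y /eqP; rewrite eqn_pmul2r // => /eqP.
move=> a; rewrite mem_filter andbC -dvdn_divisors // hecke_pairsP //.
apply/andP/mapP => [[/dvdnP[x ->] h]|[x]].
  exists x => //; rewrite mem_filter h -dvdn_divisors //.
  move: h; rewrite dvdn_gcd => /andP[h _]; apply: dvdn_trans h; rewrite -mulnA; exact: dvdn_mulr.
by rewrite mem_filter => /andP[h _] ->; rewrite dvdn_mull.
Qed.

(** The substitution f = a b, after which a double sum over a and b can be ordered by f. *)
Lemma sum_divisors_shift (V : nmodType) q q' a (P : pred nat) (F : nat -> V) : (0 < q)%N -> (0 < q')%N -> (a %| q)%N ->
  \sum_(b <- divisors q' | P b) F b =
  \sum_(f <- divisors (q * q') | [&& (a %| f)%N, (f %/ a %| q')%N & P (f %/ a)%N]) F (f %/ a)%N.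
Proof.
move=> q0 q0' aq; have a0 : (0 < a)%N by apply: dvdn_gt0 aq.
rewrite -[LHS]big_filter -[RHS]big_filter.
have -> : [seq f <- divisors (q * q') | [&& (a %| f)%N, (f %/ a %| q')%N & P (f %/ a)%N]] =
   [seq i <- [seq f <- divisors (q * q') | (a %| f) && (f %/ a %| q')]%N | P (i %/ a)%N].
  by rewrite -filter_predI; apply: eq_filter => f /=; rewrite andbA andbC.
have -> : \sum_(i <- [seq i <- [seq f <- divisors (q * q') | (a %| f) && (f %/ a %| q')]%N | P (i %/ a)%N]) F (i %/ a)%N
  = \sum_(j <- [seq j <- map (fun f => f %/ a)%N [seq f <- divisors (q * q') | (a %| f) && (f %/ a %| q')]%N | P j]) F j.
  by rewrite filter_map big_map.
apply: perm_big; apply: perm_filter; apply: uniq_perm; first exact: divisors_uniq.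
  rewrite map_inj_in_uniq; first by rewrite filter_uniq // divisors_uniq.
  move=> x y; rewrite !mem_filter => /andP[/andP[hx _] _] /andP[/andP[hy _] _] e.
  by rewrite -(divnK hx) -(divnK hy) e.
move=> b; rewrite -dvdn_divisors //; apply/idP/mapP => [h|[f]].
  exists (b * a)%N; last by rewrite mulnK.
  by rewrite mem_filter dvdn_mull // mulnK // h -dvdn_divisors ?muln_gt0 ?q0 // mulnC dvdn_mul.
by rewrite mem_filter => /andP[/andP[_ h] _] ->.
Qed.

End HeckeCount.

(** * Composition of two Hecke operators *)

Section HeckeCommute.
Context {R : realType}.
Local Notation C := R[i].
Variables (k : nat) (hk : (1 <= k <= 11)%N) (r : R).
Local Notation nu := (@freq R k).
Local Notation N := (Nk k).
Local Notation D := (Dk k).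
Local Notation nfreq := (nfreq k).
Local Notation nindex := (nindex k).
Local Notation hecke := (@hecke R k r).
Local Notation hecke_twist := (@hecke_twist R k r).

Lemma nfreq_neq0 n : nfreq n != 0.
Proof.
apply/eqP => h; have := Dk_lt hk; have := Dk_gt0 hk; move: h; rewrite /nfreq.
move: N D => x y e y0 xy; have h : (0 <= n) \/ (n <= -1) by lia.
by case: h => h; nia.
Qed.

(** The second factor is read at the index to which the outer operator has moved n; the sign of its
    frequency is that of the determinant times nu. *)
Definition hecke_twist2 (neg neg' : bool) (n : int) : C :=
  hecke_twist neg n * (if neg' then if 0 < (sgn_if neg)%:~R * nu n then 1 else (Lambda k r)%:C else 1).

Lemma hecke_twist2C neg neg' n : hecke_twist2 neg neg' n = hecke_twist2 neg' neg n.
Proof. by rewrite /hecke_twist2 /hecke_twist /sgn_if; case: neg neg' => [] [] //=; rewrite ?expr0 ?mul1r ?mulr1. Qed.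

Lemma sum_count (I : Type) (s : seq I) (P : pred I) (x : C) : \sum_(i <- s | P i) x = x *+ count P s.
Proof. by rewrite big_const_seq iter_addr_0. Qed.

(** A pair a, b enters only through f = a b: chi(a) chi(b) = chi(f), and the index is that of q q' t
    / f^2 up to sign. Commutation is thereby reduced to the symmetry of the multiplicities. *)
Lemma hecke_hecke neg neg' q q' c n : (0 < q)%N -> (0 < q')%N ->
  (12 %| k%:Z * (sgn_if neg * q%:Z - 1))%Z -> (12 %| k%:Z * (sgn_if neg' * q'%:Z - 1))%Z ->
  hecke neg q (hecke neg' q' c) n = hecke_twist2 neg neg' n * \sum_(f <- divisors (q * q'))
    (chi k f%:Z * c (nindex ((sgn_if neg * sgn_if neg' * (q * q')%N%:Z * nfreq n) %/ (f * f)%N)%Z)) *+ count (hecke_pairs q q' `|nfreq n| f) (divisors q).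
Proof.
move=> q0 q0' hq hq'.
pose B (f : nat) := chi k f%:Z * c (nindex ((sgn_if neg * sgn_if neg' * (q * q')%N%:Z * nfreq n) %/ (f * f)%N)%Z).
set lm := (if neg' then if 0 < (sgn_if neg)%:~R * nu n then 1 else (Lambda k r)%:C else 1 : C).
rewrite /hecke /hecke_twist2 -/lm -mulrA; congr (_ * _).
under [in RHS]eq_bigr => f _ do rewrite -sum_count.
rewrite (exchange_big_dep xpredT) //= mulr_sumr /hecke_formal; apply: eq_big_seq => a.
rewrite -dvdn_divisors // => aq; have a0 : (0 < a)%N by apply: dvdn_gt0 aq.
rewrite {1}/hecke_term; case: ifPn => at_; last first.
  rewrite mulr0 big1 ?mulr0 // => f /andP[h _].
  by move: at_; rewrite dvdzE h.
have tn := nfreq_move q0 hq aq at_.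
have at' : (a %| `|nfreq n|)%N by move: at_; rewrite dvdzE.
set na := nindex _; have lam_na : hecke_twist neg' na = lm.
  rewrite /hecke_twist /lm; case: (neg') => //; congr (if _ then _ else _).
  have /dvdzP[u eu] := at_.
  have tna : nfreq na = sgn_if neg * (q %/ a)%:Z * u by rewrite tn eu mulzK // eqz_nat -lt0n.
  have aR : 0 < a%:R :> R by rewrite ltr0n.
  have dR : 0 < (q %/ a)%N%:R :> R by rewrite ltr0n divn_gt0 // dvdn_leq.
  have NR : 0 < (N%:R)^-1 :> R by rewrite invr_gt0 ltr0n Nk_gt0.
  rewrite !nu_nfreq tna eu !intrM -!pmulrn [in RHS]mulrA !(pmulr_lgt0 _ NR) mulrAC (pmulr_lgt0 _ dR).
  by rewrite mulrA (pmulr_lgt0 _ aR).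
rewrite lam_na mulrCA; congr (_ * _).
pose P (b : nat) := (b %| (q %/ a) * (`|nfreq n| %/ a))%N.
have Pb (b : nat) : (b %| nfreq na)%Z = P b.
  rewrite /P dvdzE tn !abszM /= (_ : `|sgn_if neg|%N = 1%N); last by rewrite /sgn_if; case: (neg).
  rewrite mul1n; congr (_ %| _ * _)%N.
  by have /dvdzP[u ->] := at_; rewrite mulzK ?eqz_nat -?lt0n // abszM mulnK.
have -> : \sum_(b <- divisors q') chi k b%:Z * hecke_term k neg' q' b c na =
    \sum_(b <- divisors q' | P b) chi k b%:Z * c (nindex (sgn_if neg' * (q' %/ b)%:Z * (nfreq na %/ b)%Z)).
  rewrite [RHS]big_mkcond; apply: eq_bigr => b _; rewrite /hecke_term Pb.
  by case: ifP => // _; rewrite mulr0.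
rewrite (sum_divisors_shift _ _ q0 q0' aq) mulr_sumr.
apply: eq_big => [f|f /and3P[af fq' Pf]].
  by rewrite /hecke_pairs at'.
have f0 : (0 < f)%N.
  rewrite lt0n; apply: contraTneq fq' => ->; rewrite div0n dvd0n -lt0n //.
have b0 : (0 < f %/ a)%N by rewrite divn_gt0 // dvdn_leq.
rewrite mulrA -chiM //; last 2 first.
- by apply: coprime_dvdl aq _; apply: coprime_q hq.
- by apply: coprime_dvdl fq' _; apply: coprime_q hq'.
rewrite mulnC divnK //; congr (_ * c (nindex _)).
have := Pf; rewrite -Pb => /dvdzP[u eu].
have hb : (nfreq na %/ (f %/ a)%N)%Z = u by rewrite eu mulzK // eqz_nat -lt0n.
rewrite hb.
have e1 : sgn_if neg * (q %/ a)%:Z * (nfreq n %/ a)%Z = u * (f %/ a)%N%:Z by rewrite -tn eu.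
have /dvdzP[v ev] := at_.
rewrite ev mulzK ?eqz_nat -?lt0n // in e1.
set b := (f %/ a)%N in b0 fq' e1 *.
have fE : f = (b * a)%N by rewrite divnK.
have qE : q = ((q %/ a) * a)%N by rewrite divnK.
have q'E : q' = ((q' %/ b) * b)%N by rewrite divnK.
have -> : sgn_if neg * sgn_if neg' * (q * q')%N%:Z * nfreq n = sgn_if neg' * (q' %/ b)%N%:Z * u * (f * f)%N%:Z.
  rewrite ev fE [in LHS]qE [in LHS]q'E !PoszM.
  transitivity (sgn_if neg' * (q' %/ b)%N%:Z * b%:Z * a%:Z * a%:Z * (sgn_if neg * (q %/ a)%N%:Z * v)); first by ring.
  by rewrite e1; ring.
by rewrite mulzK // eqz_nat -lt0n muln_gt0 f0.
Qed.

Lemma heckeC neg neg' q q' c n : (0 < q)%N -> (0 < q')%N ->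
  (12 %| k%:Z * (sgn_if neg * q%:Z - 1))%Z -> (12 %| k%:Z * (sgn_if neg' * q'%:Z - 1))%Z ->
  hecke neg q (hecke neg' q' c) n = hecke neg' q' (hecke neg q c) n.
Proof.
move=> q0 q0' hq hq'; rewrite !hecke_hecke // hecke_twist2C [in RHS]mulnC.
congr (_ * _); apply: eq_big_seq => f; rewrite -dvdn_divisors ?muln_gt0 ?q0 // => fq.
rewrite (mulrC (sgn_if neg')) -(hecke_count_sym (f := f)) //; last by rewrite lt0n absz_eq0 nfreq_neq0.
by rewrite (dvdn_gt0 _ fq) // muln_gt0 q0.
Qed.

End HeckeCommute.

(** * Finite dimension *)

Section Coefficients.
Context {R : realType}.
Local Notation C := R[i].
Variables (k : nat) (hk : (1 <= k <= 11)%N) (r : R) (r0 : r != 0).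
Local Notation nu := (@freq R k).
Local Notation wser := (@wser R k r).
Local Notation wterm := (@wterm R k r).
Local Notation subexp := (@subexp R k).
Local Notation fcoef := (@fcoef R k).

Lemma wser_cts w c z : subexp c -> uhp z -> cts (wser w c) z.
Proof. by move=> hc zu; exact: (@C1on_cts R _ _ _ (wser_C1 hk r0 w hc) z zu). Qed.

Lemma wterm_expi (w m n : int) (y t : R) : wterm w m ((0 + t) +i* y) * expi (- nu n) t = wterm w m (0 +i* y) * expi (m - n)%:~R t.
Proof.
rewrite wterm_shift -mulrA -[e2pi _]/(expi (nu m) t) -expiD; congr (_ * expi _ t).
by rewrite /freq intrD mulrNz; ring.
Qed.

(** Orthogonality evaluates the integral of each partial sum, and the tails are small uniformly in
    t. *)
Lemma fcoef_wser c n (y : R) : subexp c -> 0 < y -> fcoef (wser k%:Z c) n 0 y = c n * wterm k%:Z n (0 +i* y).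
Proof.
move=> hc y0; have [B [q [q01 hB]]] := subexp_geodom hk r0 k%:Z hc y0.
pose u t m := c m * wterm k%:Z m ((0 + t) +i* y).
have gu t : geodom (u t) B q by apply: hB => /=.
pose F M t := \sum_(0 <= i < M) (u t i%:Z + u t (- i.+1%:Z)) * expi (- nu n) t.
have ct m : ctsR (fun t => u t m * expi (- nu n) t).
  have -> : (fun t => u t m * expi (- nu n) t) = (fun t => (c m * wterm k%:Z m (0 +i* y)) * expi (m - n)%:~R t).
    by apply/funext => t; rewrite /u -mulrA wterm_expi mulrA.
  by apply: ctsRM; [exact: ctsR_cst|exact: ctsR_expi].
have CiT m : cint (fun t => u t m * expi (- nu n) t) = if m == n then c n * wterm k%:Z n (0 +i* y) else 0.
  have -> : (fun t => u t m * expi (- nu n) t) = (fun t => (c m * wterm k%:Z m (0 +i* y)) * expi (m - n)%:~R t).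
    by apply/funext => t; rewrite /u -mulrA wterm_expi mulrA.
  rewrite cintZ ?cint_expi; last exact: ctsR_expi.
  by rewrite subr_eq0; case: eqP => [->|_]; rewrite ?mulr1 ?mulr0.
have cF M : ctsR (F M).
  by apply: ctsR_sum => i; move: (ctsRD (ct i%:Z) (ct (- i.+1%:Z))); congr ctsR; apply/funext => t; rewrite mulrDl.
have cS : ctsR (fun t => wser k%:Z c ((0 + t) +i* y) * expi (- nu n) t).
  by apply: ctsR_fcoef => // z zu; exact: wser_cts.
have CF M : (`|n| < M)%N -> cint (F M) = c n * wterm k%:Z n (0 +i* y).
  move=> nM; rewrite cint_sum; last first.
    by move=> i; move: (ctsRD (ct i%:Z) (ct (- i.+1%:Z))); congr ctsR; apply/funext => t; rewrite mulrDl.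
  (* The partial sums take i and -(i + 1) together; [j] is the pair that contains n. *)
  pose j := if 0 <= n then `|n|%N else `|n|.-1%N.
  have jM : (j < M)%N by rewrite /j; case: ifP => _ //; apply: leq_ltn_trans nM; exact: leq_pred.
  rewrite (bigD1_seq j) ?iota_uniq ?mem_index_iota //= big1 ?addr0.
    transitivity (cint (fun t => u t j%:Z * expi (- nu n) t + u t (- j.+1%:Z) * expi (- nu n) t)).
      by apply: eq_cint => t _; rewrite mulrDl.
    rewrite cintD // !CiT.
    have : [&& j%:Z == n & - j.+1%:Z != n] || [&& j%:Z != n & - j.+1%:Z == n] by rewrite /j; case: (n) => m /=; lia.
    by case/orP => /andP[h1 h2]; rewrite ?h1 ?h2 ?(negbTE h1) ?(negbTE h2) ?addr0 ?add0r.
  move=> i ij; transitivity (cint (fun t => u t i%:Z * expi (- nu n) t + u t (- i.+1%:Z) * expi (- nu n) t)).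
    by apply: eq_cint => t _; rewrite mulrDl.
  rewrite cintD // !CiT; have -> : (i%:Z == n) = false.
    by apply/eqP => e; move/eqP: ij; apply; rewrite /j -e.
  have -> : (- i.+1%:Z == n) = false.
    by apply/eqP => e; move/eqP: ij; apply; rewrite /j -e.
  by rewrite addr0.
have bound M : (`|n| < M)%N -> normc (fcoef (wser k%:Z c) n 0 y - c n * wterm k%:Z n (0 +i* y)) <= 4 * B / (1 - q) * q ^+ M.
  move=> nM; rewrite -(CF M nM) /fcoef.
  have -> : cint (fun t => wser k%:Z c ((0 + t) +i* y) * expi (- nu n) t) - cint (F M) =
     cint (fun t => wser k%:Z c ((0 + t) +i* y) * expi (- nu n) t + (-1) * F M t).
    rewrite cintD ?cintZ ?mulN1r //; apply: ctsRM => //; exact: ctsR_cst.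
  apply: le_trans (cint_le_cst (M := 2 * B * q ^+ M / (1 - q)) _ _) _.
  - by apply: ctsRD => //; apply: ctsRM => //; exact: ctsR_cst.
  - move=> t _; have -> : wser k%:Z c ((0 + t) +i* y) * expi (- nu n) t + (-1) * F M t =
      ((sumN (fun m => u t m%:Z) - series (fun m => u t m%:Z) M) + (sumN (fun m => u t (- m.+1%:Z)) - series (fun m => u t (- m.+1%:Z)) M)) * expi (- nu n) t.
      have -> : wser k%:Z c ((0 + t) +i* y) = sumN (fun m => u t m%:Z) + sumN (fun m => u t (- m.+1%:Z)) by [].
      rewrite /F -mulr_suml big_split !seriesEnat /=.
      by move: (\sum_(_ <= _ < _) _) (\sum_(_ <= _ < _) _) (sumN _) (sumN _) (expi _ _) => a1 a2 a3 a4 a5; ring.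
    rewrite normcM normc_expi mulr1; apply: le_trans (le_normcD _ _) _.
    have h1 := sumN_tail q01 M (fun m => (gu t m).1); have h2 := sumN_tail q01 M (fun m => (gu t m).2).
    by apply: le_trans (lerD h1 h2) _; rewrite le_eqVlt; apply/orP; left; apply/eqP; ring.
  by rewrite le_eqVlt; apply/orP; left; apply/eqP; ring.
apply/eqP; rewrite -subr_eq0 -normc_eq0; apply/eqP; apply/le_anti; rewrite normc_ge0 andbT.
have lim : (fun M => 4 * B / (1 - q) * q ^+ M) @ \oo --> (4 * B / (1 - q) * 0 : R).
  by apply: cvgMr; apply: cvg_expr; rewrite ger0_norm; case/andP: q01.
rewrite mulr0 in lim; apply: (cvgr_to_ge lim); exists `|n|.+1 => // M /= nM; exact: bound.
Qed.

(** On this segment |z|^2 <= 1/2, so Im(-1/z) >= 1, and the factor of automorphy has modulus 1. *)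
Lemma maass_coef_half c (M : R) x : maass_coef k r c -> (forall z, 1 <= Im z -> normc (wser k%:Z c z) <= M) -> - 2^-1 <= x <= 2^-1 ->
  normc (wser k%:Z c (x +i* 2^-1)) <= M.
Proof.
move=> [hc ha] hM hx; set z := x +i* 2^-1; have zu : uhp z by rewrite /uhp /= invr_gt0.
have dt : 0 * 0 - (-1) * 1 = 1 :> int by [].
have j0 : cdfac 1 0 z != 0 by apply: cdfac_neq0.
have E := ha _ _ _ _ dt z zu.
have -> : normc (wser k%:Z c z) = normc (wser k%:Z c (mob 0 (-1) 1 0 z)).
  by rewrite E !normcM etavE normc_root12 normcX normc_phase // expr1n !mul1r.
apply: hM; rewrite Im_mob // dt mul1r.
have -> : cdfac 1 0 z = z by rewrite /cdfac mul1r addr0.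
rewrite normc_sqr /=; have x2 : x ^+ 2 <= 4^-1.
  have -> : 4^-1 = 2^-1 ^+ 2 :> R by field.
  by rewrite -[x ^+ 2]real_normK ?num_real // lerXn2r ?nnegrE ?invr_ge0 // ler_norml.
have d0 : 0 < x ^+ 2 + 2^-1 ^+ 2 :> R by rewrite ltr_wpDl ?sqr_ge0 // exprn_gt0 // invr_gt0.
by rewrite ler_pdivlMr // mul1r; lra.
Qed.

(** The lower bound of W makes the n-th Whittaker term nonzero at a large height, where the n-th
    Fourier coefficient vanishes. *)
Lemma wser_zero c n : subexp c -> (forall z, 1 <= Im z -> wser k%:Z c z = 0) -> c n = 0.
Proof.
move=> sc zero; have p2 := pi_ge2 R.
have [B [t0 [B0 hB]]] := wW_lower2 hk r0.
have n0 := @freq_norm_gt0 R k hk n.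
pose y := Num.max 1 ((`|t0| + 1) / `|nu n|).
have y1 : 1 <= y by rewrite /y le_max lexx.
have y0 : 0 < y by apply: lt_le_trans y1.
have W0 : wterm k%:Z n (0 +i* y) != 0.
  have tl : t0 < 4 * pi * `|nu n| * y.
    have : (`|t0| + 1) <= `|nu n| * y by rewrite mulrC -ler_pdivrMr // /y le_max lexx orbT.
    have : t0 <= `|t0| by exact: ler_norm.
    have : 1 * (`|nu n| * y) <= 4 * pi * (`|nu n| * y) by rewrite ler_wpM2r ?mulr_ge0 ?(ltW y0) //; lra.
    by rewrite mul1r mulrA; lra.
  rewrite wterm_iy; apply: mulf_neq0; first by rewrite rc_eq0 invr_eq0 gt_eqF // sqrtr_gt0.
  rewrite -normc_gt0; apply: lt_le_trans (hB n _ tl).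
  by rewrite mulr_gt0 ?expR_gt0.
apply: (mulIf W0); rewrite mul0r -fcoef_wser // /fcoef.
rewrite (eq_cint (g := fun=> 0)) ?cint_cst // => t _.
by rewrite zero ?mul0r.
Qed.

(* If |f| <= M for Im z >= 1 then also on the segment Im z = 1/2, |x| <= 1/2,
   whence a bound for all coefficients; if the low ones vanish, it improves M
   to M / 2. *)
Lemma maass_coef_rigid : exists X : R, forall c, maass_coef k r c -> (forall n, `|nu n| <= X -> c n = 0) -> forall n, c n = 0.
Proof.
have p0 := pi_gt0 R; have p2 := pi_ge2 R.
have [A A0 hA] := wterm_bound hk r0 k%:Z (ltr01 : 0 < 1 :> R).
have [B [t0 [B0 hB]]] := wW_lower2 hk r0.
(* Bounding sqrt|nu| by exp|nu|, a term with |nu| > X has exponent at most |nu| - 7/10 pi |nu|,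
   which is below - X/8 - |nu|/8 since pi >= 2. The first part gives smallness, the second the
   geometric ratio [q]. *)
pose q : R := expR (- 8^-1).
have q01 : 0 <= q < 1 by rewrite expR_ge0 /= expR_lt1 oppr_lt0 invr_gt0 ltr0n.
have q1 : 0 < 1 - q by rewrite subr_gt0; case/andP: q01.
pose K := 2 * (A + 1) / B; have K0 : 0 < K by rewrite divr_gt0 // mulr_gt0 // ltr_wpDl.
(* Chosen so that the final estimate 2 K M de / (1 - q) equals M / 2. *)
pose de := (1 - q) / (4 * K); have de0 : 0 < de by rewrite divr_gt0 // mulr_gt0.
have [X eX tX] : exists2 X : R, expR (- (X / 8)) <= de & t0 <= X.
  exists (Num.max (8 / de) t0); last by rewrite le_max lexx orbT.
  apply: le_trans (_ : expR (- de^-1) <= _).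
    rewrite ler_expR lerN2 ler_pdivlMr // mulrC; apply: le_trans (_ : 8 / de <= _) => //.
    by rewrite le_max lexx.
  rewrite expRN -[leRHS]invrK lef_pV2 ?posrE ?expR_gt0 ?invr_gt0 //.
  by apply: le_trans (expR_ge1Dx _); rewrite lerDr.
exists X => c hc hz; have [sc ac] := hc.
have step (M : R) : 0 <= M -> (forall z, 1 <= Im z -> normc (wser k%:Z c z) <= M) -> forall z, 1 <= Im z -> normc (wser k%:Z c z) <= M / 2.
  move=> M0 hM.
  have cb n : X < `|nu n| -> normc (c n) <= 2 * M / B * (Num.sqrt `|nu n| * expR (11 / 10 * (pi * `|nu n|))).
    move=> nX; have n0 := @freq_norm_gt0 R k hk n.
    have h2 : 0 < 2^-1 :> R by rewrite invr_gt0.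
    have hle : normc (c n * wterm k%:Z n (0 +i* 2^-1)) <= 2 * M.
      rewrite -fcoef_wser //; apply: cint_le_cst.
        by apply: ctsR_fcoef => // z zu; exact: wser_cts.
      by move=> x hx; rewrite normcM normc_expi mulr1 add0r; exact: maass_coef_half.
    have s0 : 0 < Num.sqrt `|nu n| by rewrite sqrtr_gt0.
    have tl : t0 < 4 * pi * `|nu n| * 2^-1.
      have : t0 < `|nu n| by apply: le_lt_trans nX.
      have : 2 * `|nu n| <= pi * `|nu n| by rewrite ler_wpM2r // ltW.
      have -> : 4 * pi * `|nu n| * 2^-1 = 2 * (pi * `|nu n|) by field.
      move: (pi * `|nu n|) => y; lra.
    have := hB n _ tl; rewrite wterm_iy normcM normcM normcRE ger0_norm ?invr_ge0 ?sqrtr_ge0 // in hle *.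
    move=> lowb.
    have lowb' : B * expR (- (11 / 10 * (pi * `|nu n|))) <= normc (wW (wparam k k n) r (4 * pi * `|nu n| * 2^-1)).
      by apply: le_trans lowb; rewrite ler_pM2l // ler_expR le_eqVlt; apply/orP; left; apply/eqP; field.
    have e0 := expR_gt0 (11 / 10 * (pi * `|nu n|)).
    rewrite expRN in lowb'.
    move: hle lowb'; move: (normc (wW _ _ _)) (Num.sqrt _) (expR _) s0 e0 => W s E s0 E0 hle lowb'.
    have WB : B / E <= W by [].
    have h3 : normc (c n) * (s^-1 * (B / E)) <= 2 * M.
      apply: le_trans hle; rewrite ler_wpM2l ?normc_ge0 // ler_wpM2l // invr_ge0.
      exact: ltW.
    have -> : normc (c n) = normc (c n) * (s^-1 * (B / E)) * (s * E / B).
      by move: (gt_eqF s0) (gt_eqF E0) (gt_eqF B0) => f1 f2 f3; field; rewrite f1 f2 f3.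
    have -> : 2 * M / B * (s * E) = 2 * M * (s * E / B) by ring.
    by rewrite ler_wpM2r // divr_ge0 ?mulr_ge0 // ltW.
  move=> z z1; have zu : uhp z by apply: lt_le_trans z1; exact: ltr01.
  pose L := K * M * expR (- (X / 8)).
  have tb n : normc (c n * wterm k%:Z n z) <= L * expR (- 8^-1 * `|nu n|).
    have L0 : 0 <= L := mulr_ge0 (mulr_ge0 (ltW K0) M0) (expR_ge0 _).
    case: (lerP `|nu n| X) => nX; first by rewrite hz // mul0r normc0 mulr_ge0 ?expR_ge0.
    have n0 := @freq_norm_gt0 R k hk n.
    rewrite normcM; apply: le_trans (ler_pM (normc_ge0 _) (normc_ge0 _) (cb n nX) (hA n z z1)) _.
    have sq : Num.sqrt `|nu n| <= expR `|nu n|.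
      apply: le_trans (_ : 1 + `|nu n| <= _); last exact: expR_ge1Dx.
      rewrite -[X in _ <= 1 + X](sqr_sqrtr (ltW n0)); move: (Num.sqrt _) => s.
      have := sqr_ge0 (s - 1); rewrite sqrrB mulr1 expr1n; have := sqr_ge0 s; lra.
    have E1 : expR (- (9 / 5 * pi) * (`|nu n| * Im z)) <= expR (- (9 / 5 * (pi * `|nu n|))).
      have h : pi * `|nu n| <= pi * (`|nu n| * Im z) by rewrite ler_pM2l // ler_peMr.
      have -> : - (9 / 5 * pi) * (`|nu n| * Im z) = - (9 / 5 * (pi * (`|nu n| * Im z))) by move: (pi : R) => p; ring.
      rewrite ler_expR; lra.
    have E2 : expR (- (X / 8)) * expR (- 8^-1 * `|nu n|) >= expR `|nu n| * expR (11 / 10 * (pi * `|nu n|)) * expR (- (9 / 5 * (pi * `|nu n|))).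
      rewrite -!expRD ler_expR.
      have : 2 * `|nu n| <= pi * `|nu n| by rewrite ler_wpM2r // ltW.
      move: nX n0; move: (pi * `|nu n|) `|nu n| => y x; lra.
    have C0 : 0 <= 2 * M / B by rewrite divr_ge0 ?mulr_ge0 // ltW.
    apply: le_trans (_ : (2 * M / B * (expR `|nu n| * expR (11 / 10 * (pi * `|nu n|)))) * (A * expR (- (9 / 5 * (pi * `|nu n|)))) <= _).
      apply: ler_pM.
      - exact: mulr_ge0 C0 (mulr_ge0 (sqrtr_ge0 _) (expR_ge0 _)).
      - exact: mulr_ge0 A0 (expR_ge0 _).
      - by rewrite ler_wpM2l // ler_wpM2r ?expR_ge0.
      - by rewrite ler_wpM2l.
    have -> : (2 * M / B * (expR `|nu n| * expR (11 / 10 * (pi * `|nu n|)))) * (A * expR (- (9 / 5 * (pi * `|nu n|)))) =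
      (2 * M / B * A) * (expR `|nu n| * expR (11 / 10 * (pi * `|nu n|)) * expR (- (9 / 5 * (pi * `|nu n|)))) by ring.
    have -> : L * expR (- 8^-1 * `|nu n|) = (2 * M / B * (A + 1)) * (expR (- (X / 8)) * expR (- 8^-1 * `|nu n|)) by rewrite /L /K; ring.
    apply: ler_pM => //.
    - exact: mulr_ge0 C0 A0.
    - by rewrite ler_wpM2l // lerDl.
  have L0 : 0 <= L := mulr_ge0 (mulr_ge0 (ltW K0) M0) (expR_ge0 _).
  have gd : geodom (fun n => c n * wterm k%:Z n z) L q.
    move=> n; have h8 : 0 <= 8^-1 :> R by rewrite invr_ge0.
    have [h1 h2] := @expR_q_bound R k hk (8^-1) n h8.
    by split; apply: le_trans (tb _) _; rewrite ler_wpM2l.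
  apply: le_trans (sumZ_le q01 gd) _.
  rewrite ler_pdivrMr // /L.
  apply: le_trans (_ : 2 * (K * M * de) <= _); first by rewrite ler_pM2l // ler_wpM2l // mulr_ge0 // ltW.
  rewrite /de le_eqVlt; apply/orP; left; apply/eqP.
  have H (a b m : R) : a != 0 -> 2 * (a * m * (b / (4 * a))) = m / 2 * b by move=> f1; field.
  by apply: H; rewrite gt_eqF.
have [M M0 hM] := wser_bounded hk r0 k%:Z sc (ltr01 : 0 < 1 :> R).
have zero z : 1 <= Im z -> wser k%:Z c z = 0.
  move=> z1; have all j : forall z, 1 <= Im z -> normc (wser k%:Z c z) <= M / 2 ^+ j.
    elim: j => [|j IH]; first by rewrite expr0 divr1.
    by move=> w w1; rewrite exprS invfM mulrA -mulrAC; apply: step => //; rewrite divr_ge0 // exprn_ge0.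
  apply/eqP; rewrite -normc_eq0; apply/eqP/le_anti; rewrite normc_ge0 andbT.
  have lim : (fun j => M * 2^-1 ^+ j) @ \oo --> (M * 0 : R).
    by apply: cvgMr; apply: cvg_expr; rewrite ger0_norm ?invr_ge0 // invf_lt1 // ltr1n.
  rewrite mulr0 in lim; apply: (cvgr_to_ge lim); exists 0%N => // j _ /=.
  by rewrite exprVn; exact: all.
by move=> n; apply: (wser_zero n sc) => z; exact: zero.
Qed.

End Coefficients.

(** * Simultaneous eigenvectors *)

Section JointEigenvector.
Variables (F : closedFieldType) (n : nat) (I : Type) (M : I -> 'M[F]_n) (phi : 'cV[F]_n).

Lemma mx_eigen (m : nat) (A : 'M[F]_m) : (0 < m)%N -> exists a : F, (\rank (A - a%:M)%R < m)%N.
Proof.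
move=> m0; have /closed_rootP[a ra] : size (char_poly A) != 1%N by rewrite size_char_poly; case: m m0 A.
exists a; move: ra; rewrite -eigenvalue_root_char /eigenvalue /eigenspace kermx_eq0 /row_free => h.
by rewrite ltn_neqAle h rank_leq_row.
Qed.

Definition stable_nonzero (W : 'M[F]_n) : Prop := (forall i, W *m M i <= W)%MS /\ W *m phi != 0.

(* On a stable subspace of minimal dimension on which phi does not vanish, the
   image of M i - a is too small for phi to be nonzero on it. *)
Lemma joint_eigen : (forall i j, M i *m M j = M j *m M i) -> phi != 0 ->
  exists (x : 'rV[F]_n) (l : I -> F), [/\ x *m phi != 0, forall i, x *m M i *m phi = l i *: (x *m phi)
    & forall i j, x *m M i *m M j *m phi = (l i * l j) *: (x *m phi)].
Proof.
move=> comm phi0.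
have ex : exists m, `[< exists2 W, stable_nonzero W & \rank W = m >].
  exists (\rank (1%:M : 'M[F]_n)); apply/asboolP; exists 1%:M => //; split; last by rewrite mul1mx.
  by move=> i; rewrite submx1.
case: (ex_minnP ex) => m /asboolP[W [stW W0] rW] minm.
have stabB i : (row_base W *m M i <= row_base W)%MS.
  by rewrite eq_row_base (submx_trans _ (stW i)) // submxMr // eq_row_base.
pose B := row_base W.
have B0 : B *m phi != 0.
  apply: contraNneq W0 => h; have /submxP[X ->] : (W <= B)%MS by rewrite eq_row_base.
  by rewrite -mulmxA h mulmx0.
have m0 : (0 < \rank W)%N.
  by rewrite lt0n; apply: contraNneq W0 => /eqP; rewrite mxrank_eq0 => /eqP ->; rewrite mul0mx.
have act i : exists a, B *m M i *m phi = a *: (B *m phi).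
  have /submxP[X eX] := stabB i.
  have [a ha] := mx_eigen X m0; exists a.
  pose W' := B *m (M i - a%:M).
  have eW' : W' = (X - a%:M) *m B by rewrite /W' mulmxBr mulmxBl eX mul_mx_scalar mul_scalar_mx.
  apply/eqP; rewrite -subr_eq0; apply/negPn/negP => h.
  have hW' : W' *m phi != 0.
    by move: h; congr (_ != _); rewrite /W' mulmxBr mulmxBl mul_mx_scalar scalemxAl.
  have rk : (\rank W' < m)%N by rewrite -rW eW' (leq_ltn_trans (mxrankM_maxl _ _)).
  have : (m <= \rank W')%N.
    apply: minm; apply/asboolP; exists <<W'>>%MS; last by rewrite genmxE.
    split.
      move=> j; rewrite genmxE (eqmxMr _ (genmxE _)).
      have /submxP[Y eY] := stabB j.
      have -> : W' *m M j = Y *m W'.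
        rewrite /W' -mulmxA; have -> : (M i - a%:M) *m M j = M j *m (M i - a%:M).
          by rewrite mulmxBl mulmxBr comm mul_scalar_mx mul_mx_scalar.
        by rewrite (mulmxA B (M j)) [B *m M j]eY -mulmxA.
      exact: submxMl.
    apply: contraNneq hW' => e; have /submxP[Y ->] : (W' <= <<W'>>)%MS by rewrite genmxE.
    by rewrite -mulmxA e mulmx0.
  by rewrite leqNgt rk.
have [l hl] := boolp.choice act.
have [i0 hi0] : exists i0, row i0 B *m phi != 0.
  apply: contrapT => /forallNP h; move/negP: B0; apply; apply/eqP/row_matrixP => i.
  by rewrite row_mul row0; move: (h i) => /negP; rewrite negbK => /eqP.
exists (row i0 B), l; split => // [i|i j].
  by rewrite -!row_mul hl linearZ /= row_mul.
have /submxP[X eX] := stabB i.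
rewrite -!row_mul; have -> : B *m M i *m M j *m phi = (l i * l j) *: (B *m phi).
  have eX' : B *m M i = X *m B := eX.
  transitivity (X *m (B *m M j *m phi)); first by rewrite eX' !mulmxA.
  by rewrite hl -scalemxAr mulmxA -eX' hl scalerA mulrC.
by rewrite linearZ /= row_mul.
Qed.

End JointEigenvector.

(** * Waveforms and their coefficient sequences *)

Section MaassSpace.
Context {R : realType}.
Local Notation C := R[i].
Variables (k : nat) (hk : (1 <= k <= 11)%N) (r : R) (r0 : r != 0).
Variables (v : 'M[int]_2 -> C) (hv : eta_multiplier k v).
Local Notation wser := (@wser R k r).

(** A Whittaker series is bounded on y >= 1/2, which contains the fundamental domain, so |f|^2 / y^2
    is integrable by [strip_finite]. *)
Lemma wser_maass_space c : maass_coef k r c -> maass_space v k r (wser k%:Z c).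
Proof.
move=> [sc ac]; have [h1 h2] := wser_maass hk r0 sc.
split => //; first by have /automorphicP := ac; apply.
have hC := wser_C1 hk r0 k%:Z sc.
have y0 : 0 < 2^-1 :> R by rewrite invr_gt0.
have [M M0 hM] := wser_bounded hk r0 k%:Z sc y0.
have fin := @strip_finite R _ (strip_density_ge0 (wser k%:Z c)) (fun y => @strip_density_ctsx R _ _ _ hC y) (fun x => @strip_density_ctsy R _ _ _ hC x) (M ^+ 2).
rewrite /square_integrable; apply: le_lt_trans (fin _).
  rewrite le_eqVlt; apply/orP; left; apply/eqP; apply: eq_integral => p /set_mem hp.
  by rewrite /strip_density max_l // FD_y.
move=> x y hy; have yp : 0 < y by apply: lt_le_trans hy.
rewrite /strip_density max_l // ler_wpM2r ?invr_ge0 ?sqr_ge0 // lerXn2r ?nnegrE ?normc_ge0 //.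
exact: hM.
Qed.

Lemma maass_space_wser f : maass_space v k r f -> exists2 c, maass_coef k r c & forall z, uhp z -> f z = wser k%:Z c z.
Proof.
move=> [[c1 cx cy] /(automorphicP hv) af lap L2].
have per : qper k f.
  move=> z zu; have dt : 1 * 1 - 1 * 0 = 1 :> int by [].
  have := af _ _ _ _ dt z zu; rewrite mob_T => ->.
  have -> : phase 0 1 z = 1 by rewrite (phase_upper z (ltn0Sn 0)).
  rewrite exp1rz mulr1; congr (_ * _).
  have [_ _ h _] := etav_rules (R := R) (det_det_mod k (erefl : 1 * 1 - 0 * 0 = 1 :> int)).
  by move: h; rewrite !add0r etav1 mulr1 addr0 => ->; rewrite root12E.
have [c [sc fc _]] := fourier_main hk r0 (uhp_C1_C1on c1) (uhp_C1_C1on cx) (uhp_C1_C1on cy) lap per L2.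
by exists c => //; split => //; exact: automorphic_eq fc af.
Qed.

End MaassSpace.

(** * Sequence spaces determined by finitely many values *)

Section SequenceSpaces.
Variables (F : fieldType) (J : Type) (P : (J -> F) -> Prop).
Hypotheses (P0 : P (fun=> 0)) (PL : forall a b c, P b -> P c -> P (fun j => a * b j + c j)).

Lemma lin_closed_sum (I : Type) (s : seq I) (u : I -> F) (b : I -> J -> F) : (forall i, P (b i)) -> P (fun j => \sum_(i <- s) u i * b i j).
Proof.
move=> h; elim: s => [|i s IH].
  by rewrite (_ : (fun j => _) = fun=> 0) //; apply/funext => j; rewrite big_nil.
rewrite (_ : (fun j => _) = fun j => u i * b i j + \sum_(l <- s) u l * b l j); first exact: PL.
by apply/funext => j; rewrite big_cons.
Qed.

Variables (p : nat) (f : 'I_p -> J).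
Hypothesis rigid : forall c, P c -> (forall i, c (f i) = 0) -> forall j, c j = 0.

Definition restr (c : J -> F) : 'rV[F]_p := \row_i c (f i).
Definition in_restr (w : 'rV[F]_p) : Prop := exists2 c, P c & restr c = w.

Lemma in_restr_sub m (B : 'M[F]_(m, p)) w : (forall i, in_restr (row i B)) -> (w <= B)%MS -> in_restr w.
Proof.
move=> h /submxP[x ->]; have [c hc] := boolp.choice (fun i => let: ex_intro2 c a b := h i in ex_intro (fun c => P c /\ restr c = row i B) c (conj a b)).
exists (fun j => \sum_(i < m) x 0 i * c i j); first by apply: lin_closed_sum => i; case: (hc i).
apply/rowP => l; rewrite !mxE; apply: eq_bigr => i _; congr (_ * _).
by have [_ /rowP/(_ l)] := hc i; rewrite !mxE.
Qed.

Lemma finite_basis : exists n (e : 'I_n -> J -> F), [/\ forall i, P (e i),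
  forall u : 'I_n -> F, (forall j, \sum_(i < n) u i * e i j = 0) -> forall i, u i = 0
  & forall c, P c -> exists u : 'I_n -> F, forall j, c j = \sum_(i < n) u i * e i j].
Proof.
have ex : exists m, `[< exists2 B : 'M[F]_p, (forall i, in_restr (row i B)) & \rank B = m >].
  exists 0%N; apply/asboolP; exists 0; last by rewrite mxrank0.
  by move=> i; rewrite row0; exists (fun=> 0) => //; apply/rowP => l; rewrite !mxE.
have bd m : `[< exists2 B : 'M[F]_p, (forall i, in_restr (row i B)) & \rank B = m >] -> (m <= p)%N.
  by move=> /asboolP[B _ <-]; exact: rank_leq_row.
case: (ex_maxnP ex bd) => m /asboolP[B hB rB] maxm.
pose B0 := row_base B.
have hB0 i : in_restr (row i B0).
  by apply: (in_restr_sub hB); rewrite (submx_trans (row_sub _ _)) // eq_row_base.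
have [e he] := boolp.choice (fun i => let: ex_intro2 c a b := hB0 i in ex_intro (fun c => P c /\ restr c = row i B0) c (conj a b)).
have resE (u : 'rV_(\rank B)) : restr (fun j => \sum_i u 0 i * e i j) = u *m B0.
  apply/rowP => l; rewrite !mxE; apply: eq_bigr => i _; congr (_ * _).
  by have [_ /rowP/(_ l)] := he i; rewrite !mxE.
exists (\rank B), e; split; first by move=> i; case: (he i).
- move=> u h i; pose x : 'rV_(\rank B) := \row_i u i.
  have : x *m B0 = 0.
    rewrite -resE; apply/rowP => l; rewrite !mxE -[RHS](h (f l)); apply: eq_bigr => l' _.
    by rewrite mxE.
  move/eqP; rewrite mulmx_free_eq0 ?row_base_free // => /eqP/rowP/(_ i).
  by rewrite !mxE.
move=> c hc; have sub : (restr c <= B0)%MS.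
  rewrite eq_row_base; apply/negPn/negP => h.
  have lt : (B < B + restr c)%MS.
    rewrite ltmxE addsmxSl; apply: contraNN h; apply: submx_trans; exact: addsmxSr.
  have := rank_ltmx lt; rewrite rB ltnNge; apply/negP/negPn; apply: maxm.
  apply/asboolP; exists (B + restr c)%MS => // i.
  apply: (@in_restr_sub _ (col_mx B (restr c))).
    move=> l; case: (split_ordP l) => l' ->; first by rewrite rowKu.
    rewrite rowKd; exists c => //; by rewrite [l']ord1 row_id.
  by rewrite -addsmxE row_sub.
have [x ex'] := submxP sub; exists (x 0) => j.
have h : P (fun j => (-1) * (\sum_i x 0 i * e i j) + c j).
  by apply: PL => //; apply: lin_closed_sum => i; case: (he i).
have := rigid h _ j; rewrite mulN1r addrC => hz.
apply/eqP; rewrite -subr_eq0; apply/eqP; apply: hz => i.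
by have := congr1 (fun w : 'rV_p => w 0 i) ex'; rewrite -resE !mxE mulN1r => ->; rewrite addrC subrr.
Qed.

End SequenceSpaces.

(** * A coefficient sequence on which c(0) is multiplicative *)

Section Assembly.
Context {R : realType}.
Local Notation C := R[i].
Variables (k : nat) (hk : (1 <= k <= 11)%N) (r : R) (r0 : r != 0).
Local Notation nu := (@freq R k).
Local Notation wser := (@wser R k r).
Local Notation maass_coef := (@maass_coef R k r).
Local Notation hecke := (@hecke R k r).

Lemma maass_coef_lin a b c : maass_coef b -> maass_coef c -> maass_coef (fun n => a * b n + c n).
Proof.
move=> [sb ab] [sc ac]; have sab := subexpZ a sb; split; first exact: subexpD.
move=> x y u w dt z zu; have mu : uhp (mob x y u w z) by apply: mob_uhp => //; rewrite dt.
rewrite !(wserD hk r0) // !(wserZ hk r0) // ab // ac //; ring.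
Qed.

Lemma maass_coef0 : maass_coef (fun=> 0).
Proof.
have s0 : subexp k (fun=> 0 : C) by apply: (@subexp_bounded _ _ _ 0) => n; rewrite normc0.
have Z w z : wser w (fun=> 0) z = 0 by rewrite /wser -[RHS]sumZ0; apply: eq_sumZ => n; rewrite mul0r.
by split => // x y u w dt z zu; rewrite !Z mulr0.
Qed.

Lemma finite_indices : exists (p : nat) (f : 'I_p -> int), forall c, maass_coef c -> (forall i, c (f i) = 0) -> forall n, c n = 0.
Proof.
have [X hX] := maass_coef_rigid hk r0.
pose m := (Num.bound `|X|).+1.
have Xm : X < m%:R.
  apply: le_lt_trans (ler_norm X) _; apply: lt_trans (archi_boundP (normr_ge0 X)) _.
  by rewrite ltr_nat.
exists (m + m)%N, (fun i => if (i < m)%N then i%:Z else - (i - m).+1%:Z) => c hc h.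
apply: hX => // n hn.
have nm (j : nat) : j%:R + 12^-1 <= X -> (j < m)%N.
  move=> hj; rewrite -(ltr_nat R); apply: le_lt_trans Xm; apply: le_trans hj.
  by rewrite lerDl invr_ge0.
case: n hn => j hn.
  have jm : (j < m)%N by apply: nm; apply: le_trans hn; have [] := @freq_abs R k hk j.
  have jmm : (j < m + m)%N by apply: ltn_addr.
  by have := h (Ordinal jmm); rewrite /= jm.
have jm : (j < m)%N by apply: nm; apply: le_trans hn; have [] := @freq_abs R k hk j.
have jmm : (m + j < m + m)%N by rewrite ltn_add2l.
by have := h (Ordinal jmm); rewrite /= ltnNge leq_addr /= addKn.
Qed.

Lemma hecke_lin neg q (n : nat) (x : 'I_n -> C) (e : 'I_n -> int -> C) m :
  hecke neg q (fun j => \sum_(i < n) x i * e i j) m = \sum_(i < n) x i * hecke neg q (e i) m.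
Proof.
rewrite /hecke /hecke_formal; under [in RHS]eq_bigr => i _ do rewrite mulrCA mulr_sumr.
rewrite -mulr_sumr exchange_big /=; congr (_ * _); apply: eq_bigr => a _.
rewrite /hecke_term; case: ifP => _.
  by rewrite mulr_sumr; apply: eq_bigr => i _; rewrite mulrCA.
by rewrite mulr0 big1 // => i _; rewrite !mulr0.
Qed.

Definition hecke_ok (p : bool * nat) := (0 < p.2)%N && (12 %| k%:Z * (sgn_if p.1 * p.2%:Z - 1))%Z.

(** In a basis the Hecke operators become commuting matrices acting on row vectors, and evaluation
    at 0 becomes the column [phi], nonzero because of [c0]; [joint_eigen] supplies the vector. The
    products are stated with values at 0, where eigenvalues have been eliminated. *)
Lemma eigen_coef c0 : maass_coef c0 -> c0 0 != 0 -> exists c, [/\ maass_coef c, c 0 != 0 &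
  forall p p' : bool * nat, hecke_ok p -> hecke_ok p' ->
    hecke p'.1 p'.2 (hecke p.1 p.2 c) 0 * c 0 = hecke p.1 p.2 c 0 * hecke p'.1 p'.2 c 0].
Proof.
move=> hc0 c00; have [d [f rig]] := finite_indices.
have [n [e [he free span]]] := finite_basis maass_coef0 maass_coef_lin rig.
have hop_V (i : {p | hecke_ok p}) (a : 'I_n) : maass_coef (hecke (val i).1 (val i).2 (e a)).
  by case: i => p /= /andP[h1 h2]; exact: maass_coef_hecke.
have [M hM] : exists M : {p | hecke_ok p} -> 'M[C]_n, forall i a m, hecke (val i).1 (val i).2 (e a) m = \sum_(b < n) M i a b * e b m.
  have h i a := span _ (hop_V i a).
  have [g hg] := boolp.choice (fun ia : {p | hecke_ok p} * 'I_n => h ia.1 ia.2).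
  exists (fun i => \matrix_(a, b) g (i, a) b) => i a m; rewrite (hg (i, a)).
  by apply: eq_bigr => b _; rewrite mxE.
pose S (x : 'rV[C]_n) m := \sum_(a < n) x 0 a * e a m.
have SM i x m : hecke (val i).1 (val i).2 (S x) m = S (x *m M i) m.
  rewrite /S hecke_lin; under eq_bigr => a _ do rewrite hM mulr_sumr.
  rewrite exchange_big; apply: eq_bigr => b _; rewrite mxE mulr_suml; apply: eq_bigr => a _.
  by rewrite mulrA.
have E1 i y : hecke (val i).1 (val i).2 (S y) = S (y *m M i) by apply/funext => m; exact: SM.
have S_inj x y : (forall m, S x m = S y m) -> x = y.
  move=> h; apply/rowP => a; apply/eqP; rewrite -subr_eq0; apply/eqP.
  apply: (free (fun a => x 0 a - y 0 a)) => m.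
  under eq_bigr => b _ do rewrite mulrBl.
  by rewrite sumrB; have := h m; rewrite /S => ->; rewrite subrr.
have comm i j : M i *m M j = M j *m M i.
  apply/row_matrixP => a; rewrite !row_mul.
  rewrite ![row a _]rowE; apply: S_inj => m.
  rewrite -!E1.
  case: i => [[b1 q1] /= /andP[h1 h2]]; case: j => [[b2 q2] /= /andP[h3 h4]].
  exact: heckeC.
pose phi : 'cV[C]_n := \col_a e a 0.
have Sphi x : S x 0 = (x *m phi) 0 0 by rewrite mxE; apply: eq_bigr => a _; rewrite mxE.
have phi0 : phi != 0.
  have [u hu] := span _ hc0; apply: contraNneq c00 => h; rewrite hu big1 // => a _.
  by have /colP/(_ a) := h; rewrite !mxE => ->; rewrite mulr0.
have [x [l [x0 h1 h2]]] := joint_eigen comm phi0.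
exists (S x); split.
- by apply: (lin_closed_sum maass_coef0 maass_coef_lin).
- by apply: contraNneq x0 => h; apply/eqP/matrixP => a b; rewrite !ord1 -Sphi h mxE.
move=> p p' hp hp'; pose i : {p | hecke_ok p} := exist _ p hp; pose j : {p | hecke_ok p} := exist _ p' hp'.
have e1 : hecke p.1 p.2 (S x) = S (x *m M i) := E1 i x.
have e2 : hecke p'.1 p'.2 (S x) = S (x *m M j) := E1 j x.
have e3 : hecke p'.1 p'.2 (S (x *m M i)) = S (x *m M i *m M j) := E1 j (x *m M i).
rewrite e1 e2 e3 !Sphi h2 !h1 !mxE; ring.
Qed.

End Assembly.

(** * Coefficient relations *)

Section HeckeRelations.
Context {R : realType}.
Local Notation C := R[i].
Variables (k : nat) (hk : (1 <= k <= 11)%N) (r : R) (r0 : r != 0).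
Local Notation nu := (@freq R k).
Local Notation wser := (@wser R k r).
Local Notation maass_coef := (@maass_coef R k r).
Local Notation hecke := (@hecke R k r).
Local Notation N := (Nk k).
Local Notation D := (Dk k).
Local Notation nfreq := (nfreq k).
Local Notation nindex := (nindex k).

Lemma nfreq0 : nfreq 0 = D%:Z. Proof. by rewrite /nfreq mulr0 add0r. Qed.

Lemma nu0_gt0 : 0 < nu 0.
Proof. by have := @freq_pos R k hk 0%N; rewrite add0r; apply: lt_le_trans; rewrite invr_gt0 ltr0n. Qed.

Lemma nfreq_nindex_mul neg q : (12 %| k%:Z * (sgn_if neg * q%:Z - 1))%Z -> nfreq (nindex (sgn_if neg * q%:Z * D%:Z)) = sgn_if neg * q%:Z * D%:Z.
Proof.
rewrite dvd12k // => h; apply: nfreqK => //.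
by rewrite -{2}(mul1r D%:Z) -mulrBl dvdz_mulr.
Qed.

Lemma nu_nindex_mul neg q : (12 %| k%:Z * (sgn_if neg * q%:Z - 1))%Z -> (0 < q)%N ->
  (0 < nu (nindex (sgn_if neg * q%:Z * D%:Z))) = ~~ neg.
Proof.
move=> hq q0; have NR : 0 < (N%:R)^-1 :> R by rewrite invr_gt0 ltr0n Nk_gt0.
have D0 := Dk_gt0 hk.
rewrite nu_nfreq nfreq_nindex_mul // (pmulr_lgt0 _ NR) ltr0z.
rewrite pmulr_lgt0 ?ltz_nat // pmulr_lgt0 ?ltz_nat //.
by rewrite /sgn_if; case: neg hq.
Qed.

Lemma sum_divisors_gcd (q m : nat) (G : nat -> C) : (0 < q)%N -> \sum_(a <- divisors q | (a %| m)%N) G a = \sum_(a <- divisors (gcdn q m)) G a.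
Proof.
move=> q0; rewrite -big_filter; apply: perm_big; apply: uniq_perm; rewrite ?filter_uniq ?divisors_uniq //.
move=> a; rewrite mem_filter -!dvdn_divisors ?gcdn_gt0 ?q0 // dvdn_gcd andbC //.
Qed.

(** At n = 0 the integer t is D, and coprimality leaves the divisor a = 1, where chi is 1; the
    frequency is positive, so the twist is 1. *)
Lemma hecke_at0 neg q c : (0 < q)%N -> coprime q D -> hecke neg q c 0 = c (nindex (sgn_if neg * q%:Z * D%:Z)).
Proof.
move=> q0 cq; rewrite /hecke /hecke_twist nu0_gt0 /hecke_formal.
have -> : \sum_(a <- divisors q) chi k a%:Z * hecke_term k neg q a c 0 =
   \sum_(a <- divisors q | (a %| D)%N) chi k a%:Z * c (nindex (sgn_if neg * (q %/ a)%:Z * (D %/ a)%N%:Z)).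
  rewrite [RHS]big_mkcond; apply: eq_bigr => a _; rewrite /hecke_term nfreq0 dvdzE /= divz_nat.
  by case: ifP => // _; rewrite mulr0.
rewrite sum_divisors_gcd // (eqP cq) big_seq1 chiE subrr mulr0 mul0r root12_0 mul1r !divn1.
by case: neg; rewrite mul1r.
Qed.

(** The outer operator moves the index 0 to a frequency with the sign of the determinant, and at a
    negative one the inner operator carries [Lambda]. A divisor of q is prime to D, so if it divides
    q' D it divides q'. *)
Lemma hecke_hecke_at0 neg q q' c : (0 < q)%N -> (0 < q')%N -> coprime q D -> coprime q' D ->
  (12 %| k%:Z * (sgn_if neg * q%:Z - 1))%Z -> (12 %| k%:Z * (sgn_if neg * q'%:Z - 1))%Z ->
  hecke neg q' (hecke neg q c) 0 = (if neg then (Lambda k r)%:C else 1) *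
    \sum_(a <- divisors (gcdn q q')) chi k a%:Z * c (nindex (((q %/ a) * (q' %/ a) * D)%N%:Z)).
Proof.
move=> q0 q0' cq cq' hq hq'; rewrite hecke_at0 // /hecke /hecke_twist nu_nindex_mul //.
have -> : (if neg then if ~~ neg then 1 else (Lambda k r)%:C else 1) = (if neg then (Lambda k r)%:C else 1) :> C by case: (neg).
congr (_ * _); rewrite -sum_divisors_gcd // /hecke_formal [RHS]big_mkcond; apply: eq_big_seq => a.
rewrite -dvdn_divisors // => aq; have a0 : (0 < a)%N by apply: dvdn_gt0 aq.
have ca : coprime a D by apply: coprime_dvdl aq cq.
rewrite /hecke_term nfreq_nindex_mul // dvdzE !abszM /= (_ : `|sgn_if neg|%N = 1%N); last by rewrite /sgn_if; case: (neg).
rewrite mul1n Gauss_dvdl //; case: ifP => [/dvdnP[y ey]|]; last by rewrite mulr0.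
congr (_ * c (nindex _)).
have -> : (sgn_if neg * q'%:Z * D%:Z %/ a%:Z)%Z = sgn_if neg * y%:Z * D%:Z.
  have -> : sgn_if neg * q'%:Z * D%:Z = sgn_if neg * y%:Z * D%:Z * a%:Z by rewrite ey PoszM; ring.
  by rewrite mulzK // eqz_nat -lt0n.
rewrite ey mulnK // !PoszM; transitivity ((sgn_if neg * sgn_if neg) * (q %/ a)%N%:Z * y%:Z * D%:Z); first by ring.
by rewrite sgn_if_sq mul1r.
Qed.

Lemma nindex_hecke_index a b d : (0 < a)%N -> (0 < b)%N -> (d %| a)%N -> (d %| b)%N ->
  (12 %| k * (a - 1))%N && (12 %| k * (b - 1))%N || (12 %| k * (a + 1))%N && (12 %| k * (b + 1))%N ->
  nindex ((a %/ d) * (b %/ d) * D)%N%:Z = (hecke_index k a b d)%:Z.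
Proof.
move=> a0 b0 da db h; have := hecke_indexE a0 b0 da db h.
have d0 : (0 < d)%N by apply: dvdn_gt0 da.
move/dvdnP: da => [x ->]; move/dvdnP: db => [y ->]; rewrite !mulnK //.
move: (hecke_index _ _ _ _) => i e.
have e2 : (12 * i + k = k * (x * y))%N.
  apply/eqP; rewrite -(eqn_pmul2r (_ : 0 < d ^ 2)%N) ?expn_gt0 ?d0 // e; apply/eqP; ring.
have e3 : (N * i + D = D * (x * y))%N.
  apply/eqP; rewrite -(eqn_pmul2r (gcd12_gt0 k)); apply/eqP.
  rewrite mulnDl mulnAC Nk_mul Dk_mul e2 -{1}(Dk_mul k); ring.
have -> : (x * y * D)%N%:Z = nfreq i%:Z by rewrite /nfreq -PoszM -PoszD e3 mulnC.
exact: nindexK.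
Qed.

(** From 12 m = k m1 follows N m = D m1, so the integers t at m and - m are D (m1 + 1) and - D (m1 -
    1): this is the origin of m1 + 1 and m1 - 1. *)
Lemma nindex_pm m m1 : (12 * m = k * m1)%N -> nindex ((m1 + 1)%N%:Z * D%:Z) = m%:Z /\
  ((0 < m1)%N -> nindex (- ((m1 - 1)%N%:Z * D%:Z)) = - m%:Z).
Proof.
move=> e; have e2 : (N * m = D * m1)%N.
  apply/eqP; rewrite -(eqn_pmul2r (gcd12_gt0 k)); apply/eqP.
  by rewrite mulnAC Nk_mul e -{1}(Dk_mul k); ring.
have e3 : N%:Z * m%:Z = D%:Z * m1%:Z by rewrite -!PoszM e2.
split=> [|m0]; rewrite -[RHS](nindexK k) /nfreq ?mulrN e3; apply: congr1.
  by rewrite PoszD; ring.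
by rewrite -subzn //; ring.
Qed.

Lemma hecke_relations c : (forall p p' : bool * nat, hecke_ok k p -> hecke_ok k p' ->
    hecke p'.1 p'.2 (hecke p.1 p.2 c) 0 * c 0 = hecke p.1 p.2 c 0 * hecke p'.1 p'.2 c 0) ->
  forall m n : nat, (0 < m)%N -> (0 < n)%N -> 12 * m = 0 %[mod k] -> 12 * n = 0 %[mod k] ->
   let m1 := (12 * m %/ k)%N in let n1 := (12 * n %/ k)%N in
   (coprime (m1 + 1) D -> coprime (n1 + 1) D -> c m%:Z * c n%:Z = c 0 * hecke_sum k c (m1 + 1) (n1 + 1)) /\
   (coprime (m1 - 1) D -> coprime (n1 - 1) D ->
      c (- m%:Z) * c (- n%:Z) = (Lambda k r)%:C * c 0 * hecke_sum k c (m1 - 1) (n1 - 1)).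
Proof.
move=> H m n m0 n0 em en m1 n1.
have [k0 k11] := andP hk.
have eqm x x1 : x1 = (12 * x %/ k)%N -> 12 * x = 0 %[mod k] -> (12 * x = k * x1)%N.
  by move=> -> h; rewrite [RHS]mulnC divnK // /dvdn h mod0n.
have Em := eqm _ m1 erefl em; have En := eqm _ n1 erefl en.
(* Since k < 12. It makes m1 - 1 positive and its truncated subtraction exact. *)
have gt1 x x1 : (12 * x = k * x1)%N -> (0 < x)%N -> (1 < x1)%N by nia.
have m2 := gt1 _ _ Em m0; have n2 := gt1 _ _ En n0.
have [m1p m1n] := nindex_pm Em; have [n1p n1n] := nindex_pm En.
have dvp x x1 : (12 * x = k * x1)%N -> (12 %| k%:Z * (sgn_if false * (x1 + 1)%N%:Z - 1))%Z.
  by move=> e; apply/dvdzP; exists x%:Z; rewrite /sgn_if expr0 mul1r PoszD addrK -PoszM -e PoszM mulrC.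
have dvn x x1 : (12 * x = k * x1)%N -> (0 < x1)%N -> (12 %| k%:Z * (sgn_if true * (x1 - 1)%N%:Z - 1))%Z.
  move=> e x0; apply/dvdzP; exists (- x%:Z); rewrite /sgn_if /= expr1 mulN1r -subzn // opprB addrAC subrr sub0r.
  by rewrite mulrN -PoszM -e PoszM mulrC mulNr mulrC.
have hs a b : (0 < a)%N -> (0 < b)%N ->
  (12 %| k * (a - 1))%N && (12 %| k * (b - 1))%N || (12 %| k * (a + 1))%N && (12 %| k * (b + 1))%N ->
  \sum_(d <- divisors (gcdn a b)) chi k d%:Z * c (nindex (((a %/ d) * (b %/ d) * D)%N%:Z)) = hecke_sum k c a b.
  move=> a0 b0 h; apply: eq_big_seq => d; rewrite -dvdn_divisors ?gcdn_gt0 ?a0 // dvdn_gcd => /andP[da db].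
  by rewrite nindex_hecke_index.
split=> c1 c2.
  have := H (false, (m1 + 1)%N) (false, (n1 + 1)%N).
  rewrite /hecke_ok /= !addn_gt0 /= !orbT /= => /(_ (dvp _ _ Em) (dvp _ _ En)).
  rewrite hecke_hecke_at0 ?addn_gt0 ?orbT ?(dvp _ _ Em) ?(dvp _ _ En) // !hecke_at0 ?addn_gt0 ?orbT // hs ?addn_gt0 ?orbT //; last first.
    by apply/orP; left; rewrite !addnK -Em -En; rewrite (dvdn_mulr m (dvdnn 12)) (dvdn_mulr n (dvdnn 12)).
  by rewrite mul1r /sgn_if !mul1r m1p n1p mulrC => ->.
have m3 : (0 < m1 - 1)%N by rewrite subn_gt0.
have n3 : (0 < n1 - 1)%N by rewrite subn_gt0.
have m4 := ltnW m2; have n4 := ltnW n2.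
have := H (true, (m1 - 1)%N) (true, (n1 - 1)%N).
rewrite /hecke_ok /= m3 n3 /= => /(_ (dvn _ _ Em m4) (dvn _ _ En n4)).
rewrite hecke_hecke_at0 ?(dvn _ _ Em m4) ?(dvn _ _ En n4) // !hecke_at0 // hs //; last first.
  by apply/orP; right; rewrite !subnK // -Em -En; rewrite (dvdn_mulr m (dvdnn 12)) (dvdn_mulr n (dvdnn 12)).
rewrite /sgn_if /= expr1 !mulN1r !mulNr m1n // n1n // => <-; ring.
Qed.

End HeckeRelations.

(** * From bases of sequences to bases of waveforms *)

Section Bases.
Context {R : realType}.
Local Notation C := R[i].
Variables (k : nat) (hk : (1 <= k <= 11)%N) (r : R) (r0 : r != 0).
Variables (v : 'M[int]_2 -> C) (hv : eta_multiplier k v).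
Local Notation wser := (@wser R k r).
Local Notation maass_coef := (@maass_coef R k r).

Lemma wser_sumZ (I : Type) (s : seq I) (a : I -> C) (e : I -> int -> C) z : (forall i, maass_coef (e i)) -> uhp z ->
  \sum_(i <- s) a i * wser k%:Z (e i) z = wser k%:Z (fun n => \sum_(i <- s) a i * e i n) z.
Proof.
move=> h zu; rewrite (wser_sum hk r0) //; last by move=> i; apply: subexpZ; case: (h i).
by apply: eq_bigr => i _; rewrite (wserZ hk r0) //; case: (h i).
Qed.

Lemma uhp_basis_maass_coef (T : finType) (e : T -> int -> C) : (forall t, maass_coef (e t)) ->
  (forall u : T -> C, (forall n, \sum_t u t * e t n = 0) -> forall t, u t = 0) ->
  (forall c, maass_coef c -> exists u : T -> C, forall n, c n = \sum_t u t * e t n) ->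
  uhp_basis (maass_space v k r) [set f | exists t, f = wser k%:Z (e t)].
Proof.
move=> he free span; split.
- by move=> f [t ->]; exact: wser_maass_space.
- move=> m b a injb Bb h; have [s hs] := boolp.choice Bb.
  have injs : injective s by move=> i j e1; apply: injb; rewrite !hs e1.
  have hes i : maass_coef (e (s i)) by [].
  have z0 n : \sum_(i < m) a i * e (s i) n = 0.
    apply: (@wser_zero R k hk r r0 (fun n => \sum_(i < m) a i * e (s i) n)).
      apply: subexp_sum => i; apply: subexpZ; by case: (hes i).
    move=> z z1; have zu : uhp z by apply: lt_le_trans z1; exact: ltr01.
    rewrite -(wser_sumZ _ _ hes zu) -[RHS](h z zu); apply: eq_bigr => i _; by rewrite hs.
  (* The given functions are distinct, so they come from distinct basis sequences, and the
     coefficient collected at [s i] is the single [a i]. *)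
  move=> i; have := free (fun t => \sum_(j | s j == t) a j) _ (s i).
  rewrite (big_pred1 i) => [|j]; last by rewrite /= (inj_eq injs).
  apply => n; rewrite -[RHS](z0 n) [RHS](partition_big s xpredT) //=; apply: eq_bigr => t _.
  by rewrite mulr_suml; apply: eq_bigr => j /eqP ->.
- move=> f Mf; have [c hc fc] := maass_space_wser hk r0 hv Mf.
  have [u hu] := span _ hc.
  exists #|T|, (fun i => wser k%:Z (e (enum_val i))), (fun i => u (enum_val i)); split; first by move=> i; exists (enum_val i).
  move=> z zu; rewrite fc // (@eq_wser R k r k%:Z _ _ z hu) -(wser_sumZ _ _ he zu) (reindex _ (onW_bij _ (@enum_val_bij T))) //=.
Qed.

End Bases.

Theorem theorem3p1 (R : realType) (k : nat) (hk : (1 <= k <= 11)%N)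
    (r : R) (hr : 4^-1 < 4^-1 + r ^+ 2)
    (v : 'M[int]_2 -> R[i]) (hv : eta_multiplier k v) :
  exists B : set (R[i] -> R[i]),
    uhp_basis (maass_space v k r) B /\
    forall f, B f ->
      exists c : int -> R[i],
        fourier_expansion k r f c /\
        (c 0 != 0 ->
         forall m n : nat, (0 < m)%N -> (0 < n)%N ->
           12 * m = 0 %[mod k] -> 12 * n = 0 %[mod k] ->
           let m1 := (12 * m %/ k)%N in
           let n1 := (12 * n %/ k)%N in
           (coprime (m1 + 1) (Dk k) -> coprime (n1 + 1) (Dk k) ->
              c m%:Z * c n%:Z = c 0 * hecke_sum k c (m1 + 1) (n1 + 1))
           /\
           (coprime (m1 - 1) (Dk k) -> coprime (n1 - 1) (Dk k) ->
              c (- m%:Z) * c (- n%:Z)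
              = (Lambda k r)%:C * c 0 * hecke_sum k c (m1 - 1) (n1 - 1))).
Proof.
have r0 : r != 0.
  by apply: contraTneq hr => ->; rewrite expr0n addr0 ltxx.
have fe c : maass_coef k r c -> fourier_expansion k r (wser k r k%:Z c) c.
  move=> [sc _] z zu; have := wser_has hk r0 k%:Z sc zu; congr has_sumZ.
  by apply/funext => n; rewrite whittaker_termE.
have [d [f rig]] := finite_indices hk r0.
pose P (c : int -> R[i]) := maass_coef k r c /\ c 0 = 0.
have P0 : P (fun=> 0) by split => //; exact: maass_coef0.
have PL a b c : P b -> P c -> P (fun n => a * b n + c n).
  by move=> [hb b0] [hc c0]; split; [exact: maass_coef_lin|rewrite b0 c0 mulr0 addr0].
have [n [e [he free span]]] := finite_basis P0 PL (fun c hc => rig c hc.1).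
(* If c(0) vanishes on every waveform, a basis of its kernel is a basis of the whole space and the
   relations are void. *)
case: (pselect (exists2 c, maass_coef k r c & c 0 != 0)) => [[c0 hc0 c00]|none]; last first.
  exists [set f | exists t, f = wser k r k%:Z (e t)]; split.
    apply: (uhp_basis_maass_coef hk r0 hv) => [t||c hc]; [by case: (he t)|exact: free|].
    by apply: span; split => //; apply: contrapT => /eqP h; apply: none; exists c.
  move=> g [t ->]; exists (e t); split; first by apply: fe; case: (he t).
  by case: (he t) => _ ->; rewrite eqxx.
have [c [hc cn0 hec]] := eigen_coef hk r0 hc0 c00.
(* The distinguished sequence comes in front of a basis of the kernel of c(0), whose members satisfy
   the relations vacuously. *)
pose E (t : 'I_n.+1) := if unlift ord0 t is Some i then e i else c.
have hE t : maass_coef k r (E t) by rewrite /E; case: unliftP => [i|] //= _; case: (he i).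
have bigo (u : 'I_n.+1 -> R[i]) m : \sum_t u t * E t m = u ord0 * c m + \sum_(i < n) u (lift ord0 i) * e i m.
  rewrite big_ord_recl /E unlift_none; congr (_ + _).
  by apply: eq_bigr => i _; rewrite liftK.
exists [set f | exists t, f = wser k r k%:Z (E t)]; split.
  apply: (uhp_basis_maass_coef hk r0 hv) => // [u hu|x hx].
    have e0 i : e i 0 = 0 by case: (he i).
    have u0 : u ord0 = 0.
      have := hu 0; rewrite bigo big1 ?addr0; last by move=> i _; rewrite e0 mulr0.
      by move/eqP; rewrite mulf_eq0 (negbTE cn0) orbF => /eqP.
    move=> t; case: (unliftP ord0 t) => [i|] -> //; apply: (free (fun i => u (lift ord0 i))) => m.
    by have := hu m; rewrite bigo u0 mul0r add0r.
  (* Subtracting the multiple of [c] with the same value at 0 leads into the kernel. *)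
  have hx' : P (fun m => - (x 0 / c 0) * c m + x m).
    by split; [exact: maass_coef_lin|rewrite mulNr divfK // addNr].
  have [u hu] := span _ hx'.
  exists (fun t => if unlift ord0 t is Some i then u i else x 0 / c 0) => m.
  rewrite bigo unlift_none; under eq_bigr do rewrite liftK.
  by rewrite -hu addrA mulNr subrr add0r.
move=> g [t ->]; exists (E t); split; first exact: fe.
rewrite /E; case: unliftP => [i _|_]; first by case: (he i) => _ ->; rewrite eqxx.
by move=> _; exact: (hecke_relations hk r0 hec).
Qed.
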